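(* Let $\alpha\in(0,1)$, $T>0$, and let $\phi$ and $f$ satisfy: $\phi\in D(\mathcal{L}^{9/2})$ and $f(\cdot,t),f_t(\cdot,t),f_{tt}(\cdot,t)\in D(\mathcal{L}^{9/2})$ for each $t\in(0,T]$, and there are constants $\rho<1$ and $C_1$ independent of $t$ with $$\|f(\cdot,t)\|_{\mathcal{L}^{5/2}}+\|f_t(\cdot,t)\|_{\mathcal{L}^{1/2}}+t^{\rho}\|f_{tt}(\cdot,t)\|_{\mathcal{L}^{1/2}}\le C_1,\quad t\in(0,T].$$ Let $u$ be the unique solution on $[0,1]\times[0,T]$ of $$u(x,t)=\phi(x)+\int_0^t\frac{(t-s)^{\alpha-1}}{\Gamma(\alpha)}\left(\frac{\partial^2u}{\partial x^2}(x,s)+f(x,s)\right)ds,\qquad u(0,t)=u(1,t)=0,$$ and assume $\partial^6u/\partial x^6$ and $\partial u/\partial t$ exist and are continuous on $[0,1]\times[0,T]$. Then there is a constant $C>0$, independent of the spatial and temporal grids, such that for every uniform spatial grid, every temporal grid, and the solution $\{u_i^n:0\le i\le M,\ 0\le n\le N\}$ of scheme (S1) (given in the context), the grid function $i\mapsto u(x_i,t_n)-u_i^n$ satisfies $$\|u(x_i,t_n)-u_i^n\|_A\le\sqrt{\frac{T^{\alpha}}{\Gamma(\alpha+1)}}\;C\left(h^4+\tau_{\max}\right),\qquad 1\le n\le N.$$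
   Context: Function spaces: let $\lambda_i=(i\pi)^2$, $\psi_i(x)=\sqrt2\sin(i\pi x)$ be the Dirichlet eigenpairs of $\mathcal{L}=-\partial^2/\partial x^2$ on $(0,1)$; $D(\mathcal{L}^{\gamma})=\{g\in L^2(0,1):\sum_i\lambda_i^{2\gamma}|(g,\psi_i)|^2<\infty\}$, $\|g\|_{\mathcal{L}^\gamma}=(\sum_i\lambda_i^{2\gamma}|(g,\psi_i)|^2)^{1/2}$, with $(\cdot,\cdot)$ the $L^2(0,1)$ inner product. Grids: $0=t_0<t_1<\dots<t_N=T$ is an arbitrary partition, $\tau_n=t_n-t_{n-1}$, $\tau_{\max}=\max_{1\le j\le N}\tau_j$; $h=1/M$ with $M$ a positive integer, $x_i=ih$, $0\le i\le M$. Grid operators: $\mathcal{H}_hv_i=\frac1{12}(v_{i+1}+10v_i+v_{i-1})$ for $1\le i\le M-1$, $\mathcal{H}_hv_i=v_i$ for $i=0,M$; $\delta_xv_{i-1/2}=(v_i-v_{i-1})/h$; $\delta_x^2v_i=(v_{i+1}-2v_i+v_{i-1})/h^2$. $\mathcal{H}_h$ acts on functions of $x$ through their values at grid points. For grid functions $v,w$ vanishing at $i=0,M$, $\langle v,w\rangle_A=h\sum_{i=1}^{M}\delta_xv_{i-1/2}\,\delta_xw_{i-1/2}-\frac{h^2}{12}h\sum_{i=1}^{M-1}\delta_x^2v_i\,\delta_x^2w_i$ and $\|v\|_A=\sqrt{\langle v,v\rangle_A}$. Scheme (S1): with $a_k^n=\frac1{\Gamma(\alpha)}\int_{t_{k-1}}^{t_k}(t_n-s)^{\alpha-1}ds$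 and $f_{1-\alpha}(x,t)=\int_0^t\frac{(t-s)^{\alpha-1}}{\Gamma(\alpha)}f(x,s)\,ds$, find $u_i^n$ with $u_i^0=\phi(x_i)$ for $0\le i\le M$, $u_0^n=u_M^n=0$, and for $1\le i\le M-1$, $1\le n\le N$, $$\mathcal{H}_hu_i^n=\mathcal{H}_h\phi(x_i)+\mathcal{H}_hf_{1-\alpha}(x_i,t_n)+\sum_{k=1}^{n}\frac{a_k^n}{2}\left(\delta_x^2u_i^k+\delta_x^2u_i^{k-1}\right).$$ *)

(* Defs.v *)
From HB Require Import structures.
From mathcomp Require Import all_boot all_order all_algebra.
From mathcomp Require Import all_classical all_reals all_analysis.
Set Implicit Arguments.
Unset Strict Implicit.
Unset Printing Implicit Defensive.
Import Order.TTheory GRing.Theory Num.Theory.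
Import numFieldNormedType.Exports.
Local Open Scope classical_set_scope.
Local Open Scope ring_scope.

Section Calculus.
Context {R : realType}.
Implicit Types (A : set R) (f g : R -> R) (u : R -> R -> R).

Definition Gamma (a : R) : R :=
  \int[lebesgue_measure]_(x in `]0, +oo[) (x `^ (a - 1) * expR (- x)).

(* Derivative relative to A: the difference quotient only sees points of A, so
   it is the one-sided derivative at an endpoint of an interval A. *)
Definition derivableS A f (x : R) : Prop :=
  cvg (((f y - f x) / (y - x)) @[y --> within A x^']).

Definition deriveS A f (x : R) : R :=
  lim (((f y - f x) / (y - x)) @[y --> within A x^']).

Definition dx (k : nat) u (x t : R) : R :=
  iter k (deriveS `[0, 1]) (u ^~ t) x.

Definition dx_exists (k : nat) u (x t : R) : Prop :=
  forall j : nat, (j < k)%N ->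
    derivableS `[0, 1] (iter j (deriveS `[0, 1]) (u ^~ t)) x.

(* Time derivatives relative to ]0, T] and to [0, T]; they differ at t = 0 only. *)
Definition dt_oc (T : R) u (x t : R) : R := deriveS `]0, T] (u x) t.

Definition dt_cc (T : R) u (x t : R) : R := deriveS `[0, T] (u x) t.

End Calculus.

Section FunctionSpaces.
Context {R : realType}.
Implicit Types (g : R -> R) (gamma : R).

(* Eigenpairs are indexed from i = 1. *)
Definition lambda (i : nat) : R := (i%:R * pi) ^+ 2.

Definition psi (i : nat) (x : R) : R := Num.sqrt 2 * sin (i%:R * pi * x).

Definition in_L2 g : Prop :=
  measurable_fun (`]0, 1[ : set R) g /\
  lebesgue_measure.-integrable (`]0, 1[ : set R) (fun x => (g x ^+ 2)%:E).

Definition L2_inner g1 g2 : R :=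
  \int[lebesgue_measure]_(x in `]0, 1[) (g1 x * g2 x).

Definition spectral_sum gamma g : \bar R :=
  (\sum_(1 <= i <oo) (lambda i `^ (2 * gamma) * `|L2_inner g (psi i)| ^+ 2)%:E)%E.

Definition in_dom gamma g : Prop :=
  in_L2 g /\ (spectral_sum gamma g < +oo)%E.

Definition dom_norm gamma g : \bar R := (spectral_sum gamma g `^ 2^-1)%E.

End FunctionSpaces.

Section Problem.
Context {R : realType}.
Implicit Types (alpha T : R) (phi : R -> R) (f u : R -> R -> R).

Definition frac_kernel alpha (t s : R) : R := (t - s) `^ (alpha - 1) / Gamma alpha.

(* f_{1-alpha} *)
Definition frac_int alpha f (x t : R) : R :=
  \int[lebesgue_measure]_(s in `]0, t[) (frac_kernel alpha t s * f x s).

(* Integrals of non-integrable functions have default values in the library,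
   so integrability is required explicitly. *)
Definition is_solution alpha T phi f u : Prop :=
  (forall x t : R, 0 <= x <= 1 -> 0 <= t <= T ->
     lebesgue_measure.-integrable (`]0, t[ : set R)
       (fun s => (frac_kernel alpha t s * (dx 2 u x s + f x s))%:E) /\
     u x t = phi x + frac_int alpha (fun y s => dx 2 u y s + f y s) x t) /\
  (forall t : R, 0 <= t <= T -> u 0 t = 0 /\ u 1 t = 0).

End Problem.

Section Grids.
Context {R : realType}.
Implicit Types (M N : nat) (t : nat -> R) (v w : nat -> R).

(* Only the values t 0, ..., t N are relevant. *)
Definition is_partition (T : R) N t : Prop :=
  [/\ t 0%N = 0, t N = T & forall n : nat, (n < N)%N -> t n < t n.+1].

Definition tau t (n : nat) : R := t n - t n.-1.

Definition tau_max N t : R := \big[Num.max/0]_(1 <= j < N.+1) tau t j.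

Definition mesh M : R := M%:R^-1.

Definition node M (i : nat) : R := i%:R * mesh M.

(* A grid function on 0 <= i <= M is the restriction of some v : nat -> R. *)
Definition Hh M v (i : nat) : R :=
  if (0 < i < M)%N then (v i.+1 + 10 * v i + v i.-1) / 12 else v i.

(* delta_half M v i is the difference quotient at the midpoint i - 1/2. *)
Definition delta_half M v (i : nat) : R := (v i - v i.-1) / mesh M.

Definition delta2 M v (i : nat) : R :=
  (v i.+1 - 2 * v i + v i.-1) / mesh M ^+ 2.

Definition ipA M v w : R :=
  mesh M * (\sum_(1 <= i < M.+1) delta_half M v i * delta_half M w i)
  - mesh M ^+ 2 / 12 * (mesh M * \sum_(1 <= i < M) delta2 M v i * delta2 M w i).

Definition normA M v : R := Num.sqrt (ipA M v v).

Definition quad_weight (alpha : R) t (n k : nat) : R :=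
  (Gamma alpha)^-1 *
  \int[lebesgue_measure]_(s in `]t k.-1, t k[) ((t n - s) `^ (alpha - 1)).

(* U n i is the approximation at the node x_i and the time t_n. *)
Definition scheme_S1 (alpha : R) (phi : R -> R) (f : R -> R -> R) M N t
    (U : nat -> nat -> R) : Prop :=
  [/\ forall i : nat, (i <= M)%N -> U 0%N i = phi (node M i),
      forall n : nat, (1 <= n <= N)%N -> U n 0%N = 0 /\ U n M = 0
    & forall n i : nat, (1 <= n <= N)%N -> (1 <= i < M)%N ->
        Hh M (U n) i =
          Hh M (fun j => phi (node M j)) i
          + Hh M (fun j => frac_int alpha f (node M j) (t n)) i
          + \sum_(1 <= k < n.+1) quad_weight alpha t n k / 2 *
              (delta2 M (U k) i + delta2 M (U k.-1) i)].

End Grids.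

(* Main.v *)
(* The error is expanded in the discrete sine modes, in which the compact operator
   becomes multiplication by a factor between 2/3 and 1.  In every mode the exact
   solution and the scheme solve the same scalar Volterra equation, up to a
   consistency term of size h^4 and to the replacement of the integrand by averages.
   Writing t^(alpha-1) as a Laplace transform c * int_0^oo exp(-p t) p^(-alpha) dp
   turns the memory term into a family of relaxation states indexed by p.  For stiff
   modes an energy identity for these states, localised in a short time window, and
   for the other modes a maximum principle, bound the error of one mode by
   C (beta tau + dq) on an arbitrary temporal grid, where beta is a Lipschitz constant
   in time of the mode of u_xx and dq bounds its consistency term.

   The solution is not C^1 in time in a norm strong enough to bound all the beta
   directly.  Instead, the k-th Fourier coefficient of u solves a fractional
   relaxation equation with a forcing of Lipschitz constant L_k, and a comparison
   argument shows that lambda_k times this coefficient is Lipschitz with constant L_k.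
   The weighted bound on f_tt gives sum_k lambda_k L_k^2 < oo, and aliasing followed by
   Cauchy-Schwarz turns this into a bound of sum_j mu_j beta_j^2 that does not depend
   on the spatial grid.  Parseval then sums the modes in the energy norm. *)

Require Import Defs.
From HB Require Import structures.
From mathcomp Require Import all_boot all_order all_algebra.
From mathcomp Require Import all_classical all_reals all_analysis.
From mathcomp Require Import measurable_realfun.
From mathcomp Require Import ring lra zify.
Import Order.TTheory GRing.Theory Num.Theory.
Import numFieldNormedType.Exports.
Local Open Scope classical_set_scope.
Local Open Scope ring_scope.
Set Implicit Arguments.
Unset Strict Implicit.
Unset Printing Implicit Defensive.

(** * Singular integrals and the Laplace representation of the kernel *)

Section Calculus.
Context {R : realType}.
Implicit Types (f F G : R -> R) (a b r s t x y Q : R).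
Local Notation mu := (@lebesgue_measure R).

(** In a stiff mode the averages [(x k + x k.+1) / 2] do not see an alternating error, so a maximum
    principle is of no use there, while an arbitrary grid rules out discrete convolution arguments.
    The Laplace states make the memory local: each state obeys a one-step recursion, and estimates
    are added over the steps without comparing their lengths. The delicate point is a lower bound
    for the dissipation. It comes from the states with [p] in a band below [1 / tau], which every
    step resolves. There [p * z] is small compared with the size [lam * X] of the source, because
    the tail sums of the source are Hoelder continuous of exponent [1 - alpha]; this rests on the
    monotone ratios of the quadrature weights. As for the solution, nothing is assumed on [u_xx] at
    the end points or on its modulus of continuity in time, and [f_tt] is only a pointwise
    derivative. Hence the means with positive kernels in place of partial sums of sine series, and
    the fundamental theorem for everywhere differentiable functions. *)

Lemma derivable_within_continuous_itv F a b :
  (forall x, a <= x <= b -> derivable F x 1) -> {within `[a, b], continuous F}.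
Proof.
move=> dF; apply: derivable_within_continuous => x.
by rewrite in_itv/=; exact: dF.
Qed.

Lemma FTC2_segment f F a b : a <= b ->
  (forall x, a <= x <= b -> is_derive x 1 F (f x)) ->
  {within `[a, b], continuous f} ->
  (\int[mu]_(x in `[a, b]) (f x)%:E = (F b - F a)%:E)%E.
Proof.
rewrite le_eqVlt => /predU1P[->|ab] dF cf.
  by rewrite set_itv1 integral_set1 subrr.
rewrite (@continuous_FTC2 _ f F)//.
  have cF : {within `[a, b], continuous F}.
    by apply: derivable_within_continuous_itv => x /dF[].
  have [_ cFa cFb] := (continuous_within_itvP F ab).1 cF.
  split=> // x; rewrite in_itv/= => /andP[ax xb].
  by have [] := dF x; rewrite ?(ltW ax) ?(ltW xb).
move=> x; rewrite in_itv/= => /andP[ax xb].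
by rewrite derive1E; apply: @derive_val; apply: dF; rewrite !ltW.
Qed.

(* Exhausting an interval by segments gives the fundamental theorem for
   integrands that are singular at an end point or on unbounded intervals. *)
Lemma ge0_FTC2_exhaust f F (u v : nat -> R) (A : set R) l1 l2 :
  {homo u : m n / (m <= n)%N >-> n <= m} ->
  {homo v : m n / (m <= n)%N >-> m <= n} ->
  (forall n, u n <= v n) -> A = \bigcup_n `[u n, v n]%classic ->
  (forall x, A x -> 0 <= f x) ->
  {in A, forall x, is_derive x 1 F (f x)} ->
  (forall x, A x -> {for x, continuous f}) ->
  F (u n) @[n --> \oo] --> l1 -> F (v n) @[n --> \oo] --> l2 ->
  (\int[mu]_(x in A) (f x)%:E = (l2 - l1)%:E)%E.
Proof.
move=> nu nv uv Auv f0 dF cf Fu Fv.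
have cwf n : {within `[u n, v n], continuous f}.
  apply: continuous_in_subspaceT => x /set_mem xuv; apply: cf.
  by rewrite Auv; exists n.
have fE n : (\int[mu]_(x in `[u n, v n]) (f x)%:E = (F (v n) - F (u n))%:E)%E.
  apply: FTC2_segment => // x xuv; apply: dF.
  by rewrite Auv inE; exists n => //=; rewrite in_itv.
have H : ((\int[mu]_(x in `[u n, v n]) (f x)%:E)%E @[n --> \oo]
           --> (\int[mu]_(x in A) (f x)%:E)%E).
  rewrite Auv; apply: ge0_nondecreasing_set_cvg_integral.
  - move=> m n mn; apply/subsetPset => x /=; rewrite !in_itv/= => /andP[h1 h2].
    by rewrite (le_trans (nu _ _ mn) h1) (le_trans h2 (nv _ _ mn)).
  - by [].
  - move=> n; apply/measurable_EFinP.
    exact: subspace_continuous_measurable_fun.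
  - by move=> n x xuv; rewrite lee_fin f0// Auv; exists n.
have H2 : ((\int[mu]_(x in `[u n, v n]) (f x)%:E)%E @[n --> \oo]
           --> (l2 - l1)%:E).
  under eq_fun do rewrite fE.
  by apply: cvg_EFin; [exact: nearW|exact: cvgB].
exact: cvg_unique H H2.
Qed.


Lemma continuous_powR r x : 0 < x -> {for x, continuous (@powR R ^~ r)}.
Proof.
move=> x0; apply: differentiable_continuous; apply/derivable1_diffP.
exact: (@ex_derive _ _ _ _ _ _ _ (@is_derive1_powR _ r _ x0)).
Qed.

Lemma cvg_powR (u : nat -> R) x r : 0 < r -> (forall n, 0 <= u n) ->
  u n @[n --> \oo] --> x -> (u n `^ r) @[n --> \oo] --> x `^ r.
Proof.
move=> r0 u0 ux.
have x0 : 0 <= x.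
  have /cvg_lim <- := ux => //.
  by apply: limr_ge; [apply/cvg_ex; exists x|exact: nearW].
(* The power need not be differentiable at the limit 0; there the bound [u n < e^(1 / r)] replaces
   continuity. *)
have [x00|xn0] := eqVneq x 0; last first.
  have xp : 0 < x by rewrite lt_neqAle eq_sym xn0.
  exact: (cvg_comp u (@powR R ^~ r) ux (continuous_powR xp)).
move: ux; rewrite x00 powR0 ?gt_eqF// => /cvgr0Pnorm_lt ux.
apply/cvgr0Pnorm_lt => e e0; near=> n.
rewrite ger0_norm ?powR_ge0//.
have h : `|u n| < e `^ r^-1 by near: n; apply: ux; rewrite powR_gt0.
rewrite ger0_norm// in h.
have := @gt0_ltr_powR _ _ r0 (u n) (e `^ r^-1) (u0 n) (powR_ge0 _ _) h.
by rewrite -powRrM mulVf ?gt_eqF// powRr1 ?(ltW e0).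
Unshelve. all: by end_near. Qed.

Lemma cvg_divS x : (x / n.+1%:R) @[n --> \oo] --> (0 : R).
Proof.
rewrite -[X in _ --> X](mulr0 x); apply: cvgM; first exact: cvg_cst.
exact: cvg_harmonic.
Qed.

Lemma archi_ge x : exists n : nat, x <= n.+1%:R.
Proof.
have [x0|x0] := leP 0 x; last by exists 0%N; rewrite (le_trans (ltW x0)).
exists (Num.bound x); apply: ltW; apply: (lt_trans (archi_boundP x0)).
by rewrite ltr_nat.
Qed.

Lemma is_derive_powR_div r x : r != 0 -> 0 < x ->
  is_derive x 1 (fun y => y `^ r / r) (x `^ (r - 1)).
Proof.
move=> r0 x0; have := @is_derive1_powR _ r _ x0 => h.
have := @is_deriveZ _ _ _ (@powR R ^~ r) r^-1 x 1 _ h.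
rewrite [X in is_derive _ _ _ X](_ : _ = x `^ (r - 1)); last first.
  by rewrite /GRing.scale/= mulrA mulVf// mul1r.
by congr is_derive; apply/funext => y; rewrite mulrC.
Qed.

Lemma integral_powR_near0 r Q : 0 < r -> 0 < Q ->
  (\int[mu]_(x in `]0%R, Q]) (x `^ (r - 1))%:E = (Q `^ r / r)%:E)%E.
Proof.
move=> r0 Q0.
rewrite (@ge0_FTC2_exhaust _ (fun y => y `^ r / r) (fun n => Q / n.+1%:R)
  (fun=> Q) _ 0 (Q `^ r / r)) ?subr0//.
- move=> m n mn; rewrite ler_pM2l// lef_pV2 ?posrE// ler_nat ltnS//.
- by move=> n; rewrite ler_pdivrMr// ler_peMr ?(ltW Q0)// ler1n.
- apply/seteqP; split => [x|x [n _]] /=; rewrite !in_itv/= => /andP[x0 xQ].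
    have [n nx] := archi_ge (Q / x).
    exists n => //=; rewrite in_itv/= xQ andbT ler_pdivrMr//.
    by rewrite mulrC -ler_pdivrMr.
  by rewrite xQ andbT (lt_le_trans _ x0)// divr_gt0.
- by move=> x _; exact: powR_ge0.
- move=> x; rewrite inE/= in_itv/= => /andP[x0 _].
  by apply: is_derive_powR_div => //; rewrite gt_eqF.
- by move=> x; rewrite /= in_itv/= => /andP[x0 _]; exact: continuous_powR.
- rewrite -(mul0r r^-1); apply: cvgM; last exact: cvg_cst.
  rewrite -(@powR0 _ r) ?gt_eqF//; apply: cvg_powR => //; last exact: cvg_divS.
  by move=> n; rewrite divr_ge0// ltW.
- exact: cvg_cst.
Qed.

Lemma integral_powR_nearoo r Q : 0 < r -> 0 < Q ->
  (\int[mu]_(x in `[Q, +oo[) (x `^ (- r - 1))%:E = (Q `^ (- r) / r)%:E)%E.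
Proof.
move=> r0 Q0.
rewrite (@ge0_FTC2_exhaust _ (fun y => y `^ (- r) / (- r)) (fun=> Q)
  (fun n => Q * n.+1%:R) _ (Q `^ (- r) / (- r)) 0) ?sub0r ?invrN ?mulrN ?opprK//.
- by move=> m n mn; rewrite ler_pM2l// ler_nat ltnS.
- by move=> n; rewrite ler_peMr ?(ltW Q0)// ler1n.
- apply/seteqP; split => [x|x [n _]] /=; rewrite !in_itv/=.
    rewrite andbT => xQ; have [n nx] := archi_ge (x / Q).
    exists n => //=; rewrite in_itv/= xQ /= mulrC.
    by rewrite -ler_pdivrMr.
  by move=> /andP[->].
- by move=> x _; exact: powR_ge0.
- move=> x; rewrite inE/= in_itv/= andbT => x0; rewrite -invrN.
  apply: is_derive_powR_div; first by rewrite oppr_eq0 gt_eqF.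
  exact: lt_le_trans x0.
- move=> x; rewrite /= in_itv/= andbT => x0; apply: continuous_powR.
  exact: lt_le_trans x0.
- exact: cvg_cst.
- rewrite -invrN -[X in _ --> X](mul0r (- r)^-1).
  apply: cvgM; last exact: cvg_cst.
  rewrite -(@powR0 _ r) ?gt_eqF//.
  have -> : (fun n => (Q * n.+1%:R) `^ (- r)) =
      (fun n => (Q^-1 / n.+1%:R) `^ r).
    apply/funext => n; rewrite -invfM -[(_ * _)^-1]powR_inv1 ?mulr_ge0 ?(ltW Q0)//.
    by rewrite -powRrM mulN1r.
  apply: cvg_powR => //; last exact: cvg_divS.
  by move=> n; rewrite divr_ge0 ?invr_ge0// ltW.
Qed.

(** The interval is open at [b], where the kernel is singular if [b = t] and [r < 1]; the exhausting
    segments stay away from [b]. *)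
Lemma integral_kernel r a b t : 0 < r -> a <= b <= t ->
  (\int[mu]_(s in `[a, b[) ((t - s) `^ (r - 1))%:E =
   (((t - a) `^ r - (t - b) `^ r) / r)%:E)%E.
Proof.
move=> r0 /andP[]; rewrite le_eqVlt => /predU1P[<-|ab] bt.
  by rewrite set_itvco0 integral_set0 subrr mul0r.
rewrite (@ge0_FTC2_exhaust _ (fun s => - ((t - s) `^ r / r)) (fun=> a)
  (fun n => b - (b - a) / n.+1%:R) _ (- ((t - a) `^ r / r)) (- ((t - b) `^ r / r))).
- by congr (_%:E); ring.
- by [].
- move=> m n mn; rewrite lerD2l lerN2 ler_pM2l ?subr_gt0//.
  by rewrite lef_pV2 ?posrE// ler_nat ltnS.
- move=> n; rewrite lerBrDl -lerBrDr ler_pdivrMr// ler_peMr// ?ler1n//.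
  by rewrite subr_ge0 ltW.
- apply/seteqP; split => [x|x [n _]] /=; rewrite !in_itv/= => /andP[ax xb].
    have [n nx] := archi_ge ((b - a) / (b - x)).
    exists n => //=; rewrite in_itv/= ax/= lerBrDl -lerBrDr ler_pdivrMr//.
    by rewrite mulrC -ler_pdivrMr// subr_gt0.
  rewrite ax/=; apply: (le_lt_trans xb); rewrite ltrBlDr ltrDl.
  by rewrite divr_gt0// subr_gt0.
- by move=> x _; exact: powR_ge0.
- move=> x; rewrite inE/= in_itv/= => /andP[ax xb].
  have tx : 0 < t - x by rewrite subr_gt0 (lt_le_trans xb).
  have d1 : is_derive x 1 (fun s => t - s) (-1).
    by have := is_deriveB (is_derive_cst t x (1 : R)) (is_derive_id x (1 : R)); rewrite sub0r.
  have d2 := is_derive_powR_div (lt0r_neq0 r0) tx.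
  have := @is_derive1_comp _ (fun y => y `^ r / r) (fun s => t - s) x _ _ d2 d1.
  move=> /is_deriveN; rewrite mulrN1 opprK => h; exact: (is_derive_eq h).
- move=> x; rewrite /= in_itv/= => /andP[ax xb].
  have tx : 0 < t - x by rewrite subr_gt0 (lt_le_trans xb).
  apply: (@continuous_comp _ _ _ (fun s => t - s) (@powR R ^~ (r - 1))).
    by apply: cvgB; [exact: cvg_cst|exact: cvg_id].
  exact: continuous_powR.
- exact: cvg_cst.
- apply: cvgN; apply: cvgM; last exact: cvg_cst.
  apply: cvg_powR => //.
    move=> n; rewrite subr_ge0 lerBlDr (le_trans bt)// lerDl.
    by rewrite divr_ge0// subr_ge0 ltW.
  rewrite -[X in _ --> t - X]subr0.
  apply: cvgB; first exact: cvg_cst.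
  by apply: cvgB; [exact: cvg_cst|exact: cvg_divS].
Qed.

End Calculus.

(** * Dilation of integrals over the half line *)

Section Dilation.
Context {R : realType}.
Local Notation mu := (@lebesgue_measure R).

Lemma itv0y_exhaust (c : R) : 0 < c ->
  `]0, +oo[%classic = \bigcup_n `[c / n.+1%:R, c * n.+1%:R]%classic.
Proof.
move=> c0; apply/seteqP; split => [x|x [n _]] /=; rewrite !in_itv/= ?andbT.
  move=> x0; have [n nx] := archi_ge (Num.max (c / x) (x / c)).
  exists n => //=; rewrite in_itv/= ler_pdivrMr// mulrC -ler_pdivrMr//.
  move: nx; rewrite ge_max => /andP[-> /=].
  by rewrite ler_pdivrMr// mulrC.
by move=> /andP[h _]; apply: lt_le_trans h; rewrite divr_gt0.
Qed.

Lemma ge0_integral_exhaust (f : R -> R) (c : R) : 0 < c ->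
  (forall x, 0 < x -> 0 <= f x) -> (forall x, 0 < x -> {for x, continuous f}) ->
  (\int[mu]_(x in `[(c / n.+1%:R)%R, (c * n.+1%:R)%R]) (f x)%:E @[n --> \oo] -->
   \int[mu]_(x in `]0%R, +oo[) (f x)%:E)%E.
Proof.
move=> c0 f0 cf; rewrite (itv0y_exhaust c0).
have pos n x : `[c / n.+1%:R, c * n.+1%:R]%classic x -> 0 < x.
  by rewrite /= in_itv/= => /andP[h _]; apply: lt_le_trans h; rewrite divr_gt0.
apply: ge0_nondecreasing_set_cvg_integral.
- move=> m n mn; apply/subsetPset => x /=; rewrite !in_itv/= => /andP[h1 h2].
  apply/andP; split.
    by apply: le_trans h1; rewrite ler_pM2l// lef_pV2 ?posrE// ler_nat ltnS.
  by apply: (le_trans h2); rewrite ler_pM2l// ler_nat ltnS.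
- by [].
- move=> n; apply/measurable_EFinP; apply: subspace_continuous_measurable_fun => //.
  by apply: continuous_in_subspaceT => x /set_mem /pos; exact: cf.
- by move=> n x /pos x0; rewrite lee_fin f0.
Qed.

(** Substitution is applied on segments: [[c / n.+1, c * n.+1]] is the image of [[1 / n.+1, n.+1]]
    under the dilation, so both sides are limits of the same sequence. *)
Lemma integral_dilation (f : R -> R) (c : R) : 0 < c ->
  (forall x, 0 < x -> 0 <= f x) -> (forall x, 0 < x -> {for x, continuous f}) ->
  (\int[mu]_(x in `]0%R, +oo[) (f x)%:E =
   \int[mu]_(x in `]0%R, +oo[) (f (c * x) * c)%:E)%E.
Proof.
move=> c0 f0 cf.
have cMc (x : R) : {for x, continuous (fun y => c * y)}.
  by apply: cvgM; [exact: cvg_cst|exact: cvg_id].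
have cfc x : 0 < x -> {for x, continuous (fun x => f (c * x) * c)}.
  move=> x0; apply: cvgM; last exact: cvg_cst.
  apply: (@continuous_comp _ _ _ (fun y => c * y) f); first exact: cMc.
  by apply: cf; rewrite mulr_gt0.
have h1 := ge0_integral_exhaust c0 f0 cf.
have fc0 x : 0 < x -> 0 <= f (c * x) * c.
  by move=> x0; rewrite mulr_ge0 ?f0 ?mulr_gt0// ltW.
have h2 := ge0_integral_exhaust ltr01 fc0 cfc.
have dF (x : R) : is_derive x 1 (fun y => c * y) c.
  have := @is_deriveZ _ _ _ (@id R) c x 1 1 (is_derive_id x (1 : R)).
  by rewrite /GRing.scale/= mulr1.
have F' : derive1 (fun y : R => c * y) = cst c.
  by apply/funext => x; rewrite derive1E; apply: @derive_val; exact: dF.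
apply: (cvg_unique _ h1) => //.
suff -> : (fun n : nat => \int[mu]_(x in `[(c / n.+1%:R)%R, (c * n.+1%:R)%R]) (f x)%:E)%E =
  (fun n : nat => \int[mu]_(x in `[(1 / n.+1%:R)%R, (1 * n.+1%:R)%R]) (f (c * x) * c)%:E)%E.
  exact: h2.
apply/funext => n; rewrite div1r mul1r.
have := @integration_by_substitution_increasing _ (fun y => c * y) f n.+1%:R^-1 n.+1%:R.
rewrite F' => ->//.
- by rewrite (le_trans (y := 1)) ?invf_le1 ?ler1n.
- by move=> x y _ _ xy; rewrite ltr_pM2l.
- by move=> x _; exact: cvg_cst.
- exact: is_cvg_cst.
- exact: is_cvg_cst.
- split.
  + by move=> x _; apply: ex_derive.
  + by apply: cvg_at_right_filter; exact: cMc.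
  + by apply: cvg_at_left_filter; exact: cMc.
- apply: continuous_in_subspaceT => x /set_mem /=; rewrite in_itv/= => /andP[h _].
  by apply: cf; apply: lt_le_trans h; rewrite divr_gt0.
Qed.

End Dilation.

(** With the convention [0^-1 = 0], the identity [f^-1 = f * (f^2)^-1] holds everywhere and reduces
    the reciprocal to a real power of a nonnegative function. *)
Lemma measurable_funV (R : realType) d (T : measurableType d) (D : set T) (f : T -> R) :
  measurable_fun D f -> measurable_fun D (fun x => (f x)^-1).
Proof.
move=> mf; have -> : (fun x => (f x)^-1) = (fun x => f x * (f x ^+ 2) `^ (-1)).
  apply/funext => x; rewrite powR_inv1 ?sqr_ge0//.
  have [->|f0] := eqVneq (f x) 0; first by rewrite invr0 mul0r.
  by rewrite expr2 invfM mulrA mulfV// mul1r.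
apply: measurable_funM => //.
apply: (@measurableT_comp _ _ _ _ _ _ (@powR R ^~ (-1))).
  exact: measurable_powR.
exact: measurable_funX.
Qed.

(** * Integration against the density [p^(- alpha)] of the Laplace representation *)

Section LaplaceFunctional.
Context {R : realType}.
Context (alpha : R) (alpha01 : 0 < alpha < 1).
Implicit Types (phi chi : R -> R) (Q K r tau : R).
Local Notation mu := (@lebesgue_measure R).
Local Notation ray := (`]0, +oo[%classic : set R).

Let a0 : 0 < alpha. Proof. by case/andP: alpha01. Qed.
Let a1 : 0 < 1 - alpha. Proof. by case/andP: alpha01 => _; rewrite subr_gt0. Qed.

Definition LI phi := \int[mu]_(p in ray) (phi p * p `^ (- alpha)).
Definition inL phi :=
  mu.-integrable ray (EFin \o (fun p => phi p * p `^ (- alpha))).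

Lemma LI_eq phi chi : (forall p, 0 < p -> phi p = chi p) -> LI phi = LI chi.
Proof.
move=> e; apply: eq_Rintegral => p; rewrite inE/= in_itv/= andbT => p0.
by rewrite e.
Qed.

Lemma inL_eq phi chi : (forall p, 0 < p -> phi p = chi p) -> inL phi -> inL chi.
Proof.
move=> e; apply: eq_integrable => //= p; rewrite inE/= in_itv/= andbT => p0.
by rewrite e.
Qed.

Lemma inLD phi chi : inL phi -> inL chi -> inL (fun p => phi p + chi p).
Proof.
move=> h1 h2; have : mu.-integrable ray ((EFin \o (fun p => phi p * p `^ (- alpha))%R) \+
    (EFin \o (fun p => chi p * p `^ (- alpha))%R))%E by exact: integrableD.
by apply: eq_integrable => //= p _; rewrite mulrDl.
Qed.

Lemma inLZ K phi : inL phi -> inL (fun p => K * phi p).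
Proof.
move=> h1; have : mu.-integrable ray (fun p => K%:E * (phi p * p `^ (- alpha))%R%:E)%E.
  exact: integrableZl.
by apply: eq_integrable => //= p _; rewrite -EFinM mulrA.
Qed.

Lemma inLB phi chi : inL phi -> inL chi -> inL (fun p => phi p - chi p).
Proof.
move=> h1 h2; apply: (@inL_eq (fun p => phi p + (-1) * chi p)).
  by move=> p _; rewrite mulN1r.
by apply: inLD => //; exact: inLZ.
Qed.

Lemma inL0 : inL (fun=> 0).
Proof.
have := integrable0 mu ray; apply: eq_integrable => //= p _; by rewrite mul0r.
Qed.

Lemma inL_sum m n (phi : nat -> R -> R) :
  (forall i, (m <= i < n)%N -> inL (phi i)) ->
  inL (fun p => \sum_(m <= i < n) phi i p).
Proof.
move=> h; elim: n h => [|n IH] h.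
  by apply: inL_eq inL0 => p _; rewrite big_geq.
have [mn|nm] := leqP m n; last first.
  by apply: inL_eq inL0 => p _; rewrite big_geq.
apply: (@inL_eq (fun p => \sum_(m <= i < n) phi i p + phi n p)).
  by move=> p _; rewrite big_nat_recr.
apply: inLD; last by apply: h; rewrite mn/=.
by apply: IH => i /andP[mi ni]; apply: h; rewrite mi ltnS ltnW.
Qed.

Lemma LID phi chi : inL phi -> inL chi ->
  LI (fun p => phi p + chi p) = LI phi + LI chi.
Proof.
move=> h1 h2; rewrite /LI -RintegralD//.
by apply: eq_Rintegral => p _; rewrite mulrDl.
Qed.

Lemma LIZ K phi : inL phi -> LI (fun p => K * phi p) = K * LI phi.
Proof.
move=> h1; rewrite /LI -RintegralZl//.
by apply: eq_Rintegral => p _; rewrite mulrA.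
Qed.

Lemma LIB phi chi : inL phi -> inL chi ->
  LI (fun p => phi p - chi p) = LI phi - LI chi.
Proof.
move=> h1 h2; rewrite /LI -RintegralB//.
by apply: eq_Rintegral => p _; rewrite mulrBl.
Qed.

Lemma LI0 : LI (fun=> 0) = 0.
Proof. by rewrite -[RHS](mul0r (LI (fun=> 0))) -LIZ ?mul0r//; exact: inL0. Qed.

Lemma LI_sum m n (phi : nat -> R -> R) :
  (forall i, (m <= i < n)%N -> inL (phi i)) ->
  LI (fun p => \sum_(m <= i < n) phi i p) = \sum_(m <= i < n) LI (phi i).
Proof.
move=> h; elim: n h => [|n IH] h.
  by rewrite big_geq// -[RHS]LI0; apply: LI_eq => p _; rewrite big_geq.
have [mn|nm] := leqP m n; last first.
  by rewrite big_geq// -[RHS]LI0; apply: LI_eq => p _; rewrite big_geq.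
rewrite big_nat_recr//= -IH; last first.
  by move=> i /andP[mi ni]; apply: h; rewrite mi ltnS ltnW.
rewrite -LID; last 2 first.
- by apply: inL_sum => i /andP[mi ni]; apply: h; rewrite mi ltnS ltnW.
- by apply: h; rewrite mn/=.
by apply: LI_eq => p _; rewrite big_nat_recr.
Qed.

Lemma LI_le phi chi : inL phi -> inL chi ->
  (forall p, 0 < p -> phi p <= chi p) -> LI phi <= LI chi.
Proof.
move=> h1 h2 h; apply: le_Rintegral => // p; rewrite /= in_itv/= andbT => p0.
by rewrite ler_wpM2r ?powR_ge0// h.
Qed.

Lemma LI_ge0 phi : (forall p, 0 < p -> 0 <= phi p) -> 0 <= LI phi.
Proof.
move=> h; apply: Rintegral_ge0 => p; rewrite /= in_itv/= andbT => p0.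
by rewrite mulr_ge0 ?powR_ge0// h.
Qed.

Lemma inL_dom phi chi : measurable_fun ray phi -> inL chi ->
  (forall p, 0 < p -> `|phi p| <= chi p) -> inL phi.
Proof.
move=> mphi ichi h; apply: le_integrable ichi => //.
  apply/measurable_EFinP; apply: measurable_funM => //.
  by apply: measurable_funTS; exact: measurable_powR.
move=> p; rewrite /= in_itv/= andbT => p0.
rewrite lee_fin normrM [leRHS]normrM ler_wpM2r//.
by rewrite (le_trans (h _ p0))// ler_norm.
Qed.

Lemma LI_norm phi chi : inL phi -> inL chi ->
  (forall p, 0 < p -> `|phi p| <= chi p) -> `|LI phi| <= LI chi.
Proof.
move=> h1 h2 h; rewrite ler_norml -mulN1r -(LIZ _ h2); apply/andP; split.
  apply: LI_le => //; first exact: inLZ.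
  by move=> p /h; rewrite ler_norml mulN1r => /andP[].
by apply: LI_le => // p /h; rewrite ler_norml => /andP[].
Qed.

Let integrable_ge0 (f : R -> R) (l : R) : measurable_fun ray f ->
  (forall p, 0 < p -> 0 <= f p) ->
  (\int[mu]_(p in ray) (f p)%:E = l%:E)%E -> mu.-integrable ray (EFin \o f).
Proof.
move=> mf f0 fl; apply/integrableP; split; first exact/measurable_EFinP.
suff -> : (\int[mu]_(p in ray) `|(EFin \o f) p| = l%:E)%E by exact: ltry.
rewrite -fl; apply: eq_integral => p; rewrite inE/= in_itv/= andbT => p0.
by rewrite ger0_norm// f0.
Qed.

(** The two model majorants: a power below a cut-off [Q] and [1 / p] above it. Bounds on states are
    split at a suitable [Q] and compared with them; against [p^(- alpha)] the first is integrable
    for [r > alpha - 1], the second because [alpha > 0]. *)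
Definition low_pow Q r p : R := if p < Q then p `^ r else 0.
Definition high_inv Q p : R := if p < Q then 0 else p^-1.

Lemma measurable_low_pow Q r D : measurable_fun D (low_pow Q r).
Proof.
apply: measurable_funTS; apply: measurable_fun_ifT => //.
exact: measurable_fun_ltr.
Qed.

Lemma measurable_high_inv Q D : measurable_fun D (high_inv Q).
Proof.
apply: measurable_funTS; apply: measurable_fun_ifT => //.
  exact: measurable_fun_ltr.
exact: measurable_funV.
Qed.

Lemma LI_low_pow Q r : 0 < Q -> alpha - 1 < r ->
  inL (low_pow Q r) /\ LI (low_pow Q r) = Q `^ (r + 1 - alpha) / (r + 1 - alpha).
Proof.
move=> Q0 ra.
have e0 : 0 < r + 1 - alpha by lra.
have H : (\int[mu]_(p in ray) (low_pow Q r p * p `^ (- alpha))%:E =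
    (Q `^ (r + 1 - alpha) / (r + 1 - alpha))%:E)%E.
  rewrite -(integral_powR_near0 e0 Q0).
  rewrite -integral_itv_bndo_bndc; last first.
    by apply/measurable_EFinP; apply: measurable_funTS; exact: measurable_powR.
  have -> : (`]0, Q[ = ray `&` [set p | p < Q])%classic.
    by apply/seteqP; split => p /=; rewrite !in_itv/= ?andbT => /andP.
  rewrite integral_mkcondr; apply: eq_integral => p.
  rewrite inE/= in_itv/= andbT => p0; rewrite patchE /low_pow.
  have [pQ|pQ] := ltP p Q; last first.
    by rewrite mul0r memNset//=; apply/negP; rewrite -leNgt.
  rewrite mem_set//=.
  by rewrite -powRD; [congr (_ `^ _)%:E; ring|rewrite (gt_eqF p0) implybT].
split; last by rewrite /LI /Rintegral H.
apply: integrable_ge0 H.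
  apply: measurable_funM; first exact: measurable_low_pow.
  by apply: measurable_funTS; exact: measurable_powR.
move=> p p0; rewrite mulr_ge0 ?powR_ge0// /low_pow; case: ifP => // _.
exact: powR_ge0.
Qed.

Lemma LI_high_inv Q : 0 < Q ->
  inL (high_inv Q) /\ LI (high_inv Q) = Q `^ (- alpha) / alpha.
Proof.
move=> Q0.
have H : (\int[mu]_(p in ray) (high_inv Q p * p `^ (- alpha))%:E =
    (Q `^ (- alpha) / alpha)%:E)%E.
  rewrite -(integral_powR_nearoo a0 Q0).
  have -> : (`[Q, +oo[ = ray `&` [set p | Q <= p])%classic.
    apply/seteqP; split => p /=; rewrite !in_itv/= ?andbT; last by case.
    by move=> h; split => //; exact: lt_le_trans h.
  rewrite integral_mkcondr; apply: eq_integral => p.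
  rewrite inE/= in_itv/= andbT => p0; rewrite patchE /high_inv.
  have [pQ|pQ] := ltP p Q.
    by rewrite mul0r memNset//=; apply/negP; rewrite -ltNge.
  rewrite mem_set//= addrC powRD; last by rewrite (gt_eqF p0) implybT.
  by rewrite powR_inv1// ltW.
split; last by rewrite /LI /Rintegral H.
apply: integrable_ge0 H.
  apply: measurable_funM; first exact: measurable_high_inv.
  by apply: measurable_funTS; exact: measurable_powR.
move=> p p0; rewrite mulr_ge0 ?powR_ge0// /high_inv; case: ifP => // _.
by rewrite invr_ge0 ltW.
Qed.

Definition Cmin : R := (1 - alpha)^-1 + alpha^-1.

Lemma Cmin_gt0 : 0 < Cmin.
Proof. by rewrite addr_gt0 ?invr_gt0. Qed.

(** The bounds [tau] and [1 / p] cross at the cut-off [Q = 1 / tau]. The two sides contribute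
    [tau^alpha / (1 - alpha)] and [tau^alpha / alpha], whence [Cmin]. *)
Lemma LI_min tau phi : 0 < tau -> measurable_fun ray phi ->
  (forall p, 0 < p -> `|phi p| <= tau) ->
  (forall p, 0 < p -> `|phi p| <= p^-1) ->
  inL phi /\ `|LI phi| <= Cmin * tau `^ alpha.
Proof.
move=> t0 mphi h1 h2.
have ti0 : 0 < tau^-1 by rewrite invr_gt0.
have am1 : alpha - 1 < 0 by rewrite subr_lt0; case/andP: alpha01.
have [i1 l1] := LI_low_pow ti0 am1.
have [i2 l2] := LI_high_inv ti0.
pose chi p := tau * low_pow tau^-1 0 p + high_inv tau^-1 p.
have ichi : inL chi by apply: inLD => //; exact: inLZ.
have hchi p : 0 < p -> `|phi p| <= chi p.
  move=> p0; rewrite /chi /low_pow /high_inv; case: ifP => _.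
    by rewrite powRr0 mulr1 addr0 h1.
  by rewrite mulr0 add0r h2.
have iphi : inL phi by exact: inL_dom ichi hchi.
split => //; apply: (le_trans (LI_norm iphi ichi hchi)).
rewrite /chi LID//; last exact: inLZ.
rewrite LIZ// l1 l2 add0r /Cmin mulrDl.
have -> : (tau^-1) `^ (- alpha) = tau `^ alpha.
  by rewrite -[tau^-1]powR_inv1 ?(ltW t0)// -powRrM mulN1r opprK.
have -> : (tau^-1) `^ (1 - alpha) = tau^-1 * tau `^ alpha.
  rewrite powRD ?invr_eq0 ?(gt_eqF t0) ?implybT// powRr1 ?(ltW ti0)//.
  by rewrite -[tau^-1 in X in _ * X]powR_inv1 ?(ltW t0)// -powRrM mulN1r opprK.
rewrite le_eqVlt; apply/orP; left; apply/eqP; field.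
by rewrite !gt_eqF.
Qed.

(** The value of the Gamma function at [1 - alpha], which normalizes the Laplace representation of
    the kernel. *)
Definition cL : R := LI (fun p => expR (- p)).

Let measurable_expN t D : measurable_fun D (fun p : R => expR (- (p * t))).
Proof.
apply: measurable_funTS; apply: measurableT_comp => //.
by apply: measurableT_comp => //; exact: measurable_funM.
Qed.

Lemma mulr_expN_le1 (x : R) : 0 <= x -> x * expR (- x) <= 1.
Proof.
move=> x0; rewrite expRN ler_pdivrMr ?expR_gt0// mul1r.
by apply: le_trans (expR_ge1Dx x); rewrite lerDr.
Qed.

Lemma inL_exp t : 0 < t -> inL (fun p => expR (- (p * t))).
Proof.
move=> t0.
have h p : 0 < p -> `|expR (- (p * t))| <= 1.
  by move=> p0; rewrite ger0_norm ?expR_ge0// -expR0 ler_expR oppr_le0 mulr_ge0 ?ltW.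
have h2 p : 0 < p -> `|expR (- (p * t))| <= t^-1 * p^-1.
  move=> p0; rewrite ger0_norm ?expR_ge0// -invfM -[leRHS]mul1r.
  by rewrite ler_pdivlMr ?mulr_gt0// mulrC [X in X * _]mulrC mulr_expN_le1// mulr_ge0 ?ltW.
have am1 : alpha - 1 < 0 by rewrite subr_lt0; case/andP: alpha01.
have [i1 _] := LI_low_pow ltr01 am1.
have [i2 _] := LI_high_inv ltr01.
apply: (@inL_dom _ (fun p => low_pow 1 0 p + t^-1 * high_inv 1 p)) => //.
  by apply: inLD => //; exact: inLZ.
move=> p p0; rewrite /low_pow /high_inv; case: ifP => _.
  by rewrite powRr0 mulr0 addr0 h.
by rewrite add0r h2.
Qed.

Lemma cL_gt0 : 0 < cL.
Proof.
have am1 : alpha - 1 < 0 by rewrite subr_lt0; case/andP: alpha01.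
have [i1 l1] := LI_low_pow ltr01 am1.
have ie : inL (fun p => expR (- p)).
  by apply: inL_eq (inL_exp ltr01) => p _; rewrite mulr1.
apply: (@lt_le_trans _ _ (LI (fun p => expR (-1) * low_pow 1 0 p))).
  by rewrite LIZ// l1 add0r powR1 mul1r mulr_gt0 ?expR_gt0 ?invr_gt0.
apply: LI_le => //; first exact: inLZ.
move=> p p0; rewrite /low_pow; case: ifPn => [p1|_]; last by rewrite mulr0 expR_ge0.
by rewrite powRr0 mulr1 ler_expR lerN2 ltW.
Qed.

Lemma LI_exp t : 0 < t -> LI (fun p => expR (- (p * t))) = cL * t `^ (alpha - 1).
Proof.
move=> t0; rewrite /cL {2}/LI /Rintegral (@integral_dilation _ _ t)//; last 2 first.
- by move=> x x0; rewrite mulr_ge0 ?expR_ge0 ?powR_ge0.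
- move=> x x0; apply: cvgM; last exact: continuous_powR.
  by apply: continuous_comp; [exact: opp_continuous|exact: continuous_expR].
have -> : (\int[mu]_(x in ray) (expR (- (t * x)) * (t * x) `^ (- alpha) * t)%:E)%E =
   (\int[mu]_(x in ray) (t `^ (1 - alpha) * (expR (- (x * t)) * x `^ (- alpha)))%:E)%E.
  apply: eq_integral => x; rewrite inE/= in_itv/= andbT => x0; congr (_%:E).
  rewrite powRM ?(ltW t0) ?(ltW x0)// powRD ?(gt_eqF t0) ?implybT//.
  rewrite powRr1 ?(ltW t0)// [t * x]mulrC; ring.
rewrite -/(Rintegral _ _ _) RintegralZl//; last exact: inL_exp.
rewrite mulrAC -powRD ?(gt_eqF t0) ?implybT//.
by rewrite addrA subrK addrC addNr powRr0 mul1r.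
Qed.

End LaplaceFunctional.

(** * Weights and memory of the quadrature *)

Section Cone.
Context {R : realFieldType}.
Implicit Types (a : nat -> nat -> R) (v c : nat -> R).

(* Row [m] has columns [k < m]; the extra bound [v0] plays the role of one more
   column to the left, filled with ones.  Rows are peeled off from the bottom,
   the ratio [v k / a n k] being nonincreasing in [k]. *)
Lemma triangular_cone a v (v0 : R) n :
  (forall k m, (k < m <= n)%N -> 0 < a m k) ->
  (forall k m m', (k < m <= m')%N -> (m' <= n)%N -> a m' k <= a m k) ->
  (forall k l m m', (k < l < m)%N -> (m <= m' <= n)%N ->
     a m' l * a m k <= a m' k * a m l) ->
  0 <= v0 ->
  (forall k, (k < n)%N -> 0 <= v k <= v0 * a n k) ->
  (forall k l, (k < l < n)%N -> v l * a n k <= v k * a n l) ->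
  exists w : nat -> R, [/\ forall m, 0 <= w m,
    forall c, \sum_(0 <= k < n) v k * c k =
      \sum_(1 <= m < n.+1) w m * \sum_(0 <= k < m) a m k * c k
    & \sum_(1 <= m < n.+1) w m <= v0].
Proof.
elim: n v v0 => [|n IH] v v0 a0 ad ar v00 vb vr.
  exists (fun=> 0); split => // [c|]; first by rewrite !big_geq.
  by rewrite big_geq.
have an0 : 0 < a n.+1 n by apply: a0; lia.
(* Subtracting [q] times the last row clears the last column. The remainder meets the hypotheses for
   the smaller triangle, with [v0 - q] as its bound. *)
pose q := v n / a n.+1 n.
have vn0 : 0 <= v n by have /andP[] := vb n (ltnSn n).
have q0 : 0 <= q by rewrite divr_ge0// ltW.
have vq k : (k < n)%N -> q * a n.+1 k <= v k.
  move=> kn; rewrite /q mulrAC ler_pdivrMr//; apply: vr.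
  lia.
have qv0 : q <= v0.
  by rewrite ler_pdivrMr//; have /andP[] := vb n (ltnSn n).
have [||||||w [w0 wc ws]] := IH (fun k => v k - q * a n.+1 k) (v0 - q).
- by move=> k m /andP[km mn]; apply: a0; lia.
- by move=> k m m' h mn; apply: ad; lia.
- by move=> k l m m' h /andP[h1 h2]; apply: ar; lia.
- by rewrite subr_ge0.
- move=> k kn; rewrite subr_ge0 vq//=.
  have /andP[_ vk] := vb k (ltnW kn).
  have ak : a n.+1 k <= a n k by apply: ad; lia.
  have ank : 0 < a n.+1 k by apply: a0; lia.
  apply: (@le_trans _ _ ((v0 - q) * a n.+1 k)); first by rewrite mulrBl lerB.
  by rewrite ler_wpM2l// subr_ge0.
- move=> k l /andP[kl ln].
  have ak : 0 < a n.+1 k by apply: a0; clear -kl ln; lia.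
  have al : 0 < a n.+1 l by apply: a0; clear -kl ln; lia.
  have bk : 0 < a n k by apply: a0; clear -kl ln; lia.
  have bl : 0 < a n l by apply: a0; clear -kl ln; lia.
  have h1 : v l * a n.+1 k <= v k * a n.+1 l by apply: vr; clear -kl ln; lia.
  have h2 : a n.+1 l * a n k <= a n.+1 k * a n l.
    by apply: ar; clear -kl ln; lia.
  rewrite -(ler_pM2r ak); apply: (@le_trans _ _ ((v k * a n.+1 l - q * a n.+1 l * a n.+1 k) * a n k)).
    rewrite mulrAC ler_pM2r// mulrBl lerB//.
  rewrite (_ : _ * a n k = (v k - q * a n.+1 k) * (a n.+1 l * a n k)); last by ring.
  rewrite (_ : (_ * a n l) * _ = (v k - q * a n.+1 k) * (a n.+1 k * a n l)); last by ring.
  by rewrite ler_wpM2l// subr_ge0 vq// (ltn_trans kl).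
exists (fun m => if m == n.+1 then q else w m); split.
- by move=> m; case: ifP.
- move=> c; rewrite [in RHS]big_nat_recr//= eqxx.
  rewrite (@eq_big_nat _ _ _ 1 n.+1 _ (fun m => w m * \sum_(0 <= k < m) a m k * c k)); last first.
    by move=> m /andP[_ mn]; rewrite ltn_eqF.
  rewrite -wc big_nat_recr//= [in RHS]big_nat_recr//= mulrDr mulrA.
  rewrite {3}/q mulfVK ?gt_eqF// addrA mulr_sumr -big_split/=.
  by congr (_ + _); apply: eq_bigr => k _; ring.
- rewrite big_nat_recr//= eqxx.
  rewrite (@eq_big_nat _ _ _ 1 n.+1 _ w); last first.
    by move=> m /andP[_ mn]; rewrite ltn_eqF.
  by rewrite -lerBrDr.
Qed.

(** Summation by parts shows that [sum (U l - U l.+1) * W l] is at least [- U n.+1 * W n] for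
    [U >= 0] and nondecreasing [W >= 0]. With [U = S + T] and [U = S - T] this confines the sum for
    [T] from both sides. *)
Lemma abel_dominated (T S W : nat -> R) n :
  (forall l, (l <= n.+1)%N -> `|T l| <= S l) ->
  (forall l, (l < n)%N -> W l <= W l.+1) -> 0 <= W 0 -> T n.+1 = 0 ->
  `|\sum_(0 <= l < n.+1) (T l - T l.+1) * W l| <=
  \sum_(0 <= l < n.+1) (S l - S l.+1) * W l + S n.+1 * W n.
Proof.
have key (U : nat -> R) : (forall l, (l <= n.+1)%N -> 0 <= U l) ->
    (forall l, (l < n)%N -> W l <= W l.+1) -> 0 <= W 0 ->
    - (U n.+1 * W n) <= \sum_(0 <= l < n.+1) (U l - U l.+1) * W l.
  elim: n => [|n IH] U0 Wi W0.
    by rewrite big_nat1 mulrBl lerDr mulr_ge0// U0.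
  rewrite big_nat_recr//=.
  have : - (U n.+1 * W n) <= \sum_(0 <= l < n.+1) (U l - U l.+1) * W l.
    by apply: IH => // l ln; [apply: U0; exact: leqW|apply: Wi; exact: leqW].
  have : U n.+1 * W n <= U n.+1 * W n.+1 by rewrite ler_wpM2l ?U0 ?Wi.
  by lra.
move=> TS Wi W0 T0; rewrite ler_norml; apply/andP; split.
- have U0 l : (l <= n.+1)%N -> 0 <= S l + T l.
    by move=> /TS; rewrite ler_norml => /andP[h _]; rewrite addrC -lerBlDr sub0r.
  have := key (fun l => S l + T l) U0 Wi W0; rewrite T0 addr0.
  rewrite (eq_bigr (fun l => (S l - S l.+1) * W l + (T l - T l.+1) * W l)).
    by rewrite big_split/=; lra.
  by move=> l _; ring.
- have U0 l : (l <= n.+1)%N -> 0 <= S l - T l.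
    by move=> /TS; rewrite ler_norml subr_ge0 => /andP[].
  have := key (fun l => S l - T l) U0 Wi W0; rewrite T0 subr0.
  rewrite (eq_bigr (fun l => (S l - S l.+1) * W l - (T l - T l.+1) * W l)).
    by rewrite sumrB; lra.
  by move=> l _; ring.
Qed.

End Cone.

(** * Monotonicity and ratios of the quadrature weights on an arbitrary grid *)

Section GridWeights.
Context {R : realType} (alpha : R) (alpha01 : 0 < alpha < 1).
Implicit Types (t c : nat -> R).
Local Notation mu := (@lebesgue_measure R).

Let a0 : 0 < alpha. Proof. by case/andP: alpha01. Qed.
Let a1 : 0 < 1 - alpha. Proof. by case/andP: alpha01 => _; rewrite subr_gt0. Qed.

Definition increasing_upto (N : nat) t := forall n, (n < N)%N -> t n < t n.+1.

Lemma increasing_upto_lt N t m n : increasing_upto N t ->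
  (m < n)%N -> (n <= N)%N -> t m < t n.
Proof.
move=> ti; elim: n => // n IH; rewrite ltnS leq_eqVlt => /predU1P[->|mn] nN.
  exact: ti.
by apply: (lt_trans (IH mn (ltnW nN))); exact: ti.
Qed.

Lemma increasing_upto_le N t m n : increasing_upto N t ->
  (m <= n)%N -> (n <= N)%N -> t m <= t n.
Proof.
move=> ti; rewrite leq_eqVlt => /predU1P[->//|mn] nN.
by apply: ltW; exact: increasing_upto_lt mn nN.
Qed.

(** The integral of [(t n - s)^(alpha - 1)] over the cell from [t k] to [t k.+1], in closed form.
    Compared with [quad_weight], the Gamma factor is left out and the cells are numbered from 0. *)
Definition weight t (n k : nat) : R :=
  ((t n - t k) `^ alpha - (t n - t k.+1) `^ alpha) / alpha.

Lemma integral_weight t n k : t k <= t k.+1 <= t n ->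
  (\int[mu]_(s in `[t k, t k.+1[) ((t n - s) `^ (alpha - 1))%:E = (weight t n k)%:E)%E.
Proof. exact: integral_kernel. Qed.

Let measurable_kernel (x : R) (D : set R) :
  measurable_fun D (EFin \o (fun s : R => (x - s) `^ (alpha - 1))).
Proof.
apply/measurable_EFinP; apply: measurable_funTS.
apply: (@measurableT_comp _ _ _ _ _ _ (@powR R ^~ (alpha - 1))).
  exact: measurable_powR.
exact: measurable_funB.
Qed.

Lemma ler_npowR (x y r : R) : r <= 0 -> 0 < x -> x <= y -> y `^ r <= x `^ r.
Proof.
move=> r0 x0 xy; have y0 := lt_le_trans x0 xy.
rewrite -[r]opprK !(powRN _ (- r)) lef_pV2 ?posrE ?powR_gt0//.
by apply: ge0_ler_powR => //; rewrite ?nnegrE ?oppr_ge0 ?(ltW x0) ?(ltW y0).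
Qed.

Lemma kernel_comparison t m m' k K : t k <= t k.+1 -> t k.+1 <= t m ->
  t k.+1 <= t m' ->
  (forall s, t k <= s < t k.+1 ->
    (t m - s) `^ (alpha - 1) <= K * (t m' - s) `^ (alpha - 1)) -> 0 <= K ->
  weight t m k <= K * weight t m' k.
Proof.
move=> tk tm tm' h K0; rewrite -lee_fin (EFinM K) -!integral_weight ?tk//.
rewrite -ge0_integralZl//.
- apply: ge0_le_integral => //.
  + by move=> s _; rewrite lee_fin powR_ge0.
  + exact: measurable_kernel.
  + by apply: measurable_funeM; exact: measurable_kernel.
- exact: measurable_kernel.
- by move=> s _; rewrite lee_fin powR_ge0.
Qed.

Lemma weight_ge_const t n k x : t k <= t k.+1 -> t k.+1 <= t n -> 0 < x ->
  t n - t k <= x -> x `^ (alpha - 1) * (t k.+1 - t k) <= weight t n k.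
Proof.
move=> tk tn x0 hx; rewrite -lee_fin (EFinM (x `^ _)) -integral_weight ?tk//.
have -> : ((t k.+1 - t k)%:E = mu `[t k, t k.+1[)%E.
  rewrite lebesgue_measure_itv/= lte_fin; case: ltgtP tk => // -> _.
  by rewrite subrr.
rewrite -integral_cst; last exact: measurable_itv.
apply: ge0_le_integral => //.
- by move=> s _; rewrite lee_fin powR_ge0.
- exact: measurable_kernel.
- move=> s; rewrite /= in_itv/= => /andP[s1 s2]; rewrite lee_fin.
  apply: ler_npowR; first by rewrite subr_le0 ltW// -subr_gt0.
    by rewrite subr_gt0 (lt_le_trans s2).
  by apply: le_trans hx; rewrite lerD2l lerN2.
Qed.

Lemma weight_le_const t n k x : t k <= t k.+1 -> t k.+1 <= t n -> 0 < x ->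
  x <= t n - t k.+1 -> weight t n k <= x `^ (alpha - 1) * (t k.+1 - t k).
Proof.
move=> tk tn x0 hx; rewrite -lee_fin (EFinM (x `^ _)) -integral_weight ?tk//.
have -> : ((t k.+1 - t k)%:E = mu `[t k, t k.+1[)%E.
  rewrite lebesgue_measure_itv/= lte_fin; case: ltgtP tk => // -> _.
  by rewrite subrr.
rewrite -integral_cst; last exact: measurable_itv.
apply: ge0_le_integral => //.
- by move=> s _; rewrite lee_fin powR_ge0.
- exact: measurable_kernel.
- move=> s; rewrite /= in_itv/= => /andP[s1 s2]; rewrite lee_fin.
  apply: ler_npowR => //; first by rewrite subr_le0 ltW// -subr_gt0.
  by apply: (le_trans hx); rewrite lerD2l lerN2 ltW.
Qed.

Section OneGrid.
Context (N : nat) (t : nat -> R) (tN : increasing_upto N t).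

Let lt_t m n : (m < n)%N -> (n <= N)%N -> t m < t n.
Proof. exact: increasing_upto_lt. Qed.
Let le_t m n : (m <= n)%N -> (n <= N)%N -> t m <= t n.
Proof. exact: increasing_upto_le. Qed.

Lemma weight_gt0 k m : (k < m <= N)%N -> 0 < weight t m k.
Proof.
move=> /andP[km mN]; rewrite divr_gt0// subr_gt0.
have h1 := le_t km mN; have h2 := lt_t (ltnSn k) (leq_trans km mN).
apply: gt0_ltr_powR; rewrite ?nnegrE ?subr_ge0//.
  by rewrite (le_trans (ltW h2)).
by rewrite ltrD2l ltrN2.
Qed.

Lemma weight_decr k m m' : (k < m <= m')%N -> (m' <= N)%N ->
  weight t m' k <= weight t m k.
Proof.
move=> /andP[km mm'] mN; rewrite -[leRHS]mul1r.
have mN' := leq_trans mm' mN.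
apply: kernel_comparison => //.
- exact: le_t (leqnSn k) (leq_trans km mN').
- exact: le_t (leq_trans km mm') mN.
- exact: le_t.
- move=> s /andP[_ s2]; rewrite mul1r; have h1 := le_t km mN'.
  apply: ler_npowR; first by rewrite subr_le0 ltW// -subr_gt0.
    by rewrite subr_gt0 (lt_le_trans s2).
  by rewrite lerD2r le_t.
Qed.

(** The quotient of the kernels for [t m'] and [t m] decreases in [s]. Its value [g] at [s = t l]
    separates the two cells: it is an upper bound of the quotient on cell [l] and a lower bound on
    cell [k], which lies to the left. *)
Lemma weight_ratio k l m m' : (k < l < m)%N -> (m <= m' <= N)%N ->
  weight t m' l * weight t m k <= weight t m' k * weight t m l.
Proof.
move=> /andP[kl lm] /andP[mm' mN].
have mN' := leq_trans mm' mN.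
have tlm := lt_t lm mN'; have tlm' := lt_t (leq_trans lm mm') mN.
pose g := (t m' - t l) `^ (alpha - 1) / (t m - t l) `^ (alpha - 1).
have am1 : alpha - 1 <= 0 by rewrite subr_le0 ltW// -subr_gt0.
have g0 : 0 < g by rewrite divr_gt0 ?powR_gt0 ?subr_gt0.
have tl1 := le_t (leqnSn l) (leq_trans lm mN').
have tl2 := le_t lm mN'; have tl3 := le_t (leq_trans lm mm') mN.
have tk1 := le_t (leqnSn k) (leq_trans (ltn_trans kl lm) mN').
have tk2 := le_t (ltn_trans kl lm) mN'.
have tk3 := le_t (leq_trans (ltn_trans kl lm) mm') mN.
have tkl := le_t kl (ltnW (leq_trans lm mN')).
have tmm := le_t mm' mN.
have h1 : weight t m' l <= g * weight t m l.
  apply: kernel_comparison => //; last exact: ltW.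
  move=> s /andP[s1 s2]; rewrite /g mulrAC ler_pdivlMr ?powR_gt0 ?subr_gt0//.
  have sm : s < t m by rewrite (lt_le_trans s2).
  have sm' : s < t m' by rewrite (lt_le_trans sm).
  rewrite -!powRM ?subr_ge0 ?(ltW sm) ?(ltW sm') ?(ltW tlm) ?(ltW tlm')//.
  apply: ler_npowR => //; first by rewrite mulr_gt0 ?subr_gt0.
  by rewrite -subr_ge0 (_ : _ - _ = (t m' - t m) * (s - t l)) ?mulr_ge0 ?subr_ge0//; ring.
have h2 : weight t m k <= g^-1 * weight t m' k.
  apply: kernel_comparison => //; last by rewrite invr_ge0 ltW.
  move=> s /andP[s1 s2]; rewrite /g invf_div mulrAC ler_pdivlMr ?powR_gt0 ?subr_gt0//.
  have sl : s < t l by rewrite (lt_le_trans s2).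
  have sm : s < t m by rewrite (lt_trans sl).
  have sm' : s < t m' by rewrite (lt_trans sl).
  rewrite -!powRM ?subr_ge0 ?(ltW sm) ?(ltW sm') ?(ltW tlm) ?(ltW tlm')//.
  apply: ler_npowR => //; first by rewrite mulr_gt0 ?subr_gt0.
  by rewrite -subr_ge0 (_ : _ - _ = (t m' - t m) * (t l - s)) ?mulr_ge0 ?subr_ge0 ?(ltW sl)//; ring.
have w1 : 0 < weight t m l by apply: weight_gt0; rewrite lm.
have w2 : 0 < weight t m k by apply: weight_gt0; rewrite (ltn_trans kl).
rewrite mulrC; apply: (le_trans (ler_pM _ _ h2 h1)); [exact: ltW| |].
  by apply/ltW/weight_gt0; rewrite (leq_trans lm).
by rewrite mulrACA mulVf ?gt_eqF// mul1r.
Qed.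

(** The kernel increases in [s], so its mean over the later cell [l] is the larger one; both means
    are compared with the kernel at [t l]. *)
Lemma step_weight_ratio k l n : (k < l < n)%N -> (n <= N)%N ->
  (t l.+1 - t l) * weight t n k <= (t k.+1 - t k) * weight t n l.
Proof.
move=> /andP[kl ln] nN.
have tln := lt_t ln nN.
have x0 : 0 < t n - t l by rewrite subr_gt0.
have h1 : weight t n k <= (t n - t l) `^ (alpha - 1) * (t k.+1 - t k).
  apply: weight_le_const => //.
  - exact: le_t (leqnSn k) (leq_trans (ltn_trans kl ln) nN).
  - exact: le_t (ltn_trans kl ln) nN.
  - by rewrite lerD2l lerN2 le_t// ltnW// (leq_trans ln).
have h2 : (t n - t l) `^ (alpha - 1) * (t l.+1 - t l) <= weight t n l.
  apply: weight_ge_const => //.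
  - exact: le_t (leqnSn l) (leq_trans ln nN).
  - exact: le_t.
have dl : 0 <= t l.+1 - t l by rewrite subr_ge0 le_t// (leq_trans ln).
have dk : 0 <= t k.+1 - t k.
  by rewrite subr_ge0 le_t// (leq_trans (ltn_trans kl ln)).
apply: (le_trans (ler_wpM2l dl h1)).
by rewrite mulrA mulrC ler_wpM2l// mulrC.
Qed.

Lemma sum_weight k m : (k <= m)%N ->
  \sum_(k <= l < m) weight t m l = (t m - t k) `^ alpha / alpha.
Proof.
move=> km; rewrite -mulr_suml; congr (_ / _).
have := @telescope_sumr _ k m (fun l => - (t m - t l) `^ alpha) km.
rewrite subrr powR0 ?gt_eqF// oppr0 sub0r opprK => <-.
by apply: eq_bigr => l _; rewrite opprK addrC.
Qed.

(** By [triangular_cone] with [v0 = 1], row [m] cut off at column [n] is a combination of the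
    earlier rows with nonnegative coefficients of sum at most 1. What later times remember of the
    first [n] steps therefore never exceeds the bound valid so far: a maximum principle without any
    condition on the grid. *)
Lemma history_le c Z n m : 0 <= Z -> (n < m <= N)%N ->
  (forall l, (l <= n)%N -> \sum_(0 <= k < l) weight t l k * c k <= Z) ->
  \sum_(0 <= k < n) weight t m k * c k <= Z.
Proof.
move=> Z0 /andP[nm mN] hZ; have nN : (n <= N)%N := ltnW (leq_trans nm mN).
have [|||||| w [w0 wc ws]] := @triangular_cone _ (weight t) (weight t m) 1 n.
- by move=> k l /andP[kl ln]; apply: weight_gt0; rewrite kl (leq_trans ln).
- by move=> k l l' h ln; apply: weight_decr => //; rewrite (leq_trans ln).
- move=> k l p p' h /andP[h1 h2]; apply: weight_ratio => //.
  by rewrite h1 (leq_trans h2).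
- by [].
- move=> k kn; rewrite mul1r; apply/andP; split.
    by apply/ltW/weight_gt0; lia.
  by apply: weight_decr; lia.
- by move=> k l /andP[kl ln]; apply: weight_ratio; lia.
rewrite wc; apply: (@le_trans _ _ (\sum_(1 <= l < n.+1) w l * Z)).
  by apply: ler_sum_nat => l /andP[_ ln]; rewrite ler_wpM2l// hZ.
by rewrite -mulr_suml -[leRHS]mul1r ler_wpM2r.
Qed.

Lemma history_norm_le c Z n m : (n < m <= N)%N ->
  (forall l, (l <= n)%N -> `|\sum_(0 <= k < l) weight t l k * c k| <= Z) ->
  `|\sum_(0 <= k < n) weight t m k * c k| <= Z.
Proof.
move=> nm h; have Z0 : 0 <= Z by apply: le_trans (h 0%N isT).
rewrite ler_norml lerNl -sumrN; apply/andP; split; last first.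
  by apply: history_le => // l /h; rewrite ler_norml => /andP[].
rewrite (eq_bigr (fun k => weight t m k * (- c k))); last by move=> k _; rewrite mulrN.
apply: history_le => // l /h; rewrite ler_norml lerNl -sumrN => /andP[h1 _].
by rewrite (eq_bigr (fun k => - (weight t l k * c k)))// => k _; rewrite mulrN.
Qed.

(** The right-hand side is the integral of [r^(- alpha)] from [y] to [x], and the integrand is at
    least its value at [x]. *)
Lemma ler_sub_powR (x y : R) : 0 <= y <= x -> 0 < x ->
  x `^ (- alpha) * (x - y) <= (x `^ (1 - alpha) - y `^ (1 - alpha)) / (1 - alpha).
Proof.
move=> /andP[y0 yx] x0.
have := @integral_kernel R (1 - alpha) 0 (x - y) x a1.
rewrite subr_ge0 yx lerBlDr lerDl y0 subr0 opprB addrCA subrr addr0 => /(_ isT) H.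
rewrite -lee_fin -H EFinM.
have -> : ((x - y)%:E = mu `[0%R, (x - y)%R[)%E.
  rewrite lebesgue_measure_itv/= lte_fin sube0; case: ltgtP => //.
    by rewrite subr_lt0 ltNge yx.
  by move=> <-.
rewrite -integral_cst; last exact: measurable_itv.
apply: ge0_le_integral => //.
- by move=> s _; rewrite lee_fin powR_ge0.
- apply/measurable_EFinP; apply: measurable_funTS.
  apply: (@measurableT_comp _ _ _ _ _ _ (@powR R ^~ (1 - alpha - 1))).
    exact: measurable_powR.
  exact: measurable_funB.
- move=> s; rewrite /= in_itv/= => /andP[s1 s2]; rewrite lee_fin.
  rewrite (_ : 1 - alpha - 1 = - alpha); last by ring.
  apply: ler_npowR; first by rewrite oppr_le0 ltW.
    by rewrite subr_gt0 (lt_le_trans s2)// lerBlDr lerDl.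
  by rewrite lerBlDr lerDl.
Qed.

End OneGrid.

(* Dual weights: [c l = alpha * (t l.+1 - t 0) `^ (- alpha)] satisfies
   [\sum_l weight t m l * c l >= 1] because it is nonincreasing. *)
Lemma tail_sum_le0 N t c Z n : increasing_upto N t -> (0 < n <= N)%N ->
  (forall m, (m <= n)%N -> `|\sum_(0 <= k < m) weight t m k * c k| <= Z) ->
  `|\sum_(0 <= l < n) (t l.+1 - t l) * c l| <=
  Z * (alpha / (1 - alpha) * (t n - t 0) `^ (1 - alpha)).
Proof.
move=> tN /andP[n0 nN] hZ.
have Z0 : 0 <= Z by apply: le_trans (hZ 0%N isT).
pose v0 := \sum_(0 <= k < n) (t k.+1 - t k) / weight t n k.
have w0n k : (k < n)%N -> 0 < weight t n k.
  by move=> kn; apply: (weight_gt0 tN); rewrite kn.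
have dt k : (k < n)%N -> 0 < t k.+1 - t k.
  by move=> kn; rewrite subr_gt0; apply: tN; rewrite (leq_trans kn).
have v0ge k : (k < n)%N -> (t k.+1 - t k) / weight t n k <= v0.
  move=> kn; rewrite /v0 big_mkord (bigD1 (Ordinal kn))//= lerDl.
  by apply: sumr_ge0 => i _; rewrite divr_ge0// ltW ?dt ?w0n.
(* The row of step lengths lies in the cone of the weight rows. The coefficients [w] do not depend
   on [c], so their sum can be estimated by testing with the dual weights [d] below. *)
have [|||||| w [w0 wc _]] := @triangular_cone _ (weight t) (fun k => t k.+1 - t k) v0 n.
- by move=> k l /andP[kl ln]; apply: (weight_gt0 tN); rewrite kl (leq_trans ln).
- by move=> k l l' h ln; apply: (weight_decr tN) => //; rewrite (leq_trans ln).
- move=> k l p p' h /andP[h1 h2]; apply: (weight_ratio tN) => //.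
  by rewrite h1 (leq_trans h2).
- by apply: le_trans (v0ge 0%N n0); rewrite divr_ge0// ltW ?dt ?w0n.
- by move=> k kn; rewrite ltW ?dt//= -ler_pdivrMr ?w0n// v0ge.
- by move=> k l h; apply: (step_weight_ratio tN).
pose d l := alpha * (t l.+1 - t 0) `^ (- alpha).
have d0 l : 0 <= d l by rewrite mulr_ge0 ?powR_ge0// ltW.
have dge m : (0 < m <= n)%N -> 1 <= \sum_(0 <= k < m) weight t m k * d k.
  move=> /andP[m0 mn].
  have tm0 : 0 < t m - t 0.
    by rewrite subr_gt0 (increasing_upto_lt tN)// (leq_trans mn).
  apply: (@le_trans _ _ (\sum_(0 <= k < m) weight t m k * (alpha * (t m - t 0) `^ (- alpha)))).
    rewrite -mulr_suml sum_weight//.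
    rewrite mulrA mulfVK ?gt_eqF// -powRD ?(gt_eqF tm0) ?implybT//.
    by rewrite subrr powRr0.
  apply: ler_sum_nat => k /andP[_ km]; apply: ler_wpM2l.
    by apply/ltW/(weight_gt0 tN); rewrite km (leq_trans mn).
  rewrite ler_pM2l//; apply: ler_npowR; first by rewrite oppr_le0 ltW.
    rewrite subr_gt0 (increasing_upto_lt tN)//.
    by rewrite (leq_trans km)// (leq_trans mn).
  by rewrite lerD2r (increasing_upto_le tN)// (leq_trans mn).
have sumd : \sum_(0 <= l < n) (t l.+1 - t l) * d l <=
    alpha / (1 - alpha) * (t n - t 0) `^ (1 - alpha).
  have := @telescope_sumr _ 0 n (fun l => (t l - t 0) `^ (1 - alpha)) (leq0n n).
  rewrite subrr powR0 ?gt_eqF// subr0 => <-; rewrite mulr_sumr.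
  apply: ler_sum_nat => l /andP[_ ln].
  have ln' := leq_trans ln nN.
  rewrite /d mulrCA -mulrA ler_pM2l//.
  have h := @ler_sub_powR (t l.+1 - t 0) (t l - t 0).
  have e : t l.+1 - t 0 - (t l - t 0) = t l.+1 - t l by ring.
  rewrite mulrC [leRHS]mulrC -e; apply: h.
    by rewrite subr_ge0 (increasing_upto_le tN)//= ?(ltnW ln')// lerD2r ltW ?tN.
  by rewrite subr_gt0 (increasing_upto_lt tN).
rewrite wc; apply: (@le_trans _ _ (\sum_(1 <= m < n.+1) w m * Z)).
  apply: (le_trans (ler_norm_sum _ _ _)); apply: ler_sum_nat => m /andP[_ mn].
  by rewrite normrM (ger0_norm (w0 m)) ler_wpM2l// hZ.
rewrite -mulr_suml mulrC ler_wpM2l//; apply: le_trans sumd.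
rewrite wc; apply: ler_sum_nat => m /andP[m0 mn].
by rewrite -[leLHS]mulr1 ler_wpM2l// dge// m0.
Qed.

(** The grid is restarted at [t j]. A row sum there is a full row sum minus the history before
    [t j], each at most [Z] in absolute value; hence the factor 2. *)
Lemma tail_sum_le N t c Z n j : increasing_upto N t -> (j < n <= N)%N ->
  (forall m, (m <= n)%N -> `|\sum_(0 <= k < m) weight t m k * c k| <= Z) ->
  `|\sum_(j <= l < n) (t l.+1 - t l) * c l| <=
  2 * Z * (alpha / (1 - alpha) * (t n - t j) `^ (1 - alpha)).
Proof.
move=> tN /andP[jn nN] hZ.
pose t' i := t (j + i)%N; pose c' i := c (j + i)%N.
have tN' : increasing_upto (N - j) t'.
  by move=> i ij; rewrite /t' addnS; apply: tN; lia.
have e m : (j <= m)%N -> \sum_(0 <= k < m - j) weight t' (m - j) k * c' k =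
    \sum_(j <= k < m) weight t m k * c k.
  move=> jm; rewrite -{3}[j]add0n big_addn; apply: eq_big_nat => i _.
  by rewrite /weight /t' /c' subnKC// addnS addnC.
have := @tail_sum_le0 (N - j) t' c' (2 * Z) (n - j) tN'.
rewrite subn_gt0 jn leq_sub2r// => /(_ isT).
have -> : t' (n - j)%N = t n by rewrite /t' subnKC// ltnW.
have -> : t' 0 = t j by rewrite /t' addn0.
have -> : \sum_(0 <= l < n - j) (t' l.+1 - t' l) * c' l =
    \sum_(j <= l < n) (t l.+1 - t l) * c l.
  rewrite -[in RHS](add0n j) big_addn; apply: eq_big_nat => i _.
  by rewrite /t' /c' addnS addnC.
apply=> m mn.
have jm : (j <= j + m)%N by rewrite leq_addr.
have := e _ jm; rewrite addKn => ->.
have jmn : (j + m <= n)%N by lia.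
have := hZ _ jmn; rewrite (@big_cat_nat _ _ _ j)//= => h1.
have h2 : `|\sum_(0 <= k < j) weight t (j + m) k * c k| <= Z.
  case: m {h1 mn e} jm jmn => [|m] jm jmn.
    by rewrite addn0; apply: hZ; rewrite ltnW.
  apply: (history_norm_le tN); first by lia.
  by move=> l lj; apply: hZ; lia.
rewrite (_ : 2 * Z = Z + Z); last by ring.
move: h1 h2; set x := \sum_(0 <= k < j) _; set y := \sum_(j <= k < _) _ => h1 h2.
have -> : y = (x + y) - x by ring.
by apply: (le_trans (ler_normB _ _)); exact: lerD.
Qed.

End GridWeights.

(** * Exponential averages, and optimization over a parameter *)

Section ExpBounds.
Context {R : realType}.
Implicit Types p x y : R.

Lemma ge0_1B_expN x : 0 <= x -> 0 <= 1 - expR (- x).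
Proof. by move=> x0; rewrite subr_ge0 -expR0 ler_expR oppr_le0. Qed.

Lemma le_1B_expN x : 1 - expR (- x) <= x.
Proof. by have := expR_ge1Dx (- x); lra. Qed.

Lemma ge_1B_expN x : 0 <= x <= 1 -> x / 2 <= 1 - expR (- x).
Proof.
move=> /andP[x0 x1].
have h := expR_ge1Dx x; have h1 := expRxMexpNx_1 x.
have h2 := expR_gt0 (- x); nra.
Qed.

(* [int_0^x exp (- p * s) ds] *)
Definition expW p x : R := (1 - expR (- (p * x))) / p.

Lemma expW_ge0 p x : 0 < p -> 0 <= x -> 0 <= expW p x.
Proof.
by move=> p0 x0; rewrite divr_ge0 ?(ltW p0)// ge0_1B_expN// mulr_ge0 ?(ltW p0).
Qed.

Lemma expW_le p x : 0 < p -> expW p x <= x.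
Proof. by move=> p0; rewrite ler_pdivrMr// mulrC le_1B_expN. Qed.

Lemma expW_leV p x : 0 < p -> expW p x <= p^-1.
Proof.
move=> p0; by rewrite ler_pdivrMr// mulVf ?gt_eqF// lerBlDr lerDl.
Qed.

Lemma expW_ge p x : 0 < p -> 0 <= x -> p * x <= 1 -> x / 2 <= expW p x.
Proof.
move=> p0 x0 px; rewrite ler_pdivlMr//.
have := @ge_1B_expN (p * x); rewrite px mulr_ge0 ?(ltW p0)// => /(_ isT).
by lra.
Qed.

Lemma expWD p x y : expR (- (p * y)) * expW p x + expW p y = expW p (x + y).
Proof. rewrite /expW mulrDr opprD expRD; ring. Qed.

Lemma measurable_expW x (D : set R) : measurable_fun D (fun p => expW p x).
Proof.
apply: measurable_funTS; apply: measurable_funM; last exact: measurable_funV.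
apply: measurable_funB => //; apply: measurableT_comp => //.
by apply: measurableT_comp => //; exact: measurable_funM.
Qed.

(** The choice [theta = x / D] leaves [x / 2 <= K * D / x]; if [D = 0], a large [theta] contradicts
    [x > 0]. This converts inequalities of Young type into Cauchy-Schwarz inequalities, for sums and
    for integrals alike. *)
Lemma quadratic_optimum x D K : 0 <= x -> 0 <= D -> 0 <= K ->
  (forall theta, 0 < theta -> x <= theta * D / 2 + K / theta) ->
  x ^+ 2 <= 2 * D * K.
Proof.
move=> x0 D0 K0 h; have [->|xn0] := eqVneq x 0.
  by rewrite expr0n/= !mulr_ge0.
have xp : 0 < x by rewrite lt_neqAle eq_sym xn0.
have [D00|Dn0] := eqVneq D 0.
  have := h (2 * (K + 1) / x); rewrite divr_gt0 ?mulr_gt0 ?ltr_wpDl//.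
  rewrite D00 mulr0 mul0r add0r => /(_ isT).
  rewrite invf_div mulrA ler_pdivlMr ?mulr_gt0 ?ltr_wpDl//.
  by rewrite mulrC ler_pM2r//; lra.
have Dp : 0 < D by rewrite lt_neqAle eq_sym Dn0.
have := h (x / D); rewrite divr_gt0// mulfVK ?gt_eqF// invf_div => /(_ isT) h1.
have : x / 2 <= K * (D / x) by lra.
rewrite mulrA ler_pdivlMr//; nra.
Qed.

End ExpBounds.

(** * Relaxation states driven by a piecewise constant source *)

Section States.
Context {R : realType} (alpha : R) (alpha01 : 0 < alpha < 1).
Context (N : nat) (t : nat -> R) (tN : increasing_upto N t) (t00 : t 0 = 0).
Implicit Types (c : nat -> R) (s : nat -> R -> R) (p : R).
Local Notation ray := (`]0, +oo[%classic : set R).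
Local Notation LI := (LI alpha).
Local Notation inL := (inL alpha).
Local Notation Cmin := (Cmin alpha).
Local Notation cL := (cL alpha).
Local Notation dt n := (t n.+1 - t n).

Let a0 : 0 < alpha. Proof. by case/andP: alpha01. Qed.

Let dt_ge0 n : (n < N)%N -> 0 <= dt n.
Proof. by move=> nN; rewrite subr_ge0 ltW ?tN. Qed.

Let t_ge0 n : (n <= N)%N -> 0 <= t n.
Proof. by move=> nN; rewrite -t00 (increasing_upto_le tN). Qed.

(** Each step is the exact flow of [z' = - p * z + c n] followed by the increment [s n p], which
    will carry the defect of replacing the integrand by averages. *)
Fixpoint state c s n p : R :=
  if n is m.+1 then
    expR (- (p * dt m)) * state c s m p + c m * expW p (dt m) + s m p
  else 0.

Lemma measurable_state c s n : (n <= N)%N ->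
  (forall k, (k < N)%N -> measurable_fun ray (s k)) ->
  measurable_fun ray (state c s n).
Proof.
move=> + ms; elim: n => [|n IH] nN /=; first exact: measurable_cst.
apply: measurable_funD; last exact: ms.
apply: measurable_funD.
  apply: measurable_funM; last by apply: IH; exact: ltnW.
  apply: measurable_funTS; apply: measurableT_comp => //.
  by apply: measurableT_comp => //; exact: measurable_funM.
by apply: measurable_funM => //; exact: measurable_expW.
Qed.

Lemma stateE c s n p : state c s n p = state c (fun _ _ => 0) n p + state (fun=> 0) s n p.
Proof.
elim: n => [|n IH] /=; first by rewrite addr0.
by rewrite IH; ring.
Qed.

Lemma state_sum c n p : state c (fun _ _ => 0) n p =
  \sum_(0 <= k < n) c k * (expR (- (p * (t n - t k.+1))) * expW p (dt k)).
Proof.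
elim: n => [|n IH] /=; first by rewrite big_geq.
rewrite big_nat_recr//= subrr mulr0 oppr0 expR0 mul1r addr0 IH mulr_sumr.
congr (_ + _); apply: eq_big_nat => k /andP[_ kn].
rewrite mulrCA; congr (_ * _); rewrite mulrA -expRD; congr (expR _ * _); ring.
Qed.

Lemma state_le c s G (n : nat) p : 0 < p -> (n <= N)%N ->
  (forall k, (k < n)%N -> `|c k * expW p (dt k) + s k p| <= G * expW p (dt k)) ->
  `|state c s n p| <= G * expW p (t n).
Proof.
move=> p0; elim: n => [|n IH] nN h /=.
  by rewrite normr0 t00 /expW mulr0 oppr0 expR0 subrr mul0r mulr0.
have -> : expW p (t n.+1) = expR (- (p * dt n)) * expW p (t n) + expW p (dt n).
  by rewrite expWD; congr expW; ring.
rewrite (mulrDr G) -addrA (le_trans (ler_normD _ _))// lerD//; last exact: h.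
rewrite normrM ger0_norm ?expR_ge0// mulrCA ler_wpM2l ?expR_ge0//.
by apply: IH; [exact: ltnW|move=> k kn; apply: h; exact: leqW].
Qed.

(* The tail sums of [c] are Hoelder continuous, and the state is a mean of them. *)
Lemma state_slow c Z n p : 0 < p -> (0 < n <= N)%N ->
  (forall m, (m <= n)%N -> `|\sum_(0 <= k < m) weight alpha t m k * c k| <= Z) ->
  `|state c (fun _ _ => 0) n p| <= 4 * Z * (alpha / (1 - alpha)) * p `^ (alpha - 1).
Proof.
move=> p0 /andP[n0 nN] hZ; case: n n0 nN hZ => // n _ nN hZ.
have Z0 : 0 <= Z by apply: le_trans (hZ 0%N isT).
have b0 : 0 <= alpha / (1 - alpha).
  by rewrite divr_ge0 ?(ltW a0)// subr_ge0 ltW//; case/andP: alpha01.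
pose Tl l := \sum_(l <= k < n.+1) dt k * c k.
pose K := 2 * Z * (alpha / (1 - alpha)) * p `^ (alpha - 1).
have K0 : 0 <= K by rewrite /K mulr_ge0 ?powR_ge0// mulr_ge0// mulr_ge0.
(* [S] dominates the tail sums, because [d^(1 - alpha) = p^(alpha - 1) * (p * d)^(1 - alpha)] and
   [y^(1 - alpha) <= 1 + y]. It is affine in [t l], so that its own Abel sum can be computed. *)
pose S l := K * (1 + p * (t n.+1 - t l)).
(* The mean of [exp (- p * (t n.+1 - r))] over cell [l], hence nondecreasing in [l] and at most
   1. *)
pose W l := expR (- (p * (t n.+1 - t l.+1))) * expW p (dt l) / dt l.
have dtp k : (k <= n)%N -> 0 < dt k.
  by move=> kn; rewrite subr_gt0 tN// (leq_ltn_trans kn).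
have eT : \sum_(0 <= l < n.+1) (Tl l - Tl l.+1) * W l = state c (fun _ _ => 0) n.+1 p.
  rewrite state_sum; apply: eq_big_nat => l /andP[_ ln].
  rewrite /Tl big_ltn// addrK /W; have := dtp l ln.
  by move: (dt l) => d d0; field; rewrite gt_eqF.
have Tle l : (l <= n.+1)%N -> `|Tl l| <= S l.
  rewrite leq_eqVlt => /predU1P[->|ln].
    by rewrite /Tl big_geq// normr0 mulr_ge0// subrr mulr0 addr0.
  have h := @tail_sum_le _ _ alpha01 N t c Z n.+1 l tN.
  have jn : (l < n.+1 <= N)%N by rewrite ln nN.
  apply: (le_trans (h jn hZ)).
  rewrite /S /K -!mulrA ler_wpM2l// ler_wpM2l// ler_wpM2l ?(ltW a0)//.
  rewrite ler_wpM2l ?invr_ge0 ?subr_ge0 ?(ltW (proj2 (andP alpha01)))//.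
  have d0 : 0 < t n.+1 - t l.
    by rewrite subr_gt0 (increasing_upto_lt tN).
  move: (t n.+1 - t l) d0 => d d0.
  have -> : d `^ (1 - alpha) = p `^ (alpha - 1) * (p * d) `^ (1 - alpha).
    rewrite powRM ?(ltW p0) ?(ltW d0)// mulrA -powRD ?(gt_eqF p0) ?implybT//.
    by rewrite (_ : alpha - 1 + (1 - alpha) = 0) ?powRr0 ?mul1r//; ring.
  rewrite ler_wpM2l ?powR_ge0//.
  have pd : 0 <= p * d by rewrite mulr_ge0 ?(ltW p0) ?(ltW d0).
  have [d1|d1] := leP 1 (p * d).
    apply: (@le_trans _ _ (p * d)); last by rewrite lerDr.
    by apply: ler1_powR => //; rewrite lerBlDr lerDl ltW.
  apply: (@le_trans _ _ (1 `^ (1 - alpha))); last by rewrite powR1 lerDl.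
  apply: ge0_ler_powR; rewrite ?nnegrE ?(ltW d1)// subr_ge0.
  by case/andP: alpha01 => _ /ltW.
have Wle l : (l <= n)%N -> W l <= expR (- (p * (t n.+1 - t l.+1))).
  move=> ln; rewrite ler_pdivrMr ?dtp// ler_wpM2l ?expR_ge0// expW_le//.
have Wge l : (l <= n)%N -> expR (- (p * (t n.+1 - t l))) <= W l.
  move=> ln; rewrite ler_pdivlMr ?dtp// -(_ : expR (- (p * (t n.+1 - t l.+1))) *
    expR (- (p * dt l)) = expR (- (p * (t n.+1 - t l)))); last first.
    by rewrite -expRD; congr expR; ring.
  rewrite -mulrA ler_wpM2l ?expR_ge0// /expW ler_pdivlMr//.
  have := expR_ge1Dx (p * dt l); have := expRxMexpNx_1 (p * dt l).
  have := expR_gt0 (- (p * dt l)); have := dtp l ln; nra.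
have := @abel_dominated _ Tl S W n Tle.
rewrite eT => h; apply: le_trans (h _ _ _) _.
- move=> l ln; apply: (le_trans (Wle _ (ltnW ln))); exact: Wge.
- by apply: le_trans (Wge 0%N isT); exact: expR_ge0.
- by rewrite /Tl big_geq.
have W1 : W n <= 1 by apply: (le_trans (Wle n (leqnn n))); rewrite subrr mulr0 oppr0 expR0.
have SE : \sum_(0 <= l < n.+1) (S l - S l.+1) * W l = K * (1 - expR (- (p * t n.+1))).
  transitivity (K * (p * state (fun=> 1) (fun _ _ => 0) n.+1 p)).
    rewrite state_sum mulr_sumr mulr_sumr; apply: eq_big_nat => l /andP[_ ln].
    rewrite /S /W; have := dtp l ln => d0.
    by field; rewrite gt_eqF.
  congr (_ * _); rewrite -[RHS](@mulfVK _ p) ?gt_eqF// mulrC; congr (_ * _).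
  elim: (n.+1) => [|m IH] /=.
    by rewrite t00 mulr0 oppr0 expR0 subrr mul0r.
  by rewrite IH mul1r addr0 -/(expW p (t m)) expWD addrC subrK.
rewrite SE /S subrr mulr0 addr0 mulr1.
have e0 := expR_ge0 (- (p * t n.+1)).
rewrite (_ : 4 * Z * _ * _ = K + K); last by rewrite /K; ring.
by apply: lerD; rewrite -[leRHS]mulr1 ler_wpM2l//; lra.
Qed.

End States.

(** * Energy estimates for one mode *)

Section Energy.
Context {R : realType} (alpha : R) (alpha01 : 0 < alpha < 1).
Context (N : nat) (t : nat -> R) (tN : increasing_upto N t) (t00 : t 0 = 0).
Context (c : nat -> R) (s : nat -> R -> R) (b : nat -> R) (G : R).
Local Notation ray := (`]0, +oo[%classic : set R).
Local Notation LI := (LI alpha).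
Local Notation inL := (inL alpha).
Local Notation Cmin := (Cmin alpha).
Local Notation dt n := (t n.+1 - t n).
Local Notation z := (state t c s).
Implicit Types (p K x : R) (n k : nat) (phi : R -> R).

Context (ms : forall k, (k < N)%N -> measurable_fun ray (s k))
  (s_le : forall k p, (k < N)%N -> 0 < p -> `|s k p| <= b k * expW p (dt k))
  (b_ge0 : forall k, 0 <= b k) (c_le : forall k, (k < N)%N -> `|c k| + b k <= G).

Let a0 : 0 < alpha. Proof. by case/andP: alpha01. Qed.

Let dt_gt0 n : (n < N)%N -> 0 < dt n.
Proof. by move=> nN; rewrite subr_gt0 tN. Qed.

Let t_ge0 n : (n <= N)%N -> 0 <= t n.
Proof. by move=> nN; rewrite -t00 (increasing_upto_le tN). Qed.

Lemma LI_expW x : 0 <= x ->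
  inL (fun p => expW p x) /\ LI (fun p => expW p x) <= Cmin * x `^ alpha.
Proof.
rewrite le_eqVlt => /predU1P[<-|x0].
  have e p : 0 < p -> 0 = expW p 0.
    by move=> _; rewrite /expW mulr0 oppr0 expR0 subrr mul0r.
  split; first by apply: inL_eq e _; exact: inL0.
  rewrite -(LI_eq alpha e) LI0 mulr_ge0 ?powR_ge0// ltW//.
  exact: Cmin_gt0.
have [||| h1 h2] := @LI_min R alpha alpha01 x (fun p => expW p x) x0.
- exact: measurable_expW.
- by move=> p p0; rewrite ger0_norm ?expW_ge0 ?(ltW x0)// expW_le.
- by move=> p p0; rewrite ger0_norm ?expW_ge0 ?(ltW x0)// expW_leV.
by split => //; apply: le_trans h2; exact: ler_norm.
Qed.

Lemma LI_dom_expW K x phi : 0 <= x -> measurable_fun ray phi ->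
  (forall p, 0 < p -> `|phi p| <= K * expW p x) ->
  inL phi /\ `|LI phi| <= K * LI (fun p => expW p x).
Proof.
move=> x0 mphi h; have [i1 _] := LI_expW x0.
have i2 := inLZ K i1.
have i3 : inL phi by exact: inL_dom mphi i2 h.
by split => //; rewrite -LIZ//; exact: LI_norm.
Qed.

Let mz n : (n <= N)%N -> measurable_fun ray (z n).
Proof. by move=> nN; apply: (@measurable_state R N). Qed.

Lemma state_bound n p : (n <= N)%N -> 0 < p -> `|z n p| <= G * expW p (t n).
Proof.
move=> nN p0; apply: (@state_le R N t) => // k kn.
have kN := leq_trans kn nN.
have w0 : 0 <= expW p (dt k) by rewrite expW_ge0// ltW// dt_gt0.
apply: (le_trans (ler_normD _ _)); apply: (@le_trans _ _ ((`|c k| + b k) * expW p (dt k))).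
  by rewrite mulrDl lerD ?s_le// normrM (ger0_norm w0).
by rewrite ler_wpM2r// c_le.
Qed.

Let G_ge0 : (0 < N)%N -> 0 <= G.
Proof. by move=> N0; apply: le_trans (c_le N0); rewrite addr_ge0. Qed.

Lemma mul_state_bound n p : (n <= N)%N -> 0 < p -> (0 < N)%N -> `|p * z n p| <= G.
Proof.
move=> nN p0 N0; rewrite normrM gtr0_norm//.
apply: (@le_trans _ _ (p * (G * p^-1))); last by rewrite mulrCA mulfV ?gt_eqF// mulr1.
rewrite ler_pM2l//; apply: (le_trans (state_bound nN p0)).
by rewrite ler_wpM2l ?G_ge0// expW_leV.
Qed.

Definition Phi n := LI (fun p => p * z n p ^+ 2).
(** Without [s], the time derivative of the state is [c n - p * z n p] at the start of the step and
    decays like [exp (- p * r)]; the squared exponential has integral [expW p (2 * dt n) / 2]. So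
    [Dis] is the integral of [z'^2] in the identity [(p * z^2 / 2)' = c * z' - z'^2]. *)
Definition Dis n := LI (fun p => (c n - p * z n p) ^+ 2 * (expW p (2 * dt n) / 2)).

Lemma inL_state n : (n <= N)%N -> inL (z n).
Proof.
move=> nN; have [|//] := @LI_dom_expW G (t n) (z n) (t_ge0 nN) (mz nN).
by move=> p p0; exact: state_bound.
Qed.

Lemma inL_Phi n : (0 < N)%N -> (n <= N)%N -> inL (fun p => p * z n p ^+ 2).
Proof.
move=> N0 nN; have [||//] := @LI_dom_expW (G ^+ 2) (t n)
    (fun p => p * z n p ^+ 2) (t_ge0 nN).
  by apply: measurable_funM => //; apply: measurable_funX; exact: mz.
move=> p p0; rewrite expr2 mulrA normrM expr2 -mulrA ler_pM//.
  exact: mul_state_bound.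
exact: state_bound.
Qed.

Lemma inL_Dis n : (n < N)%N ->
  inL (fun p => (c n - p * z n p) ^+ 2 * (expW p (2 * dt n) / 2)).
Proof.
move=> nN; have N0 : (0 < N)%N by apply: leq_ltn_trans nN.
have d0 : 0 <= 2 * dt n by rewrite mulr_ge0// ltW// dt_gt0.
have [||//] := @LI_dom_expW (2 * G ^+ 2) (2 * dt n)
    (fun p => (c n - p * z n p) ^+ 2 * (expW p (2 * dt n) / 2)) d0.
  apply: measurable_funM.
    apply: measurable_funX; apply: measurable_funB => //.
    by apply: measurable_funM => //; apply: mz; exact: ltnW.
  by apply: measurable_funM => //; exact: measurable_expW.
move=> p p0; have w0 := expW_ge0 p0 d0.
rewrite ger0_norm; last by rewrite mulr_ge0 ?sqr_ge0// divr_ge0.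
rewrite mulrA mulrAC ler_wpM2r// ler_pdivrMr//.
rewrite (_ : 2 * G ^+ 2 * 2 = (G + G) ^+ 2); last by ring.
rewrite -real_normK ?num_real// lerXn2r ?nnegrE ?addr_ge0 ?G_ge0//.
apply: (le_trans (ler_normB _ _)); apply: lerD; last exact: mul_state_bound (ltnW nN) p0 N0.
by apply: le_trans (c_le nN); rewrite lerDl.
Qed.

(** With [a = cn - p * zn] and the increment [sn] rescaled to [sg], the difference of the two sides
    is [(1 - E) / p] times a quadratic form in [a] and [sg]. Only half of the dissipation is kept;
    the other half absorbs the cross term [E * a * sg] through the square of [a / 2 + sg]. *)
Let step_algebra (p E cn zn sn bn : R) : 0 < p -> 0 <= E < 1 ->
  `|sn| <= bn * ((1 - E) / p) ->
  p * (E * zn + cn * ((1 - E) / p) + sn) ^+ 2 / 2 - p * zn ^+ 2 / 2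
    + (cn - p * zn) ^+ 2 * ((1 - E ^+ 2) / p / 2) / 2
  <= cn * (E * zn + cn * ((1 - E) / p) + sn - zn) + 3 / 2 * bn ^+ 2 * ((1 - E) / p).
Proof.
move=> p0 /andP[E0 E1] hs.
have w0 : 0 < 1 - E by rewrite subr_gt0.
pose sg := sn * p / (1 - E).
pose a := cn - p * zn.
have zE : zn = (cn - a) / p by rewrite /a; field; rewrite gt_eqF.
have sE : sn = sg * (1 - E) / p by rewrite /sg; field; rewrite !gt_eqF.
have sgb : sg ^+ 2 <= bn ^+ 2.
  have bn0 : 0 <= bn.
    by move: (le_trans (normr_ge0 _) hs); rewrite pmulr_lge0// divr_gt0.
  rewrite -[leLHS]real_normK ?num_real// lerXn2r ?nnegrE//.
  rewrite /sg !normrM normfV (gtr0_norm w0) (gtr0_norm p0).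
  by rewrite ler_pdivrMr// -ler_pdivlMr// -mulrA.
rewrite -subr_ge0.
have -> : cn * (E * zn + cn * ((1 - E) / p) + sn - zn) + 3 / 2 * bn ^+ 2 * ((1 - E) / p)
  - (p * (E * zn + cn * ((1 - E) / p) + sn) ^+ 2 / 2 - p * zn ^+ 2 / 2
    + (cn - p * zn) ^+ 2 * ((1 - E ^+ 2) / p / 2) / 2) =
  (1 - E) / p * ((1 + E) / 4 * a ^+ 2 + E * a * sg - (1 - E) / 2 * sg ^+ 2 + 3 / 2 * bn ^+ 2).
  by rewrite sE zE; field; rewrite gt_eqF.
rewrite mulr_ge0 ?divr_ge0 ?(ltW w0) ?(ltW p0)//.
have h1 : 0 <= E * (a / 2 + sg) ^+ 2 by rewrite mulr_ge0 ?sqr_ge0.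
have h2 := sqr_ge0 a; have h3 := sqr_ge0 sg.
have h4 : (1 - E) * sg ^+ 2 <= sg ^+ 2 by rewrite ler_piMl// lerBlDr lerDl.
nra.
Qed.

Lemma energy_step n : (n < N)%N ->
  (Phi n.+1 - Phi n) / 2 + Dis n / 2 <=
  c n * (LI (z n.+1) - LI (z n)) + 3 / 2 * b n ^+ 2 * (Cmin * dt n `^ alpha).
Proof.
move=> nN; have N0 : (0 < N)%N by apply: leq_ltn_trans nN.
have d0 := dt_gt0 nN.
have [iw lw] := LI_expW (ltW d0).
have i1 := inL_Phi N0 nN; have i2 := inL_Phi N0 (ltnW nN).
have i3 := inL_Dis nN; have i4 := inL_state nN; have i5 := inL_state (ltnW nN).
apply: (@le_trans _ _ (c n * (LI (z n.+1) - LI (z n)) +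
   3 / 2 * b n ^+ 2 * LI (fun p => expW p (dt n)))); last first.
  by rewrite lerD2l ler_wpM2l// mulr_ge0 ?sqr_ge0.
have -> : (Phi n.+1 - Phi n) / 2 + Dis n / 2 =
    LI (fun p => 2^-1 * (p * z n.+1 p ^+ 2 - p * z n p ^+ 2) +
     2^-1 * ((c n - p * z n p) ^+ 2 * (expW p (2 * dt n) / 2))).
  have j1 := inLB i1 i2; have j2 := inLZ 2^-1 j1; have j3 := inLZ 2^-1 i3.
  by rewrite (LID j2 j3) (LIZ _ j1) (LIZ _ i3) (LIB i1 i2) ![2^-1 * _]mulrC.
have -> : c n * (LI (z n.+1) - LI (z n)) + 3 / 2 * b n ^+ 2 * LI (fun p => expW p (dt n)) =
    LI (fun p => c n * (z n.+1 p - z n p) + 3 / 2 * b n ^+ 2 * expW p (dt n)).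
  have j1 := inLB i4 i5; have j2 := inLZ (c n) j1.
  have j3 := inLZ (3 / 2 * b n ^+ 2) iw.
  by rewrite (LID j2 j3) (LIZ _ j1) (LIZ _ iw) (LIB i4 i5).
apply: LI_le.
- by apply: inLD; apply: inLZ => //; exact: inLB.
- by apply: inLD; apply: inLZ => //; exact: inLB.
move=> p p0.
have pd : 0 < p * dt n by rewrite mulr_gt0.
have := @step_algebra p (expR (- (p * dt n))) (c n) (z n p) (s n p) (b n) p0.
rewrite expR_ge0 -expR0 ltr_expR oppr_lt0 pd => /(_ isT).
rewrite expR0 => /(_ (s_le nN p0)).
have -> : expR (- (p * dt n)) ^+ 2 = expR (- (p * (2 * dt n))).
  by rewrite expr2 -expRD; congr expR; ring.
rewrite /= /expW; lra.
Qed.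

(** A state moves by [a * expW p (dt n) + s n p] with [a = c n - p * z n p]. Cauchy-Schwarz in [p],
    carried out through the parameter [theta], separates [Dis n] from the total mass of [expW],
    which is at most [Cmin * dt n^alpha]. *)
Lemma increment_step n : (n < N)%N ->
  (LI (z n.+1) - LI (z n)) ^+ 2 <=
  4 * Dis n * (Cmin * dt n `^ alpha) + 2 * (b n * (Cmin * dt n `^ alpha)) ^+ 2.
Proof.
move=> nN; have N0 : (0 < N)%N by apply: leq_ltn_trans nN.
have d0 := dt_gt0 nN.
have [iw lw] := LI_expW (ltW d0).
have i3 := inL_Dis nN; have i4 := inL_state nN; have i5 := inL_state (ltnW nN).
set K := Cmin * _ in lw *.
have K0 : 0 <= K by rewrite mulr_ge0 ?powR_ge0// ltW// Cmin_gt0.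
have D0 : 0 <= Dis n.
  apply: LI_ge0 => p p0; rewrite mulr_ge0 ?sqr_ge0// divr_ge0// expW_ge0//.
  by rewrite mulr_ge0// ltW.
have key theta : 0 < theta ->
    `|LI (z n.+1) - LI (z n)| <= theta * Dis n / 2 + K / theta + b n * K.
  move=> h0; rewrite -LIB//.
  apply: (@le_trans _ _ (LI (fun p => theta / 2 *
    ((c n - p * z n p) ^+ 2 * (expW p (2 * dt n) / 2)) + (theta^-1 + b n) * expW p (dt n)))).
    apply: LI_norm; [exact: inLB|by apply: inLD; exact: inLZ|].
    move=> p p0 /=; set a := c n - p * z n p; set E := expR _.
    have pd : 0 < p * dt n by rewrite mulr_gt0.
    have E0 : 0 < E by exact: expR_gt0.
    have E1 : E < 1 by rewrite /E -expR0 ltr_expR oppr_lt0.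
    have -> : E * z n p + c n * expW p (dt n) + s n p - z n p = a * expW p (dt n) + s n p.
      by rewrite /a /expW -/E; field; rewrite gt_eqF.
    apply: (le_trans (ler_normD _ _)).
    rewrite (mulrDl theta^-1) addrA lerD// ?s_le//.
    have -> : expW p (2 * dt n) = (1 + E) * expW p (dt n).
      rewrite /expW -/E (_ : expR (- (p * (2 * dt n))) = E ^+ 2); first by ring.
      by rewrite expr2 /E -expRD; congr expR; ring.
    have w0 : 0 <= expW p (dt n) by rewrite expW_ge0// ltW.
    rewrite normrM (ger0_norm w0).
    rewrite [leRHS](_ : _ = (theta / 4 * a ^+ 2 * (1 + E) + theta^-1) * expW p (dt n)); last first.
      by field; rewrite gt_eqF.
    rewrite ler_wpM2r// -real_normK ?num_real//.
    set y := `|a|; have y0 : 0 <= y by exact: normr_ge0.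
    rewrite -(ler_pM2l h0) mulrDr mulfV ?gt_eqF//.
    have h1 : 0 <= (theta * y / 2 - 1) ^+ 2 by exact: sqr_ge0.
    have h2 : 0 <= theta ^+ 2 * y ^+ 2 * E by rewrite mulr_ge0 ?(ltW E0)// mulr_ge0 ?sqr_ge0.
    nra.
  have j1 := inLZ (theta / 2) i3; have j2 := inLZ (theta^-1 + b n) iw.
  rewrite (LID j1 j2) (LIZ _ i3) (LIZ _ iw).
  rewrite -addrA lerD//; first by rewrite mulrAC.
  rewrite (_ : K / theta + b n * K = (theta^-1 + b n) * K); last by ring.
  by rewrite ler_wpM2l// addr_ge0 ?invr_ge0// ltW.
set x := `|_| in key.
have -> : (LI (z n.+1) - LI (z n)) ^+ 2 = x ^+ 2 by rewrite real_normK ?num_real.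
have bK : 0 <= b n * K by rewrite mulr_ge0.
have x0 : 0 <= x by exact: normr_ge0.
have [xb|bx] := leP x (b n * K).
  have : x ^+ 2 <= (b n * K) ^+ 2 by rewrite lerXn2r ?nnegrE.
  have := mulr_ge0 D0 K0; have := sqr_ge0 (b n * K); lra.
have := @quadratic_optimum _ (x - b n * K) (Dis n) K _ D0 K0.
rewrite subr_ge0 (ltW bx) => /(_ isT) h.
have {h} : (x - b n * K) ^+ 2 <= 2 * Dis n * K.
  by apply: h => theta /key; lra.
have := sqr_ge0 (x - 2 * (b n * K)); nra.
Qed.

End Energy.

(** * Energy and dissipation of one mode in a time window *)

Section Window.
Context {R : realType} (alpha : R) (alpha01 : 0 < alpha < 1).
Context (N : nat) (t : nat -> R) (tN : increasing_upto N t) (t00 : t 0 = 0).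
Context (lam beta tau X C3 g : R) (x q : nat -> R) (s : nat -> R -> R).
Local Notation ray := (`]0, +oo[%classic : set R).
Local Notation LI := (LI alpha).
Local Notation inL := (inL alpha).
Local Notation Cmin := (Cmin alpha).
Local Notation cL := (cL alpha).
Local Notation dt n := (t n.+1 - t n).
Let c n : R := - (lam * ((x n + x n.+1) / 2)).
Let b n : R := beta * dt n.
Local Notation z := (state t c s).
Local Notation Phi := (Phi alpha t c s).
Local Notation Dis := (Dis alpha t c s).

Context (lam0 : 0 < lam) (beta0 : 0 <= beta) (tau0 : 0 < tau) (X0 : 0 < X)
  (C30 : 0 <= C3) (g0 : 0 <= g)
  (ms : forall k, (k < N)%N -> measurable_fun ray (s k))
  (s_le : forall k p, (k < N)%N -> 0 < p -> `|s k p| <= b k * expW p (dt k))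
  (dt_le : forall k, (k < N)%N -> dt k <= tau)
  (yE : forall n, (n <= N)%N -> cL * (x n + q n) = LI (z n))
  (q_lip : forall k, (k < N)%N -> lam * `|q k.+1 - q k| <= beta * dt k)
  (x_le : forall n, (n <= N)%N -> `|x n| <= X)
  (slow : forall n p, (n <= N)%N -> 0 < p -> `|z n p| <= C3 * X * p `^ (alpha - 1))
  (G_le : lam * X + beta * tau <= g * lam * X).

Let a0 : 0 < alpha. Proof. by case/andP: alpha01. Qed.
Let a1 : 0 < 1 - alpha. Proof. by case/andP: alpha01 => _; rewrite subr_gt0. Qed.
Let cL0 : 0 < cL. Proof. exact: cL_gt0. Qed.
Let Cm0 : 0 < Cmin. Proof. exact: Cmin_gt0. Qed.

Let dt_gt0 n : (n < N)%N -> 0 < dt n.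
Proof. by move=> nN; rewrite subr_gt0 tN. Qed.

Let ravg n : (n < N)%N -> `|(x n + x n.+1) / 2| <= X.
Proof.
move=> nN; rewrite normrM [`|2^-1|]gtr0_norm ?invr_gt0// ler_pdivrMr//.
apply: (le_trans (ler_normD _ _)); rewrite mulr2n mulrDr mulr1.
by apply: lerD; apply: x_le => //; exact: ltnW.
Qed.

Let c_le k : (k < N)%N -> `|c k| + b k <= lam * X + beta * tau.
Proof.
move=> kN; apply: lerD; last by rewrite ler_wpM2l// dt_le.
by rewrite normrN normrM (gtr0_norm lam0) ler_pM2l// ravg.
Qed.

(* On a partition with large gaps [b] may be negative outside of [k < N]. *)
Let b' k : R := if (k < N)%N then b k else 0.

Let b'_ge0 k : 0 <= b' k.
Proof. by rewrite /b'; case: ifP => // kN; rewrite mulr_ge0// ltW// dt_gt0. Qed.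

Let s_le' k p : (k < N)%N -> 0 < p -> `|s k p| <= b' k * expW p (dt k).
Proof. by move=> kN; rewrite /b' kN; exact: s_le. Qed.

Let c_le' k : (k < N)%N -> `|c k| + b' k <= lam * X + beta * tau.
Proof. by move=> kN; rewrite /b' kN; exact: c_le. Qed.

Let est := @energy_step R alpha alpha01 N t tN t00 c s b' _ ms s_le' b'_ge0 c_le'.
Let ist := @increment_step R alpha alpha01 N t tN t00 c s b' _ ms s_le' b'_ge0 c_le'.
Let iPhi := @inL_Phi R alpha alpha01 N t tN t00 c s b' _ ms s_le' b'_ge0 c_le'.
Let iDis := @inL_Dis R alpha alpha01 N t tN t00 c s b' _ ms s_le' b'_ge0 c_le'.
Let pz_le := @mul_state_bound R N t tN t00 c s b' _ s_le' b'_ge0 c_le'.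

Let Dis_ge0 n : (n < N)%N -> 0 <= Dis n.
Proof.
move=> nN; apply: LI_ge0 => p p0; rewrite mulr_ge0 ?sqr_ge0// divr_ge0//.
by rewrite expW_ge0// mulr_ge0// ltW// dt_gt0.
Qed.

Let Phi_ge0 n : 0 <= Phi n.
Proof. by apply: LI_ge0 => p p0; rewrite mulr_ge0 ?sqr_ge0// ltW. Qed.

(** The error of the mode is [x + q]; the part [x], which enters the averages, is stored in the
    first term and the memory in the second. [inj_rate] bounds the energy supplied per unit of time
    by the averaging defect [s] and by the drift of [q]. *)
Definition energy n := cL * lam / 2 * x n ^+ 2 + Phi n / 2.
Definition inj_rate := 3 / 2 * Cmin * beta ^+ 2 * (tau * tau `^ alpha) + cL * beta * X.

Let dtpow_le n : (n < N)%N -> dt n * dt n `^ alpha <= tau * tau `^ alpha.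
Proof.
move=> nN; apply: ler_pM; rewrite ?powR_ge0 ?(ltW (dt_gt0 nN)) ?dt_le//.
by apply: ge0_ler_powR; rewrite ?nnegrE ?(ltW a0) ?(ltW (dt_gt0 nN)) ?(ltW tau0) ?dt_le.
Qed.

(** Since [c n] is [- lam] times the average of [x n] and [x n.+1], the product
    [c n * (x n.+1 - x n)] is exactly minus the increment of [lam / 2 * x^2]. This is where the
    averaging in the scheme matters. *)
Lemma energy_decay n : (n < N)%N ->
  energy n.+1 - energy n + Dis n / 2 <= dt n * inj_rate.
Proof.
move=> nN; have := est nN; rewrite -!yE//; last exact: ltnW.
have d0 := dt_gt0 nN.
have h1 : c n * (cL * (x n.+1 + q n.+1) - cL * (x n + q n)) <=
    - (cL * lam / 2 * (x n.+1 ^+ 2 - x n ^+ 2)) + dt n * (cL * beta * X).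
  have h : `|lam * ((x n + x n.+1) / 2) * (q n.+1 - q n)| <= X * (beta * dt n).
    rewrite [lam * _]mulrC -mulrA normrM ler_pM ?normr_ge0//; first exact: ravg.
    by rewrite normrM (gtr0_norm lam0) q_lip.
  have {}h : - (lam * ((x n + x n.+1) / 2) * (q n.+1 - q n)) <= X * (beta * dt n).
    by rewrite lerNl; move: h; rewrite ler_norml => /andP[].
  rewrite /c; have := ler_wpM2l (ltW cL0) h; nra.
have h2 : 3 / 2 * b' n ^+ 2 * (Cmin * dt n `^ alpha) <=
    dt n * (3 / 2 * Cmin * beta ^+ 2 * (tau * tau `^ alpha)).
  rewrite /b' nN /b.
  rewrite (_ : 3 / 2 * _ * _ = (dt n * (3 / 2 * Cmin * beta ^+ 2)) * (dt n * dt n `^ alpha)); last by ring.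
  rewrite [leRHS]mulrA ler_wpM2l ?dtpow_le//.
  by rewrite mulr_ge0 ?(ltW d0)// mulr_ge0 ?sqr_ge0// mulr_ge0 ?(ltW Cm0).
rewrite /energy /inj_rate; lra.
Qed.

Lemma energy_sum m n : (m <= n <= N)%N ->
  energy n + \sum_(m <= k < n) Dis k / 2 <= energy m + (t n - t m) * inj_rate.
Proof.
move=> /andP[]; elim: n => [|n IH] mn nN.
  by move: mn; rewrite leqn0 => /eqP->; rewrite big_geq// addr0 subrr mul0r addr0.
move: mn; rewrite leq_eqVlt => /predU1P[->|mn].
  by rewrite big_geq// addr0 subrr mul0r addr0.
rewrite big_nat_recr//=; have := IH mn (ltnW nN); have := energy_decay nN.
by lra.
Qed.

Let pow_mul p : 0 < p -> p * p `^ (alpha - 1) = p `^ alpha.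
Proof. by move=> p0; rewrite mulr_powRB1 ?(ltW p0). Qed.

Let pow_sqr p : 0 < p -> p * (p `^ (alpha - 1)) ^+ 2 = p `^ (2 * alpha - 1).
Proof.
move=> p0; rewrite expr2 {1}(_ : p = p `^ 1); last by rewrite powRr1 ?(ltW p0).
rewrite -!powRD ?(gt_eqF p0) ?implybT//; congr (_ `^ _); ring.
Qed.

Let low_exp : alpha - 1 < 2 * alpha - 1.
Proof. by have := a0; lra. Qed.

Let slow_sqr n p : (n <= N)%N -> 0 < p ->
  p * z n p ^+ 2 <= (C3 * X) ^+ 2 * p `^ (2 * alpha - 1).
Proof.
move=> nN p0; rewrite -pow_sqr// [leRHS]mulrCA ler_pM2l// -exprMn.
rewrite -real_normK ?num_real// lerXn2r ?nnegrE ?slow//.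
by rewrite mulr_ge0 ?powR_ge0// mulr_ge0// ltW.
Qed.

(** The cut-off [Q = lam^(1 / alpha)] balances the two bounds [C3 * X * p^(alpha - 1)] and
    [g * lam * X / p] of a state, so that both parts of the integral have the order [lam * X^2]. *)
Lemma Phi_le n : (0 < N)%N -> (n <= N)%N -> Phi n <= (C3 ^+ 2 + g ^+ 2) / alpha * (lam * X ^+ 2).
Proof.
move=> N0 nN; pose Q := lam `^ alpha^-1.
have Q0 : 0 < Q by rewrite powR_gt0.
have [i1 l1] := LI_low_pow Q0 low_exp.
have [i2 l2] := LI_high_inv alpha01 Q0.
have Qa : Q `^ alpha = lam by rewrite /Q -powRrM mulVf ?gt_eqF// powRr1 ?ltW.
apply: (@le_trans _ _ (LI (fun p => (C3 * X) ^+ 2 * low_pow Q (2 * alpha - 1) p +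
     (g * lam * X) ^+ 2 * high_inv Q p))).
  have j1 := inLZ ((C3 * X) ^+ 2) i1; have j2 := inLZ ((g * lam * X) ^+ 2) i2.
  apply: LI_le; [exact: iPhi|exact: inLD|].
  move=> p p0; rewrite /low_pow /high_inv; case: ifP => _.
    by rewrite mulr0 addr0 slow_sqr.
  rewrite mulr0 add0r ler_pdivlMr//.
  rewrite (_ : p * _ * p = (p * z n p) ^+ 2); last by ring.
  rewrite -real_normK ?num_real// lerXn2r ?nnegrE//.
    by rewrite !mulr_ge0 ?(ltW lam0) ?(ltW X0).
  by apply: le_trans G_le; exact: pz_le.
have j1 := inLZ ((C3 * X) ^+ 2) i1; have j2 := inLZ ((g * lam * X) ^+ 2) i2.
rewrite (LID j1 j2) (LIZ _ i1) (LIZ _ i2) l1 l2 powRN Qa.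
rewrite (_ : 2 * alpha - 1 + 1 - alpha = alpha); last by ring.
rewrite Qa le_eqVlt; apply/orP; left; apply/eqP; field.
by rewrite !gt_eqF.
Qed.

Section OnePeriod.
Context (P : R) (P0 : 0 < P) (Ptau : 4 * P * tau <= 1).

(** The mass of the band [P <= p < 2 * P] for the density [p^(- alpha)]. *)
Definition mP := ((2 * P) `^ (1 - alpha) - P `^ (1 - alpha)) / (1 - alpha).

Let P20 : 0 < 2 * P. Proof. by rewrite mulr_gt0. Qed.
Let am1 : alpha - 1 < 0. Proof. by have := a1; lra. Qed.

Let band p : R := low_pow (2 * P) 0 p - low_pow P 0 p.

Let bandE : inL band /\ LI band = mP.
Proof.
have [i1 l1] := LI_low_pow P20 am1.
have [i2 l2] := LI_low_pow P0 am1.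
split; first exact: inLB.
by rewrite (LIB i1 i2) l1 l2 !add0r /mP mulrBl.
Qed.

Lemma mP_gt0 : 0 < mP.
Proof.
rewrite divr_gt0// subr_gt0; apply: gt0_ltr_powR; rewrite ?nnegrE ?(ltW P0) ?(ltW P20)//.
by have := P0; lra.
Qed.

Let Pd n : (n < N)%N -> 4 * P * dt n <= 1.
Proof.
by move=> nN; apply: le_trans Ptau; rewrite ler_pM2l ?dt_le// mulr_gt0.
Qed.

Let Pa := P `^ alpha.

(** In the band the relaxation is slow enough to be resolved by a step, so
    [expW p (2 * dt n) >= dt n], and [slow] bounds [p * z]. As [c n] does not depend on [p], it can
    be averaged over the band, where it differs from [c n - p * z] by this bounded amount and is
    thus seen by the dissipation. *)
Lemma source_le n : (n < N)%N ->
  dt n * c n ^+ 2 <= 4 / mP * Dis n + 8 * (C3 * X) ^+ 2 * Pa ^+ 2 * dt n.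
Proof.
move=> nN; have d0 := dt_gt0 nN; have m0 := mP_gt0.
have [ib lb] := bandE; have iD := iDis nN.
rewrite -(ler_pM2r m0) [leRHS]mulrDl.
rewrite (_ : 4 / mP * Dis n * mP = 4 * Dis n); last by field; rewrite gt_eqF.
rewrite -lb -(LIZ (dt n * c n ^+ 2) ib) -(LIZ (8 * (C3 * X) ^+ 2 * Pa ^+ 2 * dt n) ib).
rewrite /Dis -(LIZ 4 iD).
have j1 := inLZ (dt n * c n ^+ 2) ib.
have j2 := inLZ (8 * (C3 * X) ^+ 2 * Pa ^+ 2 * dt n) ib; have j3 := inLZ 4 iD.
rewrite -(LID j3 j2); apply: LI_le => //; first exact: inLD.
move=> p p0; set a := c n - p * z n p.
have w0 : 0 <= expW p (2 * dt n) by rewrite expW_ge0// mulr_ge0// ltW.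
rewrite /band /low_pow powRr0.
have [pP|Pp] := ltP p P.
  have PP : P < 2 * P by have := P0; lra.
  rewrite (lt_trans pP PP) subrr !mulr0 addr0 mulr_ge0// mulr_ge0 ?sqr_ge0//.
  by rewrite divr_ge0.
have [p2P|_] := ltP p (2 * P); last first.
  rewrite subrr !mulr0 addr0 mulr_ge0// mulr_ge0 ?sqr_ge0//.
  by rewrite divr_ge0.
rewrite subr0 !mulr1.
have w1 : dt n <= expW p (2 * dt n).
  have := @expW_ge R p (2 * dt n) p0.
  rewrite (_ : 2 * dt n / 2 = dt n); last by field.
  apply; first by rewrite mulr_ge0// ltW.
  by have := Pd nN; nra.
have h1 : (p * z n p) ^+ 2 <= 4 * (C3 * X) ^+ 2 * Pa ^+ 2.
  rewrite (_ : 4 * _ * _ = (C3 * X * (2 * Pa)) ^+ 2); last by ring.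
  have CX : 0 <= C3 * X by rewrite mulr_ge0// ltW.
  rewrite -real_normK ?num_real// lerXn2r ?nnegrE ?mulr_ge0 ?powR_ge0 ?(ltW X0)//.
  rewrite normrM (gtr0_norm p0); apply: (@le_trans _ _ (p * (C3 * X * p `^ (alpha - 1)))).
    by rewrite ler_pM2l// slow// ltnW.
  rewrite [leLHS]mulrCA pow_mul// ler_wpM2l//.
  apply: (@le_trans _ _ ((2 * P) `^ alpha)).
    by apply: ge0_ler_powR; rewrite ?nnegrE ?(ltW a0) ?(ltW p0) ?(ltW P20) ?(ltW p2P).
  rewrite powRM ?(ltW P0)// ler_wpM2r ?powR_ge0//.
  by apply: ler1_powR; [lra|case/andP: alpha01 => _ /ltW].
have -> : c n = a + p * z n p by rewrite /a; ring.
have h2 : dt n * a ^+ 2 <= expW p (2 * dt n) * a ^+ 2 by rewrite ler_wpM2r ?sqr_ge0.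
have h3 := ler_wpM2l (ltW d0) h1.
have h4 : 0 <= dt n * (a - p * z n p) ^+ 2 by rewrite mulr_ge0 ?sqr_ge0 ?(ltW d0).
move: h2 h3 h4; set w := expW _ _; set y := p * _ => h2 h3 h4.
nra.
Qed.

(** Below [P] the bound [slow] suffices. Above [P], writing [p * z = c n - a] bounds [p * z^2] by
    multiples of [c n^2 / p] and [a^2 / p], and the latter belongs to the dissipation because
    [dt n * P <= p * expW p (2 * dt n)]. *)
Lemma Phi_step_le n : (n < N)%N ->
  dt n * Phi n <= (C3 * X) ^+ 2 * Pa / alpha * dt n
    + 2 * (Pa^-1 / alpha) * (dt n * c n ^+ 2) + 4 / P * Dis n.
Proof.
move=> nN; have d0 := dt_gt0 nN; have iD := iDis nN.
have N0 : (0 < N)%N by apply: leq_ltn_trans nN.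
have [i1 l1] := LI_low_pow P0 low_exp.
have [i2 l2] := LI_high_inv alpha01 P0.
have iP := iPhi N0 (ltnW nN).
have e1 : LI (low_pow P (2 * alpha - 1)) = Pa / alpha.
  by rewrite l1 (_ : 2 * alpha - 1 + 1 - alpha = alpha)//; ring.
have -> : (C3 * X) ^+ 2 * Pa / alpha * dt n
    + 2 * (Pa^-1 / alpha) * (dt n * c n ^+ 2) + 4 / P * Dis n =
   LI (fun p => (C3 * X) ^+ 2 * dt n * low_pow P (2 * alpha - 1) p
     + 2 * (dt n * c n ^+ 2) * high_inv P p
     + 4 / P * ((c n - p * z n p) ^+ 2 * (expW p (2 * dt n) / 2))).
  have j1 := inLZ ((C3 * X) ^+ 2 * dt n) i1.
  have j2 := inLZ (2 * (dt n * c n ^+ 2)) i2; have j3 := inLZ (4 / P) iD.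
  have j4 := inLD j1 j2.
  rewrite (LID j4 j3) (LID j1 j2) (LIZ _ i1) (LIZ _ i2) (LIZ _ iD) e1 l2 powRN -/Pa.
  by rewrite /Dis; congr (_ + _); ring.
rewrite /Phi -(LIZ (dt n) iP).
have j0 := inLZ (dt n) iP.
have j1 := inLZ ((C3 * X) ^+ 2 * dt n) i1.
have j2 := inLZ (2 * (dt n * c n ^+ 2)) i2; have j3 := inLZ (4 / P) iD.
apply: LI_le => //; first by apply: inLD => //; exact: inLD.
move=> p p0; set a := c n - p * z n p.
have w0 : 0 <= expW p (2 * dt n) by rewrite expW_ge0// mulr_ge0// ltW.
have r0 : 0 <= 4 / P * (a ^+ 2 * (expW p (2 * dt n) / 2)).
  by rewrite mulr_ge0 ?divr_ge0 ?(ltW P0)// mulr_ge0 ?sqr_ge0// divr_ge0.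
rewrite /low_pow /high_inv; have [pP|Pp] := ltP p P.
  rewrite mulr0 addr0; apply: (@le_trans _ _ ((C3 * X) ^+ 2 * dt n * p `^ (2 * alpha - 1))).
    by rewrite mulrAC [leRHS]mulrC ler_pM2l// slow_sqr// ltnW.
  by rewrite lerDl.
rewrite mulr0 add0r.
have zE : z n p = (c n - a) / p by rewrite /a; field; rewrite gt_eqF.
have w1 : dt n * P <= p * expW p (2 * dt n).
  rewrite /expW [leRHS]mulrCA mulfV ?gt_eqF// mulr1.
  apply: (@le_trans _ _ (1 - expR (- (2 * P * dt n)))).
    rewrite (_ : dt n * P = 2 * P * dt n / 2); last by field.
    apply: ge_1B_expN; have := Pd nN; have := mulr_gt0 P0 d0 => h1 h2.
    by apply/andP; split; nra.
  rewrite lerD2l lerN2 ler_expR lerN2 -mulrA mulrCA ler_wpM2r// mulr_ge0// ltW//.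
rewrite zE (_ : dt n * _ = (dt n / p) * (c n - a) ^+ 2); last by field; rewrite gt_eqF.
have h1 : (c n - a) ^+ 2 <= 2 * c n ^+ 2 + 2 * a ^+ 2 by have := sqr_ge0 (c n + a); nra.
apply: (le_trans (ler_wpM2l _ h1)); first by rewrite divr_ge0 ?ltW.
rewrite mulrDr; apply: lerD; first by rewrite le_eqVlt; apply/orP; left; apply/eqP; ring.
rewrite (_ : 4 / P * _ = expW p (2 * dt n) / P * (2 * a ^+ 2)); last by field; rewrite gt_eqF.
apply: ler_wpM2r; first by rewrite mulr_ge0 ?sqr_ge0.
by rewrite ler_pdivrMr// mulrAC ler_pdivlMr// [leRHS]mulrC.
Qed.

Definition A1 : R := (cL / lam + Pa^-1 / alpha) * (8 * (C3 * X) ^+ 2 * Pa ^+ 2)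
  + lam / cL * (beta * Cmin * (tau * tau `^ alpha)) ^+ 2
  + cL / (2 * lam) * (beta * tau) ^+ 2 + (C3 * X) ^+ 2 * Pa / (2 * alpha).
Definition A2 : R := (cL / lam + Pa^-1 / alpha) * (4 / mP)
  + 2 * lam / cL * Cmin * (tau * tau `^ alpha) + 2 / P.

(** Coercivity: energy above the level [A1] has to dissipate. The value [x n] is recovered from the
    average in [c n] together with the increments of [x + q] and of [q]; the average alone would
    miss an alternating sequence. *)
Lemma energy_step_le n : (n < N)%N -> dt n * energy n <= A1 * dt n + A2 * Dis n.
Proof.
move=> nN; have d0 := dt_gt0 nN; have D0 := Dis_ge0 nN.
have Pa0 : 0 < Pa by rewrite powR_gt0.
have hs := source_le nN; have hP := Phi_step_le nN.
have hi := ist nN; rewrite -!yE// in hi; last exact: ltnW.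
set Sc := dt n * c n ^+ 2 in hs hP.
pose dy := x n.+1 + q n.+1 - (x n + q n); pose dq := q n.+1 - q n.
have hdy : cL ^+ 2 * (dt n * dy ^+ 2) <= 4 * Cmin * (tau * tau `^ alpha) * Dis n
    + 2 * (beta * Cmin * (tau * tau `^ alpha)) ^+ 2 * dt n.
  have := ler_wpM2l (ltW d0) hi; rewrite /b' nN /b.
  rewrite (_ : dt n * (cL * _ - _) ^+ 2 = cL ^+ 2 * (dt n * dy ^+ 2)); last by rewrite /dy; ring.
  move=> h; apply: (le_trans h); rewrite mulrDr; apply: lerD.
    rewrite (_ : dt n * _ = 4 * Cmin * Dis n * (dt n * dt n `^ alpha)); last by ring.
    rewrite [leRHS](_ : _ = 4 * Cmin * Dis n * (tau * tau `^ alpha)); last by ring.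
    by rewrite ler_wpM2l ?dtpow_le// mulr_ge0// mulr_ge0// ltW.
  rewrite (_ : dt n * _ = 2 * (beta * Cmin) ^+ 2 * dt n * (dt n * dt n `^ alpha) ^+ 2); last by ring.
  rewrite [leRHS](_ : _ = 2 * (beta * Cmin) ^+ 2 * dt n * (tau * tau `^ alpha) ^+ 2); last by ring.
  rewrite ler_wpM2l//; first by rewrite mulr_ge0 ?(ltW d0)// mulr_ge0 ?sqr_ge0.
  by rewrite lerXn2r ?nnegrE ?dtpow_le// mulr_ge0 ?powR_ge0// ltW.
have hdq : lam ^+ 2 * dq ^+ 2 <= (beta * tau) ^+ 2.
  rewrite -exprMn -real_normK ?num_real// lerXn2r ?nnegrE ?mulr_ge0 ?(ltW tau0)//.
  rewrite normrM (gtr0_norm lam0); apply: (le_trans (q_lip nN)).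
  by rewrite ler_wpM2l// dt_le.
have hx : lam ^+ 2 * x n ^+ 2 <= 2 * c n ^+ 2 + lam ^+ 2 * (dy ^+ 2 + dq ^+ 2).
  rewrite (_ : c n ^+ 2 = lam ^+ 2 * ((x n + x n.+1) / 2) ^+ 2); last by rewrite /c; ring.
  rewrite [leRHS](_ : _ = lam ^+ 2 *
    (2 * ((x n + x n.+1) / 2) ^+ 2 + (dy ^+ 2 + dq ^+ 2))); last by ring.
  apply: ler_wpM2l; first exact: sqr_ge0.
  have -> : dy = x n.+1 - x n + dq by rewrite /dy /dq; ring.
  have := sqr_ge0 (2 * dq + (x n.+1 - x n)).
  have := sqr_ge0 (x n.+1); have := sqr_ge0 (x n + 3 * x n.+1); nra.
have l2 : 0 < lam ^+ 2 by rewrite exprn_gt0.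
have hxd : dt n * x n ^+ 2 <= 2 / lam ^+ 2 * Sc + (dt n * dy ^+ 2) + dt n * dq ^+ 2.
  rewrite -(ler_pM2l l2) !mulrDr.
  rewrite (_ : lam ^+ 2 * (2 / lam ^+ 2 * Sc) = 2 * Sc); last by field; rewrite gt_eqF.
  by have := ler_wpM2l (ltW d0) hx; rewrite /Sc; lra.
have hdq' : dt n * dq ^+ 2 <= (beta * tau) ^+ 2 / lam ^+ 2 * dt n.
  rewrite mulrC ler_wpM2r ?(ltW d0)// ler_pdivlMr// mulrC//.
have c20 : 0 < cL ^+ 2 by rewrite exprn_gt0.
have hdy' : dt n * dy ^+ 2 <= (4 * Cmin * (tau * tau `^ alpha) * Dis n
    + 2 * (beta * Cmin * (tau * tau `^ alpha)) ^+ 2 * dt n) / cL ^+ 2.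
  by rewrite ler_pdivlMr// mulrC.
have k1 : 0 <= cL * lam / 2 by rewrite divr_ge0// mulr_ge0// ltW.
have hx1 := ler_wpM2l k1 hxd.
have hy1 := ler_wpM2l k1 hdy'.
have hq1 := ler_wpM2l k1 hdq'.
have k2 : 0 <= cL / lam + Pa^-1 / alpha.
  by rewrite addr_ge0 ?divr_ge0 ?invr_ge0 ?(ltW cL0) ?(ltW lam0) ?(ltW Pa0) ?(ltW a0).
have hs1 := ler_wpM2l k2 hs.
rewrite /energy mulrDr.
have e1 : cL * lam / 2 * (2 / lam ^+ 2 * Sc) = cL / lam * Sc by field; rewrite gt_eqF.
have e2 : cL * lam / 2 * ((4 * Cmin * (tau * tau `^ alpha) * Dis n
    + 2 * (beta * Cmin * (tau * tau `^ alpha)) ^+ 2 * dt n) / cL ^+ 2) =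
   2 * lam / cL * Cmin * (tau * tau `^ alpha) * Dis n +
   lam / cL * (beta * Cmin * (tau * tau `^ alpha)) ^+ 2 * dt n by field; rewrite gt_eqF.
have e3 : cL * lam / 2 * ((beta * tau) ^+ 2 / lam ^+ 2 * dt n) =
   cL / (2 * lam) * (beta * tau) ^+ 2 * dt n by field; rewrite gt_eqF.
rewrite e2 in hy1; rewrite e3 in hq1; rewrite !mulrDr e1 in hx1.
have e4 : (C3 * X) ^+ 2 * Pa / (2 * alpha) = (C3 * X) ^+ 2 * Pa / alpha / 2.
  by field; rewrite gt_eqF.
have e5 : 4 / P = 2 / P + 2 / P by field; rewrite gt_eqF.
rewrite e5 in hP; rewrite /A1 /A2 e4.
move: hs1 hx1 hy1 hq1 hP.
set u1 := cL / lam; set u2 := Pa^-1 / alpha; set u3 := 4 / mP.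
set u4 := 8 * _ * _; set u5 := 2 * lam / cL * Cmin * _; set u6 := lam / cL * _.
set u7 := cL / (2 * lam) * _; set u8 := _ / alpha; set u9 := 2 / P.
set D := Dis n; set d := dt n; set y2 := dy ^+ 2; set q2 := dq ^+ 2.
set x2 := x n ^+ 2; set Ph := Phi n; set k := cL * lam / 2.
lra.
Qed.

End OnePeriod.

(* [C5 / 2] bounds the energy at the left end of the window. *)
Lemma window_contradiction m sigma P C5 : (m < N)%N -> `|x N| = X ->
  sigma / 2 <= t N - t m <= sigma -> 0 < P -> 4 * P * tau <= 1 ->
  cL + (C3 ^+ 2 + g ^+ 2) / alpha + cL / 4 <= C5 ->
  sigma * inj_rate <= cL / 8 * (lam * X ^+ 2) ->
  A1 P <= cL / 32 * (lam * X ^+ 2) -> A2 P * C5 <= cL / 32 * sigma -> False.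
Proof.
move=> mN xN /andP[s1 s2] P0 Pt hC5 hJ hA1 hA2.
have N0 : (0 < N)%N by apply: leq_ltn_trans mN.
have lX : 0 < lam * X ^+ 2 by rewrite mulr_gt0 ?exprn_gt0.
have sig0 : 0 < sigma.
  by apply: lt_le_trans s2; rewrite subr_gt0 (increasing_upto_lt tN).
have J0 : 0 <= inj_rate.
  rewrite addr_ge0// ?mulr_ge0 ?sqr_ge0 ?powR_ge0 ?(ltW Cm0) ?(ltW cL0) ?(ltW tau0) ?(ltW X0)//.
have xE n : (n <= N)%N -> x n ^+ 2 <= X ^+ 2.
  by move=> nN; rewrite -real_normK ?num_real// lerXn2r ?nnegrE ?(ltW X0)// x_le.
have hVN : cL * lam / 2 * X ^+ 2 <= energy N.
  by rewrite /energy -xN real_normK ?num_real// lerDl divr_ge0// Phi_ge0.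
(* Since at most [sigma * inj_rate] is supplied inside the window, the energy before [N] cannot lie
   far below its final value, which is at least [cL / 2 * (lam * X^2)]. *)
have big n : (m <= n < N)%N -> cL / 4 * (lam * X ^+ 2) <= energy n.
  move=> /andP[mn nN]; have := @energy_sum n N; rewrite (ltnW nN) leqnn => /(_ isT).
  have : 0 <= \sum_(n <= k < N) Dis k / 2.
    by rewrite big_nat; apply: sumr_ge0 => k /andP[_ kN]; rewrite divr_ge0// Dis_ge0.
  have : (t N - t n) * inj_rate <= sigma * inj_rate.
    rewrite ler_wpM2r//; apply: le_trans s2; rewrite lerD2l lerN2.
    by apply: (increasing_upto_le tN) => //; exact: ltnW.
  have : 0 < cL * (lam * X ^+ 2) by rewrite mulr_gt0.
  by move: hVN hJ; set e := energy n; set e2 := energy N; lra.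
have hVm : energy m <= (cL / 2 + (C3 ^+ 2 + g ^+ 2) / alpha / 2) * (lam * X ^+ 2).
  have := Phi_le N0 (ltnW mN); have := ler_wpM2l (ltW (mulr_gt0 cL0 lam0)) (xE m (ltnW mN)).
  by rewrite /energy; lra.
pose DW := \sum_(m <= k < N) Dis k.
have hDW : DW <= C5 * (lam * X ^+ 2).
  have := @energy_sum m N; rewrite (ltnW mN) leqnn => /(_ isT).
  rewrite -mulr_suml -/DW.
  have h1 : (t N - t m) * inj_rate <= sigma * inj_rate by rewrite ler_wpM2r.
  have h2 := ler_wpM2r (ltW lX) hC5.
  have h3 : 0 <= energy N by apply: le_trans hVN; rewrite mulr_ge0 ?sqr_ge0// divr_ge0// mulr_ge0// ltW.
  by lra.
have A20 : 0 <= A2 P.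
  have m0 := mP_gt0 P0; have pa : 0 < P `^ alpha by rewrite powR_gt0.
  have k1 : 0 <= cL / lam by rewrite divr_ge0// ltW.
  have k2 : 0 <= (P `^ alpha)^-1 / alpha by rewrite divr_ge0 ?invr_ge0 ?ltW.
  have k3 : 0 <= 4 / mP P by rewrite divr_ge0// ltW.
  have k4 : 0 <= 2 * lam / cL by rewrite divr_ge0 ?mulr_ge0 ?ltW.
  have k5 : 0 <= 2 / P by rewrite divr_ge0// ltW.
  have k6 : 0 <= tau * tau `^ alpha by rewrite mulr_ge0 ?powR_ge0// ltW.
  rewrite /A2 addr_ge0// addr_ge0//; first by rewrite mulr_ge0// addr_ge0.
  by rewrite mulr_ge0// mulr_ge0// ltW.
(* The energy is large at every step of the window, so coercivity demands more dissipation than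
   [C5 * (lam * X^2)], the amount available by [hDW]. *)
have h1 : \sum_(m <= n < N) dt n * (cL / 4 * (lam * X ^+ 2)) <=
    \sum_(m <= n < N) (A1 P * dt n + A2 P * Dis n).
  apply: ler_sum_nat => n /andP[mn nN].
  apply: le_trans (energy_step_le P0 Pt nN).
  by rewrite ler_wpM2l ?(ltW (dt_gt0 nN))// big// mn.
move: h1; rewrite big_split/= -!mulr_sumr -mulr_suml telescope_sumr; last exact: ltnW.
rewrite -/DW => h1.
have h2 : A1 P * (t N - t m) <= cL / 32 * (lam * X ^+ 2) * sigma.
  apply: (@le_trans _ _ (cL / 32 * (lam * X ^+ 2) * (t N - t m))).
    by rewrite ler_wpM2r// (le_trans _ s1)// divr_ge0// ltW.
  by rewrite ler_wpM2l// mulr_ge0 ?divr_ge0 ?(ltW cL0) ?(ltW lX).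
have h3 : A2 P * DW <= cL / 32 * sigma * (lam * X ^+ 2).
  by apply: (le_trans (ler_wpM2l A20 hDW)); rewrite [leLHS]mulrA ler_wpM2r// ltW.
have h4 : sigma / 2 * (cL / 4 * (lam * X ^+ 2)) <= (t N - t m) * (cL / 4 * (lam * X ^+ 2)).
  by rewrite ler_wpM2r// mulr_ge0 ?divr_ge0 ?(ltW cL0) ?(ltW lX).
have h5 : 0 < sigma * (cL * (lam * X ^+ 2)) by rewrite !mulr_gt0.
by lra.
Qed.

(** Serves when no full window fits before [t N]: the energy balance then starts at time 0, where
    all states vanish. *)
Lemma short_time : `|x N| = X ->
  cL * lam / 2 * X ^+ 2 <= cL * lam / 2 * x 0 ^+ 2 + t N * inj_rate.
Proof.
move=> xN; have := @energy_sum 0 N; rewrite leqnn => /(_ isT).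
have -> : energy 0 = cL * lam / 2 * x 0 ^+ 2.
  rewrite /energy /Phi -[RHS]addr0; congr (_ + _).
  by rewrite -[RHS](mul0r 2^-1) -(LI0 alpha); congr (_ / _); apply: LI_eq => p _ /=; rewrite expr0n/= mulr0.
have : 0 <= \sum_(0 <= k < N) Dis k / 2.
  by rewrite big_nat; apply: sumr_ge0 => k /andP[_ kN]; rewrite divr_ge0// Dis_ge0.
have : cL * lam / 2 * X ^+ 2 <= energy N.
  by rewrite /energy -xN real_normK ?num_real// lerDl divr_ge0// Phi_ge0.
by rewrite t00 subr0; lra.
Qed.

End Window.

Lemma argmax_nat (R : realDomainType) (f : nat -> R) N :
  exists2 m, (m <= N)%N & forall n, (n <= N)%N -> f n <= f m.
Proof.
elim: N => [|N [m mN hm]]; first by exists 0%N => // n; rewrite leqn0 => /eqP->.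
have [h|h] := leP (f N.+1) (f m).
  exists m; first exact: leqW.
  by move=> n; rewrite leq_eqVlt => /predU1P[->//|]; rewrite ltnS; exact: hm.
exists N.+1 => // n; rewrite leq_eqVlt => /predU1P[->//|]; rewrite ltnS => /hm h2.
by apply: (le_trans h2); exact: ltW.
Qed.

(** * The error recursion of one mode, and its nonstiff case *)

Section ScalarStability.
Context {R : realType} (alpha : R) (alpha01 : 0 < alpha < 1).
Context (T lam0 : R) (T0 : 0 < T) (l00 : 0 < lam0).
Local Notation ray := (`]0, +oo[%classic : set R).
Local Notation LI := (LI alpha).
Local Notation Cmin := (Cmin alpha).
Local Notation cL := (cL alpha).

Let a0 : 0 < alpha. Proof. by case/andP: alpha01. Qed.
Let a1 : 0 < 1 - alpha. Proof. by case/andP: alpha01 => _; rewrite subr_gt0. Qed.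
Let cL0 : 0 < cL. Proof. exact: cL_gt0. Qed.
Let Cm0 : 0 < Cmin. Proof. exact: Cmin_gt0. Qed.

(** The same defect of averaging appears as [s] in the Laplace states and as [gr] in the kernel
    form. Both forms of the equation are recorded: [se_L] drives the energy argument, [se_sum] the
    maximum principle and the bound on slow states. *)
Record scheme_error (N : nat) (t : nat -> R) (lam beta tau dq : R)
    (x q gr : nat -> R) (s : nat -> R -> R) : Prop := SchemeError {
  se_inc : increasing_upto N t; se_t0 : t 0 = 0; se_T : t N <= T;
  se_lam : lam0 <= lam; se_beta : 0 <= beta; se_tau : 0 < tau <= T;
  se_dt : forall k, (k < N)%N -> t k.+1 - t k <= tau;
  se_ms : forall k, (k < N)%N -> measurable_fun ray (s k);
  se_s : forall k p, (k < N)%N -> 0 < p ->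
    `|s k p| <= beta * (t k.+1 - t k) * expW p (t k.+1 - t k);
  se_L : forall n, (n <= N)%N -> cL * (x n + q n) =
    LI (state t (fun k => - (lam * ((x k + x k.+1) / 2))) s n);
  se_sum : forall n, (n <= N)%N -> x n + q n =
    \sum_(0 <= k < n) weight alpha t n k * - (lam * ((x k + x k.+1) / 2)) + gr n;
  se_gr : forall n, (n <= N)%N -> `|gr n| <= beta * tau * (T `^ alpha / alpha);
  se_q_lip : forall k, (k < N)%N -> lam * `|q k.+1 - q k| <= beta * (t k.+1 - t k);
  se_q : forall n, (n <= N)%N -> `|q n| <= dq }.

Let Cr := T `^ alpha / alpha.
Let Cr0 : 0 < Cr. Proof. by rewrite divr_gt0// powR_gt0. Qed.

(* At a positive maximum the last average is nonpositive, while consecutive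
   values are close to each other. *)
Lemma nonstiff N t lam beta tau dq x q gr s :
  scheme_error N t lam beta tau dq x q gr s -> lam * tau `^ alpha <= alpha / 2 ->
  forall n, (n <= N)%N -> `|x n + q n| <= (4 * (Cr + 1)) * (beta * tau + dq).
Proof.
move=> [tN t00 tT hlam b0 /andP[tau0 _] hdt _ _ _ hsum hgr _ hq] ns.
have lam_gt0 : 0 < lam by apply: lt_le_trans hlam.
pose c k := - (lam * ((x k + x k.+1) / 2)).
pose zc m := \sum_(0 <= k < m) weight alpha t m k * c k.
pose dl := beta * tau + dq.
have dq0 : 0 <= dq by apply: le_trans (hq 0%N isT).
have bt0 : 0 <= beta * tau by rewrite mulr_ge0 ?(ltW tau0).
have dl0 : 0 <= dl by rewrite addr_ge0.
pose e := (Cr + 1) * dl.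
have e0 : 0 <= e by rewrite mulr_ge0// addr_ge0// ltW.
have xz m : (m <= N)%N -> `|x m - zc m| <= e.
  move=> mN; rewrite (_ : x m - zc m = gr m - q m); last first.
    have h : x m + q m = zc m + gr m := hsum m mN.
    rewrite (_ : x m = zc m + gr m - q m); last by rewrite -h addrK.
    by ring.
  apply: (le_trans (ler_normB _ _)); rewrite /e mulrDl mul1r; apply: lerD.
    apply: (le_trans (hgr _ mN)); rewrite mulrC -/Cr ler_wpM2l ?(ltW Cr0)//.
    by rewrite lerDl.
  by apply: (le_trans (hq _ mN)); rewrite lerDr.
have [m mN hm] := argmax_nat (fun m => `|zc m|) N.
pose Z := `|zc m|.
have Z3 : Z <= 3 * e.
  have [m0|m0] := posnP m.
    by rewrite /Z m0 /zc big_geq// normr0 mulr_ge0.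
  case: m m0 mN hm @Z => // k _ kN hm Z.
  pose sg := Num.sg (zc k.+1).
  have Z0 : 0 <= Z by exact: normr_ge0.
  have sgZ : sg * zc k.+1 = Z by rewrite /Z /sg -normrEsg.
  have sg1 : `|sg| <= 1 by rewrite /sg normr_sg; case: eqP.
  pose hist := \sum_(0 <= j < k) weight alpha t k.+1 j * c j.
  have hle : `|hist| <= Z.
    apply: (history_norm_le alpha01 tN); first by rewrite ltnSn kN.
    by move=> l lk; apply: hm; rewrite (leq_trans lk)// ltnW.
  have zE : zc k.+1 = hist + weight alpha t k.+1 k * c k by rewrite /zc big_nat_recr.
  have w0 : 0 < weight alpha t k.+1 k by apply: (weight_gt0 alpha01 tN); rewrite ltnSn.
  have sc : 0 <= sg * c k.
    rewrite -(pmulr_rge0 _ w0) mulrCA.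
    have -> : sg * (weight alpha t k.+1 k * c k) = Z - sg * hist.
      by rewrite -sgZ zE; ring.
    rewrite subr_ge0; apply: (le_trans (ler_norm _)); rewrite normrM -[leRHS]mul1r.
    by apply: ler_pM.
  have sx : sg * (x k + x k.+1) <= 0.
    have -> : sg * (x k + x k.+1) = - (2 / lam * (sg * c k)).
      by rewrite /c; field; rewrite gt_eqF.
    by rewrite oppr_le0 mulr_ge0// divr_ge0// ltW.
  have M c0 : (c0 <= N)%N -> `|x c0| <= Z + e.
    move=> cN; rewrite -[x c0](subrK (zc c0)) addrC.
    by apply: (le_trans (ler_normD _ _)); apply: lerD; [exact: hm|exact: xz].
  have cM j : (j < N)%N -> `|c j| <= lam * (Z + e).
    move=> jN; rewrite normrN normrM (gtr0_norm lam_gt0) ler_pM2l//.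
    rewrite normrM [`|2^-1|]gtr0_norm ?invr_gt0// ler_pdivrMr//.
    apply: (le_trans (ler_normD _ _)); rewrite mulr2n mulrDr mulr1.
    by apply: lerD; apply: M => //; exact: ltnW.
  have dk0 : 0 < t k.+1 - t k by rewrite subr_gt0 tN.
  have tk0 : 0 <= t k by rewrite -t00 (increasing_upto_le tN)// ltnW.
  have wk : weight alpha t k.+1 k <= tau `^ alpha / alpha.
    rewrite /weight subrr powR0 ?gt_eqF// subr0 ler_pM2r ?invr_gt0//.
    by apply: ge0_ler_powR; rewrite ?nnegrE ?(ltW a0) ?(ltW dk0) ?(ltW tau0) ?hdt.
  (* Here [lam * tau^alpha <= alpha / 2] enters: the new cell, and the loss of weight on all old
     cells together, each contribute at most [tau^alpha / alpha] times [lam * (Z + e)]. *)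
  have dz : `|zc k.+1 - zc k| <= Z + e.
    have -> : zc k.+1 - zc k = weight alpha t k.+1 k * c k
        - \sum_(0 <= j < k) (weight alpha t k j - weight alpha t k.+1 j) * c j.
      have -> : \sum_(0 <= j < k) (weight alpha t k j - weight alpha t k.+1 j) * c j = zc k - hist.
        by rewrite /zc /hist -sumrB; apply: eq_bigr => j _; rewrite mulrBl.
      by rewrite zE; ring.
    apply: (@le_trans _ _ (2 * (tau `^ alpha / alpha) * (lam * (Z + e)))); last first.
      rewrite mulrA -[leRHS]mul1r ler_wpM2r ?addr_ge0//.
      rewrite -(ler_pM2r a0) mul1r (_ : _ * alpha = 2 * (lam * tau `^ alpha)); last first.
        by field; rewrite gt_eqF.
      by lra.
    apply: (le_trans (ler_normB _ _)).
    rewrite (_ : 2 * _ * _ = tau `^ alpha / alpha * (lam * (Z + e)) +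
       tau `^ alpha / alpha * (lam * (Z + e))); last by ring.
    have Ze : 0 <= lam * (Z + e) by rewrite mulr_ge0 ?addr_ge0 ?(ltW lam_gt0).
    apply: lerD.
      by rewrite normrM gtr0_norm// ler_pM ?(ltW w0)// cM.
    apply: (@le_trans _ _ (\sum_(0 <= j < k) (weight alpha t k j - weight alpha t k.+1 j) * (lam * (Z + e)))).
      apply: (le_trans (ler_norm_sum _ _ _)); apply: ler_sum_nat => j /andP[_ jk].
      have wd : weight alpha t k.+1 j <= weight alpha t k j.
        by apply: (weight_decr alpha01 tN) => //; rewrite jk leqnSn.
      rewrite normrM ger0_norm ?subr_ge0// ler_wpM2l ?subr_ge0// cM//.
      exact: ltn_trans kN.
    rewrite -mulr_suml ler_wpM2r// sumrB sum_weight// t00 subr0.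
    have := @sum_weight _ _ alpha01 t 0 k.+1 isT.
    rewrite big_nat_recr//= t00 subr0 => h.
    have tk1 : t k `^ alpha / alpha <= t k.+1 `^ alpha / alpha.
      rewrite ler_pM2r ?invr_gt0//; apply: ge0_ler_powR; rewrite ?nnegrE ?(ltW a0)//.
        by rewrite (le_trans tk0)// ltW// tN.
      by rewrite ltW// tN.
    move: h wk tk1; set u := \sum_(_ <= _ < _) _; lra.
  have h1 : sg * (zc k.+1 - zc k) <= Z + e.
    apply: (le_trans (ler_norm _)); rewrite normrM -[leRHS]mul1r.
    by apply: ler_pM.
  have h2 : sg * (zc k - x k) <= e.
    apply: (le_trans (ler_norm _)); rewrite normrM -[leRHS]mul1r.
    by apply: ler_pM => //; rewrite distrC xz// ltnW.
  have h3 : sg * (zc k.+1 - x k.+1) <= e.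
    apply: (le_trans (ler_norm _)); rewrite normrM -[leRHS]mul1r.
    by apply: ler_pM => //; rewrite distrC xz.
  (* Twice the extreme value is split so that the sum of [x k] and [x k.+1], which has the opposite
     sign, can be discarded. *)
  have h4 : 2 * (sg * zc k.+1) = sg * (zc k.+1 - zc k) + sg * (zc k - x k)
    + sg * (zc k.+1 - x k.+1) + sg * (x k + x k.+1) by ring.
  rewrite sgZ in h4; lra.
move=> n nN; rewrite hsum// -/(zc n).
apply: (le_trans (ler_normD _ _)).
rewrite (_ : _ * (beta * tau + dq) = 3 * e + e); last by rewrite /e /dl; ring.
apply: lerD; first exact: (le_trans (hm _ nN)).
apply: (le_trans (hgr _ nN)); rewrite mulrC -/Cr /e ler_pM ?(ltW Cr0)// ?lerDl//.
Qed.

Lemma scheme_error_le N N' t lam beta tau dq x q gr s : (N' <= N)%N ->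
  scheme_error N t lam beta tau dq x q gr s ->
  scheme_error N' t lam beta tau dq x q gr s.
Proof.
move=> NN [tN ? tT ? ? ? hdt hms hs hL hsum hgr hql hq].
split => //.
- by move=> n nN; apply: tN; exact: leq_trans NN.
- by apply: le_trans tT; exact: (increasing_upto_le tN).
- by move=> k kN; apply: hdt; exact: leq_trans NN.
- by move=> k kN; apply: hms; exact: leq_trans NN.
- by move=> k p kN; apply: hs; exact: leq_trans NN.
- by move=> n nN; apply: hL; exact: leq_trans NN.
- by move=> n nN; apply: hsum; exact: leq_trans NN.
- by move=> n nN; apply: hgr; exact: leq_trans NN.
- by move=> n nN; apply: hql; exact: leq_trans NN.
- by move=> n nN; apply: hq; exact: leq_trans NN.
Qed.

Definition slow_const := 4 * (2 + Cr) * (alpha / (1 - alpha)) + T `^ alpha.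
Local Notation C3 := slow_const.

Lemma slow_const_gt0 : 0 < C3.
Proof.
by rewrite addr_gt0 ?powR_gt0// !mulr_gt0 ?invr_gt0// addr_gt0.
Qed.

(** The piecewise constant part falls under [state_slow] with [Z = (2 + Cr) * X]. For the defect,
    [expW p (t n)] is at most [T] and at most [1 / p], hence at most their geometric mean
    [T^alpha * p^(alpha - 1)]. *)
Lemma state_slow_le N t lam beta tau dq x q gr s X n p :
  scheme_error N t lam beta tau dq x q gr s ->
  (forall n, (n <= N)%N -> `|x n| <= X) -> beta * tau + dq <= X ->
  (n <= N)%N -> 0 < p ->
  `|state t (fun k => - (lam * ((x k + x k.+1) / 2))) s n p|
    <= C3 * X * p `^ (alpha - 1).
Proof.
move=> [tN t00 tT hlam b0 /andP[tau0 _] hdt _ hs _ hsum hgr _ hq] hx dX nN p0.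
have dq0 : 0 <= dq by apply: le_trans (hq 0%N isT).
have bt0 : 0 <= beta * tau by rewrite mulr_ge0 ?(ltW tau0).
have X0 : 0 <= X by apply: le_trans dX; exact: addr_ge0.
have [n0|n0] := posnP n.
  rewrite n0 /= normr0 mulr_ge0 ?powR_ge0// mulr_ge0//; exact: ltW slow_const_gt0.
rewrite stateE; apply: (le_trans (ler_normD _ _)).
rewrite (_ : C3 * X * _ = 4 * ((2 + Cr) * X) * (alpha / (1 - alpha)) * p `^ (alpha - 1)
  + T `^ alpha * X * p `^ (alpha - 1)); last by rewrite /slow_const; ring.
apply: lerD.
  apply: (state_slow alpha01 tN t00) => //; first by rewrite n0.
  move=> m mn; have mN := leq_trans mn nN.
  set S := \sum_(_ <= _ < _) _.
  have -> : S = x m + q m - gr m by rewrite hsum// -/S addrK.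
  rewrite (_ : (2 + Cr) * X = X + X + Cr * X); last by ring.
  apply: (le_trans (ler_normB _ _)); apply: lerD.
    apply: (le_trans (ler_normD _ _)); apply: lerD; first exact: hx.
    by apply: (le_trans (hq _ mN)); apply: le_trans dX; rewrite lerDr.
  apply: (le_trans (hgr _ mN)); rewrite mulrC ler_wpM2l ?(ltW Cr0)//.
  by apply: le_trans dX; rewrite lerDl.
have tn0 : 0 <= t n by rewrite -t00 (increasing_upto_le tN).
have tnT : t n <= T by apply: le_trans tT; exact: (increasing_upto_le tN).
apply: (@le_trans _ _ (beta * tau * expW p (t n))).
  apply: (@state_le R N t) => // k kn; rewrite mul0r add0r.
  have kN := leq_trans kn nN.
  have dk0 : 0 <= t k.+1 - t k by rewrite subr_ge0 ltW// tN.
  apply: (le_trans (hs _ _ kN p0)); rewrite ler_wpM2r ?expW_ge0//.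
  by rewrite ler_wpM2l// hdt.
have w0 := expW_ge0 p0 tn0.
have wle : expW p (t n) <= T `^ alpha * p `^ (alpha - 1).
  have -> : p `^ (alpha - 1) = (p^-1) `^ (1 - alpha).
    rewrite -[p^-1]powR_inv1 ?(ltW p0)// -powRrM; congr (_ `^ _); ring.
  have [->|wn0] := eqVneq (expW p (t n)) 0.
    by rewrite mulr_ge0 ?powR_ge0.
  have wp : 0 < expW p (t n) by rewrite lt_neqAle eq_sym wn0.
  have -> : expW p (t n) = expW p (t n) `^ alpha * expW p (t n) `^ (1 - alpha).
    rewrite -powRD ?wn0 ?implybT// addrC subrK powRr1//.
  apply: ler_pM; rewrite ?powR_ge0//.
    apply: ge0_ler_powR; rewrite ?nnegrE ?(ltW a0) ?w0 ?(ltW T0)//.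
    by apply: le_trans tnT; exact: expW_le.
  apply: ge0_ler_powR; rewrite ?nnegrE ?(ltW a1) ?w0 ?invr_ge0 ?(ltW p0)//.
  exact: expW_leV.
rewrite [leRHS](_ : _ = X * (T `^ alpha * p `^ (alpha - 1))); last by ring.
by apply: ler_pM => //; apply: le_trans dX; rewrite lerDl.
Qed.

End ScalarStability.

(** * Choice of the constants, and stability of a stiff mode *)

Section ScalarStability.
Context {R : realType} (alpha : R) (alpha01 : 0 < alpha < 1).
Context (T lam0 : R) (T0 : 0 < T) (l00 : 0 < lam0).
Local Notation ray := (`]0, +oo[%classic : set R).
Local Notation LI := (LI alpha).
Local Notation Cmin := (Cmin alpha).
Local Notation cL := (cL alpha).
Local Notation scheme_error := (scheme_error alpha T lam0).
Local Notation C3 := (slow_const alpha T).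

Let a0 : 0 < alpha. Proof. by case/andP: alpha01. Qed.
Let a1 : 0 < 1 - alpha. Proof. by case/andP: alpha01 => _; rewrite subr_gt0. Qed.
Let cL0 : 0 < cL. Proof. exact: cL_gt0. Qed.
Let Cm0 : 0 < Cmin. Proof. exact: Cmin_gt0. Qed.

Let Cr := T `^ alpha / alpha.
Let Cr0 : 0 < Cr. Proof. by rewrite divr_gt0// powR_gt0. Qed.

Let C30 : 0 < C3. Proof. exact: slow_const_gt0. Qed.
(** Comes from [beta * tau <= X <= lam * X / lam0]. *)
Let g := 1 + lam0^-1.
Let C5 := cL + (C3 ^+ 2 + g ^+ 2) / alpha + cL / 4.
Let c5 := ((2 : R) `^ (1 - alpha) - 1) / (1 - alpha).
Let Ta := T `^ alpha.

Let g_gt0 : 0 < g. Proof. by rewrite addr_gt0 ?invr_gt0. Qed.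
Let C5_gt0 : 0 < C5.
Proof. by rewrite !addr_gt0 ?divr_gt0// addr_gt0// exprn_gt0. Qed.
Let c5_gt0 : 0 < c5.
Proof.
rewrite divr_gt0// subr_gt0.
have := @gt0_ltr_powR R _ a1 1 2; rewrite !nnegrE powR1/= => h.
by apply: h; rewrite ?ler0n ?ltr1n.
Qed.
Let Ta_gt0 : 0 < Ta. Proof. exact: powR_gt0. Qed.

Let small (a b : R) : 0 <= a -> 0 < b -> exists2 K, 0 < K & forall K', K <= K' -> a / K' <= b.
Proof.
move=> a_ge0 b_gt0; exists ((a + 1) / b); first by rewrite divr_gt0// ltr_wpDl.
move=> K'; rewrite ler_pdivrMr// => h.
have K0 : 0 < K' by rewrite -(pmulr_lgt0 _ b_gt0); apply: lt_le_trans h; rewrite ltr_wpDl.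
rewrite ler_pdivrMr// mulrC; apply: le_trans h; by rewrite lerDl.
Qed.

Let small_powR (a b : R) : 0 < a -> 0 < b ->
  exists2 K, 0 < K & forall K', K <= K' -> (a / K') `^ alpha <= b.
Proof.
move=> a_gt0 b_gt0.
have [K K0 hK] := small (ltW a_gt0) (powR_gt0 alpha^-1 b_gt0).
exists K => // K' KK; have := hK _ KK => h.
have -> : b = (b `^ alpha^-1) `^ alpha.
  by rewrite -powRrM mulVf ?gt_eqF// powRr1// ltW.
apply: ge0_ler_powR; rewrite ?nnegrE ?(ltW a0) ?powR_ge0//.
by rewrite divr_ge0 ?(ltW a_gt0)// (le_trans (ltW K0)).
Qed.

(** The window will have length [K1 * lam * tau], the band will start at [P], which is [K2] over
    that length, and the contradiction will start from a maximum above [K3 * (beta * tau + dq)]. The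
    choice is made in the order [K2], [K1], [K3]: the first controls the factor of the dissipation
    in [A2], the second makes [P^alpha / lam] small, the third makes the terms with [beta]
    negligible. *)
Let constants : exists K1 K2 K3 : R, [/\ 0 < K1, 0 < K2 & 2 <= K3] /\
  [/\ 4 * K2 <= K1 * lam0, 2 <= K1 * lam0,
      (K2 / (K1 * lam0)) `^ alpha * (2 / alpha) <= 1
    & (8 * C3 ^+ 2 * (cL + alpha^-1) + C3 ^+ 2 / (2 * alpha)) *
      ((K2 / (K1 * lam0)) `^ alpha * (2 / alpha)) <= cL / 64] /\
  [/\ (Cmin ^+ 2 * Ta ^+ 2 / cL + cL / (2 * lam0 ^+ 2)) / K3 <= cL / 64,
      C5 * ((cL + alpha^-1) * (4 / c5) + 2) / K2 <= cL / 64,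
      C5 * (2 * Cmin * Ta / cL) / K1 <= cL / 64
    & K1 * (3 / 2 * Cmin * Ta + cL) / K3 <= cL / 8].
Proof.
have h64 : 0 < cL / 64 by rewrite divr_gt0.
have h8 : 0 < cL / 8 by rewrite divr_gt0.
have ia0 : 0 < alpha^-1 by rewrite invr_gt0.
have i0 : 0 < cL + alpha^-1 by rewrite addr_gt0.
have [K2 K20 hK2] := small (ltW (mulr_gt0 C5_gt0 (addr_gt0 (mulr_gt0 i0 (divr_gt0 (@ltr0n R 4) c5_gt0)) (@ltr0n R 2)))) h64.
pose E := 8 * C3 ^+ 2 * (cL + alpha^-1) + C3 ^+ 2 / (2 * alpha).
have E0 : 0 < E by rewrite addr_gt0 ?mulr_gt0 ?invr_gt0 ?mulr_gt0 ?exprn_gt0.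
pose eta := Num.min (alpha / 2) (alpha / 2 * (cL / 64) / E).
have eta0 : 0 < eta by rewrite lt_min !divr_gt0 ?mulr_gt0.
have [K1a K1a0 hK1a] := small_powR (divr_gt0 K20 l00) eta0.
have [K1b K1b0 hK1b] := small (ltW (mulr_gt0 C5_gt0 (divr_gt0 (mulr_gt0 (mulr_gt0 (@ltr0n R 2) Cm0) Ta_gt0) cL0))) h64.
pose K1 := K1a + K1b + (4 * K2 + 2) / lam0.
have t0 : 0 < (4 * K2 + 2) / lam0 by rewrite divr_gt0 ?addr_gt0 ?mulr_gt0.
have K1a1 : K1a <= K1 by rewrite /K1; lra.
have K1b1 : K1b <= K1 by rewrite /K1; lra.
have K10 : 0 < K1 by rewrite /K1; lra.
have K1l : 4 * K2 + 2 <= K1 * lam0.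
  by rewrite -ler_pdivrMr//; rewrite /K1; lra.
have C30' : 0 <= K1 * (3 / 2 * Cmin * Ta + cL).
  apply: mulr_ge0; first exact: ltW.
  by rewrite addr_ge0 ?(ltW cL0)// mulr_ge0 ?(ltW Ta_gt0)// mulr_ge0 ?(ltW Cm0).
have D0 : 0 <= Cmin ^+ 2 * Ta ^+ 2 / cL + cL / (2 * lam0 ^+ 2).
  apply: addr_ge0; apply: divr_ge0; [|exact: ltW|exact: ltW|].
    by apply: mulr_ge0; exact: sqr_ge0.
  by apply: mulr_ge0; rewrite ?sqr_ge0.
have [K3a K3a0 hK3a] := small C30' h8.
have [K3b K3b0 hK3b] := small D0 h64.
have e_le : (K2 / (K1 * lam0)) `^ alpha <= eta.
  by have := hK1a _ K1a1; rewrite -mulrA -invfM [lam0 * _]mulrC.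
have := e_le; rewrite le_min => /andP[e1 e2].
exists K1, K2, (K3a + K3b + 2); split; first by split => //; lra.
split; last first.
  split; [|exact: hK2|exact: hK1b|].
    by apply: hK3b; lra.
  by apply: hK3a; lra.
split; [lra|lra| |].
  by rewrite -ler_pdivlMr ?divr_gt0// mul1r invf_div.
rewrite -/E mulrC -ler_pdivlMr// -ler_pdivlMr ?divr_gt0// invf_div.
by apply: (le_trans e2); rewrite le_eqVlt; apply/orP; left; apply/eqP; field; rewrite !gt_eqF.
Qed.

Lemma mPE P : 0 < P -> mP alpha P = c5 * P `^ (1 - alpha).
Proof.
move=> P0; rewrite /mP /c5 powRM ?(ltW P0)//; field; rewrite gt_eqF//.
Qed.

Local Ltac keep_section := clear -alpha01 T0 l00 a0 a1 cL0 Cm0 Cr0 C30 g_gt0 C5_gt0 c5_gt0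
  Ta_gt0 small small_powR constants.

Theorem scalar_stability : exists2 C : R, 0 < C &
  forall N t lam beta tau dq x q gr s,
    scheme_error N t lam beta tau dq x q gr s ->
    forall n, (n <= N)%N -> `|x n + q n| <= C * (beta * tau + dq).
Proof.
have [K1 [K2 [K3 [[K10 K20 K32] [[k1 k2 k3 k4] [k5 k6 k7 k8]]]]]] := constants.
exists (4 * (Cr + 1) + (K3 + 1)).
  by rewrite addr_gt0 ?mulr_gt0 ?addr_gt0//; lra.
move=> N t lam beta tau dq x q gr s H n nN.
have [tN t00 tT hlam b0 /andP[tau0 tauT] hdt hms hs hL hsum hgr hql hq] := H.
have lam_gt0 : 0 < lam by apply: lt_le_trans hlam.
have dq0 : 0 <= dq by apply: le_trans (hq 0%N isT).
have bt0 : 0 <= beta * tau by rewrite mulr_ge0 ?(ltW tau0).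
pose dl := beta * tau + dq.
have dl0 : 0 <= dl by rewrite addr_ge0.
(* Beyond this threshold, [1 / (lam * tau^alpha)] is at most [2 / alpha], the only form in which
   stiffness is used below. *)
have [ns|st] := leP (lam * tau `^ alpha) (alpha / 2).
  apply: (le_trans (nonstiff alpha01 T0 l00 H ns nN)); rewrite -/dl ler_wpM2r// lerDl; lra.
have [N' N'N hX] := argmax_nat (fun m => `|x m|) N.
pose X := `|x N'|.
have [XK|XK] := leP X (K3 * dl).
  apply: (le_trans (ler_normD _ _)).
  have h1 := hX _ nN; have h2 := hq _ nN; rewrite /= -/X in h1; rewrite -/dl.
  have : 0 <= (Cr + 1) * dl by rewrite mulr_ge0// addr_ge0// ltW.
  have : dq <= dl by rewrite lerDr.
  by nra.
exfalso.
have X0 : 0 < X by apply: le_lt_trans XK; rewrite mulr_ge0//; lra.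
have H' := scheme_error_le N'N H.
have [tN' _ tT' _ _ _ hdt' hms' hs' hL' hsum' hgr' hql' hq'] := H'.
have hX' m : (m <= N')%N -> `|x m| <= X by move=> mN; apply: hX; exact: leq_trans N'N.
have dlX : dl <= X by nra.
have btX : beta * tau <= X by apply: le_trans dlX; rewrite lerDl.
have slow' m p : (m <= N')%N -> 0 < p ->
  `|state t (fun k => - (lam * ((x k + x k.+1) / 2))) s m p| <= C3 * X * p `^ (alpha - 1).
  exact: (state_slow_le alpha01 T0 H').
have hG : lam * X + beta * tau <= g * lam * X.
  rewrite /g mulrDl mul1r mulrDl lerD2l; apply: (le_trans btX).
  by rewrite ler_peMl ?(ltW X0)// mulrC ler_pdivlMr// mul1r.
pose sigma := K1 * lam * tau.
pose lX := lam * X ^+ 2.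
have lX0 : 0 < lX by rewrite mulr_gt0// exprn_gt0.
have sig0 : 0 < sigma by rewrite !mulr_gt0.
have bK3 : beta * tau <= X / K3.
  rewrite ler_pdivlMr; last by lra.
  by apply: le_trans (ltW XK); rewrite [leRHS]mulrC ler_wpM2r ?lerDl//; lra.
have K30 : 0 < K3 by lra.
have bK3' : (beta * tau) ^+ 2 <= X ^+ 2 / K3.
  apply: (@le_trans _ _ (X / K3 * X)); last by rewrite expr2 mulrAC.
  by rewrite expr2 ler_pM.
have taua : tau `^ alpha <= Ta.
  by apply: ge0_ler_powR; rewrite ?nnegrE ?(ltW a0) ?(ltW tau0) ?(ltW T0).
have taua0 : 0 < tau `^ alpha by rewrite powR_gt0.
have hJ : sigma * inj_rate alpha beta tau X <= cL / 8 * (lam * X ^+ 2).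
  apply: (@le_trans _ _ (K1 * (3 / 2 * Cmin * Ta + cL) / K3 * lX)); last first.
    by rewrite ler_wpM2r// ltW.
  rewrite /inj_rate /sigma (_ : K1 * lam * tau * _ = K1 * lam *
    (3 / 2 * Cmin * (tau `^ alpha * (beta * tau) ^+ 2) + cL * (beta * tau * X))); last by ring.
  rewrite [leRHS](_ : _ = K1 * lam * (3 / 2 * Cmin * (Ta * (X ^+ 2 / K3)) +
     cL * (X / K3 * X))); last by rewrite /lX; field; rewrite gt_eqF.
  rewrite ler_wpM2l ?mulr_ge0 ?(ltW K10) ?(ltW lam_gt0)//; apply: lerD.
    by rewrite ler_wpM2l ?mulr_ge0 ?(ltW Cm0)// ler_pM ?sqr_ge0 ?(ltW taua0).
  by rewrite ler_wpM2l ?(ltW cL0)// ler_wpM2r// ltW.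
(* If the maximum occurs within one window length of time 0, the energy starts from [x 0 = - q 0],
   which is small against [X]. *)
have [tsmall|tlarge] := leP (t N') sigma.
  have := short_time alpha01 tN' t00 lam_gt0 b0 tau0 hms' hs' hdt' hL' hql' hX' erefl.
  have x0 : x 0%N ^+ 2 <= X ^+ 2 / 4.
    have -> : x 0%N = - q 0%N.
      apply/eqP; rewrite -addr_eq0; have := hL 0%N isT.
      rewrite [RHS](_ : _ = 0); last exact: LI0.
      by move/eqP; rewrite mulf_eq0 gt_eqF.
    rewrite sqrrN (_ : X ^+ 2 / 4 = (X / 2) ^+ 2); last by field.
    rewrite -real_normK ?num_real// lerXn2r ?nnegrE ?divr_ge0 ?(ltW X0)//.
    apply: (le_trans (hq _ _)) => //; have : dq <= dl by rewrite lerDr.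
    by nra.
  have J0 : 0 <= inj_rate alpha beta tau X.
    by rewrite addr_ge0 ?mulr_ge0 ?sqr_ge0 ?powR_ge0 ?(ltW Cm0) ?(ltW cL0) ?(ltW tau0) ?(ltW X0).
  have h1 := ler_wpM2r J0 tsmall.
  have h2 := ler_wpM2l (ltW (mulr_gt0 cL0 lam_gt0)) x0.
  have h3 : 0 < cL * lX by rewrite mulr_gt0.
  move: h1 h2 h3 hJ; rewrite /lX; set J := inj_rate _ _ _ _; keep_section; lra.
(* The window starts at the first grid point within [sigma] of [t N']. Since [2 * tau <= sigma], it
   is at least [sigma / 2] long on every grid. *)
have ex : exists m, t N' - sigma <= t m by exists N'; rewrite lerBlDr lerDl ltW.
pose m := ex_minn ex.
have [tm m_min] : t N' - sigma <= t m /\ forall k, t N' - sigma <= t k -> (m <= k)%N.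
  by rewrite /m; case: ex_minnP.
have mle : (m <= N')%N by apply: m_min; rewrite lerBlDr lerDl ltW.
have m_gt0 : (0 < m)%N.
  by rewrite lt0n; apply/eqP => me; move: tm; rewrite me t00 leNgt subr_gt0 tlarge.
have sig2 : 2 * tau <= sigma.
  rewrite ler_pM2r//; apply: (le_trans k2); by rewrite ler_pM2l.
have tm1 : t m.-1 < t N' - sigma.
  by rewrite ltNge; apply/negP => /m_min; rewrite -ltnS prednK// ltnn.
have tm2 : t m <= t m.-1 + tau.
  by have := hdt' m.-1; rewrite (prednK m_gt0) lerBlDl => h; apply: h.
have hsig : sigma / 2 <= t N' - t m <= sigma.
  by move: tm tm1 tm2 sig2; keep_section => ? ? ? ?; apply/andP; split; lra.
have mlt : (m < N')%N.
  move: mle; rewrite leq_eqVlt => /predU1P[me|//].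
  by move: hsig sig2 tau0; rewrite me subrr => /andP[+ _]; keep_section; lra.
pose P := K2 / sigma.
have P0 : 0 < P by rewrite divr_gt0.
have lam2 : 0 < lam0 ^+ 2 by rewrite exprn_gt0.
have Pt : 4 * P * tau <= 1.
  rewrite (_ : _ * tau = 4 * K2 / (K1 * lam)); last first.
    by rewrite /P /sigma; field; rewrite !gt_eqF.
  rewrite ler_pdivrMr ?mulr_gt0// mul1r; apply: (le_trans k1); by rewrite ler_pM2l.
have Pa0 : 0 < P `^ alpha by rewrite powR_gt0.
pose e := P `^ alpha / lam.
have e0 : 0 < e by rewrite divr_gt0.
pose e1 := (K2 / (K1 * lam0)) `^ alpha * (2 / alpha).
(* [P^alpha / lam] equals [(K2 / (K1 * lam))^alpha / (lam * tau^alpha)], and stiffness bounds the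
   last denominator from below; so the bound no longer involves [tau]. *)
have ee : e <= e1.
  have P1 : P = K2 / (K1 * lam) / tau by rewrite /P /sigma; field; rewrite !gt_eqF.
  rewrite /e P1 powRM ?invr_ge0 ?(ltW tau0)//; last first.
    by rewrite divr_ge0 ?mulr_ge0 ?(ltW K20) ?(ltW K10) ?(ltW lam_gt0).
  have -> : tau^-1 `^ alpha = (tau `^ alpha)^-1.
    by rewrite -(powR_inv1 (ltW tau0)) -powRrM mulN1r powRN.
  rewrite -mulrA -invfM /e1.
  have p1 : 0 <= K2 / (K1 * lam) by rewrite divr_ge0 ?mulr_ge0 ?(ltW K20) ?(ltW K10) ?(ltW lam_gt0).
  apply: ler_pM; rewrite ?powR_ge0 ?invr_ge0 ?mulr_ge0 ?(ltW lam_gt0) ?(ltW taua0)//.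
    apply: ge0_ler_powR; rewrite ?nnegrE ?(ltW a0)//.
      by rewrite divr_ge0 ?mulr_ge0 ?(ltW K20) ?(ltW K10) ?(ltW l00).
    rewrite ler_pM2l// lef_pV2 ?posrE ?mulr_gt0//; by rewrite ler_pM2l.
  rewrite -[2 / alpha]invf_div lef_pV2 ?posrE ?mulr_gt0 ?divr_gt0//.
  by rewrite [leRHS]mulrC; exact: ltW.
have e1_le1 : e1 <= 1 by [].
have hA1 : A1 alpha lam beta tau X C3 P <= cL / 32 * (lam * X ^+ 2).
  rewrite /A1.
  have q1 : (cL / lam + (P `^ alpha)^-1 / alpha) * (8 * (C3 * X) ^+ 2 * (P `^ alpha) ^+ 2)
     + (C3 * X) ^+ 2 * (P `^ alpha) / (2 * alpha) =
     lX * (8 * C3 ^+ 2 * (cL * e ^+ 2 + alpha^-1 * e) + C3 ^+ 2 / (2 * alpha) * e).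
    by rewrite /lX /e; field; rewrite !gt_eqF.
  have q2 : 8 * C3 ^+ 2 * (cL * e ^+ 2 + alpha^-1 * e) + C3 ^+ 2 / (2 * alpha) * e <= cL / 64.
    apply: le_trans k4; rewrite -/e1 [leRHS]mulrDl; apply: lerD; last first.
      by rewrite ler_wpM2l ?divr_ge0 ?sqr_ge0 ?mulr_ge0 ?(ltW a0).
    have c8 : 0 <= 8 * C3 ^+ 2 by rewrite pmulr_rge0// sqr_ge0.
    rewrite -[leRHS]mulrA (ler_wpM2l c8)// [leRHS]mulrDl; apply: lerD; last first.
      by rewrite ler_wpM2l ?invr_ge0 ?(ltW a0).
    rewrite ler_wpM2l ?(ltW cL0)// expr2 -[leRHS]mul1r ler_pM ?(ltW e0)//.
    exact: (le_trans ee e1_le1).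
  have q3 : lam / cL * (beta * Cmin * (tau * tau `^ alpha)) ^+ 2 <=
      lX * (Cmin ^+ 2 * Ta ^+ 2 / cL / K3).
    rewrite (_ : lam / cL * _ = lam / cL * Cmin ^+ 2 * ((tau `^ alpha) ^+ 2 * (beta * tau) ^+ 2)); last by ring.
    rewrite [leRHS](_ : _ = lam / cL * Cmin ^+ 2 * (Ta ^+ 2 * (X ^+ 2 / K3))); last first.
      by rewrite /lX; field; rewrite !gt_eqF.
    apply: ler_wpM2l; first by rewrite mulr_ge0 ?sqr_ge0 ?divr_ge0 ?ltW.
    apply: ler_pM; rewrite ?sqr_ge0//.
    by rewrite lerXn2r ?nnegrE ?(ltW taua0) ?(ltW Ta_gt0).
  have q4 : cL / (2 * lam) * (beta * tau) ^+ 2 <= lX * (cL / (2 * lam0 ^+ 2) / K3).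
    rewrite [leRHS](_ : _ = cL * lam / (2 * lam0 ^+ 2) * (X ^+ 2 / K3)); last first.
      by rewrite /lX; field; rewrite !gt_eqF.
    apply: ler_pM; rewrite ?sqr_ge0 ?divr_ge0 ?mulr_ge0 ?(ltW cL0) ?(ltW lam_gt0)//.
    rewrite ler_pdivrMr ?mulr_gt0//.
    rewrite (_ : cL * lam / (2 * lam0 ^+ 2) * (2 * lam) = cL * (lam ^+ 2 / lam0 ^+ 2)); last first.
      by field; rewrite gt_eqF.
    rewrite ler_peMr ?(ltW cL0)// ler_pdivlMr// mul1r.
    by rewrite lerXn2r ?nnegrE ?(ltW l00) ?(ltW lam_gt0).
  have q5 := ler_wpM2l (ltW lX0) q2; have q6 := ler_wpM2l (ltW lX0) k5.
  rewrite -q1 in q5; rewrite mulrDl mulrDr in q6.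
  rewrite -[lam * X ^+ 2]/lX; move: q3 q4 q5 q6.
  set v1 := (_ + _) * (8 * _ * _); set v2 := lam / cL * _; set v3 := cL / (2 * lam) * _.
  set v4 := _ / (2 * alpha); set v5 := lX * (_ / K3); set v6 := lX * (_ / K3).
  by keep_section; lra.
have hA2 : A2 alpha lam tau P * C5 <= cL / 32 * sigma.
  rewrite /A2 mPE//.
  have PP : P `^ (1 - alpha) = P / P `^ alpha.
    by rewrite powRD ?(gt_eqF P0) ?implybT// powRr1 ?(ltW P0)// powRN.
  have sE : sigma = K2 / P by rewrite /P; field; rewrite !gt_eqF.
  have q1 : (cL / lam + (P `^ alpha)^-1 / alpha) * (4 / (c5 * P `^ (1 - alpha))) + 2 / P =
    sigma * (((cL * e + alpha^-1) * (4 / c5) + 2) / K2).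
    by rewrite PP sE /e; field; rewrite !gt_eqF.
  have q2 : 2 * lam / cL * Cmin * (tau * tau `^ alpha) <= sigma * ((2 * Cmin * Ta / cL) / K1).
    rewrite [leRHS](_ : _ = 2 * lam / cL * Cmin * (tau * Ta)); last first.
      by rewrite /sigma; field; rewrite !gt_eqF.
    apply: ler_wpM2l; first by rewrite mulr_ge0 ?divr_ge0 ?mulr_ge0 ?ltW.
    by rewrite ler_wpM2l// ltW.
  have q3 : C5 * (((cL * e + alpha^-1) * (4 / c5) + 2) / K2) <= cL / 64.
    apply: le_trans k6; rewrite mulrA ler_wpM2r ?invr_ge0 ?(ltW K20)//.
    have c45 : 0 <= 4 / c5 by rewrite divr_ge0// ltW.
    apply: (ler_wpM2l (ltW C5_gt0)); rewrite lerD2r; apply: (ler_wpM2r c45); rewrite lerD2r.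
    by rewrite -[leRHS]mulr1 ler_wpM2l ?(ltW cL0)// (le_trans ee e1_le1).
  have q4 := ler_wpM2l (ltW sig0) q3; have q5 := ler_wpM2l (ltW sig0) k7.
  have q6 := ler_wpM2r (ltW C5_gt0) q2.
  move: q1 q4 q5 q6; rewrite -[C5 * _ / K1]mulrA.
  set w1 := _ / K2; set w2 := _ / K1; set w3 := 2 * lam / cL * _ * _; set w4 := _ * (4 / _).
  move=> q1 q4 q5 q6.
  have -> : (w4 + w3 + 2 / P) * C5 = (w4 + 2 / P) * C5 + w3 * C5 by ring.
  rewrite q1; move: q4 q5 q6; keep_section; lra.
exact: (window_contradiction alpha01 tN' t00 lam_gt0 b0 tau0 X0 (ltW C30) (ltW g_gt0) hms' hs' hdt' hL'
  hql' hX' slow' hG mlt erefl hsig P0 Pt (lexx _) hJ hA1 hA2).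
Qed.

End ScalarStability.

(** * Discrete sine modes *)

Section GridModes.
Context {R : realType} (M : nat) (M0 : (0 < M)%N).
Implicit Types (v w : nat -> R) (i j k l : nat).

Let Mp : 0 < M%:R :> R. Proof. by rewrite ltr0n. Qed.
Let Mn : M%:R != 0 :> R. Proof. by rewrite gt_eqF. Qed.

Definition theta (k : nat) : R := k%:R * pi / M%:R.
Definition gsin (j i : nat) : R := sin (theta (j * i)).
Definition gmode v j : R := 2 / M%:R * \sum_(1 <= i < M) v i * gsin j i.
(** The eigenvalue of minus the second difference on the sine mode [j]. *)
Definition gev (j : nat) : R := 2 * M%:R ^+ 2 * (1 - cos (theta j)).
Definition cossum l : R := \sum_(1 <= i < M) cos (theta (l * i)).

Lemma theta_pi q : theta (M * q) = pi *+ q.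
Proof. by rewrite /theta natrM -mulr_natl; field. Qed.

Lemma thetaD k l : theta (k + l) = theta k + theta l.
Proof. by rewrite /theta natrD mulrDl mulrDl. Qed.

Lemma thetaM k l : theta (k * l) = l%:R * theta k.
Proof. by rewrite /theta natrM; field. Qed.

Lemma cos_theta_period q : cos (theta (2 * M * q)) = 1.
Proof.
rewrite (_ : (2 * M * q = M * (2 * q))%N); last by lia.
rewrite theta_pi -[pi *+ _]add0r (alternatingn (@cosDpi R)) cos0 mulr1.
by rewrite exprM sqrrN expr1n expr1n.
Qed.

Lemma sin_half_theta_neq0 l : ~~ (2 * M %| l)%N -> sin (theta l / 2) != 0.
Proof.
move=> nd; have M2 : (0 < 2 * M)%N by lia.
have e : theta l / 2 = (l %% (2 * M))%:R * pi / (2 * M%:R) + pi *+ (l %/ (2 * M)).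
  rewrite {1}(divn_eq l (2 * M)) /theta -mulr_natl natrD !natrM.
  by field.
rewrite e (alternatingn (@sinDpi R)) mulf_neq0 ?signr_eq0//.
have r0 : (0 < l %% (2 * M))%N by rewrite lt0n; apply: contraNneq nd => r0; rewrite /dvdn r0.
have rM := ltn_pmod l M2.
rewrite gt_eqF// sin_gt0_pi//; apply/andP; split.
  by rewrite divr_gt0 ?mulr_gt0 ?pi_gt0 ?ltr0n.
rewrite ltr_pdivrMr ?mulr_gt0// mulrC ltr_pM2l ?pi_gt0// -natrM ltr_nat//.
Qed.

Lemma cossum_dvd l : (2 * M %| l)%N -> cossum l = M%:R - 1.
Proof.
move=> /dvdnP[q ->]; rewrite /cossum (eq_bigr (fun=> 1)); last first.
  by move=> i _; rewrite -mulnA mulnCA cos_theta_period.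
by rewrite sumr_const_nat natrB.
Qed.

(** Multiplication by [2 * sin (theta l / 2)] makes the sum telescope; the divisibility condition
    says that this factor is not 0. *)
Lemma cossum_ndvd l : ~~ (2 * M %| l)%N -> cossum l = - (1 + (-1) ^+ l) / 2.
Proof.
move=> nd; have s0 := sin_half_theta_neq0 nd.
set ph := theta l in s0; set s := sin (ph / 2) in s0.
have e : 2 * s * cossum l = sin (M%:R * ph - ph / 2) - sin (1%:R * ph - ph / 2).
  rewrite /cossum mulr_sumr.
  rewrite -(@telescope_sumr _ 1 M (fun i => sin (i%:R * ph - ph / 2))) //.
  apply: eq_bigr => i _; rewrite thetaM -/ph.
  rewrite (_ : i.+1%:R * ph - ph / 2 = i%:R * ph + ph / 2); last by rewrite -natr1; field.
  by rewrite sinD sinB /s; ring.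
have e1 : M%:R * ph = pi *+ l by rewrite -theta_pi mulnC thetaM.
have e2 : 1%:R * ph - ph / 2 = ph / 2 by field.
rewrite e1 e2 [pi *+ l + _]addrC (alternatingn (@sinDpi R)) sinN -/s in e.
apply: (mulfI (_ : 2 * s != 0)); first by rewrite mulf_neq0.
by rewrite e; field.
Qed.

Lemma gsinC k j : gsin k j = gsin j k.
Proof. by rewrite /gsin mulnC. Qed.

Lemma gsin0 j : gsin j 0 = 0.
Proof. by rewrite /gsin muln0 /theta mul0r mul0r sin0. Qed.

Lemma gsinM j : gsin j M = 0.
Proof. by rewrite /gsin mulnC theta_pi -[pi *+ _]add0r (alternatingn (@sinDpi R)) sin0 mulr0. Qed.

Lemma gsin_sum k j : (j <= k)%N ->
  \sum_(1 <= i < M) gsin k i * gsin j i = (cossum (k - j) - cossum (k + j)) / 2.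
Proof.
move=> jk; rewrite /cossum -sumrB mulr_suml; apply: eq_bigr => i _.
rewrite mulnDl thetaD cosD.
have -> : theta ((k - j) * i) = theta (k * i) - theta (j * i).
  by rewrite -[(k * i)%N]/((k * i)%N) -{2}(subnK jk) mulnDl thetaD addrK.
by rewrite cosB /gsin; field.
Qed.

Let dvd_lt l : (0 < l < 2 * M)%N -> ~~ (2 * M %| l)%N.
Proof. by move=> /andP[l0 lM]; rewrite gtnNdvd. Qed.

Let sign_sub k j : (j <= k)%N -> (-1) ^+ (k + j) = (-1) ^+ (k - j) :> R.
Proof.
move=> jk; rewrite -signr_odd -[RHS]signr_odd oddD oddB//.
Qed.

(** The two cosine sums depend only on the parity of their index, which the sum and the difference
    of [k] and [j] share, so they cancel. In truncated subtraction [(k - j) + (j - k)] is the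
    distance of [k] and [j]. *)
Lemma gsin_alias k j : ~~ (2 * M %| k + j)%N -> ~~ (2 * M %| (k - j) + (j - k))%N ->
  \sum_(1 <= i < M) gsin k i * gsin j i = 0.
Proof.
wlog jk : j k / (j <= k)%N => [hw h1 h2|h1 h2].
  have [jk|kj] := leqP j k; first exact: hw.
  under eq_bigr do rewrite mulrC.
  by apply: hw; [exact: ltnW|rewrite addnC|rewrite addnC].
have e : (k - j + (j - k) = k - j)%N by lia.
rewrite e in h2.
by rewrite gsin_sum// !cossum_ndvd// sign_sub// subrr mul0r.
Qed.

Lemma gsin_orth k j : (0 < k < M)%N -> (0 < j < M)%N ->
  \sum_(1 <= i < M) gsin k i * gsin j i = if k == j then M%:R / 2 else 0.
Proof.
move=> /andP[k0 kM] /andP[j0 jM]; case: eqP => [->|/eqP kj].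
  rewrite gsin_sum// subnn cossum_dvd// cossum_ndvd; last by apply: dvd_lt; lia.
  by rewrite -signr_odd addnn odd_double expr0; field.
by apply: gsin_alias; apply: dvd_lt; move: kj; lia.
Qed.

Lemma gsin_sqr_sum k : \sum_(1 <= i < M) gsin k i ^+ 2 <= M%:R / 2.
Proof.
under eq_bigr do rewrite expr2.
rewrite gsin_sum// subnn cossum_dvd// ler_pM2r ?invr_gt0//.
have [d|d] := boolP (2 * M %| k + k)%N.
  by rewrite cossum_dvd// subrr.
by rewrite cossum_ndvd// -signr_odd addnn odd_double expr0; lra.
Qed.

Lemma gsin_sum_le k j : `|\sum_(1 <= i < M) gsin k i * gsin j i| <= M%:R / 2.
Proof.
apply: (le_trans (ler_norm_sum _ _ _)).
apply: (@le_trans _ _ (\sum_(1 <= i < M) (gsin k i ^+ 2 + gsin j i ^+ 2) / 2)).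
  apply: ler_sum => i _; rewrite normrM -[gsin k i ^+ 2]real_normK ?num_real//.
  rewrite -[gsin j i ^+ 2]real_normK ?num_real//.
  by have := sqr_ge0 (`|gsin k i| - `|gsin j i|); lra.
rewrite -mulr_suml big_split/=; have := gsin_sqr_sum k; have := gsin_sqr_sum j; lra.
Qed.

Lemma eq_gmode v w j : (forall i, (0 < i < M)%N -> v i = w i) -> gmode v j = gmode w j.
Proof.
by move=> h; rewrite /gmode; congr (_ * _); apply: eq_big_nat => i /h ->.
Qed.

Lemma gmodeD v w j : gmode (fun i => v i + w i) j = gmode v j + gmode w j.
Proof.
by rewrite /gmode -mulrDr -big_split/=; congr (_ * _); apply: eq_bigr => i _; rewrite mulrDl.
Qed.

Lemma gmodeZ a v j : gmode (fun i => a * v i) j = a * gmode v j.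
Proof.
by rewrite /gmode [RHS]mulrCA [in RHS]mulr_sumr; congr (_ * _); apply: eq_bigr => i _; rewrite mulrA.
Qed.

Lemma gmodeB v w j : gmode (fun i => v i - w i) j = gmode v j - gmode w j.
Proof.
by rewrite /gmode -mulrBr -sumrB; congr (_ * _); apply: eq_bigr => i _; rewrite mulrBl.
Qed.

Lemma gmode0 j : gmode (fun=> 0) j = 0.
Proof. by rewrite /gmode big1 ?mulr0// => i _; rewrite mul0r. Qed.

Lemma gmode_sum m n (F : nat -> nat -> R) j :
  gmode (fun i => \sum_(m <= k < n) F k i) j = \sum_(m <= k < n) gmode (F k) j.
Proof.
elim: n => [|n IH].
  by rewrite big_geq// -[RHS](gmode0 j); apply: eq_gmode => i _; rewrite big_geq.
have [mn|mn] := leqP m n; last first.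
  by rewrite big_geq// -[RHS](gmode0 j); apply: eq_gmode => i _; rewrite big_geq.
rewrite big_nat_recr//= -IH -gmodeD; apply: eq_gmode => i _.
by rewrite big_nat_recr.
Qed.

Lemma gmode_le v B j : (forall i, (0 < i < M)%N -> `|v i| <= B) -> 0 <= B -> `|gmode v j| <= 2 * B.
Proof.
move=> h B0; rewrite /gmode normrM ger0_norm ?divr_ge0// -mulrA ler_pM2l//.
rewrite mulrC ler_pdivrMr//; apply: (le_trans (ler_norm_sum _ _ _)).
apply: (@le_trans _ _ (\sum_(1 <= i < M) B)).
  apply: ler_sum_nat => i hi; rewrite normrM -[leRHS]mulr1 ler_pM ?h//.
  exact: sin_max.
by rewrite sumr_const_nat -[B *+ _]mulr_natr ler_wpM2l// ler_nat leq_subr.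
Qed.

(** The matrix [gsin] is symmetric, so the orthogonality of its rows is also that of its columns. *)
Lemma gmodeK v i : (0 < i < M)%N -> v i = \sum_(1 <= j < M) gmode v j * gsin j i.
Proof.
move=> hi.
have -> : \sum_(1 <= j < M) gmode v j * gsin j i =
    2 / M%:R * \sum_(1 <= j < M) \sum_(1 <= l < M) v l * gsin j l * gsin j i.
  by rewrite mulr_sumr; apply: eq_bigr => j _; rewrite -mulr_suml mulrA.
rewrite exchange_big/=.
transitivity (2 / M%:R * \sum_(1 <= l < M) (v l * (if l == i then M%:R / 2 else 0))).
  rewrite (bigD1_seq i)/= ?mem_index_iota ?iota_uniq// eqxx big1 ?addr0; last first.
    by move=> l /negPf ->; rewrite mulr0.
  by field.
congr (_ * _); apply: eq_big_nat => l hl.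
rewrite -(gsin_orth hl hi) mulr_sumr; apply: eq_bigr => j _.
by rewrite (gsinC j l) (gsinC j i) mulrA.
Qed.

Lemma gmode_parseval v w :
  \sum_(1 <= i < M) v i * w i = M%:R / 2 * \sum_(1 <= j < M) gmode v j * gmode w j.
Proof.
rewrite (@eq_big_nat _ _ _ _ _ _ (fun i => \sum_(1 <= j < M) gmode v j * (w i * gsin j i))); last first.
  move=> i hi; rewrite [in LHS](gmodeK v hi) mulr_suml; apply: eq_bigr => j _; ring.
rewrite exchange_big mulr_sumr; apply: eq_bigr => j _.
by rewrite -mulr_sumr [RHS]mulrCA; congr (_ * _); rewrite /gmode; field.
Qed.

Let shift_sum v w : v 0%N = 0 -> v M = 0 -> w 0%N = 0 -> w M = 0 ->
  \sum_(1 <= i < M) (v i.+1 + v i.-1) * w i = \sum_(1 <= i < M) v i * (w i.+1 + w i.-1).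
Proof.
case: M M0 => // m _ v0 vM w0 wM; rewrite !big_add1/=.
apply/eqP; rewrite -subr_eq0 -sumrB.
rewrite (@telescope_sumr_eq _ _ _ (fun i => v i.+1 * w i - v i * w i.+1))//; last first.
  by move=> i _ /=; ring.
by rewrite v0 vM w0 wM; apply/eqP; ring.
Qed.

Let gsin_rec j i : (0 < i)%N -> gsin j i.+1 + gsin j i.-1 = 2 * cos (theta j) * gsin j i.
Proof.
case: i => // i _ /=; rewrite /gsin.
have -> : theta (j * i.+2) = theta (j * i.+1) + theta j by rewrite -thetaD mulnS addnC.
have -> : theta (j * i) = theta (j * i.+1) - theta j by rewrite mulnS thetaD [theta j + _]addrC addrK.
by rewrite sinD sinB; ring.
Qed.

Lemma delta2E v i : delta2 M v i = M%:R ^+ 2 * (v i.+1 - 2 * v i + v i.-1).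
Proof. by rewrite /delta2 /mesh exprVn invrK mulrC. Qed.

Lemma gmode_delta2 v j : v 0%N = 0 -> v M = 0 ->
  gmode (delta2 M v) j = - gev j * gmode v j.
Proof.
move=> v0 vM; rewrite /gmode mulrCA; congr (_ * _).
transitivity (M%:R ^+ 2 * (\sum_(1 <= i < M) (v i.+1 + v i.-1) * gsin j i
   - 2 * \sum_(1 <= i < M) v i * gsin j i)).
  rewrite mulr_sumr -sumrB mulr_sumr; apply: eq_bigr => i _.
  by rewrite delta2E; ring.
rewrite (shift_sum v0 vM (gsin0 j) (gsinM j)) /gev.
rewrite (@eq_big_nat _ _ _ _ _ _ (fun i => 2 * cos (theta j) * (v i * gsin j i))); last first.
  by move=> i /andP[i0 _]; rewrite gsin_rec//; ring.
by rewrite -mulr_sumr; ring.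
Qed.

(** The factor by which the compact operator acts on the sine mode [j]. *)
Definition gsymb (j : nat) : R := (5 + cos (theta j)) / 6.

Lemma gmode_Hh v j : v 0%N = 0 -> v M = 0 -> gmode (Hh M v) j = gsymb j * gmode v j.
Proof.
move=> v0 vM.
rewrite (@eq_gmode _ (fun i => v i + (12 * M%:R ^+ 2)^-1 * delta2 M v i)); last first.
  by move=> i hi; rewrite /Hh hi delta2E; field.
by rewrite gmodeD gmodeZ gmode_delta2// /gev /gsymb; field.
Qed.

Lemma gsymb_bound j : 2 / 3 <= gsymb j <= 1.
Proof.
rewrite /gsymb; have := cos_geN1 (theta j); have := cos_le1 (theta j) => h1 h2.
by apply/andP; split; lra.
Qed.

Let sum_by_parts v : v 0%N = 0 -> v M = 0 ->
  \sum_(1 <= i < M.+1) (v i - v i.-1) ^+ 2 =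
  - \sum_(1 <= i < M) v i * (v i.+1 - 2 * v i + v i.-1).
Proof.
case: M M0 => // m _ v0 vM; rewrite !big_add1/= big_nat_recl//= -sumrN.
apply/eqP; rewrite -subr_eq0 -addrA -sumrB.
rewrite (@telescope_sumr_eq _ _ _ (fun i => v i.+1 * (v i.+1 - v i)))//.
  by rewrite v0 vM; apply/eqP; ring.
by move=> i _ /=; ring.
Qed.

(** The correction by second differences only lowers the norm and is dropped. The remaining sum is
    integrated by parts and diagonalized; the factor [1 / 2] is [mesh M] times the [M / 2] of
    Parseval. *)
Lemma normA_le v : v 0%N = 0 -> v M = 0 ->
  normA M v <= Num.sqrt (2^-1 * \sum_(1 <= j < M) gev j * gmode v j ^+ 2).
Proof.
move=> v0 vM; apply: ler_wsqrtr; rewrite /ipA.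
have m0 : 0 <= mesh M :> R by rewrite invr_ge0.
have h0 : 0 <= mesh M ^+ 2 / 12 * (mesh M * \sum_(1 <= i < M) delta2 M v i * delta2 M v i) :> R.
  apply: mulr_ge0; first by rewrite divr_ge0// sqr_ge0.
  apply: mulr_ge0 => //; apply: sumr_ge0 => i _; rewrite -expr2; exact: sqr_ge0.
apply: (@le_trans _ _ (mesh M * \sum_(1 <= i < M.+1) delta_half M v i * delta_half M v i)).
  by rewrite lerBlDr lerDl.
have e : \sum_(1 <= i < M.+1) delta_half M v i * delta_half M v i =
   - \sum_(1 <= i < M) v i * delta2 M v i.
  transitivity (M%:R ^+ 2 * \sum_(1 <= i < M.+1) (v i - v i.-1) ^+ 2).
    rewrite mulr_sumr; apply: eq_bigr => i _; rewrite /delta_half /mesh invrK; ring.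
  rewrite sum_by_parts// mulrN mulr_sumr; congr (- _); apply: eq_bigr => i _.
  by rewrite delta2E; ring.
rewrite e gmode_parseval (@eq_bigr _ _ _ _ _ _ _ (fun j => - (gev j * gmode v j ^+ 2))); last first.
  by move=> j _; rewrite gmode_delta2//; ring.
rewrite sumrN; set S := \sum_(_ <= _ < _) _.
by rewrite le_eqVlt; apply/orP; left; apply/eqP; rewrite /mesh; field.
Qed.

Lemma sin_le (x : R) : 0 <= x -> sin x <= x.
Proof.
rewrite le_eqVlt => /predU1P[<-|x0]; first by rewrite sin0.
have [|c _] := @MVT R sin cos 0 x x0 (fun y _ => is_derive_sin y).
  by apply: continuous_subspaceT => y; exact: continuous_sin.
by rewrite sin0 !subr0 => ->; rewrite ler_piMl ?cos_le1// ltW.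
Qed.

(* Halving the angle twice keeps the cosine above [1 / 2]. *)
Lemma sin_ge (x : R) : 0 <= x <= pi / 2 -> x / 4 <= sin x.
Proof.
move=> /andP[]; rewrite le_eqVlt => /predU1P[<-|x0 xpi]; first by rewrite sin0 mul0r.
have cos2 y : 0 <= y <= pi / 4 -> 2^-1 <= cos y.
  move=> /andP[y0 yp]; have c0 : 0 <= cos y.
    by apply: cos_ge0_pihalf; have := @pi_gt0 R; lra.
  have : 0 <= cos (y *+ 2).
    by apply: cos_ge0_pihalf; rewrite [y *+ 2]mulr2n; have := @pi_gt0 R; lra.
  rewrite cos_mulr2n mulr2n => h.
  rewrite leNgt; apply/negP => h2.
  have : cos y ^+ 2 < 2^-1 ^+ 2 by rewrite ltrXn2r.
  by rewrite expr2; lra.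
pose y := x / 2; have y0 : 0 < y by rewrite /y; lra.
have yp : y <= pi / 4 by rewrite /y; lra.
have [|c] := @MVT R sin cos 0 y y0 (fun y _ => is_derive_sin y).
  by apply: continuous_subspaceT => z; exact: continuous_sin.
rewrite in_itv/= => /andP[c0 cy]; rewrite sin0 !subr0 => sy.
have cc : 2^-1 <= cos c by apply: cos2; lra.
have cy2 : 2^-1 <= cos y by apply: cos2; lra.
have -> : x = y *+ 2 by rewrite mulr2n /y; lra.
rewrite sin_mulr2n mulr2n sy.
have h1 : 2^-1 * y <= cos c * y by rewrite ler_wpM2r// ltW.
have h2 : 2^-1 * (2^-1 * y) <= cos y * (cos c * y) by apply: ler_pM => //; lra.
by rewrite mulr2n; lra.
Qed.

Let gev_sin j : gev j = 4 * M%:R ^+ 2 * sin (theta j / 2) ^+ 2.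
Proof.
rewrite /gev -[in LHS](divfK (_ : 2 != 0) (theta j))// mulr_natr cos_mulr2n sin2cos2 mulr2n.
by ring.
Qed.

Lemma gev_le j : gev j <= (j%:R * pi) ^+ 2.
Proof.
rewrite gev_sin.
have t0 : 0 <= theta j / 2 by rewrite !divr_ge0 ?mulr_ge0 ?pi_ge0.
have h : sin (theta j / 2) ^+ 2 <= (theta j / 2) ^+ 2.
  rewrite -real_normK ?num_real// lerXn2r ?nnegrE// ler_norml.
  rewrite lerNl -sinN; apply/andP; split; last exact: sin_le.
  have [h|h] := leP (theta j / 2) pi.
    rewrite sinN; have : 0 <= sin (theta j / 2) by apply: sin_ge0_pi; rewrite t0.
    by lra.
  have := sin_le1 (- (theta j / 2)); have := @pi_ge2 R; lra.
have M2 : 0 <= 4 * M%:R ^+ 2 :> R by rewrite mulr_ge0// sqr_ge0.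
apply: (le_trans (ler_wpM2l M2 h)); rewrite /theta le_eqVlt; apply/orP; left.
by apply/eqP; field.
Qed.

Lemma gev_ge j : (j <= M)%N -> j%:R ^+ 2 / 4 <= gev j.
Proof.
move=> jM; rewrite gev_sin.
have t0 : 0 <= theta j / 2 by rewrite !divr_ge0 ?mulr_ge0 ?pi_ge0.
have h : theta j / 2 / 4 <= sin (theta j / 2).
  apply: sin_ge; rewrite t0/= ler_pM2r// /theta ler_pdivrMr// mulrC ler_pM2l ?pi_gt0//.
  by rewrite ler_nat.
have h2 : (theta j / 2 / 4) ^+ 2 <= sin (theta j / 2) ^+ 2.
  have s0 : 0 <= theta j / 2 / 4 by rewrite divr_ge0.
  by rewrite lerXn2r ?nnegrE// (le_trans s0 h).
have M2 : 0 <= 4 * M%:R ^+ 2 :> R by rewrite mulr_ge0// sqr_ge0.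
apply: le_trans (ler_wpM2l M2 h2).
rewrite (_ : 4 * _ * _ = (j%:R ^+ 2) * (pi ^+ 2 / 16)); last by rewrite /theta; field.
rewrite ler_wpM2l ?sqr_ge0// ler_pdivlMr//.
by have := @pi_ge2 R; rewrite expr2; nra.
Qed.

End GridModes.

(** * Quadrature of the power kernel, and a maximum principle *)

Section Quadrature.
Context {R : realType} (alpha : R) (alpha01 : 0 < alpha < 1).
Implicit Types (t : nat -> R) (f g : R -> R).
Local Notation mu := (@lebesgue_measure R).
Local Notation kern x := (fun s : R => (x - s) `^ (alpha - 1)).

Let a0 : 0 < alpha. Proof. by case/andP: alpha01. Qed.

Lemma measurable_kern (x : R) (D : set R) : measurable_fun D (kern x).
Proof.
apply: measurable_funTS.
apply: (@measurableT_comp _ _ _ _ _ _ (@powR R ^~ (alpha - 1))).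
  exact: measurable_powR.
exact: measurable_funB.
Qed.

Lemma integrable_kern (a b x : R) : a <= b <= x -> mu.-integrable `[a, b[ (EFin \o kern x).
Proof.
move=> h; apply/integrableP; split; first by apply/measurable_EFinP; exact: measurable_kern.
under eq_integral do rewrite /= ger0_norm ?powR_ge0//.
by rewrite integral_kernel// ltry.
Qed.

Lemma Rint_kern (a b x : R) : a <= b <= x ->
  \int[mu]_(s in `[a, b[) kern x s = ((x - a) `^ alpha - (x - b) `^ alpha) / alpha.
Proof. by move=> h; rewrite /Rintegral integral_kernel. Qed.

Lemma integrable_kernM (a b x : R) f B : a <= b <= x -> measurable_fun `[a, b[ f ->
  (forall s, a <= s < b -> `|f s| <= B) ->
  mu.-integrable `[a, b[ (EFin \o (fun s => kern x s * f s)).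
Proof.
move=> h mf fB.
have iB : mu.-integrable `[a, b[ (EFin \o (fun s => B * kern x s)).
  by apply: eq_integrable (integrableZl _ B (integrable_kern h)) => // s _; rewrite /= EFinM.
apply: le_integrable iB => //.
  by apply/measurable_EFinP; apply: measurable_funM => //; exact: measurable_kern.
move=> s; rewrite /= in_itv/= => sab; rewrite lee_fin !normrM ger0_norm ?powR_ge0//.
rewrite mulrC ler_wpM2r ?powR_ge0//; apply: (le_trans (fB s sab)); exact: ler_norm.
Qed.

Lemma Rint_kernM_le (a b x : R) f B : a <= b <= x -> measurable_fun `[a, b[ f ->
  (forall s, a <= s < b -> `|f s| <= B) ->
  `|\int[mu]_(s in `[a, b[) (kern x s * f s)| <=
    ((x - a) `^ alpha - (x - b) `^ alpha) / alpha * B.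
Proof.
move=> h mf fB; have i1 := integrable_kernM h mf fB.
apply: (le_trans (le_normr_Rintegral _ i1)) => //.
rewrite -Rint_kern// -RintegralZr//; last exact: integrable_kern.
apply: le_Rintegral => //.
- exact: (integrable_norm i1).
- apply: eq_integrable (integrableZr _ B (integrable_kern h)) => // s _.
- by move=> s; rewrite /= in_itv/= => sab; rewrite normrM ger0_norm ?powR_ge0// ler_wpM2l ?powR_ge0// fB.
Qed.

Lemma Rint_cells t l f : (forall k, (k < l)%N -> t k <= t k.+1) ->
  mu.-integrable `[t 0%N, t l[ (EFin \o f) ->
  \int[mu]_(s in `[t 0%N, t l[) f s = \sum_(0 <= k < l) \int[mu]_(s in `[t k, t k.+1[) f s.
Proof.
elim: l => [|l IH] tl; first by rewrite set_itvco0 Rintegral_set0 big_geq.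
move=> fi; have t0l : t 0%N <= t l.
  elim: (l) (tl) => // m IHm tm; apply: (le_trans (IHm _)) => [k km|]; last exact: tm.
  by apply: tm; exact: ltnW.
have e : `[t 0%N, t l.+1[%classic = `[t 0%N, t l[%classic `|` `[t l, t l.+1[%classic :> set R.
  apply/seteqP; split => s /=; rewrite !in_itv/=.
    by move=> /andP[h1 h2]; have [h|h] := ltP s (t l); [left; rewrite h1|right].
  by move=> [/andP[h1 h2]|/andP[h1 h2]]; rewrite ?h1 ?h2 ?andbT/= ?(lt_le_trans h2 (tl _ _))// (le_trans t0l).
have i1 : mu.-integrable `[t 0%N, t l[ (EFin \o f).
  by apply: integrableS fi => //; rewrite e => s h; left.
rewrite big_nat_recr//= -IH//; last by move=> k kl; apply: tl; exact: ltnW.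
rewrite e Rintegral_setU -?e//.
apply/disj_setPS => s /= []; rewrite !in_itv/= => /andP[_ h1] /andP[h2 _].
by move: h1; rewrite ltNge h2.
Qed.

Lemma quadrature_le t n m f (c : nat -> R) om B : (n <= m)%N ->
  (forall k, (k < m)%N -> t k < t k.+1) ->
  measurable_fun `[t 0%N, t n[ f -> (forall s, t 0%N <= s < t n -> `|f s| <= B) ->
  (forall k s, (k < n)%N -> t k <= s < t k.+1 -> `|f s - c k| <= om) ->
  `|\int[mu]_(s in `[t 0%N, t n[) (kern (t m) s * f s) -
    \sum_(0 <= k < n) weight alpha t m k * c k| <=
  om * \sum_(0 <= k < n) weight alpha t m k.
Proof.
move=> nm tm mf fB fc.
have tN : increasing_upto m t by [].
have tnm : t 0%N <= t n <= t m by apply/andP; split; apply: (increasing_upto_le tN).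
have fi := integrable_kernM tnm mf fB.
rewrite (Rint_cells _ fi); last by move=> k kn; rewrite ltW// tm// (leq_trans kn).
rewrite -sumrB mulr_sumr; apply: (le_trans (ler_norm_sum _ _ _)).
apply: ler_sum_nat => k /andP[_ kn].
have km := leq_trans kn nm.
have h : t k <= t k.+1 <= t m.
  by rewrite ltW ?tm//= (increasing_upto_le tN).
have sub : `[t k, t k.+1[%classic `<=` (`[t 0%N, t n[%classic : set R).
  move=> s; rewrite /= !in_itv/= => /andP[h1 h2]; apply/andP; split.
    by apply: le_trans h1; apply: (increasing_upto_le tN) => //; exact: ltnW.
  by apply: lt_le_trans h2 _; apply: (increasing_upto_le tN).
have mfk : measurable_fun `[t k, t k.+1[ f by apply: measurable_funS sub mf.
have fBk s : t k <= s < t k.+1 -> `|f s| <= B.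
  by move=> hs; apply: fB; have := sub s; rewrite /= !in_itv/=; apply.
have ik := integrable_kernM h mfk fBk.
have -> : weight alpha t m k * c k = \int[mu]_(s in `[t k, t k.+1[) (kern (t m) s * c k).
  by rewrite RintegralZr ?Rint_kern//; exact: integrable_kern.
have ick : mu.-integrable `[t k, t k.+1[ (EFin \o (fun s => kern (t m) s * c k)).
  by apply: (@integrable_kernM _ _ _ _ `|c k|) => //.
rewrite -RintegralB//.
rewrite (_ : Rintegral _ _ _ = \int[mu]_(s in `[t k, t k.+1[) (kern (t m) s * (f s - c k))); last first.
  by apply: eq_Rintegral => s _; rewrite mulrBr.
rewrite mulrC; apply: Rint_kernM_le => //; last by move=> s; exact: fc.
by apply: measurable_funB => //.
Qed.

(** At an index where the sum is maximal and positive, the last coefficient is nonnegative: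
    otherwise the history alone would exceed the maximum, against [history_le]. So it is enough to
    control the sums that end with some [c n >= 0]. *)
Lemma explicit_max N t (c : nat -> R) K : increasing_upto N t -> 0 <= K ->
  (forall n, (n < N)%N -> 0 <= c n -> \sum_(0 <= k < n.+1) weight alpha t n.+1 k * c k <= K) ->
  forall n, (n <= N)%N -> \sum_(0 <= k < n) weight alpha t n k * c k <= K.
Proof.
move=> tN K0 hK; pose S n := \sum_(0 <= k < n) weight alpha t n k * c k.
have amax : exists2 m, (m <= N)%N & forall n, (n <= N)%N -> S n <= S m.
  elim: (N) => [|n [m mn hm]]; first by exists 0%N => // n; rewrite leqn0 => /eqP->.
  have [h|h] := leP (S n.+1) (S m).
    exists m; first exact: leqW.
    by move=> k; rewrite leq_eqVlt => /predU1P[->//|]; rewrite ltnS; exact: hm.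
  exists n.+1 => // k; rewrite leq_eqVlt => /predU1P[->//|]; rewrite ltnS => /hm h2.
  by apply: (le_trans h2); exact: ltW.
have [m mN hm] := amax.
have [Sm|Sm] := leP (S m) K; first by move=> n /hm /le_trans; apply.
exfalso; move: Sm; apply/negP; rewrite -leNgt; case: m mN hm => [|m] mN hm.
  by rewrite /S big_geq.
have [c0|c0] := leP 0 (c m); first exact: hK.
have [S0|S0] := leP (S m.+1) 0; first exact: le_trans K0.
have h : \sum_(0 <= k < m) weight alpha t m.+1 k * c k <= S m.+1.
  apply: (history_le alpha01 tN) => [||l lm]; first exact: ltW.
    by rewrite ltnSn.
  by apply: hm; rewrite (leq_trans lm)// ltnW.
have w0 : 0 < weight alpha t m.+1 m by apply: (weight_gt0 alpha01 tN); rewrite ltnSn.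
have : S m.+1 < S m.+1.
  apply: lt_le_trans h; rewrite {1}/S big_nat_recr//= gtrDl.
  by rewrite pmulr_rlt0.
by rewrite ltxx.
Qed.

End Quadrature.

(** * Time regularity for the relaxation equation *)

Section Lipschitz.
Context {R : realType}.
Implicit Types (f g : R -> R) (A : set R).

Definition lipschitz_in A (L : R) f := forall s t, A s -> A t -> `|f t - f s| <= L * `|t - s|.

Lemma lipschitz_inT_continuous L f : lipschitz_in setT L f -> continuous f.
Proof.
move=> fL x; apply/cvgrPdist_le => e e0.
have L0 : 0 <= `|L| + 1 by rewrite addr_ge0.
exists (e / (`|L| + 1)) => /=; first by rewrite divr_gt0// ltr_wpDl.
move=> y /= xy; apply: (le_trans (fL y x I I)).
apply: (@le_trans _ _ ((`|L| + 1) * `|x - y|)).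
  by rewrite ler_wpM2r//; apply: (le_trans (ler_norm L)); rewrite lerDl.
by rewrite mulrC -ler_pdivlMr ?ltr_wpDl//; exact: ltW.
Qed.

(** McShane's formula, the infimum of the cones [f s + L * |t - s|] over [A]. Functions on the whole
    line spare the relative topology of [A] in later measurability and continuity arguments. *)
Lemma lipschitz_extension A L f : A !=set0 -> 0 <= L -> lipschitz_in A L f ->
  exists2 g, lipschitz_in setT L g & forall s, A s -> g s = f s.
Proof.
move=> [a Aa] L0 fL.
pose S t := [set f s + L * `|t - s| | s in A].
have lbS t : lbound (S t) (f a - L * `|t - a|).
  move=> _ [s As <-]; rewrite lerBlDr.
  have := fL s a As Aa; rewrite ler_norml => /andP[_ h].
  have := ler_wpM2l L0 (ler_distD t a s); rewrite mulrDr (distrC a t) => h2.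
  by lra.
have S0 t : S t !=set0 by exists (f a + L * `|t - a|); exists a.
have hS t : has_inf (S t) by split => //; exists (f a - L * `|t - a|).
have half t s : inf (S t) <= inf (S s) + L * `|t - s|.
  rewrite -lerBlDr; apply: lb_le_inf => // _ [r Ar <-]; rewrite lerBlDr.
  apply: (@le_trans _ _ (f r + L * `|t - r|)).
    by apply: ge_inf; [exact: (hS t).2|exists r].
  rewrite -addrA lerD2l -mulrDr ler_wpM2l//; have := ler_distD s t r; lra.
exists (fun t => inf (S t)).
  move=> s t _ _; rewrite ler_norml; have := half t s; have := half s t.
  by rewrite distrC => h1 h2; apply/andP; split; lra.
move=> s As; apply/eqP; rewrite eq_le; apply/andP; split.
  apply: ge_inf; first exact: (hS s).2.
  by exists s => //; rewrite subrr normr0 mulr0 addr0.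
apply: lb_le_inf => // _ [r Ar <-]; rewrite -lerBlDl.
by have := fL r s Ar As; rewrite ler_norml => /andP[_].
Qed.

Lemma ler_addgt0_divS (x y D : R) : (forall n : nat, x <= y + D / n.+1%:R) -> x <= y.
Proof.
move=> h; rewrite -[y]addr0.
have cv : (y + D / n.+1%:R) @[n --> \oo] --> y + 0.
  by apply: cvgD; [exact: cvg_cst|exact: cvg_divS].
by apply: (ler_cvg_to (@cvg_cst _ x _ _ _) cv); exact: nearW.
Qed.

End Lipschitz.

(** * Comparison argument for the fractional relaxation equation *)

Section FractionalRelaxation.
Context {R : realType} (alpha : R) (alpha01 : 0 < alpha < 1).
Context (T g0 lam L C : R) (z F : R -> R).
Context (T0 : 0 < T) (g00 : 0 < g0) (lam0 : 0 < lam) (L0 : 0 <= L) (C0 : 0 <= C).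
Context (zL : lipschitz_in setT C z) (FL : lipschitz_in setT L F).
Local Notation mu := (@lebesgue_measure R).
Let G s := F s - lam * z s.
Context (zE : forall t, 0 <= t <= T ->
  z t = z 0 + g0 * \int[mu]_(s in `[0, t[) ((t - s) `^ (alpha - 1) * G s)).

Let a0 : 0 < alpha. Proof. by case/andP: alpha01. Qed.
Let a1 : 0 < 1 - alpha. Proof. by case/andP: alpha01 => _; rewrite subr_gt0. Qed.
Let La := L + lam * C.
Let La0 : 0 <= La. Proof. by rewrite addr_ge0// mulr_ge0// ltW. Qed.

Let GL s t : `|G t - G s| <= La * `|t - s|.
Proof.
rewrite (_ : G t - G s = (F t - F s) - lam * (z t - z s)); last by rewrite /G; ring.
apply: (le_trans (ler_normB _ _)); rewrite /La mulrDl; apply: lerD; first exact: FL.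
by rewrite normrM (gtr0_norm lam0) -mulrA ler_pM2l//; exact: zL.
Qed.

Let cG : continuous G. Proof. by apply: (@lipschitz_inT_continuous _ La) => s t _ _; exact: GL. Qed.

Let grid (d : R) k : R := k%:R * d.

Let grid_inc d N : 0 < d -> increasing_upto N (grid d).
Proof. by move=> d0 n _; rewrite /grid ltr_pM2r// ltr_nat. Qed.

Let grid_err d n : 0 < d -> n%:R * d <= T ->
  `|z (grid d n) - z 0 - g0 * \sum_(0 <= k < n) weight alpha (grid d) n k * G (grid d k)|
    <= g0 * (La * d * (grid d n `^ alpha / alpha)).
Proof.
move=> d0 nT; have gn0 : 0 <= grid d n by rewrite mulr_ge0// ltW.
have g0E : grid d 0 = 0 by rewrite /grid mul0r.
rewrite zE ?gn0//.
set I := Rintegral _ _ _; set S := \sum_(_ <= _ < _) _.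
rewrite (_ : z 0 + g0 * I - z 0 - g0 * S = g0 * (I - S)); last by ring.
rewrite normrM (gtr0_norm g00) ler_pM2l// /I /S.
have := @sum_weight R alpha alpha01 (grid d) 0 n isT; rewrite g0E subr0 => <-.
have -> : `[0, grid d n[%classic = `[grid d 0, grid d n[%classic :> set R by rewrite g0E.
apply: (@quadrature_le _ _ alpha01 _ _ _ _ _ _ (`|G 0| + La * T)) => //.
- by move=> k _; rewrite /grid ltr_pM2r// ltr_nat.
- by apply: measurable_funTS; exact: continuous_measurable_fun.
- move=> s; rewrite g0E => /andP[s0 sn]; rewrite -[G s](subrK (G 0)) addrC.
  apply: (le_trans (ler_normD _ _)); rewrite lerD2l; apply: (le_trans (GL _ _)).
  by rewrite subr0 ger0_norm// ler_wpM2l// (le_trans (ltW sn)).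
- move=> k s _ /andP[ks sk]; apply: (le_trans (GL _ _)); rewrite ler_wpM2l//.
  rewrite ger0_norm ?subr_ge0//; move: sk; rewrite /grid -natr1 mulrDl mul1r; lra.
Qed.

(** By its Lipschitz bound [z] moves by order [t] from time 0, whereas a nonzero [G 0] would force a
    move of order [t^alpha]. Consequently the equation extends to negative times with [G = 0] and
    [z] constant. *)
Let G00 : G 0 = 0.
Proof.
apply/eqP; rewrite -normr_le0; apply: contraT; rewrite -ltNge => G0.
have h n : `|G 0| <= C * alpha / g0 * (T / n.+1%:R) `^ (1 - alpha) + La * T / n.+1%:R.
  pose d := T / n.+1%:R; have d0 : 0 < d by rewrite divr_gt0// ltr0n.
  have dT : 1%:R * d <= T.
    by rewrite mul1r ler_pdivrMr// ler_peMr ?(ltW T0)// ler1n.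
  have := grid_err d0 dT; rewrite big_nat1 /weight /grid mul0r subr0 subrr mul1r.
  rewrite powR0 ?gt_eqF// subr0; set p := d `^ alpha => h.
  have p0 : 0 < p by rewrite powR_gt0.
  have h1 : g0 * (p / alpha * `|G 0|) <= C * d + g0 * (La * d * (p / alpha)).
    have -> : g0 * (p / alpha * `|G 0|) = `|g0 * (p / alpha * G 0)|.
      by rewrite !normrM (gtr0_norm g00) [`|p|]gtr0_norm// [`|alpha^-1|]gtr0_norm ?invr_gt0.
    have -> : g0 * (p / alpha * G 0) = (z d - z 0) - (z d - z 0 - g0 * (p / alpha * G 0)) by ring.
    apply: (le_trans (ler_normB _ _)); apply: lerD; last exact: h.
    by apply: (le_trans (zL _ _)) => //; rewrite subr0 (gtr0_norm d0).
  have dp : d = d `^ (1 - alpha) * p.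
    by rewrite /p -powRD ?(gt_eqF d0) ?implybT// subrK powRr1// ltW.
  have k0 : 0 < g0 * (p / alpha) by rewrite mulr_gt0// divr_gt0.
  rewrite -(ler_pM2l k0) -[leLHS]mulrA; apply: (le_trans h1).
  rewrite le_eqVlt; apply/orP; left; apply/eqP.
  have e1 : C * d = C * d `^ (1 - alpha) * p by rewrite {1}dp mulrA.
  have e2 : La * T / n.+1%:R = La * d by rewrite /d mulrA.
  by rewrite e1 e2 -/d; field; rewrite !gt_eqF.
have cv : (C * alpha / g0 * (T / n.+1%:R) `^ (1 - alpha) + La * T / n.+1%:R) @[n --> \oo]
    --> C * alpha / g0 * 0 + 0.
  apply: cvgD; last exact: cvg_divS.
  apply: cvgM; first exact: cvg_cst.
  rewrite -[X in _ --> X](@powR0 R (1 - alpha)) ?gt_eqF//.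
  apply: cvg_powR => //; last exact: cvg_divS.
  by move=> n; rewrite divr_ge0 ?(ltW T0).
have : `|G 0| <= C * alpha / g0 * 0 + 0.
  by apply: (ler_cvg_to (@cvg_cst _ _ _ _ _) cv); exact: nearW.
by rewrite mulr0 addr0 leNgt G0.
Qed.

Let weight_shift d n m k : weight alpha (grid d) (n + m) (k + m) = weight alpha (grid d) n k.
Proof.
rewrite /weight; congr ((_ `^ _ - _ `^ _) / _); rewrite /grid !natrD -?addSn ?natrD; ring.
Qed.

(** Truncated subtraction sends the times before 0 to 0, where [G] vanishes; on a uniform grid the
    weights are invariant under shifts, so the delayed function solves the same equation. *)
Let delayed_sum d n m :
  \sum_(0 <= k < n) weight alpha (grid d) n k * G (grid d (k - m)) =
  \sum_(0 <= k < n - m) weight alpha (grid d) (n - m) k * G (grid d k).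
Proof.
have G0 : G (grid d 0) = 0 by rewrite /grid mul0r G00.
have [nm|mn] := leqP n m.
  have -> : (n - m = 0)%N by apply/eqP; rewrite subn_eq0.
  rewrite [RHS]big_geq// big_nat big1// => k /andP[_ kn].
  rewrite (_ : (k - m = 0)%N) ?G0 ?mulr0//; apply/eqP; rewrite subn_eq0.
  exact: leq_trans (ltnW kn) nm.
rewrite (big_cat_nat (n := m)) ?(ltnW mn)//= big_nat big1 ?add0r; last first.
  move=> k /andP[_ kn].
  by rewrite (_ : (k - m = 0)%N) ?G0 ?mulr0//; apply/eqP; rewrite subn_eq0 ltnW.
rewrite -{1}[m]add0n big_addn; apply: eq_bigr => k _.
by rewrite addnK -{1}(subnK (ltnW mn)) weight_shift.
Qed.

Let Ta := T `^ alpha / alpha.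
Let Ta0 : 0 <= Ta. Proof. by rewrite divr_ge0 ?powR_ge0// ltW. Qed.

(** The difference [w] of [z] and its delay by [m] steps satisfies, up to order [d], the equation
    with [c] in place of [G]. Where [c >= 0], the relation [lam * w = (increment of F) - c] bounds
    [w], and [explicit_max] carries the bound to all indices. *)
Let step_bound d m N n : 0 < d -> (0 < m)%N -> N%:R * d <= T -> (n <= N)%N ->
  z (grid d n) - z (grid d (n - m)) <= L * (m%:R * d) / lam + (2 * C + 4 * (g0 * La * Ta)) * d.
Proof.
move=> d0 m0 NT nN; pose om := g0 * La * Ta * d.
have om0 : 0 <= om by rewrite /om; do 3 (apply: mulr_ge0; rewrite ?(ltW d0) ?(ltW g00)//).
pose c k := G (grid d k) - G (grid d (k - m)).
pose w n := z (grid d n) - z (grid d (n - m)).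
have err j : (j <= N)%N -> `|z (grid d j) - z 0 - g0 * \sum_(0 <= k < j) weight alpha (grid d) j k * G (grid d k)| <= om.
  move=> jN; have jT : j%:R * d <= T.
    by apply: le_trans NT; rewrite ler_pM2r// ler_nat.
  apply: (le_trans (grid_err d0 jT)).
  rewrite /om (_ : g0 * La * Ta * d = g0 * (La * d * Ta)); last by ring.
  rewrite ler_pM2l// ler_wpM2l ?mulr_ge0 ?(ltW d0)//.
  rewrite ler_pM2r ?invr_gt0//; apply: ge0_ler_powR; rewrite ?nnegrE ?(ltW a0) ?(ltW T0)//.
  by rewrite mulr_ge0// ltW.
have wE j : (j <= N)%N -> `|w j - g0 * \sum_(0 <= k < j) weight alpha (grid d) j k * c k| <= 2 * om.
  move=> jN; have e1 := err j jN; have e2 := err (j - m)%N (leq_trans (leq_subr _ _) jN).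
  rewrite (_ : w j - _ = (z (grid d j) - z 0 - g0 * \sum_(0 <= k < j) weight alpha (grid d) j k * G (grid d k))
   - (z (grid d (j - m)) - z 0 - g0 * \sum_(0 <= k < j - m) weight alpha (grid d) (j - m) k * G (grid d k))); last first.
    rewrite -delayed_sum /c; under eq_bigr do rewrite mulrBr.
    by rewrite sumrB /w; ring.
  by apply: (le_trans (ler_normB _ _)); lra.
have gridm k : `|grid d k - grid d (k - m)| <= m%:R * d.
  have h : (k - m <= k)%N := leq_subr _ _.
  rewrite ger0_norm ?subr_ge0 /grid -?mulrBl ?ler_pM2r ?ler_nat//.
  by rewrite -natrB// ler_nat leq_subLR addnC -leq_subLR.
pose K := (L * (m%:R * d) / lam + 2 * C * d + 2 * om) / g0.
have K0 : 0 <= K.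
  apply: divr_ge0; last exact: ltW.
  apply: addr_ge0; last by rewrite mulr_ge0.
  apply: addr_ge0; last by apply: mulr_ge0; rewrite ?(ltW d0)// mulr_ge0.
  by apply: divr_ge0; rewrite ?(ltW lam0)// mulr_ge0// mulr_ge0// ltW.
have hmax : forall j, (j <= N)%N -> \sum_(0 <= k < j) weight alpha (grid d) j k * c k <= K.
  apply: (explicit_max alpha01 (grid_inc d0)) => // j jN cj.
  have wj : lam * w j <= L * (m%:R * d).
    have e : lam * w j = F (grid d j) - F (grid d (j - m)) - c j by rewrite /w /c /G; ring.
    rewrite e; have := @FL (grid d (j - m)) (grid d j) I I.
    rewrite ler_norml => /andP[_ h]; have := ler_wpM2l L0 (gridm j); lra.
  have wj' : w j <= L * (m%:R * d) / lam by rewrite ler_pdivlMr// mulrC.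
  have dw : w j.+1 - w j <= 2 * C * d.
    have h1 : `|z (grid d j.+1) - z (grid d j)| <= C * d.
      apply: (le_trans (zL _ _)) => //; rewrite /grid -natr1 mulrDl mul1r addrAC subrr add0r.
      by rewrite (gtr0_norm d0).
    have h2 : `|z (grid d (j.+1 - m)) - z (grid d (j - m))| <= C * d.
      have [mj|jm] := leqP m j; last first.
        have -> : (j.+1 - m = 0)%N by apply/eqP; rewrite subn_eq0.
        have -> : (j - m = 0)%N by apply/eqP; rewrite subn_eq0 ltnW.
        by rewrite subrr normr0 mulr_ge0// ltW.
      rewrite subSn//; apply: (le_trans (zL _ _)) => //; rewrite /grid -natr1 mulrDl mul1r addrAC subrr add0r.
      by rewrite (gtr0_norm d0).
    by move: h1 h2; rewrite !ler_norml /w => /andP[_ h1] /andP[h2 _]; lra.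
  have := wE j.+1 jN; rewrite ler_norml => /andP[h _].
  by rewrite /K ler_pdivlMr// mulrC; lra.
have := wE n nN; rewrite ler_norml => /andP[_ h].
have := hmax n nN; rewrite /K ler_pdivlMr// mulrC => h2; rewrite -/(w n).
have -> : (2 * C + 4 * (g0 * La * Ta)) * d = 2 * C * d + 4 * om by rewrite /om; ring.
lra.
Qed.

(** The a priori constant [C] enters only through terms of order [d], which vanish as the grid is
    refined; what survives is independent of [C]. *)
Lemma relaxation_increase s t : 0 <= s <= t -> t <= T -> z t - z s <= L * (t - s) / lam.
Proof.
move=> /andP[s0 st] tT; move: st; rewrite le_eqVlt => /predU1P[->|st].
  by rewrite !subrr mulr0 mul0r.
have ts0 : 0 < t - s by rewrite subr_gt0.
apply: (@ler_addgt0_divS _ _ _ ((4 * C + 4 * (g0 * La * Ta)) * (t - s))) => n.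
pose m := n.+1; pose d := (t - s) / m%:R.
have m0 : 0 < m%:R :> R by rewrite ltr0n.
have d0 : 0 < d by rewrite divr_gt0.
have md : m%:R * d = t - s by rewrite /d mulrC divfK// gt_eqF.
have t0 : 0 <= t by rewrite (le_trans s0)// ltW.
have td0 : 0 <= t / d by rewrite divr_ge0// ltW.
(* [grid d N] is the last grid point not after [t]; as the delay [m * d] is exactly [t - s], the
   delayed point is within [d] of [s]. *)
have := truncn_itv td0; set N := Num.Def.trunc _ => /andP[].
rewrite ler_pdivlMr// ltr_pdivrMr// -natr1 mulrDl mul1r => Nt tN.
have mN : (m <= N)%N.
  rewrite -ltnS -(ltr_nat R) -(ltr_pM2r d0) md -natr1 mulrDl mul1r.
  by apply: le_lt_trans tN; rewrite lerBlDr lerDl.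
have := step_bound d0 (isT : 0 < m)%N (le_trans Nt tT) (leqnn N); rewrite md.
have h1 : z t - z (grid d N) <= C * d.
  apply: (le_trans (ler_norm _)); apply: (le_trans (zL _ _)) => //.
  by rewrite ler_wpM2l// ger0_norm ?subr_ge0// lerBlDl ltW// /grid addrC [_ * d + _]addrC.
have h2 : z (grid d (N - m)) - z s <= C * d.
  apply: (le_trans (ler_norm _)); apply: (le_trans (zL _ _)) => //.
  rewrite ler_wpM2l// ler_norml /grid natrB// mulrBl md.
  by apply/andP; split; lra.
have -> : (4 * C + 4 * (g0 * La * Ta)) * (t - s) / n.+1%:R =
  (4 * C + 4 * (g0 * La * Ta)) * d by rewrite /d; ring.
move: h1 h2; rewrite !mulrDl; lra.
Qed.

End FractionalRelaxation.

(** The equation is linear, so the one-sided bound also applies to [- z] with the forcing [- F]. *)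
Lemma relaxation_lipschitz (R : realType) (alpha T g0 lam L C : R) (z F : R -> R) :
  0 < alpha < 1 -> 0 < T -> 0 < g0 -> 0 < lam -> 0 <= L -> 0 <= C ->
  lipschitz_in setT C z -> lipschitz_in setT L F ->
  (forall t, 0 <= t <= T -> z t = z 0 + g0 * \int[lebesgue_measure]_(s in `[0, t[)
     ((t - s) `^ (alpha - 1) * (F s - lam * z s))) ->
  lipschitz_in `[0, T] (L / lam) z.
Proof.
move=> a01 T0 g00 lam0 L0 C0 zL FL zE.
have up := @relaxation_increase R alpha a01 T g0 lam L C z F T0 g00 lam0 L0 C0 zL FL zE.
have NzL : lipschitz_in setT C (fun t => - z t).
  by move=> s t _ _; rewrite -opprD normrN; exact: zL.
have NFL : lipschitz_in setT L (fun t => - F t).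
  by move=> s t _ _; rewrite -opprD normrN; exact: FL.
have NzE t : 0 <= t <= T -> - z t = - z 0 + g0 * \int[lebesgue_measure]_(s in `[0, t[)
     ((t - s) `^ (alpha - 1) * (- F s - lam * - z s)).
  move=> h; rewrite {1}zE// opprD -mulrN; congr (_ + g0 * _).
  rewrite -[LHS]mulN1r -RintegralZl//; last first.
    have cG : continuous (fun s => F s - lam * z s).
      apply: (@lipschitz_inT_continuous _ (L + lam * C)) => x y _ _.
      rewrite (_ : F y - lam * z y - _ = (F y - F x) - lam * (z y - z x)); last by ring.
      apply: (le_trans (ler_normB _ _)); rewrite mulrDl; apply: lerD; first exact: FL.
      by rewrite normrM (gtr0_norm lam0) -mulrA ler_pM2l//; exact: zL.
    apply: (@integrable_kernM _ _ a01 _ _ _ _ (`|F 0 - lam * z 0| + (L + lam * C) * T)).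
    - by case/andP: h => ->; rewrite lexx.
    - by apply: measurable_funTS; exact: continuous_measurable_fun.
    - move=> s /andP[s0 st].
      rewrite (_ : F s - lam * z s = (F 0 - lam * z 0) + ((F s - F 0) - lam * (z s - z 0))); last by ring.
      have sT : `|s - 0| <= T by rewrite subr0 ger0_norm// ltW// (lt_le_trans st)//; case/andP: h.
      apply: (le_trans (ler_normD _ _)); rewrite lerD2l.
      apply: (le_trans (ler_normB _ _)); rewrite mulrDl; apply: lerD.
        by apply: (le_trans (FL _ _ I I)); rewrite ler_wpM2l.
      rewrite normrM (gtr0_norm lam0) -mulrA ler_pM2l//.
      by apply: (le_trans (zL _ _ I I)); rewrite ler_wpM2l.
  by apply: eq_Rintegral => s _; ring.
have down := @relaxation_increase R alpha a01 T g0 lam L C _ _ T0 g00 lam0 L0 C0 NzL NFL NzE.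
have main s t : 0 <= s <= t -> t <= T -> `|z t - z s| <= L / lam * `|t - s|.
  move=> st tT; have := up s t st tT; have := down s t st tT.
  case/andP: st => s0 st; rewrite (ger0_norm (_ : 0 <= t - s)) ?subr_ge0//.
  by rewrite ler_norml [L / lam * _]mulrAC => h1 h2; apply/andP; split; lra.
move=> s t; rewrite /= !in_itv/= => /andP[s0 sT] /andP[t0 tT].
have [st|ts] := leP s t; first by apply: main; rewrite ?s0.
by rewrite distrC [`|t - s|]distrC; apply: main; rewrite ?t0// ltW.
Qed.

(** * Spatial consistency *)

Section RelativeDerivative.
Context {R : realType}.
Implicit Types (f : R -> R) (A : set R).

Lemma cvg_quotientP A f x (l : R) :
  ((f y - f x) / (y - x)) @[y --> within A x^'] --> l <->
  forall e, 0 < e -> exists2 d, 0 < d &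
    forall y, A y -> y != x -> `|y - x| < d -> `|(f y - f x) / (y - x) - l| <= e.
Proof.
split=> [/cvgrPdist_le h e e0|h].
  have [d /= d0 hd] := h e e0; exists d => // y Ay yx yd.
  by rewrite distrC; apply: (hd y) => //=; rewrite distrC.
apply/cvgrPdist_le => e e0; have [d d0 hd] := h e e0.
exists d => //= y yd yx Ay; rewrite distrC; apply: hd => //.
by rewrite distrC.
Qed.

Lemma derivableS_cvg A f x : derivableS A f x ->
  ((f y - f x) / (y - x)) @[y --> within A x^'] --> deriveS A f x.
Proof. by []. Qed.

Lemma derivableS_is_derive A f x d : 0 < d -> (forall y, `|y - x| < d -> A y) ->
  derivableS A f x -> is_derive x 1 f (deriveS A f x).
Proof.
move=> d0 dA /derivableS_cvg/cvg_quotientP h.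
have cv : h^-1 *: (f (h *: (1 : R) + x) - f x) @[h --> 0^'] --> deriveS A f x.
  apply/cvgrPdist_le => e e0; have [d1 d10 hd] := h e e0.
  exists (Num.min d d1) => /=; first by rewrite lt_min d0.
  move=> y /=; rewrite sub0r normrN lt_min => /andP[yd yd1] y0.
  have yE : y *: (1 : R) + x - x = y by rewrite addrK [_ *: _]mulr1.
  have := hd (y *: (1 : R) + x); rewrite yE mulrC distrC; apply => //.
    by apply: dA; rewrite yE.
  by rewrite -subr_eq0 yE.
split; first by apply/cvg_ex; exists (deriveS A f x).
exact: cvg_lim.
Qed.

Lemma derivableS_within_continuous A f : (forall x, A x -> derivableS A f x) ->
  {within A, continuous f}.
Proof.
move=> df; apply/subspace_continuousP => x Ax.
have /derivableS_cvg/cvg_quotientP h := df x Ax.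
apply/cvgrPdist_le => e e0; set l := deriveS A f x in h.
have [d d0 hd] := h 1 ltr01.
have l0 : 0 < `|l| + 1 by rewrite ltr_wpDl.
exists (Num.min d (e / (`|l| + 1))) => /=; first by rewrite lt_min d0 divr_gt0.
move=> y /=; rewrite lt_min => /andP[yd ye] Ay.
have [->|yx] := eqVneq y x; first by rewrite subrr normr0 ltW.
have yx0 : 0 < `|y - x| by rewrite normr_gt0 subr_eq0.
have q : `|(f y - f x) / (y - x)| <= `|l| + 1.
  rewrite -[X in `|X|](subrK l) addrC (le_trans (ler_normD _ _))// lerD2l.
  by apply: hd => //; rewrite distrC.
rewrite distrC; apply: (@le_trans _ _ ((`|l| + 1) * `|y - x|)).
  by move: q; rewrite normrM normfV ler_pdivrMr.
by rewrite mulrC -ler_pdivlMr// distrC ltW.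
Qed.

End RelativeDerivative.

(** * Interpolation between derivatives, and order of the compact scheme *)

Section Chains.
Context {R : realType}.
Implicit Types (w : nat -> R -> R) (n : nat).

(** Formulated for a family of functions and not for iterated derivatives, so that it also covers
    differences of the solution at two times. *)
Definition chain n w :=
  (forall j (x : R), (j < n)%N -> 0 < x < 1 -> is_derive x 1 (w j) (w j.+1 x)) /\
  (forall j, (j < n)%N -> {within `[(0 : R), 1], continuous (w j)}).

Lemma chain_MVT n w j a b : chain n w -> (j < n)%N -> 0 <= a -> a < b -> b <= 1 ->
  exists2 c, a < c < b & w j b - w j a = w j.+1 c * (b - a).
Proof.
move=> [wd wc] jn a0 ab b1; have [||c] := @MVT R (w j) (w j.+1) a b ab.
- move=> x; rewrite in_itv/= => /andP[ax xb]; apply: wd => //.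
  by rewrite (le_lt_trans a0 ax) (lt_le_trans xb b1).
- apply: continuous_subspaceW (wc j jn) => x; rewrite /= !in_itv/= => /andP[ax xb].
  by rewrite (le_trans a0 ax) (le_trans xb b1).
- by rewrite in_itv/= => cab e; exists c.
Qed.

(** Constants of a Landau inequality. The factor [2 * 3^j] comes from working in thirds of an
    interval and from the difference of two values in a difference quotient. *)
Fixpoint landau (j : nat) : R := if j is j'.+1 then 2 * 3 ^+ j * landau j' else 1.

Lemma landau_gt0 j : 0 < landau j.
Proof. by elim: j => //= j IH; rewrite !mulr_gt0// exprn_gt0. Qed.

(** By induction [w j] has a small value in the first and in the last third of the interval; the
    mean value theorem between these points yields a small value of [w j.+1]. *)
Lemma chain_small n w B j : chain n w -> (forall x, 0 <= x <= 1 -> `|w 0 x| <= B) ->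
  (j <= n)%N -> forall a b, 0 <= a -> a < b -> b <= 1 ->
    exists2 c, a < c < b & `|w j c| <= landau j * B / (b - a) ^+ j.
Proof.
move=> cw wB; elim: j => [|j IH] jn a b a0 ab b1.
  exists ((a + b) / 2); first by apply/andP; split; lra.
  by rewrite /= expr0 divr1 mul1r; apply: wB; apply/andP; split; lra.
pose d := (b - a) / 3; have d0 : 0 < d by rewrite /d; lra.
have [|||x /andP[ax xa] hx] := IH (ltnW jn) a (a + d) => //.
- by lra.
- by rewrite /d; lra.
have [|||y /andP[by_ yb] hy] := IH (ltnW jn) (b - d) b => //.
- by rewrite /d; lra.
- by lra.
have e1 : a + d - a = d by ring.
have e2 : b - (b - d) = d by ring.
rewrite e1 in hx; rewrite e2 in hy.
have dxy : d <= y - x by rewrite /d in xa by_ *; lra.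
have [|||c /andP[xc cy] e] := @chain_MVT n w j x y cw jn.
- by lra.
- by lra.
- by lra.
exists c; first by apply/andP; split; lra.
have yx0 : 0 < y - x by lra.
have -> : w j.+1 c = (w j y - w j x) / (y - x) by rewrite e mulfK// gt_eqF.
rewrite normrM normfV (gtr0_norm yx0) ler_pdivrMr//.
apply: (le_trans (ler_normB _ _)).
set V := landau j * B / d ^+ j in hx hy.
have V0 : 0 <= V by apply: le_trans hx.
apply: (@le_trans _ _ (2 * V)); first by lra.
have -> : landau j.+1 * B / (b - a) ^+ j.+1 = 2 * V / d.
  rewrite /V /d /= exprMn exprVn exprS !exprS; field.
  by rewrite !expf_neq0 ?gt_eqF ?subr_gt0.
have q1 : 1 <= (y - x) / d by rewrite ler_pdivlMr// mul1r.
have := ler_wpM2l V0 q1; rewrite mulr1.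
by rewrite (_ : 2 * V / d * (y - x) = 2 * (V * ((y - x) / d))); [lra|ring].
Qed.

Lemma chain_descend n w j K x c : chain n w -> (j < n)%N -> 0 <= K ->
  (forall y, 0 < y < 1 -> `|w j.+1 y| <= K) -> 0 <= x <= 1 -> 0 <= c <= 1 ->
  `|w j x - w j c| <= K * `|x - c|.
Proof.
move=> cw jn K0 hK; wlog cx : x c / c < x => [hw xI cI|/andP[x0 x1] /andP[c0 c1]].
  have [cx|xc|->] := ltgtP c x; [exact: hw| |by rewrite !subrr normr0 mulr0].
  by rewrite distrC [`|x - c|]distrC; exact: hw.
have [|d /andP[cd dx] ->] := chain_MVT cw jn c0 cx; first by [].
rewrite normrM ler_wpM2r// hK//; apply/andP; split.
  exact: le_lt_trans cd.
exact: lt_le_trans x1.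
Qed.

(** Descends from order [n]: a bound on [w j.+1] and one point with small [w j] bound [w j]
    everywhere. The constant does not depend on [w], which provides bounds uniform in time for the
    intermediate space derivatives of the solution. *)
Lemma chain_bound n B K j : 0 <= B -> 0 <= K -> (j <= n)%N ->
  exists2 D, 0 <= D & forall w, chain n w ->
    (forall x, 0 <= x <= 1 -> `|w 0 x| <= B) ->
    (forall x, 0 <= x <= 1 -> `|w n x| <= K) ->
    forall x, 0 <= x <= 1 -> `|w j x| <= D.
Proof.
move=> B0 K0 jn; rewrite -(subKn jn).
have : (n - j <= n)%N by exact: leq_subr.
elim: (n - j)%N => [|i IH] iN; first by exists K => // w _ _; rewrite subn0.
have [D D0 hD] := IH (ltnW iN).
exists (landau (n - i.+1) * B + D); first by rewrite addr_ge0// mulr_ge0// ltW ?landau_gt0.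
move=> w cw wB wK x xI.
have [|||c /andP[c0 c1] hc] := @chain_small n w B (n - i.+1) cw wB (leq_subr _ _) 0 1.
- by [].
- by [].
- by [].
rewrite subr0 expr1n divr1 in hc.
have si : ((n - i.+1).+1 = n - i)%N by rewrite subnSK.
have cI : 0 <= c <= 1 by rewrite !ltW.
have jn' : (n - i.+1 < n)%N by rewrite si leq_subr.
have h := @chain_descend n w (n - i.+1) D x c cw jn' D0 _ xI cI.
rewrite -(subrK (w (n - i.+1)%N c) (w _ x)) addrC.
apply: (le_trans (ler_normD _ _)); apply: lerD => //.
apply: (le_trans (h _)).
  by move=> y /andP[y0 y1]; rewrite si; apply: hD => //; rewrite !ltW.
rewrite -[leRHS]mulr1 ler_wpM2l// ler_norml; case/andP: xI => x0 x1; apply/andP; split; lra.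
Qed.

Lemma ler_norm_MVT0 (g g' : R -> R) (h C : R) p : 0 < h -> 0 <= C -> g 0 = 0 ->
  {within `[0, h], continuous g} ->
  (forall s, 0 < s < h -> is_derive s 1 g (g' s)) ->
  (forall s, 0 < s < h -> `|g' s| <= C * s ^+ p) ->
  forall s, 0 <= s <= h -> `|g s| <= C * s ^+ p.+1.
Proof.
move=> h0 C0 g00 gc gd hC s /andP[]; rewrite le_eqVlt => /predU1P[<- _|s0 sh].
  by rewrite g00 normr0 expr0n mulr0.
have [||c] := @MVT R g g' 0 s s0.
- move=> x; rewrite in_itv/= => /andP[x0 xs]; apply: gd; rewrite x0/=.
  exact: lt_le_trans sh.
- apply: continuous_subspaceW gc => x; rewrite /= !in_itv/= => /andP[-> xs] /=.
  exact: le_trans sh.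
rewrite in_itv/= => /andP[c0 cs]; rewrite g00 !subr0 => ->.
rewrite normrM (gtr0_norm s0) exprSr mulrA ler_wpM2r ?(ltW s0)//.
apply: (le_trans (hC c _)); first by rewrite c0 (lt_le_trans cs).
by rewrite ler_wpM2l// lerXn2r ?nnegrE ?(ltW c0) ?(ltW s0) ?(ltW cs).
Qed.

Section CompactScheme.
Context (w : nat -> R -> R) (K : R) (cw : chain 6 w).
Context (wK : forall x, 0 <= x <= 1 -> `|w 6 x| <= K).
Context (c h : R) (h0 : 0 < h) (hc0 : h <= c) (ch1 : c + h <= 1).

Let K0 : 0 <= K. Proof. by apply: le_trans (wK (_ : 0 <= 0 <= 1)); rewrite ?lexx ?ler01. Qed.

Let pos s : 0 < s < h -> 0 < c + s < 1.
Proof. by move: h0 hc0 ch1 => ? ? ? /andP[s0 sh]; apply/andP; split; lra. Qed.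

Let neg s : 0 < s < h -> 0 < c - s < 1.
Proof. by move: h0 hc0 ch1 => ? ? ? /andP[s0 sh]; apply/andP; split; lra. Qed.

Let P j (s : R) := w j (c + s).
Let N j (s : R) := w j (c - s).

Let dsum (f g : R -> R) (s a b : R) : is_derive s 1 f a -> is_derive s 1 g b ->
  is_derive s 1 (fun y => f y + g y) (a + b).
Proof. exact: is_deriveD. Qed.

Let dP j s : (j < 6)%N -> 0 < s < h -> is_derive s 1 (P j) (P j.+1 s).
Proof.
move=> j6 sI; have d1 := cw.1 j _ j6 (pos sI).
have d2 : is_derive s 1 (fun s : R => c + s) 1.
  have := dsum (is_derive_cst c s 1) (is_derive_id s 1); by rewrite add0r.
have := @is_derive1_comp R (w j) (fun s => c + s) s _ _ d1 d2.
by rewrite mulr1.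
Qed.

Let dN j s : (j < 6)%N -> 0 < s < h -> is_derive s 1 (N j) (- N j.+1 s).
Proof.
move=> j6 sI; have d1 := cw.1 j _ j6 (neg sI).
have d2 : is_derive s 1 (fun s : R => c - s) (-1).
  have := is_deriveB (is_derive_cst c s 1) (is_derive_id s 1); by rewrite sub0r.
have := @is_derive1_comp R (w j) (fun s => c - s) s _ _ d1 d2.
by rewrite mulrN1.
Qed.

Let cP j : (j < 6)%N -> {within `[0, h], continuous (P j)}.
Proof.
move=> j6; apply/subspace_continuousP => s; rewrite /= in_itv/= => /andP[s0 sh]; move: h0 hc0 ch1 => ? ? ?.
have /subspace_continuousP := cw.2 j j6.
move=> /(_ (c + s)); rewrite /= in_itv/= => hc.
apply/cvgrPdist_le => e e0; have /cvgrPdist_le hc' := hc (ltac:(apply/andP; split; lra)).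
have [d /= d0 hd] := hc' e e0; exists d => //= y yd yI.
apply: hd => /=; first by rewrite opprD addrACA subrr add0r.
by move: yI; rewrite /= !in_itv/= => /andP[? ?]; apply/andP; split; lra.
Qed.

Let cN j : (j < 6)%N -> {within `[0, h], continuous (N j)}.
Proof.
move=> j6; apply/subspace_continuousP => s; rewrite /= in_itv/= => /andP[s0 sh]; move: h0 hc0 ch1 => ? ? ?.
have /subspace_continuousP := cw.2 j j6.
move=> /(_ (c - s)); rewrite /= in_itv/= => hc.
apply/cvgrPdist_le => e e0; have /cvgrPdist_le hc' := hc (ltac:(apply/andP; split; lra)).
have [d /= d0 hd] := hc' e e0; exists d => //= y yd yI.
apply: hd => /=; first by rewrite opprD addrACA subrr add0r -opprD normrN.
by move: yI; rewrite /= !in_itv/= => /andP[? ?]; apply/andP; split; lra.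
Qed.

(** Twice the even part of [w j] about [c]; [O] is twice the odd part. *)
Let E j s := P j s + N j s.
Let O j s := P j s - N j s.

Let dE j s : (j < 6)%N -> 0 < s < h -> is_derive s 1 (E j) (O j.+1 s).
Proof. by move=> j6 sI; apply: (is_deriveD (dP j6 sI) (dN j6 sI)). Qed.

Let dO j s : (j < 6)%N -> 0 < s < h -> is_derive s 1 (O j) (E j.+1 s).
Proof.
move=> j6 sI; apply: is_derive_eq; first exact: (is_deriveB (dP j6 sI) (dN j6 sI)).
by rewrite opprK.
Qed.

Let cE j : (j < 6)%N -> {within `[0, h], continuous (E j)}.
Proof. by move=> j6 x; apply: continuousD; [exact: cP|exact: cN]. Qed.

Let cO j : (j < 6)%N -> {within `[0, h], continuous (O j)}.
Proof. by move=> j6 x; apply: continuousB; [exact: cP|exact: cN]. Qed.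

Let cX (k : nat) : {within `[0, h], continuous (fun s : R => s ^+ k)}.
Proof. by apply: continuous_subspaceT; exact: exprn_continuous. Qed.

Let cC (k : R) : {within `[0, h], continuous (fun=> k)}.
Proof. by apply: continuous_subspaceT; exact: cst_continuous. Qed.

Let dmul (f g : R -> R) (s a b : R) : is_derive s 1 f a -> is_derive s 1 g b ->
  is_derive s 1 (fun y => f y * g y) (a * g s + f s * b).
Proof.
move=> hf hg; rewrite (_ : _ + _ = f s *: b + g s *: a); first exact: is_deriveM.
by rewrite /GRing.scale/=; ring.
Qed.

Let dcst (k : R) (s : R) : is_derive s 1 (fun=> k) 0.
Proof. exact: is_derive_cst. Qed.

Let dpow2 (s : R) : is_derive s 1 (fun y : R => y ^+ 2) (2 * s).
Proof.
have := dmul (is_derive_id s (1 : R)) (is_derive_id s (1 : R)).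
by rewrite mul1r mulr1 mulr_natl mulr2n.
Qed.

Let did (s : R) : is_derive s 1 (fun y : R => y ^+ 1) 1.
Proof. exact: is_derive_id. Qed.

Let a2 := 10 * w 2 c.
Let a0 := - 2 * w 0 c.
(** [g0 h / h^2] is the consistency error at [c], and [g1] to [g4] are the successive derivatives of
    [g0]. The weights 1, 10, 1 over 12 are those for which [g0] to [g3] vanish at 0 and the fourth
    derivatives of [w 0] cancel in [g4]. Four integrations of a bound of order [s^2] for [g4] give
    order [h^6]. *)
Let g0 s := s ^+ 2 * ((E 2 s + a2) * 12^-1) + (E 0 s + a0) * -1.
Let g1 s := s ^+ 1 * ((E 2 s + a2) * 6^-1) + (s ^+ 2 * (O 3 s * 12^-1) + O 1 s * -1).
Let g2 s := (a2 * 6^-1 + E 2 s * (- (5 / 6))) + (s ^+ 1 * (O 3 s * 3^-1) + s ^+ 2 * (E 4 s * 12^-1)).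
Let g3 s := O 3 s * (- 2^-1) + (s ^+ 1 * (E 4 s * 2^-1) + s ^+ 2 * (O 5 s * 12^-1)).
Let g4 s := s ^+ 1 * (O 5 s * (2 / 3)) + s ^+ 2 * (E 6 s * 12^-1).

Let dg0 s : 0 < s < h -> is_derive s 1 g0 (g1 s).
Proof.
move=> sI; have dE2 := dE (isT : 2 < 6)%N sI; have dE0 := dE (isT : 0 < 6)%N sI.
have := dsum (dmul (dpow2 s) (dmul (dsum dE2 (dcst a2 s)) (dcst 12^-1 s)))
  (dmul (dsum dE0 (dcst a0 s)) (dcst (-1) s)).
by move/is_derive_eq; apply; rewrite /g1; field.
Qed.

Let dg1 s : 0 < s < h -> is_derive s 1 g1 (g2 s).
Proof.
move=> sI; have dE2 := dE (isT : 2 < 6)%N sI; have dO3 := dO (isT : 3 < 6)%N sI.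
have dO1 := dO (isT : 1 < 6)%N sI.
have := dsum (dmul (did s) (dmul (dsum dE2 (dcst a2 s)) (dcst 6^-1 s)))
  (dsum (dmul (dpow2 s) (dmul dO3 (dcst 12^-1 s))) (dmul dO1 (dcst (-1) s))).
by move/is_derive_eq; apply; rewrite /g2; field.
Qed.

Let dg2 s : 0 < s < h -> is_derive s 1 g2 (g3 s).
Proof.
move=> sI; have dE2 := dE (isT : 2 < 6)%N sI; have dO3 := dO (isT : 3 < 6)%N sI.
have dE4 := dE (isT : 4 < 6)%N sI.
have := dsum (dsum (dcst (a2 * 6^-1) s) (dmul dE2 (dcst (- (5 / 6)) s)))
  (dsum (dmul (did s) (dmul dO3 (dcst 3^-1 s))) (dmul (dpow2 s) (dmul dE4 (dcst 12^-1 s)))).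
by move/is_derive_eq; apply; rewrite /g3; field.
Qed.

Let dg3 s : 0 < s < h -> is_derive s 1 g3 (g4 s).
Proof.
move=> sI; have dO3 := dO (isT : 3 < 6)%N sI; have dE4 := dE (isT : 4 < 6)%N sI.
have dO5 := dO (isT : 5 < 6)%N sI.
have := dsum (dmul dO3 (dcst (- 2^-1) s))
  (dsum (dmul (did s) (dmul dE4 (dcst 2^-1 s))) (dmul (dpow2 s) (dmul dO5 (dcst 12^-1 s)))).
by move/is_derive_eq; apply; rewrite /g4; field.
Qed.

Let csum (f g : R -> R) : {within `[0, h], continuous f} ->
  {within `[0, h], continuous g} -> {within `[0, h], continuous (fun y => f y + g y)}.
Proof. by move=> cf cg x; apply: continuousD; [exact: cf|exact: cg]. Qed.

Let cmul (f g : R -> R) : {within `[0, h], continuous f} ->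
  {within `[0, h], continuous g} -> {within `[0, h], continuous (fun y => f y * g y)}.
Proof. by move=> cf cg x; apply: continuousM; [exact: cf|exact: cg]. Qed.

Let cg0 : {within `[0, h], continuous g0}.
Proof.
exact: (csum (cmul (@cX (2)) (cmul (csum (@cE 2 isT) (@cC (a2))) (@cC (12^-1))))
  (cmul (csum (@cE 0 isT) (@cC (a0))) (@cC (-1)))).
Qed.

Let cg1 : {within `[0, h], continuous g1}.
Proof.
exact: (csum (cmul (@cX (1)) (cmul (csum (@cE 2 isT) (@cC (a2))) (@cC (6^-1))))
  (csum (cmul (@cX (2)) (cmul (@cO 3 isT) (@cC (12^-1)))) (cmul (@cO 1 isT) (@cC (-1))))).
Qed.

Let cg2 : {within `[0, h], continuous g2}.
Proof.
exact: (csum (csum (@cC (a2 * 6^-1)) (cmul (@cE 2 isT) (@cC (- (5 / 6)))))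
  (csum (cmul (@cX (1)) (cmul (@cO 3 isT) (@cC (3^-1))))
        (cmul (@cX (2)) (cmul (@cE 4 isT) (@cC (12^-1)))))).
Qed.

Let cg3 : {within `[0, h], continuous g3}.
Proof.
exact: (csum (cmul (@cO 3 isT) (@cC (- 2^-1)))
  (csum (cmul (@cX (1)) (cmul (@cE 4 isT) (@cC (2^-1))))
        (cmul (@cX (2)) (cmul (@cO 5 isT) (@cC (12^-1)))))).
Qed.

Let O0 j : O j 0 = 0. Proof. by rewrite /O /P /N addr0 subr0 subrr. Qed.

Let g4_le s : 0 < s < h -> `|g4 s| <= 3 / 2 * K * s ^+ 2.
Proof.
move=> sI; have /andP[s0 sh] := sI; have pI := pos sI; have nI := neg sI.
have hO : `|O 5 s| <= K * (2 * s).
  have := @chain_descend 6 w 5 K (c + s) (c - s) cw isT K0.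
  rewrite (_ : c + s - (c - s) = 2 * s); last by ring.
  rewrite (gtr0_norm (_ : 0 < 2 * s)) ?mulr_gt0//; apply.
  - by move=> y /andP[y0 y1]; apply: wK; rewrite !ltW.
  - by case/andP: pI => h1 h2; rewrite !ltW.
  - by case/andP: nI => h1 h2; rewrite !ltW.
have hE : `|E 6 s| <= 2 * K.
  apply: (le_trans (ler_normD _ _)); rewrite mulr_natl mulr2n; apply: lerD; apply: wK.
    by case/andP: pI => h1 h2; rewrite !ltW.
  by case/andP: nI => h1 h2; rewrite !ltW.
rewrite /g4 (le_trans (ler_normD _ _))// !normrM.
rewrite [`|2|]ger0_norm// [`|3^-1|]ger0_norm ?invr_ge0// [`|12^-1|]ger0_norm ?invr_ge0// !normrX (gtr0_norm s0) expr1.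
have h1 : s * (`|O 5 s| * (2 / 3)) <= s * (K * (2 * s) * (2 / 3)).
  by rewrite ler_pM2l// ler_pM2r.
have h2 : s ^+ 2 * (`|E 6 s| / 12) <= s ^+ 2 * (2 * K / 12).
  by rewrite ler_pM2l ?exprn_gt0// ler_pM2r.
apply: (le_trans (lerD h1 h2)); rewrite le_eqVlt; apply/orP; left; apply/eqP.
by field.
Qed.

Lemma compact_consistency :
  `|(w 2 (c + h) + 10 * w 2 c + w 2 (c - h)) / 12 -
    (w 0 (c + h) - 2 * w 0 c + w 0 (c - h)) / h ^+ 2| <= 3 / 2 * K * h ^+ 4.
Proof.
have C0 : 0 <= 3 / 2 * K by rewrite mulr_ge0.
have ev j : E j 0 = 2 * w j c by rewrite /E /P /N addr0 subr0 mulr_natl mulr2n.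
have h3 s : 0 < s < h -> `|g3 s| <= 3 / 2 * K * s ^+ 3.
  move=> /andP[s0 sh]; apply: (ler_norm_MVT0 h0 C0 _ cg3 dg3 g4_le); last by rewrite !ltW.
  by rewrite /g3 O0; ring.
have h2 s : 0 < s < h -> `|g2 s| <= 3 / 2 * K * s ^+ 4.
  move=> /andP[s0 sh]; apply: (ler_norm_MVT0 h0 C0 _ cg2 dg2 h3); last by rewrite !ltW.
  by rewrite /g2 O0 ev /a2; field.
have h1 s : 0 < s < h -> `|g1 s| <= 3 / 2 * K * s ^+ 5.
  move=> /andP[s0 sh]; apply: (ler_norm_MVT0 h0 C0 _ cg1 dg1 h2); last by rewrite !ltW.
  by rewrite /g1 !O0; ring.
have := @ler_norm_MVT0 g0 g1 h _ 5 h0 C0 _ cg0 dg0 h1 h.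
rewrite lexx (ltW h0) => /(_ _ isT) hg.
have {}hg : `|g0 h| <= 3 / 2 * K * h ^+ 6 by apply: hg; rewrite /g0 !ev /a0; ring.
have hh : h != 0 by rewrite gt_eqF.
rewrite (_ : _ - _ = g0 h / h ^+ 2); last by rewrite /g0 /E /P /N /a2 /a0; field.
rewrite normrM normfV normrX (gtr0_norm h0) ler_pdivrMr ?exprn_gt0//.
by rewrite (_ : 3 / 2 * K * h ^+ 4 * h ^+ 2 = 3 / 2 * K * h ^+ 6); last by ring.
Qed.

End CompactScheme.
End Chains.

(** * Fourier sine means *)

Section UnitInterval.
Context {R : realType}.
Implicit Types (f g w : R -> R).
Local Notation mu := (@lebesgue_measure R).
Local Notation U := (`]0, 1[%classic : set R).

Lemma unit_itvP (x : R) : U x <-> 0 < x < 1.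
Proof. by rewrite /= in_itv. Qed.

Lemma mu_unit : mu U = 1%E.
Proof. by rewrite lebesgue_measure_itv/= lte_fin ltr01 oppr0 adde0. Qed.

Lemma Rint_unit_cst (c : R) : \int[mu]_(x in U) c = c.
Proof.
rewrite Rintegral_cst// [X in fine X](_ : _ = 1%E) ?mulr1//; exact: mu_unit.
Qed.

Lemma bounded_integrable f B : measurable_fun U f -> (forall x, 0 < x < 1 -> `|f x| <= B) ->
  mu.-integrable U (EFin \o f).
Proof.
move=> mf fB; apply: (@le_integrable _ _ _ mu U _ _ (EFin \o (fun=> `|B|))) => //.
- exact/measurable_EFinP.
- move=> x /unit_itvP xU; rewrite lee_fin normr_id; apply: (le_trans (fB x xU)); exact: ler_norm.
- apply/integrableP; split; first exact/measurable_EFinP.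
  rewrite (eq_integral (cst `|B|%:E)); last by move=> x _; rewrite /= normr_id.
  rewrite integral_cst// [X in (_ * X)%E](_ : _ = 1%E) ?mule1 ?ltry//; exact: mu_unit.
Qed.

Lemma Rint_unit_le f B : measurable_fun U f -> (forall x, 0 < x < 1 -> `|f x| <= B) ->
  `|\int[mu]_(x in U) f x| <= B.
Proof.
move=> mf fB; have i1 := bounded_integrable mf fB.
apply: (le_trans (le_normr_Rintegral _ i1)) => //.
have iB : mu.-integrable U (EFin \o (fun=> B)).
  by apply: (@bounded_integrable _ `|B|).
apply: (@le_trans _ _ (\int[mu]_(x in U) B)); last by rewrite Rint_unit_cst.
by apply: le_Rintegral => //; exact: (integrable_norm i1).
Qed.

Lemma Rint_unit_FTC f F : (forall x, is_derive x (1 : R) F (f x)) -> continuous f ->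
  \int[mu]_(x in U) f x = F 1 - F 0.
Proof.
move=> dF cf.
have cF : continuous F.
  by move=> x; apply/differentiable_continuous/derivable1_diffP; have [] := dF x.
have mf : measurable_fun U f by apply: measurable_funTS; exact: continuous_measurable_fun.
have h1 : derivable_oo_LRcontinuous F 0 1.
  split; first by move=> x _; have [] := dF x.
    by apply: cvg_at_right_filter; exact: cF.
  by apply: cvg_at_left_filter; exact: cF.
have h2 : {in `]0, 1[, derive1 F =1 f}.
  by move=> x _; rewrite derive1E; apply: @derive_val.
have h := continuous_FTC2 ltr01 (continuous_subspaceT cf) h1 h2.
rewrite /Rintegral integral_itv_obnd_cbnd; last by apply/measurable_EFinP; apply: measurable_funTS; exact: continuous_measurable_fun.
rewrite integral_itv_bndo_bndc; last by apply/measurable_EFinP; apply: measurable_funTS; exact: continuous_measurable_fun.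
by rewrite h.
Qed.

Lemma Rint_cos k : \int[mu]_(x in U) cos (k.+1%:R * pi * x) = 0.
Proof.
have k0 : k.+1%:R * pi != 0 :> R by rewrite mulf_neq0 ?pnatr_eq0// gt_eqF ?pi_gt0.
set a := k.+1%:R * pi; pose F (x : R) := a^-1 * sin (a * x).
have dF x : is_derive x (1 : R) F (cos (a * x)).
  have d1 : is_derive x (1 : R) (fun y => a * y) a.
    by have := is_deriveZ a (is_derive_id x (1 : R)); rewrite /GRing.scale/= mulr1.
  have d2 := @is_derive1_comp R sin (fun y => a * y) x _ _ (is_derive_sin _) d1.
  have := is_deriveZ a^-1 d2; rewrite /GRing.scale/= => h.
  by apply: is_derive_eq h _; rewrite mulrCA mulVf ?mulr1.
have cc : continuous (fun x : R => cos (a * x)).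
  move=> x; apply: (@continuous_comp _ _ _ (fun y => a * y) cos); last exact: continuous_cos.
  exact: mulrl_continuous.
rewrite (@Rint_unit_FTC _ F dF cc) /F mulr1 mulr0 sin0 mulr0 subr0 /a mulr_natl -[pi *+ _]add0r.
by rewrite (alternatingn (@sinDpi R)) sin0 !mulr0.
Qed.

Lemma measurable_cosM (a : R) D : measurable_fun D (fun x : R => cos (a * x)).
Proof.
apply: measurable_funTS; apply: continuous_measurable_fun => x.
by apply: (@continuous_comp _ _ _ (fun y => a * y) cos); [exact: mulrl_continuous|exact: continuous_cos].
Qed.

Lemma measurable_psi k D : measurable_fun D (@psi R k).
Proof.
apply: measurable_funTS; apply: continuous_measurable_fun => x.
apply: cvgM; first exact: cvg_cst.
by apply: (@continuous_comp _ _ _ (fun y => k%:R * pi * y) sin); [exact: mulrl_continuous|exact: continuous_sin].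
Qed.

Lemma psi_le k (x : R) : `|psi k x| <= 2.
Proof.
rewrite /psi normrM ger0_norm ?sqrtr_ge0// -[leRHS]mulr1 ler_pM ?sqrtr_ge0//; last exact: sin_max.
rewrite -(ler_pXn2r (n := 2)) ?nnegrE ?sqrtr_ge0// sqr_sqrtr//.
by rewrite expr2; lra.
Qed.

Lemma psiM j k (x : R) : psi j x * psi k x =
  cos ((j%:R - k%:R) * pi * x) - cos ((j + k)%:R * pi * x).
Proof.
have -> : (j%:R - k%:R) * pi * x = j%:R * pi * x - k%:R * pi * x by ring.
have -> : (j + k)%:R * pi * x = j%:R * pi * x + k%:R * pi * x by rewrite natrD; ring.
rewrite cosB cosD /psi; set a := sin (j%:R * _ * _); set b := sin (k%:R * _ * _).
rewrite [LHS](_ : _ = Num.sqrt 2 ^+ 2 * (a * b)); last by ring.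
by rewrite sqr_sqrtr//; ring.
Qed.

Lemma psi_psi k (x y : R) : psi k x * psi k y =
  cos (k%:R * (pi * (x - y))) - cos (k%:R * (pi * (x + y))).
Proof.
have -> : k%:R * (pi * (x - y)) = k%:R * pi * x - k%:R * pi * y by ring.
have -> : k%:R * (pi * (x + y)) = k%:R * pi * x + k%:R * pi * y by ring.
rewrite cosB cosD /psi; set a := sin (_ * x); set b := sin (_ * y).
rewrite [LHS](_ : _ = Num.sqrt 2 ^+ 2 * (a * b)); last by ring.
by rewrite sqr_sqrtr//; ring.
Qed.

Lemma cos_cos k (x y : R) : cos (k%:R * (pi * (x - y))) + cos (k%:R * (pi * (x + y))) =
  2 * (cos (k%:R * pi * x) * cos (k%:R * pi * y)).
Proof.
have -> : k%:R * (pi * (x - y)) = k%:R * pi * x - k%:R * pi * y by ring.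
have -> : k%:R * (pi * (x + y)) = k%:R * pi * x + k%:R * pi * y by ring.
by rewrite cosB cosD; ring.
Qed.

Lemma psi_orthonormal j k : (0 < j)%N -> (0 < k)%N ->
  \int[mu]_(x in U) (psi j x * psi k x) = (j == k)%:R.
Proof.
wlog jk : j k / (k <= j)%N => [hw j0 k0|j0 k0].
  have [kj|jk] := leqP k j; first exact: hw.
  rewrite eq_sym -hw ?(ltnW jk)//; apply: eq_Rintegral => x _; exact: mulrC.
have ic (a : R) : mu.-integrable U (EFin \o (fun x : R => cos (a * x))).
  apply: (@bounded_integrable _ 1) => [|x _]; [exact: measurable_cosM|exact: cos_max].
under eq_Rintegral do rewrite psiM.
rewrite RintegralB//.
have -> : (j + k = (j + k).-1.+1)%N by lia.
rewrite Rint_cos subr0.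
have [->|jk'] := eqVneq j k.
  rewrite subrr (_ : Rintegral _ _ _ = \int[mu]_(x in U) 1); first exact: Rint_unit_cst.
  by apply: eq_Rintegral => x _; rewrite !mul0r cos0.
rewrite -natrB// (_ : (j - k = (j - k).-1.+1)%N); last by move: jk'; lia.
exact: Rint_cos.
Qed.

End UnitInterval.

(** * A positive summability kernel for sine series *)

Section PositiveKernel.
Context {R : realType}.
Local Notation mu := (@lebesgue_measure R).
Local Notation U := (`]0, 1[%classic : set R).
Implicit Types (w g : R -> R) (x y : R) (n k : nat).

(* Fourier coefficients of [((1 + cos) / 2) ^+ n]. *)
Fixpoint acoef n k : R := if n is n'.+1 then
  if k is k'.+1 then (acoef n' k' + 2 * acoef n' k + acoef n' k.+1) / 4
  else (acoef n' 0 + acoef n' 1) / 2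
  else (k == 0)%:R.

Lemma acoef_ge0 n k : 0 <= acoef n k.
Proof.
by elim: n k => [|n IH] [|k] //=; rewrite divr_ge0// !addr_ge0// mulr_ge0.
Qed.

Lemma acoef_decr n k : acoef n k.+1 <= acoef n k.
Proof.
elim: n k => [|n IH] [|k] //=.
  by have := IH 0%N; have := IH 1%N; lra.
by have := IH k; have := IH k.+1; have := IH k.+2; lra.
Qed.

Lemma acoef_le0 n k : acoef n k <= acoef n 0.
Proof. by elim: k => // k IH; apply: le_trans IH; exact: acoef_decr. Qed.

Lemma acoef_eq0 n k : (n < k)%N -> acoef n k = 0.
Proof.
elim: n k => [|n IH] [|k] //= nk.
by rewrite !IH ?mulr0 ?addr0 ?mul0r//; lia.
Qed.

(** The de la Vallee Poussin kernel, [cos (pi * s / 2)] to the power [2 * n], without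
    normalization. *)
Definition pker n (s : R) : R := ((1 + cos (pi * s)) / 2) ^+ n.

Lemma pker_ge0 n s : 0 <= pker n s.
Proof. by rewrite exprn_ge0// divr_ge0//; have := cos_geN1 (pi * s); lra. Qed.

(** The number [K] of terms is free above the degree, so that it can stay fixed in the induction on
    [n]. *)
Lemma pkerE n K s : (n < K)%N ->
  pker n s = acoef n 0 + 2 * \sum_(0 <= k < K) acoef n k.+1 * cos (k.+1%:R * (pi * s)).
Proof.
elim: n K => [|n IH] K nK.
  by rewrite /pker expr0 /= big1 ?mulr0 ?addr0// => k _; rewrite mul0r.
rewrite /pker exprS -/(pker n s) (IH K); last by lia.
set th := pi * s; set S := \sum_(_ <= _ < _) _.
set S' := \sum_(_ <= _ < _) _.
suff e : (1 + cos th) / 2 * S = S' + (- acoef n 0 * cos th + acoef n 1) / 4.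
  by rewrite /= mulrDr mulrCA e; field.
rewrite /S /S' mulr_sumr -[RHS]addrC; apply/eqP; rewrite -subr_eq -sumrB; apply/eqP.
rewrite (@telescope_sumr_eq _ _ _ (fun k => (acoef n k * cos (k.+1%:R * th)
   - acoef n k.+1 * cos (k%:R * th)) / 4))//.
  rewrite (@acoef_eq0 n K)//; last by lia.
  by rewrite (@acoef_eq0 n K.+1) ?mul0r ?mul1r ?cos0; [field|lia].
move=> k _ /=.
have -> : cos (k.+2%:R * th) = cos (k.+1%:R * th) * cos th - sin (k.+1%:R * th) * sin th.
  by rewrite -[k.+2]addn1 natrD mulrDl mul1r cosD.
have -> : cos (k%:R * th) = cos (k.+1%:R * th) * cos th + sin (k.+1%:R * th) * sin th.
  by rewrite -cosB -[k.+1]addn1 natrD mulrDl mul1r addrK.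
by field.
Qed.

(** At [s = 0] the kernel equals 1, and [acoef n 0] is its largest coefficient. Normalizing the
    kernel therefore costs only a factor linear in [n]. *)
Lemma acoef0_ge n : 1 <= (2 * n.+1%:R + 1) * acoef n 0.
Proof.
have := pkerE 0 (ltnSn n); rewrite /pker mulr0 cos0 (_ : (1 + 1) / 2 = 1); last by field.
rewrite expr1n; set S := \sum_(_ <= _ < _) _ => e.
have : S <= n.+1%:R * acoef n 0.
  apply: (@le_trans _ _ (\sum_(0 <= k < n.+1) acoef n 0)); last first.
    by rewrite sumr_const_nat subn0 mulr_natl.
  by apply: ler_sum => k _; rewrite mulr0 cos0 mulr1 acoef_le0.
by rewrite mulrDl mul1r => h; lra.
Qed.

Lemma acoef0_gt0 n : 0 < acoef n 0.
Proof.
have := acoef0_ge n; rewrite lt_neqAle acoef_ge0 andbT eq_sym.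
by apply: contraTneq => ->; rewrite mulr0 -ltNge.
Qed.

Lemma pker_far n d s : 0 <= d -> d <= s <= 2 - d -> pker n s <= pker n d.
Proof.
move=> d0 /andP[ds s2].
have cosle (y : R) : d <= y <= 1 -> cos (pi * y) <= cos (pi * d).
  move=> /andP[dy y1]; have p0 := @pi_ge0 R.
  have pd : 0 <= pi * d <= pi.
    by rewrite mulr_ge0//= ler_piMr// (le_trans dy).
  have py : 0 <= pi * y <= pi.
    by rewrite mulr_ge0 ?(le_trans d0 dy)//= ler_piMr.
  by rewrite leNgt ltr_cos ?in_itv// -leNgt ler_wpM2l.
have h : cos (pi * s) <= cos (pi * d).
  have [s1|s1] := leP s 1; first by apply: cosle; rewrite ds.
  rewrite (_ : cos (pi * s) = cos (pi * (2 - s))); first by apply: cosle; lra.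
  rewrite (_ : pi * (2 - s) = - (pi * s) + pi *+ 2); last by rewrite mulr2n; ring.
  by rewrite cosD2pi cosN.
have h1 := cos_geN1 (pi * s); have h2 := cos_geN1 (pi * d).
by apply: lerXn2r; rewrite ?nnegrE; lra.
Qed.

Lemma pkerN n s : pker n (- s) = pker n s.
Proof. by rewrite /pker mulrN cosN. Qed.

(** Sine series damped by multipliers in [[0, 1]]. Unlike partial sums, these means keep sup norm
    bounds and converge at every point of continuity, while bounds on the coefficients pass through
    them term by term. The last term, [k = n.+1], is 0. *)
Definition fmean n w x : R :=
  \sum_(1 <= k < n.+2) acoef n k / acoef n 0 * L2_inner w (psi k) * psi k x.

(** Odd reflection of the kernel, which represents the sine means. The even reflection [sker] is its
    majorant of integral 1. *)
Definition dker n x y : R := (pker n (x - y) - pker n (x + y)) / (2 * acoef n 0).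
Definition sker n x y : R := (pker n (x - y) + pker n (x + y)) / (2 * acoef n 0).

Lemma dkerE n x y : dker n x y =
  \sum_(1 <= k < n.+2) acoef n k / acoef n 0 * psi k x * psi k y.
Proof.
rewrite big_add1/= /dker !(pkerE _ (ltnSn n)).
have a0 : 0 < acoef n 0 := acoef0_gt0 n.
rewrite (_ : _ - _ = 2 * \sum_(0 <= k < n.+1) acoef n k.+1 *
   (cos (k.+1%:R * (pi * (x - y))) - cos (k.+1%:R * (pi * (x + y))))); last first.
  under [in RHS]eq_bigr do rewrite mulrBr.
  by rewrite sumrB; ring.
rewrite mulr_sumr mulr_suml; apply: eq_bigr => k _.
by rewrite -[RHS]mulrA psi_psi; field; rewrite gt_eqF.
Qed.

Lemma sker_ge0 n x y : 0 <= sker n x y.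
Proof. by rewrite divr_ge0 ?addr_ge0 ?pker_ge0// mulr_ge0// acoef_ge0. Qed.

Lemma dker_le n x y : `|dker n x y| <= sker n x y.
Proof.
have d0 : 0 <= (2 * acoef n 0)^-1 by rewrite invr_ge0 mulr_ge0// acoef_ge0.
rewrite /dker /sker normrM (ger0_norm d0) ler_wpM2r//.
apply: (le_trans (ler_normB _ _)).
by rewrite !ger0_norm ?pker_ge0.
Qed.

Lemma measurable_pker n (a b : R) D : measurable_fun D (fun y => pker n (a + b * y)).
Proof.
apply: measurable_funTS; apply: continuous_measurable_fun => y.
apply: (@continuous_comp _ _ _ (fun y => (1 + cos (pi * (a + b * y))) / 2) (fun z : R => z ^+ n)); last exact: exprn_continuous.
apply: cvgM; last exact: cvg_cst.
apply: cvgD; first exact: cvg_cst.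
apply: (@continuous_comp _ _ _ (fun y => pi * (a + b * y)) cos); last exact: continuous_cos.
apply: cvgM; first exact: cvg_cst.
by apply: cvgD; [exact: cvg_cst|exact: mulrl_continuous].
Qed.

Lemma measurable_sker n x D : measurable_fun D (sker n x).
Proof.
rewrite (_ : sker n x = fun y => (pker n (x + (-1) * y) + pker n (x + 1 * y)) * (2 * acoef n 0)^-1); last first.
  by apply/funext => y; rewrite mulN1r mul1r.
by apply: measurable_funM => //; apply: measurable_funD; exact: measurable_pker.
Qed.

Lemma pker_le1 n s : pker n s <= 1.
Proof.
have h1 := cos_geN1 (pi * s); have h2 := cos_le1 (pi * s).
by apply: exprn_ile1; lra.
Qed.

Lemma sker_le n x y : `|sker n x y| <= (acoef n 0)^-1.
Proof.
rewrite ger0_norm ?sker_ge0// /sker ler_pdivrMr ?mulr_gt0 ?acoef0_gt0//.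
rewrite mulrCA mulVf ?gt_eqF ?acoef0_gt0// mulr1.
by have := pker_le1 n (x - y); have := pker_le1 n (x + y); lra.
Qed.

Lemma integrable_sker n x : mu.-integrable U (EFin \o sker n x).
Proof.
apply: (@bounded_integrable _ _ (acoef n 0)^-1); first exact: measurable_sker.
by move=> y _; exact: sker_le.
Qed.

Lemma Rint_sker n x : \int[mu]_(y in U) sker n x y = 1.
Proof.
have a0 : 0 < acoef n 0 := acoef0_gt0 n.
have ic (a : R) : mu.-integrable U (EFin \o (fun x : R => cos (a * x))).
  apply: (@bounded_integrable _ _ 1) => [|z _]; [exact: measurable_cosM|exact: cos_max].
pose S m y := \sum_(0 <= k < m) 2 * acoef n k.+1 / acoef n 0 * cos (k.+1%:R * pi * x) * cos (k.+1%:R * pi * y).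
have e : sker n x = fun y => 1 + S n.+1 y.
  apply/funext => y; rewrite /sker !(pkerE _ (ltnSn n)).
  rewrite [X in X / _](_ : _ = 2 * acoef n 0 + 2 * \sum_(0 <= k < n.+1) acoef n k.+1 *
    (cos (k.+1%:R * (pi * (x - y))) + cos (k.+1%:R * (pi * (x + y))))); last first.
    under [in RHS]eq_bigr do rewrite mulrDr.
    by rewrite big_split/=; ring.
  rewrite mulrDl mulfV ?mulf_neq0 ?gt_eqF//; congr (_ + _).
  rewrite mulr_sumr mulr_suml; apply: eq_bigr => k _.
  by rewrite cos_cos; field; rewrite gt_eqF.
have main m : mu.-integrable U (EFin \o S m) /\ \int[mu]_(y in U) S m y = 0.
  elim: m => [|m [im hm]].
    have -> : S 0 = fun=> 0 by apply/funext => y; rewrite /S big_geq.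
    by split; [apply: (@bounded_integrable _ _ 0) => // y _; rewrite normr0|exact: Rint_unit_cst].
  pose c := 2 * acoef n m.+1 / acoef n 0 * cos (m.+1%:R * pi * x).
  have -> : S m.+1 = fun y => S m y + c * cos (m.+1%:R * pi * y).
    by apply/funext => y; rewrite /S big_nat_recr.
  have i2 : mu.-integrable U (EFin \o (fun y => c * cos (m.+1%:R * pi * y))).
    by apply: eq_integrable (integrableZl _ c (ic (m.+1%:R * pi))) => // y _; rewrite /= EFinM.
  split; first by apply: eq_integrable (integrableD _ im i2).
  by rewrite RintegralD// hm RintegralZl ?ic// Rint_cos mulr0 addr0.
have [iS hS] := main n.+1.
rewrite e RintegralD//; last by apply: (@bounded_integrable _ _ 1) => // y _; rewrite normr1.
by rewrite hS Rint_unit_cst addr0.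
Qed.

End PositiveKernel.

(** * Bounds and pointwise convergence of the sine means *)

Section FourierMeans.
Context {R : realType}.
Local Notation mu := (@lebesgue_measure R).
Local Notation U := (`]0, 1[%classic : set R).
Implicit Types (w g : R -> R) (x y : R) (n k : nat).

Lemma fmeanE n w x : measurable_fun U w -> mu.-integrable U (EFin \o w) ->
  mu.-integrable U (EFin \o (fun y => dker n x y * w y)) /\
  fmean n w x = \int[mu]_(y in U) (dker n x y * w y).
Proof.
move=> mw iw.
have ip k : mu.-integrable U (EFin \o (fun y => w y * psi k y)).
  apply: (@le_integrable _ _ _ mu U _ _ (EFin \o (fun y => 2 * w y))) => //.
  - by apply/measurable_EFinP; apply: measurable_funM => //; exact: measurable_psi.
  - move=> y _; rewrite lee_fin [`|w y * _|]normrM [`|2 * _|]normrM [`|2|]ger0_norm// mulrC; apply: ler_wpM2r => //; exact: psi_le.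
  - by apply: eq_integrable (integrableZl _ 2 iw) => // y _; rewrite /= EFinM.
pose c k := acoef n k / acoef n 0 * psi k x.
pose S m y := \sum_(1 <= k < m.+1) c k * (w y * psi k y).
have main m : mu.-integrable U (EFin \o S m) /\
   \int[mu]_(y in U) S m y = \sum_(1 <= k < m.+1) c k * L2_inner w (psi k).
  elim: m => [|m [im hm]].
    have -> : S 0%N = fun=> 0 by apply/funext => y; rewrite /S big_geq.
    rewrite big_geq//; split; last exact: Rint_unit_cst.
    by apply: (@bounded_integrable _ _ 0) => // y _; rewrite normr0.
  have -> : S m.+1 = fun y => S m y + c m.+1 * (w y * psi m.+1 y).
    by apply/funext => y; rewrite /S big_nat_recr.
  have i2 : mu.-integrable U (EFin \o (fun y => c m.+1 * (w y * psi m.+1 y))).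
    by apply: eq_integrable (integrableZl _ (c m.+1) (ip m.+1)) => // y _; rewrite /= EFinM.
  split; first by apply: eq_integrable (integrableD _ im i2).
  by rewrite RintegralD// hm RintegralZl ?ip// [RHS]big_nat_recr.
have [iS hS] := main n.+1.
have e : (fun y => dker n x y * w y) = S n.+1.
  apply/funext => y; rewrite dkerE /S mulr_suml; apply: eq_bigr => k _.
  by rewrite /c; ring.
rewrite e; split => //; rewrite hS; apply: eq_bigr => k _; rewrite /c; ring.
Qed.

Lemma fmean_le n w x B : measurable_fun U w -> 0 <= B ->
  (forall y, 0 < y < 1 -> `|w y| <= B) -> `|fmean n w x| <= B.
Proof.
move=> mw B0 wB; have iw := bounded_integrable mw wB.
have [i1 ->] := fmeanE n x mw iw.
apply: (le_trans (le_normr_Rintegral _ i1)) => //.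
have is_ := integrable_sker n x.
have iB : mu.-integrable U (EFin \o (fun y => B * sker n x y)).
  by apply: eq_integrable (integrableZl _ B is_) => // y _; rewrite /= EFinM.
apply: (@le_trans _ _ (\int[mu]_(y in U) (B * sker n x y))).
  apply: le_Rintegral => //; first exact: (integrable_norm i1).
  move=> y /unit_itvP yU; rewrite normrM mulrC; apply: ler_pM => //; first exact: wB.
  exact: dker_le.
by rewrite RintegralZl// Rint_sker mulr1.
Qed.

(** Half of the geometric decay is spent on absorbing the linear factor from the normalization of
    the kernel. *)
Lemma pker_lin_le (rho : R) n : 0 <= rho -> rho < 1 ->
  (2 * n.+1%:R + 1) * (rho ^+ 2) ^+ n <= (2 / (1 - rho) + 3) * rho ^+ n.
Proof.
move=> r0 r1; rewrite -exprM mulnC exprM expr2 mulrA.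
apply: ler_wpM2r; first exact: exprn_ge0.
have h : (1 - rho) * (n%:R * rho ^+ n) <= 1.
  have e : 1 - rho ^+ n = (1 - rho) * \sum_(i < n) rho ^+ i by rewrite -opprB subrX1 -mulNr opprB.
  have s : n%:R * rho ^+ n <= \sum_(i < n) rho ^+ i.
    rewrite mulr_natl -[X in _ *+ X]card_ord -sumr_const; apply: ler_sum => i _.
    by apply: ler_wiXn2l => //; [exact: ltW|exact: ltnW].
  apply: (@le_trans _ _ (1 - rho ^+ n)); last by rewrite lerBlDr lerDl exprn_ge0.
  by rewrite e ler_wpM2l// subr_ge0 ltW.
have q0 : 0 < 1 - rho by rewrite subr_gt0.
have h2 : n%:R * rho ^+ n <= (1 - rho)^-1 by rewrite -div1r ler_pdivlMr// mulrC.
have h3 : rho ^+ n <= 1 by apply: exprn_ile1 => //; exact: ltW.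
rewrite -[n.+1%:R]natr1; have -> : (2 * (n%:R + 1) + 1) * rho ^+ n = 2 * (n%:R * rho ^+ n) + 3 * rho ^+ n by ring.
lra.
Qed.

(** Near [x], continuity is played against the unit mass of [sker]; at distance [d] and more the
    kernel is at most [r^n], which beats the normalization. The reflected argument [x + y] is always
    far from the peaks, since [d <= x] and [d <= 1 - x]. *)
Lemma fmean_cvg w x B : measurable_fun U w -> 0 < x < 1 ->
  (forall y, 0 < y < 1 -> `|w y| <= B) ->
  (forall e, 0 < e -> exists2 d, 0 < d & forall y, 0 < y < 1 -> `|y - x| < d -> `|w y - w x| <= e) ->
  fmean n w x @[n --> \oo] --> w x.
Proof.
move=> mw /andP[x0 x1] wB cw.
have xU : 0 < x < 1 by rewrite x0.
have B0 : 0 <= B by apply: le_trans (wB x xU).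
have iw := bounded_integrable mw wB.
apply/cvgrPdist_le => e e0; have e20 : 0 < e / 2 by rewrite divr_gt0.
have [d1 d10 hd1] := cw _ e20.
pose d := Num.min d1 (Num.min x (1 - x)).
have d0 : 0 < d by rewrite !lt_min d10 x0 subr_gt0.
have dd1 : d <= d1 by rewrite ge_min lexx.
have dx : d <= x by rewrite !ge_min lexx orbT.
have dx1 : d <= 1 - x by rewrite !ge_min lexx !orbT.
pose r := (1 + cos (pi * d)) / 2.
have r0 : 0 <= r by rewrite /r; have := cos_geN1 (pi * d); lra.
have r1 : r < 1.
  have : cos (pi * d) < cos 0.
    have dl1 : d <= 1 by lra.
    have pd : 0 <= pi * d <= pi by rewrite mulr_ge0 ?pi_ge0 ?(ltW d0)//= ler_piMr ?pi_ge0.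
    rewrite ltr_cos ?in_itv//= ?lexx ?pi_ge0//.
    by rewrite mulr_gt0 ?pi_gt0.
  by rewrite cos0 /r; lra.
pose rho := Num.sqrt r.
have rho2 : rho ^+ 2 = r by rewrite sqr_sqrtr.
have rho0 : 0 <= rho by exact: sqrtr_ge0.
have rho1 : rho < 1.
  by rewrite -(ltr_pXn2r (n := 2)) ?nnegrE// rho2 expr1n.
have est n : `|w x - fmean n w x| <= e / 2 + 2 * B * ((2 / (1 - rho) + 3) * rho ^+ n).
  have [i1 ->] := fmeanE n x mw iw.
  have a0 := @acoef0_gt0 R n.
  have is_ := integrable_sker n x.
  have iZ (c : R) : mu.-integrable U (EFin \o (fun y => c * sker n x y)).
    by apply: eq_integrable (integrableZl _ c is_) => // y _; rewrite /= EFinM.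
  have -> : w x = \int[mu]_(y in U) (w x * sker n x y) by rewrite RintegralZl// Rint_sker mulr1.
  rewrite -RintegralB//.
  have i2 : mu.-integrable U (EFin \o (fun y => w x * sker n x y - dker n x y * w y)).
    by apply: eq_integrable (integrableB _ (iZ (w x)) i1).
  apply: (le_trans (le_normr_Rintegral _ i2)) => //.
  pose E := 2 * B * (r ^+ n / acoef n 0).
  have iE : mu.-integrable U (EFin \o (fun y => e / 2 * sker n x y + E)).
    apply: eq_integrable (integrableD _ (iZ (e / 2)) (_ : mu.-integrable U (EFin \o (fun=> E)))) => //.
    by apply: (@bounded_integrable _ _ `|E|).
  apply: (@le_trans _ _ (\int[mu]_(y in U) (e / 2 * sker n x y + E))); last first.
    rewrite RintegralD//; last by apply: (@bounded_integrable _ _ `|E|).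
    rewrite RintegralZl// Rint_sker mulr1 Rint_unit_cst lerD2l /E ler_wpM2l ?mulr_ge0//.
    apply: (@le_trans _ _ ((2 * n.+1%:R + 1) * r ^+ n)); last first.
      by rewrite -rho2; exact: pker_lin_le.
    rewrite ler_pdivrMr// [leRHS]mulrAC -[leLHS]mul1r ler_wpM2r ?exprn_ge0//.
    exact: acoef0_ge.
  apply: le_Rintegral => //; first exact: (integrable_norm i2).
  move=> y /unit_itvP yU; have /andP[y0 y1] := yU.
  have c0 : 0 < 2 * acoef n 0 :> R by rewrite mulr_gt0.
  rewrite /sker /dker (_ : _ - _ = (pker n (x - y) * (w x - w y) + pker n (x + y) * (w x + w y)) / (2 * acoef n 0)); last by field; rewrite gt_eqF.
  rewrite normrM [`|_^-1|]gtr0_norm ?invr_gt0// ler_pdivrMr//.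
  rewrite [leRHS](_ : _ = e / 2 * (pker n (x - y) + pker n (x + y)) + 4 * B * r ^+ n); last first.
    by rewrite /E; field; rewrite gt_eqF.
  have p1 := pker_ge0 n (x - y); have p2 := pker_ge0 n (x + y).
  have rn0 : 0 <= r ^+ n by exact: exprn_ge0.
  have f2 : pker n (x + y) <= r ^+ n by apply: pker_far; [exact: ltW|apply/andP; split; lra].
  have wx := wB x xU; have wy := wB y yU.
  have t2 : `|pker n (x + y) * (w x + w y)| <= r ^+ n * (2 * B).
    rewrite normrM (ger0_norm p2); apply: ler_pM => //.
    by apply: (le_trans (ler_normD _ _)); lra.
  have t1 : `|pker n (x - y) * (w x - w y)| <= e / 2 * pker n (x - y) + r ^+ n * (2 * B).
    rewrite normrM (ger0_norm p1).
    have [near|far] := ltP `|y - x| d.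
      have h := hd1 y yU (lt_le_trans near dd1); rewrite distrC in h.
      have : pker n (x - y) * `|w x - w y| <= pker n (x - y) * (e / 2) by rewrite ler_wpM2l.
      have : 0 <= r ^+ n * (2 * B) by rewrite mulr_ge0// mulr_ge0.
      by lra.
    have f1 : pker n (x - y) <= r ^+ n.
      have -> : pker n (x - y) = pker n `|y - x|.
        by have [h|h] := leP 0 (y - x); [rewrite ger0_norm// -pkerN opprB|rewrite ltr0_norm// opprB].
      apply: pker_far; first exact: ltW.
      by rewrite far/=; rewrite ler_norml in far *; apply/andP; split; lra.
    have : pker n (x - y) * `|w x - w y| <= r ^+ n * (2 * B).
      by apply: ler_pM => //; apply: (le_trans (ler_normB _ _)); lra.
    have : 0 <= e / 2 * pker n (x - y) by rewrite mulr_ge0// ltW.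
    by lra.
  apply: (le_trans (ler_normD _ _)).
  have : 0 <= e / 2 * pker n (x + y) by rewrite mulr_ge0// ltW.
  by move: t1 t2; lra.
have cv : (2 * B * ((2 / (1 - rho) + 3) * rho ^+ n)) @[n --> \oo] --> (0 : R).
  rewrite -[X in _ --> X](mulr0 (2 * B)); apply: cvgM; first exact: cvg_cst.
  rewrite -[X in _ --> X](mulr0 (2 / (1 - rho) + 3)); apply: cvgM; first exact: cvg_cst.
  by apply: cvg_expr; rewrite ger0_norm.
move/cvgrPdist_le : cv => /(_ _ e20) cv.
near=> n; apply: (le_trans (est n)).
have : `|0 - 2 * B * ((2 / (1 - rho) + 3) * rho ^+ n)| <= e / 2 by near: n; exact: cv.
rewrite sub0r normrN => /(le_trans (ler_norm _)); lra.
Unshelve. all: by end_near.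
Qed.

End FourierMeans.

(** * Integral bounds obtained from Fourier coefficients *)

Section L1Bound.
Context {R : realType}.
Local Notation mu := (@lebesgue_measure R).
Local Notation U := (`]0, 1[%classic : set R).
Implicit Types (f g w : R -> R) (x y : R) (n k : nat).

Definition bounded_mfun w := measurable_fun U w /\ exists B, forall x, 0 < x < 1 -> `|w x| <= B.

Lemma bounded_mfun_integrable w : bounded_mfun w -> mu.-integrable U (EFin \o w).
Proof. by move=> [mw [B wB]]; exact: bounded_integrable wB. Qed.

Lemma bounded_mfunD f g : bounded_mfun f -> bounded_mfun g -> bounded_mfun (fun x => f x + g x).
Proof.
move=> [mf [B fB]] [mg [B' gB]]; split; first exact: measurable_funD.
by exists (B + B') => x xU; apply: (le_trans (ler_normD _ _)); apply: lerD; [exact: fB|exact: gB].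
Qed.

Lemma bounded_mfunM f g : bounded_mfun f -> bounded_mfun g -> bounded_mfun (fun x => f x * g x).
Proof.
move=> [mf [B fB]] [mg [B' gB]]; split; first exact: measurable_funM.
by exists (B * B') => x xU; rewrite normrM; apply: ler_pM; rewrite ?fB ?gB.
Qed.

Lemma bounded_mfun_cst c : bounded_mfun (fun=> c).
Proof. by split => //; exists `|c|. Qed.

Lemma bounded_mfun_psi k : bounded_mfun (psi k).
Proof. by split; [exact: measurable_psi|exists 2 => x _; exact: psi_le]. Qed.

Lemma bounded_mfun_sum (F : nat -> R -> R) (m n : nat) : (forall k, bounded_mfun (F k)) ->
  bounded_mfun (fun x => \sum_(m <= k < n) F k x).
Proof.
move=> bF; elim: n => [|n IH].
  rewrite (_ : (fun _ => _) = fun=> 0); first exact: bounded_mfun_cst.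
  by apply/funext => x; rewrite big_geq.
have [mn|nm] := leqP m n.
  rewrite (_ : (fun _ => _) = fun x => \sum_(m <= k < n) F k x + F n x); first exact: bounded_mfunD.
  by apply/funext => x; rewrite big_nat_recr.
rewrite (_ : (fun _ => _) = fun=> 0); first exact: bounded_mfun_cst.
by apply/funext => x; rewrite big_geq.
Qed.

Lemma bessel w B n : measurable_fun U w -> 0 <= B -> (forall x, 0 < x < 1 -> `|w x| <= B) ->
  \sum_(1 <= k < n.+1) L2_inner w (psi k) ^+ 2 <= B ^+ 2.
Proof.
move=> mw B0 wB; have bw : bounded_mfun w by split; last by exists B.
pose c k := L2_inner w (psi k).
pose S m x := \sum_(1 <= k < m.+1) c k * psi k x.
have bS m : bounded_mfun (S m).
  apply: bounded_mfun_sum => k; apply: bounded_mfunM; first exact: bounded_mfun_cst.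
  exact: bounded_mfun_psi.
pose E m x := w x - S m x.
have bE m : bounded_mfun (E m).
  rewrite (_ : E m = fun x => w x + (-1) * S m x); last by apply/funext => x; rewrite mulN1r.
  by apply: bounded_mfunD => //; apply: bounded_mfunM => //; exact: bounded_mfun_cst.
have SpsiE m j : (m < j)%N -> \int[mu]_(x in U) (S m x * psi j x) = 0.
  elim: m => [|m IH] mj.
    rewrite (_ : Rintegral _ _ _ = \int[mu]_(x in U) 0); first exact: Rint_unit_cst.
    by apply: eq_Rintegral => x _; rewrite /S big_geq// mul0r.
  rewrite (_ : Rintegral _ _ _ = \int[mu]_(x in U) (S m x * psi j x + c m.+1 * (psi m.+1 x * psi j x))); last first.
    by apply: eq_Rintegral => x _; rewrite /S big_nat_recr//= mulrDl mulrA.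
  rewrite RintegralD//; last 2 first.
  - by apply: bounded_mfun_integrable; apply: bounded_mfunM => //; exact: bounded_mfun_psi.
  - apply: bounded_mfun_integrable; apply: bounded_mfunM; first exact: bounded_mfun_cst.
    by apply: bounded_mfunM; exact: bounded_mfun_psi.
  rewrite IH; last exact: ltnW.
  rewrite add0r RintegralZl//; last first.
    by apply: bounded_mfun_integrable; apply: bounded_mfunM; exact: bounded_mfun_psi.
  by rewrite psi_orthonormal ?(ltn_trans _ mj)// ltn_eqF// mulr0.
have main m : \int[mu]_(x in U) (E m x ^+ 2) = \int[mu]_(x in U) (w x ^+ 2) - \sum_(1 <= k < m.+1) c k ^+ 2.
  elim: m => [|m IH].
    rewrite big_geq// subr0; apply: eq_Rintegral => x _.
    by rewrite /E /S big_geq// subr0.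
  rewrite big_nat_recr//= opprD addrA -IH.
  have i1 : mu.-integrable U (EFin \o (fun x => E m x ^+ 2)).
    apply: bounded_mfun_integrable; rewrite (_ : (fun _ => _) = fun x => E m x * E m x).
      exact: bounded_mfunM.
    by apply/funext => x; rewrite expr2.
  have iw : mu.-integrable U (EFin \o (fun x => w x * psi m.+1 x)).
    by apply: bounded_mfun_integrable; apply: bounded_mfunM => //; exact: bounded_mfun_psi.
  have iS : mu.-integrable U (EFin \o (fun x => S m x * psi m.+1 x)).
    by apply: bounded_mfun_integrable; apply: bounded_mfunM => //; exact: bounded_mfun_psi.
  have ip : mu.-integrable U (EFin \o (fun x => psi m.+1 x * psi m.+1 x)).
    by apply: bounded_mfun_integrable; apply: bounded_mfunM; exact: bounded_mfun_psi.
  have Z (q : R) (f : R -> R) : mu.-integrable U (EFin \o f) -> mu.-integrable U (EFin \o (fun x => q * f x)).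
    by move=> hf; apply: eq_integrable (integrableZl _ q hf) => // x _; rewrite /= EFinM.
  pose d := c m.+1.
  rewrite (_ : Rintegral _ _ _ = \int[mu]_(x in U) (E m x ^+ 2 + ((- 2 * d) * (w x * psi m.+1 x) +
     ((2 * d) * (S m x * psi m.+1 x) + d ^+ 2 * (psi m.+1 x * psi m.+1 x))))); last first.
    by apply: eq_Rintegral => x _; rewrite /E /S big_nat_recr//= -/(S m x) -/d; ring.
  have j3 := Z (d ^+ 2) _ ip; have j2 := Z (2 * d) _ iS; have j1 := Z (- 2 * d) _ iw.
  have j23 : mu.-integrable U (EFin \o (fun x => (2 * d) * (S m x * psi m.+1 x) + d ^+ 2 * (psi m.+1 x * psi m.+1 x))).
    by apply: eq_integrable (integrableD _ j2 j3).
  have j123 : mu.-integrable U (EFin \o (fun x => (- 2 * d) * (w x * psi m.+1 x) +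
     ((2 * d) * (S m x * psi m.+1 x) + d ^+ 2 * (psi m.+1 x * psi m.+1 x)))).
    by apply: eq_integrable (integrableD _ j1 j23).
  rewrite RintegralD// RintegralD// RintegralD// !RintegralZl// SpsiE// psi_orthonormal// eqxx.
  have -> : \int[mu]_(x in U) (w x * psi m.+1 x) = d by [].
  by rewrite (_ : true%:R = 1 :> R)// -/d; ring.
have E0 : 0 <= \int[mu]_(x in U) (E n x ^+ 2) by apply: Rintegral_ge0 => x _; exact: sqr_ge0.
rewrite main subr_ge0 in E0; apply: (le_trans E0).
apply: (le_trans (ler_norm _)); apply: Rint_unit_le; first exact: measurable_funX.
move=> x xU; rewrite normrX lerXn2r ?nnegrE//; exact: wB.
Qed.

Lemma in_L2_integrable g : in_L2 g -> mu.-integrable U (EFin \o g).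
Proof.
move=> [mg ig]; have i1 : mu.-integrable U (EFin \o (fun x => 1 + g x ^+ 2)).
  by apply: eq_integrable (integrableD _ (bounded_mfun_integrable (bounded_mfun_cst 1)) ig).
apply: le_integrable i1 => //; first exact/measurable_EFinP.
move=> x _; rewrite lee_fin [leRHS]ger0_norm ?addr_ge0 ?sqr_ge0//.
have := sqr_ge0 (`|g x| - 1); rewrite -[g x ^+ 2]real_normK ?num_real//.
by have := sqr_ge0 `|g x|; lra.
Qed.

Lemma integrableM_bounded f w : mu.-integrable U (EFin \o f) -> bounded_mfun w ->
  mu.-integrable U (EFin \o (fun x => f x * w x)).
Proof.
move=> If [mw [B wB]].
have iB : mu.-integrable U (EFin \o (fun x => B * f x)).
  by apply: eq_integrable (integrableZl _ B If) => // x _; rewrite /= EFinM.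
apply: le_integrable iB => //.
  by apply/measurable_EFinP; apply: measurable_funM => //; apply/measurable_EFinP; case/integrableP: If.
move=> x /unit_itvP xU; rewrite lee_fin !normrM mulrC ler_wpM2r//.
by apply: (le_trans (wB x xU)); exact: ler_norm.
Qed.

Lemma fmean_pairing g w n : mu.-integrable U (EFin \o g) ->
  \int[mu]_(x in U) (g x * fmean n w x) =
  \sum_(1 <= k < n.+2) acoef n k / acoef n 0 * L2_inner w (psi k) * L2_inner g (psi k).
Proof.
move=> ig; pose c k := acoef n k / acoef n 0 * L2_inner w (psi k).
have ip k := integrableM_bounded ig (bounded_mfun_psi k).
have main m : mu.-integrable U (EFin \o (fun x => g x * \sum_(1 <= k < m.+1) c k * psi k x)) /\
   \int[mu]_(x in U) (g x * \sum_(1 <= k < m.+1) c k * psi k x) = \sum_(1 <= k < m.+1) c k * L2_inner g (psi k).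
  elim: m => [|m [im hm]].
    have -> : (fun x => g x * \sum_(1 <= k < 1) c k * psi k x) = fun=> 0.
      by apply/funext => y; rewrite big_geq// mulr0.
    rewrite big_geq//; split; last exact: Rint_unit_cst.
    exact: bounded_mfun_integrable (bounded_mfun_cst 0).
  have -> : (fun x => g x * \sum_(1 <= k < m.+2) c k * psi k x) =
     (fun x => g x * (\sum_(1 <= k < m.+1) c k * psi k x) + c m.+1 * (g x * psi m.+1 x)).
    by apply/funext => y; rewrite big_nat_recr//=; ring.
  have i2 : mu.-integrable U (EFin \o (fun y => c m.+1 * (g y * psi m.+1 y))).
    by apply: eq_integrable (integrableZl _ (c m.+1) (ip m.+1)) => // y _; rewrite /= EFinM.
  split; first by apply: eq_integrable (integrableD _ im i2).
  by rewrite RintegralD// hm RintegralZl ?ip// [RHS]big_nat_recr.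
exact: (main n.+1).2.
Qed.

(** The multipliers lie in [[0, 1]], so Young's inequality for each coefficient separates [w],
    handled by Bessel's inequality, from [g]. The weights [B / 2] and [1 / (2 * B)] make the two
    halves add up to [B]. *)
Lemma fmean_pairing_le g w n B : 0 < B -> mu.-integrable U (EFin \o g) -> measurable_fun U w ->
  (forall x, 0 < x < 1 -> `|w x| <= 1) ->
  (forall n, \sum_(1 <= k < n.+1) L2_inner g (psi k) ^+ 2 <= B ^+ 2) ->
  `|\int[mu]_(x in U) (g x * fmean n w x)| <= B.
Proof.
move=> B0 ig mw w1 gB; rewrite fmean_pairing//.
apply: (le_trans (ler_norm_sum _ _ _)).
apply: (@le_trans _ _ (\sum_(1 <= k < n.+2) (B / 2 * L2_inner w (psi k) ^+ 2 + (2 * B)^-1 * L2_inner g (psi k) ^+ 2))).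
  apply: ler_sum => k _; set p := L2_inner w _; set q := L2_inner g _.
  have r01 : 0 <= (acoef n k / acoef n 0 : R) <= 1.
    rewrite divr_ge0 ?acoef_ge0//= ler_pdivrMr ?acoef0_gt0// mul1r; exact: acoef_le0.
  set r := _ / _ in r01 *; case/andP: r01 => r0 r1.
  rewrite -mulrA normrM (ger0_norm r0); apply: (@le_trans _ _ `|p * q|); first by rewrite ler_piMl.
  rewrite normrM -[p ^+ 2]real_normK ?num_real// -[q ^+ 2]real_normK ?num_real//.
  have := sqr_ge0 (B * `|p| - `|q|) => h.
  rewrite -(ler_pM2l (_ : 0 < 2 * B)) ?mulr_gt0//.
  rewrite (_ : 2 * B * (_ + _) = B ^+ 2 * `|p| ^+ 2 + `|q| ^+ 2); last by field; rewrite gt_eqF.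
  by rewrite -subr_ge0; apply: le_trans h _; rewrite le_eqVlt; apply/orP; left; apply/eqP; ring.
rewrite big_split/= -!mulr_sumr.
have h1 : \sum_(1 <= k < n.+2) L2_inner w (psi k) ^+ 2 <= 1 by rewrite -[leRHS](expr1n _ 2); exact: bessel.
have h2 := gB n.+1.
have h3 : B / 2 * \sum_(1 <= k < n.+2) L2_inner w (psi k) ^+ 2 <= B / 2.
  by rewrite -[leRHS]mulr1 ler_wpM2l// divr_ge0// ltW.
have h4 : (2 * B)^-1 * \sum_(1 <= k < n.+2) L2_inner g (psi k) ^+ 2 <= B / 2.
  apply: (@le_trans _ _ ((2 * B)^-1 * B ^+ 2)).
    by rewrite ler_wpM2l// invr_ge0 mulr_ge0// ltW.
  by rewrite le_eqVlt; apply/orP; left; apply/eqP; field; rewrite gt_eqF.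
by apply: (le_trans (lerD h3 h4)); rewrite -splitr.
Qed.

Lemma measurable_fmean n w D : measurable_fun D (fmean n w).
Proof.
rewrite (_ : fmean n w = fun x => \sum_(1 <= k < n.+2) (acoef n k / acoef n 0 * L2_inner w (psi k)) * psi k x)//.
by apply: measurable_sum => k; apply: measurable_funM => //; exact: measurable_psi.
Qed.

Lemma L2_pairing_le g w B : 0 < B -> mu.-integrable U (EFin \o g) -> continuous w ->
  (forall x, `|w x| <= 1) ->
  (forall n, \sum_(1 <= k < n.+1) L2_inner g (psi k) ^+ 2 <= B ^+ 2) ->
  `|\int[mu]_(x in U) (g x * w x)| <= B.
Proof.
move=> B0 ig cw w1 gB.
have mw : measurable_fun U w by apply: measurable_funTS; exact: continuous_measurable_fun.
have mg : measurable_fun U g by apply/measurable_EFinP; case/integrableP: ig.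
have mU : measurable U by exact: measurable_itv.
have fw x : 0 < x < 1 -> fmean n w x @[n --> \oo] --> w x.
  move=> xU; apply: (@fmean_cvg _ _ _ 1) => // e e0.
  have /cvgrPdist_le := cw x; move=> /(_ e e0) [d /= d0 hd].
  by exists d => // y _ yd; rewrite distrC; apply: hd; rewrite /= distrC.
have fw1 n x : `|fmean n w x| <= 1 by apply: fmean_le.
have [|||||i1 _ cv] := @dominated_convergence _ _ _ mu U mU (fun n => EFin \o (fun x => g x * fmean n w x))
   (EFin \o (fun x => g x * w x)) (EFin \o (fun x => `|g x|)).
- move=> n; apply/measurable_EFinP; apply: measurable_funM => //; exact: measurable_fmean.
- by apply/measurable_EFinP; exact: measurable_funM.
- apply/aeW => x /unit_itvP xU; apply: cvg_EFin; first exact: nearW.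
  by apply: cvgM; [exact: cvg_cst|exact: fw].
- exact: integrable_norm.
- by apply/aeW => x n _; rewrite lee_fin normrM ler_piMr.
have cv' : \int[mu]_(x in U) (g x * fmean n w x) @[n --> \oo] --> \int[mu]_(x in U) (g x * w x).
  by apply: fine_cvg; rewrite /Rintegral fineK ?integrable_fin_num.
have bd n := fmean_pairing_le n B0 ig mw (fun x _ => w1 x) gB.
rewrite ler_norml; apply/andP; split.
  apply: (ler_cvg_to (@cvg_cst _ _ _ _ _) cv'); apply: nearW => n.
  by have := bd n; rewrite ler_norml => /andP[].
apply: (ler_cvg_to cv' (@cvg_cst _ _ _ _ _)); apply: nearW => n.
by have := bd n; rewrite ler_norml => /andP[].
Qed.

(* Testing against continuous approximations of the sign of [g]. *)
Lemma L1_le_coefs g B : in_L2 g -> 0 < B ->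
  (forall n, \sum_(1 <= k < n.+1) L2_inner g (psi k) ^+ 2 <= B ^+ 2) ->
  \int[mu]_(x in U) `|g x| <= B.
Proof.
move=> gL2 B0 gB; have ig := in_L2_integrable gL2.
have mU : measurable U by exact: measurable_itv.
have muU : (mu U < +oo)%E by rewrite (_ : mu U = 1%E) ?ltry//; exact: mu_unit.
have [ga [cga iga gag]] := @approximation_continuous_integrable R U g mU muU ig.
have key (e : R) : 0 < e -> \int[mu]_(x in U) `|g x| <= B + 3 * e.
  move=> e0.
  have [n hn] : exists n, (\int[mu]_(x in U) `|(g x - ga n x)%:E| < e%:E)%E.
    have /fine_cvgP[_ /cvgrPdist_lt /(_ _ e0)[n _ hn]] := gag.
    exists n; have := hn n (leqnn n); rewrite /= sub0r normrN.
    have id : mu.-integrable U (EFin \o (fun x => g x - ga n x)).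
      by apply: eq_integrable (integrableB _ ig (iga n)).
    move=> h; have fi : (\int[mu]_(x in U) `|(g x - ga n x)%:E|)%E \is a fin_num.
      by rewrite ge0_fin_numE ?integral_ge0//; case/integrableP: id.
    by rewrite -(fineK fi) lte_fin; apply: le_lt_trans h; exact: ler_norm.
  set gam := ga n in hn; have cgam := cga n.
  have igam : mu.-integrable U (EFin \o gam) := iga n.
  have id : mu.-integrable U (EFin \o (fun x => g x - gam x)).
    by apply: eq_integrable (integrableB _ ig igam).
  have hn' : \int[mu]_(x in U) `|g x - gam x| <= e.
    rewrite -lee_fin /Rintegral fineK; first exact: ltW.
    by apply: integrable_fin_num => //; exact: integrable_norm id.
  (* A continuous substitute for the sign of [gam]: it is at most 1 in absolute value, and
     [gam * w >= |gam| - e]. *)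
  pose w x := gam x / (`|gam x| + e).
  have den x : 0 < `|gam x| + e by rewrite ltr_wpDl.
  have w1 x : `|w x| <= 1.
    by rewrite normrM normfV [`|_ + e|]gtr0_norm// ler_pdivrMr// mul1r lerDl ltW.
  have cw : continuous w.
    move=> x; apply: cvgM; first exact: cgam.
    apply: cvgV; first by rewrite gt_eqF.
    by apply: cvgD; [apply: cvg_norm; exact: cgam|exact: cvg_cst].
  have := @L2_pairing_le g w B B0 ig cw w1 gB; rewrite ler_norml => /andP[_ h].
  have bw : bounded_mfun w.
    split; last by exists 1 => x _; exact: w1.
    by apply: measurable_funTS; exact: continuous_measurable_fun.
  have igw := integrableM_bounded ig bw.
  have in1 := integrable_norm id; have ing := integrable_norm ig.
  have i3 : mu.-integrable U (EFin \o (fun x => g x * w x + 2 * `|g x - gam x|)).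
    apply: eq_integrable (integrableD _ igw (integrableZl _ 2 in1)) => // x _.
  have ie : mu.-integrable U (EFin \o (fun=> e)) := bounded_mfun_integrable (bounded_mfun_cst e).
  have i4 : mu.-integrable U (EFin \o (fun x => (g x * w x + 2 * `|g x - gam x|) + e)).
    by apply: eq_integrable (integrableD _ i3 ie).
  have iZ : mu.-integrable U (EFin \o (fun x => 2 * `|g x - gam x|)).
    by apply: eq_integrable (integrableZl _ 2 in1).
  apply: (@le_trans _ _ (\int[mu]_(x in U) ((g x * w x + 2 * `|g x - gam x|) + e))); last first.
    rewrite RintegralD// RintegralD// RintegralZl// Rint_unit_cst.
    by move: h hn'; lra.
  apply: le_Rintegral => // x _.
  have h1 : `|gam x| - e <= gam x * w x.
    rewrite /w mulrA ler_pdivlMr// -expr2 -[gam x ^+ 2]real_normK ?num_real//.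
    by have := sqr_ge0 e; have := ltW e0; nra.
  have h2 : - `|g x - gam x| <= (g x - gam x) * w x.
    rewrite lerNl -mulNr; apply: (le_trans (ler_norm _)); rewrite normrM normrN.
    by rewrite ler_piMr.
  have h3 : `|g x| <= `|gam x| + `|g x - gam x|.
    by rewrite -{1}(subrK (gam x) (g x)) addrC; exact: ler_normD.
  by move: h1 h2 h3; rewrite mulrBl; lra.
rewrite leNgt; apply/negP => h.
have := key ((\int[mu]_(x in U) `|g x| - B) / 6) (divr_gt0 _ _).
rewrite subr_gt0 => /(_ h (ltr0n _ 6)); lra.
Qed.

End L1Bound.

(** * Everywhere differentiable functions *)

Section LebesgueFTC.
Context {R : realType}.
Local Notation mu := (@lebesgue_measure R).
Implicit Types (g h H : R -> R).

(** Only comparisons with the centre [x] of a neighbourhood are given. The argument runs through the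
    supremum of the points [y] with [H a <= H y], which is such a point itself and can be passed
    unless it is [b]. *)
Lemma locally_nondecreasing H (a b : R) : a <= b ->
  (forall x, a <= x <= b -> exists2 d, 0 < d & forall y, a <= y <= b -> `|y - x| < d ->
     (x <= y -> H x <= H y) /\ (y <= x -> H y <= H x)) ->
  H a <= H b.
Proof.
move=> ab hH; pose S := [set y | a <= y <= b /\ H a <= H y].
have Sa : S a by split; rewrite ?lexx.
have ubS : ubound S b by move=> y [/andP[]].
have hS : has_sup S by split; [exists a|exists b].
pose c := sup S.
have ac : a <= c by apply: sup_ubound => //; exists b.
have cb : c <= b by apply: sup_le_ub => //; exists a.
have cI : a <= c <= b by rewrite ac.
have [d d0 hd] := hH c cI.
have [y Sy cy] := sup_adherent d0 hS.
have yc : y <= c by apply: sup_ubound => //; exists b.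
have Sc : H a <= H c.
  case: Sy => yI hy; apply: (le_trans hy); apply: (hd y yI _).2 => //.
  by rewrite ler0_norm ?subr_le0// opprB ltrBlDr -ltrBlDl.
move: cb; rewrite le_eqVlt => /predU1P[<-//|cb].
pose z := Num.min b (c + d / 2).
have cz : c < z by rewrite lt_min cb ltrDl divr_gt0.
have zI : a <= z <= b by rewrite ge_min lexx (le_trans ac (ltW cz)).
have zd : `|z - c| < d.
  rewrite gtr0_norm ?subr_gt0// ltrBlDl gt_min; apply/orP; right.
  by rewrite ltrD2l ltr_pdivrMr// ltr_pMr// ltr1n.
have Sz : S z by split => //; apply: (le_trans Sc); apply: (hd z zI zd).1; exact: ltW.
have : z <= c by apply: sup_ubound => //; exists b.
by rewrite leNgt cz.
Qed.

Let count_le (eps r : R) K : 0 < eps -> 0 <= r ->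
  \sum_(0 <= m < K) eps * ((m%:R * eps < r)%R)%:R <= r + eps.
Proof.
move=> e0 r0; suff : \sum_(0 <= m < K) eps * ((m%:R * eps < r)%R)%:R <= Num.min (K%:R * eps) (r + eps).
  by rewrite le_min => /andP[].
elim: K => [|K IH].
  by rewrite big_geq// le_min mul0r lexx addr_ge0// ltW.
rewrite big_nat_recr//=; move: IH; rewrite !le_min => /andP[h1 h2].
case: ltP => h; rewrite ?mulr1 ?mulr0 ?addr0.
  have : \sum_(0 <= m < K) eps * ((m%:R * eps < r)%R)%:R + eps <= K%:R * eps + eps by rewrite lerD2r.
  by rewrite -natr1 mulrDl mul1r => h3; rewrite h3/=; apply: (le_trans h3); rewrite lerD2r ltW.
by rewrite h2 andbT; apply: (le_trans h1); rewrite ler_pM2r// ler_nat.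
Qed.

Definition level_set (a b : R) (f : R -> R) (r : R) : set R := `[a, b] `&` [set x | r < f x].

Lemma measurable_level (a b : R) (f : R -> R) (r : R) : measurable_fun `[a, b] f ->
  measurable (level_set a b f r).
Proof.
move=> mf; have := mf (measurable_itv _) `]r, +oo[%classic (measurable_itv _).
rewrite (_ : _ `&` _ = level_set a b f r)//.
apply/seteqP; split => x /= [xI].
  by rewrite in_itv/= andbT => h; split.
by move=> h; split => //; rewrite in_itv/= andbT.
Qed.

Lemma open_cover (a b : R) (f : R -> R) (eps : R) : mu.-integrable `[a, b] (EFin \o f) ->
  exists V : nat -> set R, [/\ forall m, open (V m),
  forall m, level_set a b f (m%:R * eps) `<=` V m &
  forall m, (mu (V m `\` level_set a b f (m%:R * eps)) < (2 ^- m.+1)%:E)%E].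
Proof.
move=> iF; have mf : measurable_fun `[a, b] f by apply/measurable_EFinP; case/integrableP: iF.
have muI : (mu (`[a, b]%classic : set R) < +oo)%E.
  by rewrite /= lebesgue_measure_itv/=; case: ifP => _; rewrite -?EFinB ltry.
pose E m : set R := level_set a b f (m%:R * eps).
have mE m : measurable (E m) by exact: measurable_level.
have h m : exists U : set R, [/\ open U, E m `<=` U & (mu (U `\` E m) < (2 ^- m.+1)%:E)%E].
  apply: lebesgue_regularity_outer => //.
  apply: le_lt_trans muI; apply: le_measure; rewrite ?inE; [exact: mE|exact: measurable_itv|exact: subIsetl].
have [V hV] := choice h.
by exists V; split => m; have [] := hV m.
Qed.

(** A Vitali-Caratheodory argument. The superlevel sets of [f] at heights [m * eps] are enlarged to
    open sets [V m]; [U], which is [eps] times the sum of their indicators, is a lower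
    semicontinuous majorant of [f] with almost the same integral. Around [x] it stays at least
    [f x], hence at least [h x + N], so the primitive of [U] with a linear correction grows at least
    as fast as [g] at every point. *)
Lemma lower_FTC (a b : R) f g h (eps N : R) : a <= b -> 0 < eps ->
  (forall x, 0 <= f x) -> (forall x, a <= x <= b -> h x + N <= f x) ->
  mu.-integrable `[a, b] (EFin \o f) ->
  (forall x, a <= x <= b -> forall e, 0 < e -> exists2 d, 0 < d &
     forall y, a <= y <= b -> `|y - x| < d -> `|g y - g x - h x * (y - x)| <= e * `|y - x|) ->
  g b - g a <= \int[mu]_(x in `[a, b]) f x + eps * (b - a) + eps + (eps - N) * (b - a).
Proof.
move=> ab e0 f0 hf iF dg; pose I : set R := `[a, b]%classic.
have [V [oV EV muV]] := open_cover eps iF.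
pose U (x : R) : \bar R := (\sum_(0 <= m <oo) (eps * \1_(V m) x)%:E)%E.
have t0 m x : (0 <= (eps * \1_(V m) x)%:E)%E by rewrite lee_fin mulr_ge0// ltW.
have mt m D : measurable_fun D (fun x => (eps * \1_(V m) x)%:E).
  apply/measurable_EFinP; apply: measurable_funM => //.
  by apply: measurable_indic; exact: open_measurable.
have U0 x : (0 <= U x)%E by apply: nneseries_ge0.
have mU D : measurable_fun D U by apply: ge0_emeasurable_sum.
have mI : measurable I by exact: measurable_itv.
have mf : measurable_fun I f by apply/measurable_EFinP; case/integrableP: iF.
pose E (m : nat) : set R := level_set a b f (m%:R * eps).
have mE m : measurable (E m) by exact: measurable_level.
have tE0 m x : (0 <= (eps * \1_(E m) x)%:E)%E by rewrite lee_fin mulr_ge0// ltW.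
have mtE m D : measurable_fun D (fun x => (eps * \1_(E m) x)%:E).
  by apply/measurable_EFinP; apply: measurable_funM => //; apply: measurable_indic; exact: mE.
have UI : (\int[mu]_(x in I) U x <= (\int[mu]_(x in I) f x + eps * (b - a) + eps)%:E)%E.
  rewrite integral_nneseries//; last by move=> n; exact: mt.
  apply: (@le_trans _ _ (\sum_(0 <= m <oo) (\int[mu]_(x in I) (eps * \1_(E m) x)%:E + (eps / (2 ^ m.+1)%:R)%:E))%E).
    apply: lee_nneseries => [m _ _|m _]; first by apply: integral_ge0.
    have e1 (A : set R) : measurable A -> (\int[mu]_(x in I) (eps * \1_A x)%:E = eps%:E * mu (A `&` I))%E.
      move=> mA; under eq_integral do rewrite EFinM.
      rewrite ge0_integralZl//; last 2 first.
      - by apply/measurable_EFinP; exact: measurable_indic.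
      - exact: ltW.
      by rewrite integral_indic.
    rewrite !e1//; last exact: open_measurable.
    rewrite EFinM -ge0_muleDr ?lee_fin ?invr_ge0 ?ler0n//.
    apply: lee_wpmul2l; first by rewrite lee_fin ltW.
    apply: (@le_trans _ _ (mu (E m `&` I) + mu (V m `\` E m))%E).
      apply: (@le_trans _ _ (mu ((E m `&` I) `|` (V m `\` E m)))).
        apply: le_measure; rewrite ?inE//.
        - by apply: measurableI => //; exact: open_measurable.
        - apply: measurableU; first by apply: measurableI => //; exact: mE.
          by apply: measurableD; [exact: open_measurable|exact: mE].
        - by move=> x [Ox Ix]; have [Ex|Ex] := pselect (E m x); [left|right].
      apply: measureU2; first by apply: measurableI => //; exact: mE.
      by apply: measurableD; [exact: open_measurable|exact: mE].
    by rewrite leeD2l// natrX; exact: ltW.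
  apply: (le_trans (epsilon_trick _ _ _)).
  - by move=> m; apply: integral_ge0 => x _; rewrite lee_fin mulr_ge0// ltW.
  - exact: ltW.
  rewrite EFinD leeD2r// -integral_nneseries; [|by []|by move=> n; exact: mtE|by move=> n x _; exact: tE0].
  have ifin : (\int[mu]_(x in I) f x + eps * (b - a))%:E = (\int[mu]_(x in I) (f x + eps)%:E)%E.
    rewrite EFinD /Rintegral fineK; last exact: integrable_fin_num.
    have fE0 x : I x -> (0 <= (f x)%:E)%E by rewrite lee_fin.
    have cE0 x : I x -> (0 <= eps%:E)%E by move=> _; rewrite lee_fin ltW.
    have mfE : measurable_fun I (fun x => (f x)%:E) by exact/measurable_EFinP.
    have mcE : measurable_fun I (fun _ : R => eps%:E) by exact: measurable_cst.
    have -> : (\int[mu]_(x in I) (f x + eps)%:E = \int[mu]_(x in I) (f x)%:E + \int[mu]_(x in I) eps%:E)%E.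
      by rewrite -(ge0_integralD mu mI fE0 mfE cE0 mcE); apply: eq_integral => x _; rewrite EFinD.
    rewrite integral_cst//= lebesgue_measure_itv/= lte_fin.
    case: ltP => [_|ba]; first by rewrite -EFinB -EFinM.
    have eba : b = a by apply: le_anti; rewrite ab ba.
    by rewrite eba subrr mulr0 mule0.
  rewrite ifin; apply: ge0_le_integral => //.
  - by move=> x _; apply: nneseries_ge0 => m _ _; rewrite lee_fin mulr_ge0// ltW.
  - by apply: ge0_emeasurable_sum => *; [exact: tE0|exact: mtE].
  - by apply/measurable_EFinP; apply: measurable_funD.
  move=> x Ix; apply: lime_le; first by apply: is_cvg_nneseries => m _ _; rewrite lee_fin mulr_ge0// ltW.
  apply: nearW => K; rewrite sumEFin lee_fin.
  apply: le_trans (count_le K e0 (f0 x)); apply: ler_sum => m _.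
  rewrite indicE ler_wpM2l ?(ltW e0)// ler_nat.
  by case: (boolP (x \in E m)) => // /set_mem[_ /= ->].
have Ufin (A : set R) : measurable A -> A `<=` I -> (\int[mu]_(x in A) U x)%E \is a fin_num.
  move=> mA AI; rewrite ge0_fin_numE ?integral_ge0//.
  apply: le_lt_trans (ltry (\int[mu]_(x in I) f x + eps * (b - a) + eps)).
  by apply: le_trans UI; apply: ge0_subset_integral => //; exact: mU.
pose v (y : R) : R := fine (\int[mu]_(x in `[a, y]) U x).
have vB x y (k : nat) : a <= x -> x <= y -> y <= b ->
    (forall z, x < z <= y -> forall m, (m < k)%N -> V m z) -> k%:R * eps * (y - x) <= v y - v x.
  move=> ax xy yb hV.
  have sub (p q : R) : a <= p -> q <= b -> `[p, q]%classic `<=` I.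
    by move=> ap qb z /=; rewrite /I /= !in_itv/= => /andP[h1 h2]; rewrite (le_trans ap)//= (le_trans h2).
  have e : `[a, y]%classic = `[a, x]%classic `|` `]x, y]%classic :> set R.
    apply/seteqP; split => z /=; rewrite !in_itv/=.
      by move=> /andP[h1 h2]; have [zx|zx] := leP z x; [left; rewrite h1|right; apply/andP; split].
    by move=> [/andP[h1 h2]|/andP[h1 h2]]; apply/andP; split; lra.
  have subI : `]x, y]%classic `<=` I.
    by move=> z /=; rewrite /I /= !in_itv/= => /andP[h1 h2]; apply/andP; split; lra.
  have -> : v y = v x + fine (\int[mu]_(z in `]x, y]) U z).
    have dj : [disjoint `[a, x]%classic & `]x, y]%classic].
    apply/disj_setPS => z /= []; rewrite !in_itv/= => /andP[_ h1] /andP[h2 _].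
    by move: h1; rewrite leNgt h2.
  have eU : (\int[mu]_(z in `[a, y]) U z = \int[mu]_(z in `[a, x]) U z + \int[mu]_(z in `]x, y]) U z)%E.
    by rewrite e; apply: ge0_integral_setU => //; exact: mU.
  have f1 : (\int[mu]_(z in `[a, x]) U z)%E \is a fin_num.
    by apply: Ufin => //; apply: sub => //; lra.
  have f2 : (\int[mu]_(z in `]x, y]) U z)%E \is a fin_num by exact: Ufin.
  by rewrite /v eU fineD.
  rewrite [v x + _]addrC addrK -lee_fin fineK; last exact: Ufin.
  have -> : (k%:R * eps * (y - x))%:E = (\int[mu]_(z in `]x, y]) (k%:R * eps)%:E)%E.
    rewrite integral_cst//= lebesgue_measure_itv/= lte_fin.
    by case: ltP => [_|yx]; [rewrite -EFinB -EFinM|rewrite (_ : y = x) ?subrr ?mulr0 ?mule0//; apply: le_anti; rewrite yx].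
  have c0 z : `]x, y]%classic z -> (0 <= (k%:R * eps)%:E)%E.
    by move=> _; rewrite lee_fin mulr_ge0// ltW.
  have cU z : `]x, y]%classic z -> ((k%:R * eps)%:E <= U z)%E.
    rewrite /= in_itv/= => hz.
    apply: (@le_trans _ _ (\sum_(0 <= m < k) (eps * \1_(V m) z)%:E)%E); last first.
      by apply: nneseries_lim_ge.
    rewrite sumEFin lee_fin (@eq_big_nat _ _ _ _ _ _ (fun=> eps)).
      by rewrite sumr_const_nat subn0 mulr_natl.
    by move=> m /andP[_ mk]; rewrite indicE mem_set ?mulr1//; exact: hV.
  by apply: ge0_le_integral => //; exact: mU.
pose H y := v y + (eps - N) * y - g y.
have HH : H a <= H b.
  apply: locally_nondecreasing => // x xI; have /andP[ax xb] := xI.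
  have [d1 d10 hd1] := dg x xI _ e0.
  pose k := Num.Def.trunc (f x / eps).
  have fe0 : 0 <= f x / eps by rewrite divr_ge0// ltW.
  have /andP[k1 k2] := truncn_itv fe0; rewrite -/k in k1 k2.
  rewrite ler_pdivlMr// in k1; rewrite ltr_pdivrMr// in k2.
  (* all levels strictly below [f x] contain a common neighbourhood of [x] *)
  have [K [hK hfK]] : exists K : nat, (forall m, (m < K)%N -> m%:R * eps < f x) /\ f x <= K%:R * eps.
    have [ke|ke] := eqVneq (k%:R * eps) (f x).
      exists k; split; last by rewrite ke.
      by move=> m mk; rewrite -ke ltr_pM2r// ltr_nat.
    exists k.+1; split; last exact: ltW.
    move=> m; rewrite ltnS => mk; apply: (@le_lt_trans _ _ (k%:R * eps)).
      by rewrite ler_pM2r// ler_nat.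
    by rewrite lt_neqAle ke.
  have [d2 d20 hd2] : exists2 d, 0 < d & forall z, `|z - x| < d -> forall m, (m < K)%N -> V m z.
    elim: (K) (hK) => [|K' IH] hK'; first by exists 1.
    have [m mK|d d0 hd] := IH; first by apply: hK'; rewrite ltnS ltnW.
    have Ox : V K' x by apply: EV; split; [rewrite /= in_itv|exact: hK'].
    have /nbhs_ballP[d' /= d'0 hd'] := open_nbhs_nbhs (conj (oV K') Ox).
    exists (Num.min d d'); first by rewrite lt_min d0.
    move=> z; rewrite lt_min => /andP[zd zd'] m; rewrite ltnS leq_eqVlt => /predU1P[->|mK'].
      by apply: hd'; rewrite /ball/= distrC.
    exact: hd.
  exists (Num.min d1 d2); first by rewrite lt_min d10.
  move=> y yI; rewrite lt_min => /andP[yd1 yd2]; have /andP[ay yb] := yI.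
  have := hd1 y yI yd1; have hfx := hf x xI.
  split=> xy.
    have hv := vB x y K ax xy yb _.
    have {}hv : K%:R * eps * (y - x) <= v y - v x.
      apply: hv => z /andP[xz zy] m mK; apply: hd2 => //.
      apply: le_lt_trans yd2; rewrite !ger0_norm ?subr_ge0 ?(ltW xz)//; lra.
    have yx0 : 0 <= y - x by rewrite subr_ge0.
    move: (hd1 y yI yd1); rewrite (ger0_norm yx0) ler_norml => /andP[_ hg].
    have h3 := ler_wpM2r yx0 (le_trans hfx hfK).
    by rewrite /H; lra.
  have hv := vB y x K ay xy xb _.
  have {}hv : K%:R * eps * (x - y) <= v x - v y.
    apply: hv => z /andP[xz zy] m mK; apply: hd2 => //.
    apply: le_lt_trans yd2; rewrite !ler0_norm ?subr_le0//; lra.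
  have yx0 : y - x <= 0 by rewrite subr_le0.
  have xy0 : 0 <= x - y by rewrite subr_ge0.
  move: (hd1 y yI yd1); rewrite (ler0_norm yx0) ler_norml => /andP[hg _].
  have h3 := ler_wpM2r xy0 (le_trans hfx hfK).
  by rewrite /H; lra.
have va : v a = 0 by rewrite /v set_itv1 integral_set1.
have vb : v b <= \int[mu]_(x in `[a, b]) f x + eps * (b - a) + eps.
  by rewrite -lee_fin /v fineK//; apply: Ufin.
move: HH vb; rewrite /H va; move: (v b) (\int[mu]_(x in _) f x) => w1 w2.
clear -e0; lra.
Qed.

(** Truncating [h] from below at [- n] and adding [n] produces the nonnegative majorant for
    [lower_FTC]; dominated convergence then removes the truncation. *)
Lemma FTC_upper (a b : R) g h : a <= b -> mu.-integrable `[a, b] (EFin \o h) ->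
  (forall x, a <= x <= b -> forall e, 0 < e -> exists2 d, 0 < d &
     forall y, a <= y <= b -> `|y - x| < d -> `|g y - g x - h x * (y - x)| <= e * `|y - x|) ->
  g b - g a <= \int[mu]_(x in `[a, b]) h x.
Proof.
move=> ab ih dg; pose I : set R := `[a, b]%classic.
have mI : measurable I by exact: measurable_itv.
have mh : measurable_fun I h by apply/measurable_EFinP; case/integrableP: ih.
pose hn (n : nat) x := Num.max (h x) (- n%:R).
have mhn n : measurable_fun I (hn n) by apply: measurable_maxr.
have hn_le n x : `|hn n x| <= `|h x|.
  rewrite /hn; have [h1|h1] := leP (- n%:R) (h x); first by [].
  rewrite normrN ger0_norm//.
  have n0 : 0 <= n%:R :> R by [].
  rewrite ltr0_norm; lra.
have ihn n : mu.-integrable I (EFin \o hn n).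
  apply: le_integrable (integrable_norm ih) => //; first by apply/measurable_EFinP; exact: mhn.
  by move=> x _; rewrite lee_fin normr_id hn_le.
have main n : g b - g a <= \int[mu]_(x in I) hn n x.
  have bnd (m : nat) : g b - g a <= \int[mu]_(x in I) hn n x + (2 * (b - a) + 1) / m.+1%:R.
    pose eps : R := m.+1%:R^-1; have e0 : 0 < eps by rewrite invr_gt0 ltr0n.
    pose f x := hn n x + n%:R.
    have f0 x : 0 <= f x by rewrite /f -lerBlDr sub0r le_max lexx orbT.
    have ic : mu.-integrable I (EFin \o (fun=> n%:R : R)).
      apply/integrableP; split; first exact/measurable_EFinP.
      under eq_integral do rewrite /= ger0_norm//.
      by rewrite integral_cst//= lebesgue_measure_itv/=; case: ifP => _; rewrite -?EFinB -?EFinM ?mule0 ltry.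
    have iF : mu.-integrable I (EFin \o f).
      by apply: eq_integrable (integrableD _ (ihn n) ic).
    have := @lower_FTC a b f g h eps n%:R ab e0 f0 _ iF dg.
    have -> : \int[mu]_(x in `[a, b]) f x = \int[mu]_(x in I) hn n x + n%:R * (b - a).
      rewrite RintegralD// Rintegral_cst//= lebesgue_measure_itv/= lte_fin.
      case: ltP => [_|ba]; first by [].
      have eab : b - a = 0 by rewrite (_ : b = a) ?subrr//; apply: le_anti; rewrite ab ba.
      by rewrite eab /= !mulr0.
    move=> h2; apply: (le_trans (h2 _)); first by move=> x _; rewrite lerD2r le_max lexx.
    have -> : (2 * (b - a) + 1) / m.+1%:R = (2 * (b - a) + 1) * eps by [].
    by lra.
  have cv : (\int[mu]_(x in I) hn n x + (2 * (b - a) + 1) / m.+1%:R) @[m --> \oo] --> \int[mu]_(x in I) hn n x + 0.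
    apply: cvgD; first exact: cvg_cst.
    rewrite -[X in _ --> X](mulr0 (2 * (b - a) + 1)); apply: cvgM; first exact: cvg_cst.
    exact: cvg_harmonic.
  rewrite -[leRHS]addr0; apply: (ler_cvg_to (@cvg_cst _ _ _ _ _) cv); exact: nearW.
have [|||||_ _ cv] := @dominated_convergence _ _ _ mu I mI (fun n => EFin \o hn n) (EFin \o h) (EFin \o (fun x => `|h x|)).
- by move=> n; apply/measurable_EFinP; exact: mhn.
- exact/measurable_EFinP.
- apply/aeW => x _; apply: (@cvg_near_cst _ _ _ _ _ _ _).
  have [k hk] : exists k : nat, `|h x| <= k%:R.
    by exists (Num.Def.trunc `|h x|).+1; have /andP[_ /ltW] := truncn_itv (normr_ge0 (h x)).
  exists k => // n /= kn; rewrite /hn max_l//.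
  have : `|h x| <= n%:R by apply: (le_trans hk); rewrite ler_nat.
  by rewrite ler_norml => /andP[].
- exact: integrable_norm.
- by apply/aeW => x n _; rewrite lee_fin hn_le.
have cv' : \int[mu]_(x in I) hn n x @[n --> \oo] --> \int[mu]_(x in I) h x.
  by apply: fine_cvg; rewrite /Rintegral fineK ?integrable_fin_num.
by apply: (ler_cvg_to (@cvg_cst _ _ _ _ _) cv'); exact: nearW.
Qed.

(** The upper bound is applied to both signs. The derivative is integrable and exists at every
    point, with no continuity: the situation of the time derivatives of the source. *)
Lemma FTC_everywhere (a b : R) g h : a <= b -> mu.-integrable `[a, b] (EFin \o h) ->
  (forall x, a <= x <= b -> forall e, 0 < e -> exists2 d, 0 < d &
     forall y, a <= y <= b -> `|y - x| < d -> `|g y - g x - h x * (y - x)| <= e * `|y - x|) ->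
  g b - g a = \int[mu]_(x in `[a, b]) h x.
Proof.
move=> ab ih dg; apply/eqP; rewrite eq_le FTC_upper//=.
have iNh : mu.-integrable `[a, b] (EFin \o (fun x => - h x)).
  by apply: eq_integrable (integrableN ih).
have := @FTC_upper a b (fun x => - g x) (fun x => - h x) ab iNh.
have -> : \int[mu]_(x in `[a, b]) - h x = - \int[mu]_(x in `[a, b]) h x.
  rewrite -mulN1r -RintegralZl//; apply: eq_Rintegral => x _; exact: esym (mulN1r _).
rewrite -opprD lerN2; apply => x xI e e0; have [d d0 hd] := dg x xI e e0.
exists d => // y yI yd; rewrite mulNr -!opprD normrN; exact: hd.
Qed.

End LebesgueFTC.

(** * Fubini and joint measurability on rectangles *)

Section Rectangles.
Context {R : realType}.
Local Notation mu := (@lebesgue_measure R).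

(** [P] is known to be the inner integral only at those [x] whose slice is integrable; Fubini's
    theorem makes this almost every [x]. The zero extension [Ft] transfers the statement from the
    plane to the rectangle. *)
Lemma fubini_rect (A D : set R) (F : R * R -> R) (P : R -> R) :
  measurable A -> measurable D -> measurable_fun (A `*` D) F ->
  (\int[mu]_(s in D) \int[mu]_(x in A) `|F (x, s)|%:E < +oo)%E ->
  (forall s, D s -> mu.-integrable A (fun x => (F (x, s))%:E)) ->
  measurable_fun A P ->
  (forall x, A x -> mu.-integrable D (fun s => (F (x, s))%:E) ->
     P x = \int[mu]_(s in D) F (x, s)) ->
  mu.-integrable D (EFin \o (fun s => \int[mu]_(x in A) F (x, s))) /\
  \int[mu]_(x in A) P x = \int[mu]_(s in D) (\int[mu]_(x in A) F (x, s)).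
Proof.
move=> mA mD mF fin iA mP hP.
pose Ft : R * R -> R := F \_ (A `*` D).
have mAD : measurable (A `*` D) by exact: measurableX.
have mFt : measurable_fun setT Ft by apply/(measurable_restrictT _ mAD).
have FtD s : D s -> (fun x => Ft (x, s)) = (fun x => F (x, s)) \_ A.
  move=> Ds; apply/funext => x; rewrite /Ft /patch.
  case: ifPn => [/set_mem[/= Ax _]|]; first by rewrite mem_set.
  move=> h; case: ifPn => // /set_mem Ax; case/negP: h; exact/mem_set.
have FtND s : ~ D s -> (fun x => Ft (x, s)) = fun=> 0.
  move=> Ds; apply/funext => x; rewrite /Ft /patch.
  by case: ifPn => // /set_mem[/= _ /Ds].
have FtA x : A x -> (fun s => Ft (x, s)) = (fun s => F (x, s)) \_ D.
  move=> Ax; apply/funext => s; rewrite /Ft /patch.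
  case: ifPn => [/set_mem[/= _ Ds]|]; first by rewrite mem_set.
  move=> h; case: ifPn => // /set_mem Ds; case/negP: h; exact/mem_set.
have FtNA x : ~ A x -> (fun s => Ft (x, s)) = fun=> 0.
  move=> Ax; apply/funext => s; rewrite /Ft /patch.
  by case: ifPn => // /set_mem[/= /Ax].
have intA (G : R -> R) : (\int[mu]_x ((G \_ A) x)%:E = \int[mu]_(x in A) (G x)%:E)%E.
  by rewrite [RHS]integral_mkcond restrict_EFin.
have intD (G : R -> R) : (\int[mu]_x ((G \_ D) x)%:E = \int[mu]_(x in D) (G x)%:E)%E.
  by rewrite [RHS]integral_mkcond restrict_EFin.
have mEFt : measurable_fun setT (EFin \o Ft) by exact/measurable_EFinP.
have iFt : (mu \x mu)%E.-integrable setT (EFin \o Ft).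
  apply/integrable21ltyP; first exact: mEFt.
  suff -> : (\int[mu]_s \int[mu]_x `|(EFin \o Ft) (x, s)| = \int[mu]_(s in D) \int[mu]_(x in A) `|F (x, s)|%:E)%E by [].
  rewrite [RHS]integral_mkcond; apply: eq_integral => s _ /=.
  rewrite /patch; case: ifPn => [/set_mem Ds|Ds].
    rewrite -intA; apply: eq_integral => x _.
    by have /(congr1 (fun f => f x)) /= -> := FtD s Ds; rewrite /patch; case: ifP; rewrite ?normr0.
  rewrite (eq_integral (fun=> 0%E)); first exact: integral0.
  move=> x _; have nDs : ~ D s by move=> Ds'; case/negP: Ds; exact/mem_set.
  by have /(congr1 (fun f => f x)) /= -> := FtND s nDs; rewrite normr0.
have FG := Fubini iFt.
have gE s : D s -> (\int[mu]_x (EFin \o Ft) (x, s) = (\int[mu]_(x in A) F (x, s))%:E)%E.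
  move=> Ds; rewrite /Rintegral fineK; last by apply: integrable_fin_num => //; exact: iA.
  rewrite -intA; apply: eq_integral => x _.
  by have /(congr1 (fun f => f x)) /= -> := FtD s Ds.
have gN s : ~ D s -> (\int[mu]_x (EFin \o Ft) (x, s) = 0)%E.
  move=> Ds; rewrite (eq_integral (fun=> 0%E)); first exact: integral0.
  by move=> x _; have /(congr1 (fun f => f x)) /= -> := FtND s Ds.
have mG := measurable_fubini_G iFt.
have iG : mu.-integrable D (EFin \o (fun s => \int[mu]_(x in A) F (x, s))).
  apply/integrableP; split.
    apply: (eq_measurable_fun (fun s => \int[mu]_x (EFin \o Ft) (x, s))%E).
      by move=> s /set_mem; exact: gE.
    exact: measurable_funTS mG.
  pose J s := \int[mu]_(x in A) F (x, s).
  have m1 : measurable_fun D (abse \o (EFin \o J)).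
    apply: measurableT_comp => //; apply: (eq_measurable_fun (fun s => \int[mu]_x (EFin \o Ft) (x, s))%E).
      by move=> s /set_mem; exact: gE.
    exact: measurable_funTS mG.
  have m2 : measurable_fun D (fun s => \int[mu]_(x in A) `|F (x, s)|%:E)%E.
    apply: (eq_measurable_fun (fun s => \int[mu]_x `|(EFin \o Ft) (x, s)|)%E).
      move=> s /set_mem Ds; rewrite -intA; apply: eq_integral => x _.
      by have /(congr1 (fun f => f x)) /= -> := FtD s Ds; rewrite /patch; case: ifP; rewrite ?normr0.
    apply: measurable_funTS; apply: (@measurable_fun_fubini_tonelli_G _ _ _ _ _ mu (abse \o (EFin \o Ft))) => //=.
    exact: measurableT_comp.
  have le12 s : D s -> ((abse \o (EFin \o J)) s <= \int[mu]_(x in A) `|F (x, s)|%:E)%E.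
    move=> Ds; rewrite [leLHS]/= EFin_normr_Rintegral//; last exact: iA.
    by apply: le_abse_integral => //; case/integrableP: (iA s Ds).
  have nn s : D s -> (0 <= (abse \o (EFin \o J)) s)%E.
    by move=> _; exact: abse_ge0.
  exact: (le_lt_trans (ge0_le_integral mu mD nn m1 m2 le12) fin).
split=> //.
have hE x : A x -> (\int[mu]_s (EFin \o Ft) (x, s) = \int[mu]_(s in D) (F (x, s))%:E)%E.
  move=> Ax; rewrite -intD; apply: eq_integral => s _.
  by have /(congr1 (fun f => f s)) /= -> := FtA x Ax.
have hN x : ~ A x -> (\int[mu]_s (EFin \o Ft) (x, s) = 0)%E.
  move=> Ax; rewrite (eq_integral (fun=> 0%E)); first exact: integral0.
  by move=> s _; have /(congr1 (fun f => f s)) /= -> := FtNA x Ax.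
rewrite /Rintegral; congr fine.
transitivity (\int[mu]_x \int[mu]_s (EFin \o Ft) (x, s))%E.
  transitivity (\int[mu]_(x in A) \int[mu]_s (EFin \o Ft) (x, s))%E.
    apply: ae_eq_integral => //.
    - exact/measurable_EFinP.
    - by apply: measurable_funTS; exact: (measurable_fubini_F iFt).
    have := ae_integrable1 iFt; apply: filterS => x ix Ax /=.
    have iD : mu.-integrable D (fun s => (F (x, s))%:E).
      apply/integrable_mkcond => //; rewrite restrict_EFin.
      apply: eq_integrable ix => // s _.
      by have /(congr1 (fun f => f s)) /= -> := FtA x Ax.
    by rewrite hE// hP// /Rintegral fineK//; exact: integrable_fin_num.
  rewrite [LHS]integral_mkcond; apply: eq_integral => x _; rewrite /patch.
  by case: ifPn => // /negP nA; rewrite hN// => Ax; apply: nA; exact/mem_set.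
rewrite FG [RHS]integral_mkcond; apply: eq_integral => s _; rewrite /patch.
case: ifPn => [/set_mem Ds|/negP nD]; first exact: gE.
by rewrite gN// => Ds; apply: nD; exact/mem_set.
Qed.

Lemma fubini_rect_dom (A D : set R) (F : R * R -> R) (P b : R -> R) :
  measurable A -> measurable D -> measurable_fun (A `*` D) F ->
  (forall s, D s -> mu.-integrable A (fun x => (F (x, s))%:E)) ->
  mu.-integrable D (EFin \o b) ->
  (forall s, D s -> \int[mu]_(x in A) `|F (x, s)| <= b s) ->
  measurable_fun A P ->
  (forall x, A x -> mu.-integrable D (fun s => (F (x, s))%:E) ->
     P x = \int[mu]_(s in D) F (x, s)) ->
  mu.-integrable D (EFin \o (fun s => \int[mu]_(x in A) F (x, s))) /\
  \int[mu]_(x in A) P x =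
    \int[mu]_(s in D) (\int[mu]_(x in A) F (x, s)).
Proof.
move=> mA mD mF iA ib hb mP hP; apply: fubini_rect => //.
have mFt : measurable_fun setT (F \_ (A `*` D)).
  by apply/(measurable_restrictT _ (measurableX mA mD)).
have nn r : D r -> (0 <= \int[mu]_(x in A) `|F (x, r)|%:E)%E.
  by move=> _; apply: integral_ge0.
have m1 : measurable_fun D (fun r => \int[mu]_(x in A) `|F (x, r)|%:E)%E.
  apply: (eq_measurable_fun (fun r =>
      \int[mu]_x `|(EFin \o (F \_ (A `*` D))) (x, r)|)%E).
    move=> r /set_mem rI; rewrite [RHS]integral_mkcond; apply: eq_integral => x _ /=.
    rewrite /patch; case: (boolP ((x, r) \in _)) => [/set_mem[/= Ux _]|nU]; first by rewrite mem_set.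
    case: ifPn => [/set_mem Ux|_]; last by rewrite normr0.
    by case/negP: nU; exact/mem_set.
  apply: measurable_funTS; apply: (@measurable_fun_fubini_tonelli_G _ _ _ _ _
    mu (abse \o (EFin \o (F \_ (A `*` D))))) => //=.
  by apply: measurableT_comp => //; exact/measurable_EFinP.
have /integrableP[m2 fb] := ib.
have le12 r : D r -> (\int[mu]_(x in A) `|F (x, r)|%:E <= `|(b r)%:E|)%E.
  move=> Dr; have iN := integrable_norm (iA r Dr).
  rewrite -[leLHS]fineK; last exact: integrable_fin_num iN.
  rewrite lee_fin -/(Rintegral _ _ _); apply: (le_trans (hb r Dr)); exact: ler_norm.
apply: le_lt_trans fb.
have m3 : measurable_fun D (abse \o (EFin \o b)) by exact: measurableT_comp.
exact: (ge0_le_integral mu mD nn m1 m3 le12).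
Qed.

(** [F x t] is the limit of [F x (p n t)], where [p n t] is the next multiple of [1 / n.+1] after
    [t], cut off at [T] to stay where [F] is continuous in time. On each time cell the approximation
    depends on [x] alone. *)
Lemma slice_measurable (A : set R) (T : R) (F : R -> R -> R) :
  measurable A -> 0 < T -> (forall t, 0 < t <= T -> measurable_fun A (F ^~ t)) ->
  (forall x, A x -> forall t, 0 < t <= T -> forall e, 0 < e -> exists2 d, 0 < d &
     forall s, 0 < s <= T -> `|s - t| < d -> `|F x s - F x t| <= e) ->
  measurable_fun (A `*` `]0, T]) (fun z : R * R => F z.1 z.2).
Proof.
move=> mA T0 mF cF.
pose nd n j : R := Num.min T (j.+1%:R / n.+1%:R).
have nd_gt0 n j : 0 < nd n j <= T.
  by rewrite /nd ge_min lexx andbT lt_min T0 divr_gt0// ltr0n.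
pose p n (t : R) := nd n (Num.Def.trunc (n.+1%:R * t)).
have pP n t : 0 < t <= T -> t <= p n t <= t + n.+1%:R^-1.
  move=> /andP[t0 tT]; have nt0 : 0 <= n.+1%:R * t by rewrite mulr_ge0// ltW.
  have /andP[h1 h2] := truncn_itv nt0; rewrite /p /nd le_min tT ge_min/=.
  have n0 : 0 < n.+1%:R :> R by rewrite ltr0n.
  rewrite ler_pdivlMr// [t * _]mulrC (ltW h2)/=; apply/orP; right.
  rewrite ler_pdivrMr// mulrDl mulVf ?gt_eqF// [t * _]mulrC -natr1.
  by rewrite lerD2r.
pose B n j : set R := `]0, T] `&` `[j%:R / n.+1%:R, j.+1%:R / n.+1%:R[.
apply: (@measurable_fun_cvg _ _ _ _ (fun n (z : R * R) => F z.1 (p n z.2))); last first.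
  move=> [x t] [/= Ax]; rewrite in_itv/= => tT.
  apply/cvgrPdist_le => e e0; have [d d0 hd] := cF x Ax t tT e e0.
  have [N _ hN] : \forall n \near \oo, n.+1%:R^-1 < d.
    have /cvgrPdist_lt /(_ _ d0) [N _ hN] := @cvg_harmonic R.
    by exists N => // n /hN; rewrite sub0r normrN ger0_norm// invr_ge0.
  exists N => // n /hN nd'; rewrite /= distrC; apply: hd; first exact: nd_gt0.
  have /andP[h1 h2] := pP n t tT; rewrite ger0_norm ?subr_ge0//.
  by apply: le_lt_trans nd'; rewrite lerBlDl.
move=> n.
have cover : A `*` `]0, T] = \bigcup_j (A `*` B n j).
  apply/seteqP; split => [[x t] [/= Ax tT]|[x t] [j _ [/= Ax [tT _]]]]; last by split.
  have /andP[t0 _] : 0 < t <= T by move: tT; rewrite in_itv.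
  have nt0 : 0 <= n.+1%:R * t by rewrite mulr_ge0// ltW.
  exists (Num.Def.trunc (n.+1%:R * t)) => //; split => //; split => //=.
  have n0 : 0 < n.+1%:R :> R by rewrite ltr0n.
  by rewrite in_itv/= ler_pdivrMr// ltr_pdivlMr// [t * _]mulrC truncn_itv.
have mB j : measurable (A `*` B n j).
  by apply: measurableX => //; apply: measurableI; exact: measurable_itv.
rewrite cover; apply/measurable_fun_bigcup => // j.
apply: (eq_measurable_fun (fun z : R * R => F z.1 (nd n j))).
  move=> [x t] /set_mem[/= _ [_]]; rewrite /= in_itv/= => /andP[h1 h2].
  have n0 : 0 < n.+1%:R :> R by rewrite ltr0n.
  rewrite /p (_ : Num.Def.trunc _ = j)//; apply: truncn_def.
  by rewrite [_ * t]mulrC -ler_pdivrMr// h1/= -ltr_pdivlMr.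
apply: (@measurable_comp _ _ _ _ _ _ A (F ^~ (nd n j)) _ fst) => //.
- by move=> _ [[x t] [/= Ax _] <-].
- by apply: mF; exact: nd_gt0.
- by apply: measurable_funTS; exact: measurable_fst.
Qed.

Definition dt_pair (A : set R) (T : R) (g g' : R -> R -> R) :=
  forall x, A x -> forall t, 0 < t <= T -> forall e, 0 < e -> exists2 d, 0 < d &
    forall s, 0 < s <= T -> `|s - t| < d -> `|g x s - g x t - g' x t * (s - t)| <= e * `|s - t|.

Lemma dt_pair_continuous A T g g' x t e : dt_pair A T g g' -> A x -> 0 < t <= T -> 0 < e ->
  exists2 d, 0 < d & forall s, 0 < s <= T -> `|s - t| < d -> `|g x s - g x t| <= e.
Proof.
move=> h Ax tT e0; have [d d0 hd] := h x Ax t tT 1 ltr01.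
have c0 : 0 < 1 + `|g' x t| by rewrite ltr_wpDr.
exists (Num.min d (e / (1 + `|g' x t|))); first by rewrite lt_min d0 divr_gt0.
move=> s sT; rewrite lt_min => /andP[sd se].
rewrite -[g x s - g x t](subrK (g' x t * (s - t))).
apply: (le_trans (ler_normD _ _)).
apply: (@le_trans _ _ ((1 + `|g' x t|) * `|s - t|)).
  by rewrite mulrDl; apply: lerD; [exact: hd|rewrite normrM].
by rewrite mulrC -ler_pdivlMr// ltW.
Qed.

(** The derivative is the limit of difference quotients towards [c n * t] with [c n < 1]; a
    multiplicative shift stays in []0, T]] for every [t], the end point included. *)
Lemma dt_pair_measurable A T g g' : measurable A -> 0 < T ->
  (forall t, 0 < t <= T -> measurable_fun A (g ^~ t)) -> dt_pair A T g g' ->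
  measurable_fun (A `*` `]0, T]) (fun z : R * R => g' z.1 z.2).
Proof.
move=> mA T0 mg h.
have mG : measurable_fun (A `*` `]0, T]) (fun z : R * R => g z.1 z.2).
  apply: slice_measurable => // x Ax t tT e e0.
  exact: dt_pair_continuous h Ax tT e0.
pose c n : R := 1 - n.+2%:R^-1.
have c01 n : 0 < c n < 1.
  by rewrite /c subr_gt0 invf_lt1 ?ltr0n// ltr1n/= gtrBl invr_gt0 ltr0n.
have cT n t : 0 < t <= T -> 0 < c n * t <= T.
  move=> /andP[t0 tT]; have /andP[c0 c1] := c01 n; rewrite mulr_gt0//=.
  by apply: le_trans tT; rewrite ler_piMl// ltW.
have mAT : measurable (A `*` `]0, T]) by apply: measurableX.
apply: (@measurable_fun_cvg _ _ _ _ (fun n (z : R * R) => (g z.1 (c n * z.2) - g z.1 z.2) / (c n * z.2 - z.2))).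
  move=> n; apply: measurable_funM.
    apply: measurable_funB => //.
    apply: (@measurable_comp _ _ _ _ _ _ (A `*` `]0, T]) (fun z : R * R => g z.1 z.2) _ (fun z => (z.1, c n * z.2))) => //.
    - by move=> _ [[x t] [/= Ax tT] <-]; split => //=; move: tT; rewrite !in_itv/=; exact: cT.
    - apply: measurable_funTS; apply: measurable_fun_pair; first exact: measurable_fst.
      exact: (measurable_funM (measurable_cst (c n)) measurable_snd).
  apply: measurable_funV.
  by apply: measurable_funTS; apply: measurable_funB => //; apply: measurable_funM.
move=> [x t] [/= Ax]; rewrite in_itv/= => tT; have /andP[t0 _] := tT.
apply/cvgrPdist_le => e e0; have [d d0 hd] := h x Ax t tT e e0.
have dt0 : 0 < d / t by rewrite divr_gt0.
have [N _ hN] : \forall n \near \oo, n.+1%:R^-1 < d / t.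
  have /cvgrPdist_lt /(_ _ dt0) [N _ hN] := @cvg_harmonic R.
  by exists N => // n /hN; rewrite sub0r normrN ger0_norm// invr_ge0.
exists N => // n /hN nd' /=; rewrite distrC.
have st : c n * t - t = - (n.+2%:R^-1 * t) by rewrite /c; ring.
have n2 : 0 < n.+2%:R^-1 * t by rewrite mulr_gt0// invr_gt0 ltr0n.
have sd : `|c n * t - t| < d.
  rewrite st normrN gtr0_norm// -ltr_pdivlMr//; apply: le_lt_trans nd'.
  by rewrite lef_pV2 ?posrE ?ltr0n// ler_nat.
have s0 : c n * t - t != 0 by rewrite st oppr_eq0 gt_eqF.
have := hd _ (cT n t tT) sd.
rewrite -[X in `|X| <= _](divfK s0) normrM ler_pM2r ?normr_gt0//.
by rewrite mulrBl mulfK.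
Qed.

End Rectangles.

Section CoefficientDerivative.
Context {R : realType}.
Local Notation mu := (@lebesgue_measure R).
Local Notation U := (`]0, 1[%classic : set R).

(** At each [x] with an integrable time slice, [FTC_everywhere] expresses the increment of [g];
    Fubini then exchanges the integrals. Integrability on the rectangle comes from the coefficient
    bounds, which [L1_le_coefs] turns into integral bounds of the slices. *)
Lemma coef_increment (T : R) (g g' : R -> R -> R) s t B k : 0 < s <= t -> t <= T -> 0 < B ->
  (forall r, 0 < r <= T -> in_L2 (g ^~ r)) -> (forall r, 0 < r <= T -> in_L2 (g' ^~ r)) ->
  dt_pair U T g g' ->
  (forall r, s <= r <= t -> forall n, \sum_(1 <= k < n.+1) L2_inner (g' ^~ r) (psi k) ^+ 2 <= B ^+ 2) ->
  mu.-integrable `[s, t] (EFin \o (fun r => L2_inner (g' ^~ r) (psi k))) /\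
  L2_inner (g ^~ t) (psi k) - L2_inner (g ^~ s) (psi k) =
    \int[mu]_(r in `[s, t]) L2_inner (g' ^~ r) (psi k).
Proof.
move=> /andP[s0 st] tT B0 gL gL' h hB.
have T0 : 0 < T by apply: lt_le_trans tT; exact: lt_le_trans st.
have sub r : s <= r <= t -> 0 < r <= T.
  by move=> /andP[sr rt]; rewrite (lt_le_trans s0 sr) (le_trans rt tT).
have tI : 0 < t <= T by apply: sub; rewrite st lexx.
have sI : 0 < s <= T by apply: sub; rewrite st lexx.
have mg' : measurable_fun (U `*` `]0, T]) (fun z : R * R => g' z.1 z.2).
  by apply: dt_pair_measurable h => // r /gL[].
pose F (z : R * R) := g' z.1 z.2 * psi k z.1.
have mU : measurable U by exact: measurable_itv.
have mD : measurable (`[s, t]%classic : set R) by exact: measurable_itv.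
have mF : measurable_fun (U `*` `[s, t]) F.
  apply: measurable_funM.
    apply: measurable_funS mg'; first exact: measurableX.
    by move=> [x r] [/= Ux]; rewrite in_itv/= => rI; split => //=; rewrite in_itv/= sub.
  apply: (@measurable_comp _ _ _ _ _ _ setT (psi k) _ fst) => //; first exact: measurable_psi.
  by apply: measurable_funTS; exact: measurable_fst.
have ig' r : s <= r <= t -> mu.-integrable U (EFin \o (g' ^~ r)).
  by move=> /sub/gL'; exact: in_L2_integrable.
have iA r : `[s, t]%classic r -> mu.-integrable U (fun x => (F (x, r))%:E).
  rewrite /= in_itv/= => rI.
  exact: (integrableM_bounded (ig' r rI) (bounded_mfun_psi k)).
have ib : mu.-integrable `[s, t] (EFin \o (fun=> 2 * B)).
  apply/integrableP; split; first by apply/measurable_EFinP; exact: measurable_cst.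
  rewrite integral_cst//= lebesgue_measure_itv/=.
  by case: ifP => _; rewrite -?EFinB -?EFinM ?mule0 ltry.
have hb r : `[s, t]%classic r -> \int[mu]_(x in U) `|F (x, r)| <= 2 * B.
  rewrite /= in_itv/= => rI; have i1 := ig' r rI.
  have iN : mu.-integrable U (EFin \o (fun x => `|F (x, r)|)).
    by apply: integrable_norm; apply: iA; rewrite /= in_itv.
  have i2 : mu.-integrable U (EFin \o (fun x => 2 * `|g' x r|)).
    by apply: eq_integrable (integrableZl _ 2 (integrable_norm i1)).
  apply: (@le_trans _ _ (\int[mu]_(x in U) (2 * `|g' x r|))).
    apply: le_Rintegral => // x _; rewrite /F normrM mulrC ler_wpM2r//; exact: psi_le.
  rewrite RintegralZl//; last exact: integrable_norm.
  rewrite ler_wpM2l//; apply: L1_le_coefs => //; first by apply: gL'; exact: sub.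
  by apply: hB.
pose P x := (g x t - g x s) * psi k x.
have mP : measurable_fun U P.
  apply: measurable_funM; last exact: measurable_psi.
  by apply: measurable_funB; [have [] := gL t tI|have [] := gL s sI].
have ih x : U x -> mu.-integrable `[s, t] (fun r => (F (x, r))%:E) ->
    P x = \int[mu]_(r in `[s, t]) F (x, r).
  move=> Ux iF; rewrite /P mulrBl.
  apply: (@FTC_everywhere _ s t (fun r => g x r * psi k x) (fun r => F (x, r)) st iF) => r rI e e0.
  have e30 : 0 < e / 2 by rewrite divr_gt0.
  have [d d0 hd] := h x Ux r (sub r rI) _ e30; exists d => // y yI yd.
  rewrite /F/= (_ : _ - _ - _ = (g x y - g x r - g' x r * (y - r)) * psi k x); last by ring.
  rewrite normrM (_ : e * _ = e / 2 * `|y - r| * 2); last by field.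
  by apply: ler_pM => //; [apply: hd => //; exact: sub|exact: psi_le].
have [i1 e1] := fubini_rect_dom mU mD mF iA ib hb mP ih.
split; first exact: i1.
rewrite -[RHS]e1 /P /L2_inner -RintegralB//.
- by apply: eq_Rintegral => x _; rewrite mulrBl.
- exact: (integrableM_bounded (in_L2_integrable (gL t tI)) (bounded_mfun_psi k)).
- exact: (integrableM_bounded (in_L2_integrable (gL s sI)) (bounded_mfun_psi k)).
Qed.

End CoefficientDerivative.

(** * Stability of one mode on an arbitrary partition *)

Section LaplaceKernel.
Context {R : realType} (alpha : R) (alpha01 : 0 < alpha < 1).
Local Notation mu := (@lebesgue_measure R).
Local Notation ray := (`]0, +oo[%classic : set R).
Local Notation kern x := (fun s : R => (x - s) `^ (alpha - 1)).

Let ek (p x s : R) := expR (- (p * (x - s))).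

Lemma Rint_exp (a b x p : R) : 0 < p -> a <= b ->
  mu.-integrable `[a, b[ (EFin \o ek p x) /\
  \int[mu]_(s in `[a, b[) ek p x s = expR (- (p * (x - b))) * expW p (b - a).
Proof.
move=> p0 ab; have p0' : p != 0 by rewrite gt_eqF.
have d (s : R) : is_derive s (1 : R) (fun s => p^-1 * ek p x s) (ek p x s).
  have d1 : is_derive s (1 : R) (fun s : R => - (p * (x - s))) p.
    have -> : (fun s : R => - (p * (x - s))) = (fun s => p * s - p * x) by apply/funext => r; ring.
    by apply: is_derive_eq; rewrite scaler1 subr0.
  have d2 := @is_derive1_comp R expR (fun s : R => - (p * (x - s))) s _ _ (is_derive_expR _) d1.
  have d3 := is_deriveZ p^-1 d2.
  by move: d3; move/is_derive_eq; apply; rewrite /= [_ *: _]mulrCA mulVf// mulr1.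
have ce : continuous (ek p x).
  move=> s; apply: continuous_comp; last exact: continuous_expR.
  by apply: cvgN; apply: cvgM; [exact: cvg_cst|apply: cvgB; [exact: cvg_cst|exact: cvg_id]].
have me D : measurable_fun D (ek p x).
  by apply: measurable_funTS; exact: continuous_measurable_fun.
have e1 : (\int[mu]_(s in `[a, b[) (ek p x s)%:E =
    (expR (- (p * (x - b))) * expW p (b - a))%:E)%E.
  rewrite integral_itv_bndo_bndc; last exact/measurable_EFinP.
  rewrite (@FTC2_segment _ _ (fun s => p^-1 * ek p x s))//; last exact: continuous_subspaceT.
  congr (_%:E); rewrite -mulrBr /expW /ek.
  have -> : - (p * (x - a)) = - (p * (x - b)) + - (p * (b - a)) by ring.
  by rewrite expRD; field.
split; last by rewrite /Rintegral e1.
apply/integrableP; split; first by apply/measurable_EFinP; exact: me.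
by under eq_integral do rewrite /= ger0_norm ?expR_ge0//; rewrite e1 ltry.
Qed.

Lemma exp_kernel_le (a b x p B : R) (g : R -> R) : 0 < p -> a <= b -> 0 <= B ->
  measurable_fun setT g -> (forall s, a <= s < b -> `|g s| <= B) ->
  mu.-integrable `[a, b[ (EFin \o (fun s => ek p x s * g s)) /\
  \int[mu]_(s in `[a, b[) `|ek p x s * g s| <= B * (expR (- (p * (x - b))) * expW p (b - a)).
Proof.
move=> p0 ab B0 mg gB; have [i1 e1] := Rint_exp x p0 ab.
have iB : mu.-integrable `[a, b[ (EFin \o (fun s => B * ek p x s)).
  by apply: eq_integrable (integrableZl _ B i1).
have le s : a <= s < b -> `|ek p x s * g s| <= B * ek p x s.
  by move=> sI; rewrite normrM ger0_norm ?expR_ge0// mulrC ler_wpM2r ?expR_ge0// gB.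
have i2 : mu.-integrable `[a, b[ (EFin \o (fun s => ek p x s * g s)).
  apply: le_integrable iB => //.
    apply/measurable_EFinP; apply: measurable_funM; last exact: measurable_funTS.
    by have /integrableP[/measurable_EFinP] := i1.
  move=> s; rewrite /= in_itv/= => sI; rewrite lee_fin (le_trans (le s sI))//; exact: ler_norm.
split => //; rewrite -e1 -RintegralZl//.
apply: le_Rintegral => //; first exact: integrable_norm i2.
Qed.

Lemma measurable_exp_kernel (D : set (R * R)) (x : R) (g : R -> R) : measurable_fun setT g ->
  measurable_fun D (fun z : R * R => ek z.2 x z.1 * g z.1).
Proof.
move=> mg; apply: measurable_funTS; apply: measurable_funM; last first.
  by apply: (measurableT_comp mg); exact: measurable_fst.
rewrite /ek; apply: measurableT_comp; first exact: measurable_expR.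
apply: measurable_funN; apply: measurable_funM; first exact: measurable_snd.
by apply: measurable_funB => //; exact: measurable_fst.
Qed.

(** Fubini and [LI_exp]. The exponential convolutions are dominated by [B * expW p (b - a)],
    integrable against [p^(- alpha)] even if [b = x], where the power kernel is singular at the end
    of the cell. *)
Lemma LI_link (a b x B : R) (g : R -> R) : a <= b -> b <= x -> 0 <= B ->
  measurable_fun setT g -> (forall s, a <= s < b -> `|g s| <= B) ->
  inL alpha (fun p => \int[mu]_(s in `[a, b[) (ek p x s * g s)) /\
  LI alpha (fun p => \int[mu]_(s in `[a, b[) (ek p x s * g s)) =
    cL alpha * \int[mu]_(s in `[a, b[) (kern x s * g s).
Proof.
move=> ab bx B0 mg gB.
pose F (z : R * R) := ek z.2 x z.1 * g z.1 * z.2 `^ (- alpha).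
have mA : measurable (`[a, b[%classic : set R) by exact: measurable_itv.
have mD : measurable ray by exact: measurable_itv.
have mpow D : measurable_fun D (fun p : R => p `^ (- alpha)).
  by apply: measurable_funTS; exact: measurable_powR.
have mF : measurable_fun (`[a, b[ `*` ray) F.
  apply: measurable_funM; first exact: measurable_exp_kernel.
  apply: measurable_funTS; apply: (measurableT_comp (f := fun p : R => p `^ (- alpha))) => //.
have rayP p : ray p -> 0 < p by rewrite /= in_itv/= andbT.
have iA p : ray p -> mu.-integrable `[a, b[ (fun s => (F (s, p))%:E).
  move=> /rayP p0; have [i1 _] := exp_kernel_le x p0 ab B0 mg gB.
  by apply: eq_integrable (integrableZr _ (p `^ (- alpha)) i1).
have iE : inL alpha (fun p => expW p (b - a)).
  by have [] := @LI_expW _ _ alpha01 (b - a) _; rewrite ?subr_ge0.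
have ib : mu.-integrable ray (EFin \o (fun p => B * (expW p (b - a) * p `^ (- alpha)))).
  by apply: eq_integrable (integrableZl _ B iE).
have hb p : ray p -> \int[mu]_(s in `[a, b[) `|F (s, p)| <= B * (expW p (b - a) * p `^ (- alpha)).
  move=> /rayP p0; have [i1 le1] := exp_kernel_le x p0 ab B0 mg gB.
  under eq_Rintegral do rewrite /F/= normrM (ger0_norm (powR_ge0 _ _)).
  rewrite RintegralZr//; last exact: integrable_norm i1.
  rewrite mulrA ler_wpM2r ?powR_ge0//; apply: (le_trans le1).
  rewrite ler_wpM2l// ler_piMl ?expW_ge0 ?subr_ge0//.
  by rewrite -expR0 ler_expR oppr_le0 mulr_ge0 ?subr_ge0// ltW.
pose P s := cL alpha * (kern x s * g s).
have mP : measurable_fun `[a, b[ P.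
  apply: measurable_funM => //; apply: measurable_funM; first exact: measurable_kern.
  exact: measurable_funTS.
have hP s : `[a, b[%classic s -> mu.-integrable ray (fun p => (F (s, p))%:E) ->
    P s = \int[mu]_(p in ray) F (s, p).
  rewrite /= in_itv/= => /andP[_ sb] _; have xs : 0 < x - s by rewrite subr_gt0 (lt_le_trans sb).
  have e p : F (s, p) = expR (- (p * (x - s))) * p `^ (- alpha) * g s by rewrite /F/= mulrAC.
  under eq_Rintegral do rewrite e.
  rewrite RintegralZr//; last exact: (inL_exp alpha01 xs).
  by rewrite -/(LI alpha _) (LI_exp alpha01 xs) /P mulrA.
have [i1 e1] := fubini_rect_dom mA mD mF iA ib hb mP hP.
have ee p : ray p -> \int[mu]_(s in `[a, b[) F (s, p) =
    (\int[mu]_(s in `[a, b[) (ek p x s * g s)) * p `^ (- alpha).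
  move=> /rayP p0; have [j1 _] := exp_kernel_le x p0 ab B0 mg gB.
  by rewrite -RintegralZr.
split.
  by apply: eq_integrable i1 => // p /set_mem/ee h; rewrite /= h.
rewrite -RintegralZl//; last first.
  apply: (@integrable_kernM _ _ alpha01 _ _ _ _ B) => //; first by rewrite ab.
  exact: measurable_funTS.
rewrite -[RHS]/(\int[mu]_(s in `[a, b[) P s) e1 /LI.
by apply: eq_Rintegral => p /set_mem/ee ->.
Qed.

End LaplaceKernel.

Section ModeError.
Context {R : realType} (alpha T lam0 : R) (alpha01 : 0 < alpha < 1).
Context (T0 : 0 < T) (l00 : 0 < lam0).
Local Notation mu := (@lebesgue_measure R).
Local Notation ray := (`]0, +oo[%classic : set R).
Local Notation kern x := (fun s : R => (x - s) `^ (alpha - 1)).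
Local Notation ek p x s := (expR (- (p * (x - s)))).

Lemma step_le_tau_max N (t : nat -> R) k : (k < N)%N -> t k.+1 - t k <= tau_max N t.
Proof.
move=> kN; rewrite /tau_max.
by apply: (@le_bigmax_seq _ _ _ _ 0 k.+1 xpredT (tau t)) => //; rewrite mem_index_iota.
Qed.

Lemma tau_max_bounds N t : is_partition T N t -> 0 < tau_max N t <= T.
Proof.
move=> [t00 tN inc]; have N0 : (0 < N)%N.
  by rewrite lt0n; apply/negP => /eqP e; move: tN T0; rewrite e t00 => <-; rewrite ltxx.
rewrite (lt_le_trans _ (step_le_tau_max t N0)) ?subr_gt0 ?inc//=.
rewrite /tau_max big_nat_cond; apply: bigmax_le => [|[|i]]; first exact: ltW.
  by [].
move=> /andP[/andP[_ iN] _]; rewrite /tau/= -tN; have iN' : (i.+1 <= N)%N := iN.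
have h1 := increasing_upto_le inc (ltnW iN') (leqnn N); have h2 : 0 <= t i.
  by rewrite -t00; apply: (increasing_upto_le inc) => //; exact: ltnW.
have h3 : t i.+1 <= t N by apply: (increasing_upto_le inc).
by rewrite lerBlDr (le_trans h3)// lerDl.
Qed.

Section OneMode.
Context (N : nat) (t : nat -> R) (lam beta dq : R) (m q : R -> R) (x : nat -> R).
Context (tP : is_partition T N t) (lamP : lam0 <= lam) (beta0 : 0 <= beta).
Context (mL : lipschitz_in setT (beta / lam) m) (qL : lipschitz_in `[0, T] (beta / lam) q).
Context (qd : forall s, 0 <= s <= T -> `|q s| <= dq).
Context (xE : forall n, (n <= N)%N -> x n + q (t n) =
  - lam * (\int[mu]_(s in `[0, t n[) (kern (t n) s * m s) -
    \sum_(0 <= k < n) weight alpha t n k * ((m (t k) - x k + (m (t k.+1) - x k.+1)) / 2))).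

Let lam_gt0 : 0 < lam. Proof. exact: lt_le_trans lamP. Qed.
Let t00 : t 0 = 0. Proof. by case: tP. Qed.
Let inc : increasing_upto N t. Proof. by case: tP. Qed.
Let tle a b : (a <= b)%N -> (b <= N)%N -> t a <= t b.
Proof. exact: increasing_upto_le. Qed.
Let tI n : (n <= N)%N -> 0 <= t n <= T.
Proof. by move=> nN; rewrite -t00 tle//=; case: tP => _ <- _; exact: tle. Qed.
Let cm : continuous m. Proof. exact: lipschitz_inT_continuous mL. Qed.

(** On cell [k] the integrand of the error equation is [c k + gam k s]: the averaged unknown, plus
    the deviation of [- lam * m] from its average, of size [beta] times the step. [gr] collects
    [gam] in the kernel form, [s_] in the Laplace form. *)
Let c k := - (lam * ((x k + x k.+1) / 2)).
Let gam k s := - lam * (m s - (m (t k) + m (t k.+1)) / 2).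
Let gr n := \sum_(0 <= k < n) \int[mu]_(s in `[t k, t k.+1[) (kern (t n) s * gam k s).
Let s_ k p := \int[mu]_(s in `[t k, t k.+1[) (ek p (t k.+1) s * gam k s).

Let mgam k : measurable_fun setT (gam k).
Proof.
apply: measurable_funM => //; apply: measurable_funB => //.
exact: continuous_measurable_fun.
Qed.

Let gam_le k s : t k <= s < t k.+1 -> `|gam k s| <= beta * (t k.+1 - t k).
Proof.
move=> /andP[s1 s2]; rewrite /gam normrM normrN (gtr0_norm lam_gt0).
have h1 : `|m s - m (t k)| <= beta / lam * (t k.+1 - t k).
  apply: (le_trans (mL I I)); rewrite ler_wpM2l ?divr_ge0 ?(ltW lam_gt0)//.
  by rewrite ger0_norm ?subr_ge0// lerD2r ltW.
have h2 : `|m s - m (t k.+1)| <= beta / lam * (t k.+1 - t k).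
  apply: (le_trans (mL I I)); rewrite ler_wpM2l ?divr_ge0 ?(ltW lam_gt0)//.
  by rewrite distrC ger0_norm ?subr_ge0 ?(ltW s2)// lerD2l lerN2.
have -> : m s - (m (t k) + m (t k.+1)) / 2 = ((m s - m (t k)) + (m s - m (t k.+1))) / 2.
  by field.
have h3 : `|((m s - m (t k)) + (m s - m (t k.+1))) / 2| <= beta / lam * (t k.+1 - t k).
  rewrite normrM [`|2^-1|]ger0_norm// ler_pdivrMr// (le_trans (ler_normD _ _))//.
  by rewrite mulr_natr mulr2n lerD.
apply: (@le_trans _ _ (lam * (beta / lam * (t k.+1 - t k)))).
  by rewrite ler_wpM2l// ltW.
by rewrite le_eqVlt; apply/orP; left; apply/eqP; field; rewrite gt_eqF.
Qed.

Let dt0 k : (k < N)%N -> t k <= t k.+1. Proof. by move=> kN; exact: tle. Qed.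
Let B0 k : (k < N)%N -> 0 <= beta * (t k.+1 - t k).
Proof. by move=> kN; rewrite mulr_ge0// subr_ge0 dt0. Qed.

Let g_le k s : t k <= s < t k.+1 -> `|c k + gam k s| <= `|c k| + beta * (t k.+1 - t k).
Proof. by move=> h; rewrite (le_trans (ler_normD _ _))// lerD2l gam_le. Qed.
Let gB0 k : (k < N)%N -> 0 <= `|c k| + beta * (t k.+1 - t k).
Proof. by move=> kN; rewrite addr_ge0// B0. Qed.
Let mg k : measurable_fun setT (fun s => c k + gam k s).
Proof. exact: measurable_funD. Qed.

Let ms k : (k < N)%N -> measurable_fun ray (s_ k).
Proof.
move=> kN; have [iL _] := LI_link alpha01 (dt0 kN) (lexx _) (B0 kN) (mgam k) (@gam_le k).
have /integrableP[/measurable_EFinP mL' _] := iL.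
apply: (eq_measurable_fun (fun p => s_ k p * p `^ (- alpha) * p `^ alpha)).
  move=> p /set_mem; rewrite /= in_itv/= andbT => p0.
  rewrite -mulrA -powRD; last by rewrite (gt_eqF p0) implybT.
  by rewrite addNr powRr0 mulr1.
apply: measurable_funM => //; apply: measurable_funTS; exact: measurable_powR.
Qed.

Let s_le k p : (k < N)%N -> 0 < p ->
  `|s_ k p| <= beta * (t k.+1 - t k) * expW p (t k.+1 - t k).
Proof.
move=> kN p0; have [i1 h] := exp_kernel_le (t k.+1) p0 (dt0 kN) (B0 kN) (mgam k) (@gam_le k).
rewrite (le_trans (le_normr_Rintegral _ i1))// (le_trans h)//.
by rewrite subrr mulr0 oppr0 expR0 mul1r.
Qed.

Let state_Rint n p : (n <= N)%N -> 0 < p -> state t c s_ n p =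
  \sum_(0 <= k < n) \int[mu]_(s in `[t k, t k.+1[) (ek p (t n) s * (c k + gam k s)).
Proof.
move=> + p0; elim: n => [|n IH] nN; first by rewrite big_geq.
rewrite big_nat_recr//= IH; last exact: ltnW.
rewrite -addrA; congr (_ + _).
  rewrite mulr_sumr; apply: eq_big_nat => k /andP[_ kn].
  have kN : (k < N)%N by apply: leq_trans nN; exact: ltnW.
  have [i1 _] := exp_kernel_le (t n) p0 (dt0 kN) (gB0 kN) (mg k) (@g_le k).
  rewrite -RintegralZl//; apply: eq_Rintegral => s _; rewrite mulrA -expRD.
  by congr (expR _ * _); ring.
have [i1 _] := exp_kernel_le (t n.+1) p0 (dt0 nN) (B0 nN) (mgam n) (@gam_le n).
have [i2 e2] := Rint_exp (t n.+1) p0 (dt0 nN).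
have i3 : mu.-integrable `[t n, t n.+1[ (EFin \o (fun s => c n * ek p (t n.+1) s)).
  by apply: eq_integrable (integrableZl _ (c n) i2).
transitivity (\int[mu]_(s in `[t n, t n.+1[) (c n * ek p (t n.+1) s + ek p (t n.+1) s * gam n s)).
  by rewrite RintegralD// RintegralZl// e2 subrr mulr0 oppr0 expR0 mul1r.
by apply: eq_Rintegral => s _; ring.
Qed.

Let Rint_weight n k : (n <= N)%N -> (k < n)%N ->
  \int[mu]_(s in `[t k, t k.+1[) kern (t n) s = weight alpha t n k.
Proof. by move=> nN kn; rewrite Rint_kern// tle ?tle//; apply: leq_trans nN. Qed.

Let tkn n k : (n <= N)%N -> (k < n)%N -> t k <= t k.+1 <= t n.
Proof. by move=> nN kn; rewrite !tle//; apply: leq_trans nN. Qed.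

Let xE' n : (n <= N)%N -> x n + q (t n) =
  \sum_(0 <= k < n) weight alpha t n k * - (lam * ((x k + x k.+1) / 2)) + gr n.
Proof.
move=> nN; rewrite xE// /gr -big_split/=.
pose B := `|m 0| + beta / lam * T.
have mB s : 0 <= s <= T -> `|m s| <= B.
  move=> /andP[s0 sT]; rewrite -[m s](subrK (m 0)) addrC (le_trans (ler_normD _ _))//.
  rewrite lerD2l (le_trans (mL I I))// ler_wpM2l ?divr_ge0 ?(ltW lam_gt0)//.
  by rewrite subr0 ger0_norm.
have mm D : measurable_fun D m by apply: measurable_funTS; exact: continuous_measurable_fun.
have /andP[tn0 tnT] := tI nN.
have i0 : mu.-integrable `[t 0%N, t n[ (EFin \o (fun s => kern (t n) s * m s)).
  apply: (@integrable_kernM _ _ alpha01 _ _ _ _ B) => //; first by rewrite t00 tn0 lexx.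
  by move=> s /andP[h1 h2]; apply: mB; rewrite -t00 h1 (le_trans (ltW h2)).
rewrite -{1}t00 Rint_cells//; last by move=> k kn; apply: tle => //; apply: leq_trans nN.
rewrite mulrBr !mulr_sumr -sumrB; apply: eq_big_nat => k /andP[_ kn].
have h := tkn nN kn; have /andP[tk0 tkT] := tI (leq_trans (ltnW kn) nN).
have /andP[tk0' tkT'] := tI (leq_trans kn nN).
have i1 : mu.-integrable `[t k, t k.+1[ (EFin \o (fun s => kern (t n) s * m s)).
  apply: (@integrable_kernM _ _ alpha01 _ _ _ _ B) => //.
  by move=> s /andP[h1 h2]; apply: mB; rewrite (le_trans tk0 h1) (le_trans (ltW h2)).
have i2 := integrable_kern alpha01 h.
pose A := lam * ((m (t k) + m (t k.+1)) / 2).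
have -> : \int[mu]_(s in `[t k, t k.+1[) (kern (t n) s * gam k s) =
    \int[mu]_(s in `[t k, t k.+1[) (- lam * (kern (t n) s * m s) + A * kern (t n) s).
  by apply: eq_Rintegral => s _; rewrite /gam /A; ring.
rewrite RintegralD//.
- rewrite !RintegralZl// (Rint_weight nN kn) /A; ring.
- by apply: eq_integrable (integrableZl _ (- lam) i1).
- by apply: eq_integrable (integrableZl _ A i2).
Qed.

Let gr_le n : (n <= N)%N -> `|gr n| <= beta * tau_max N t * (T `^ alpha / alpha).
Proof.
move=> nN; rewrite /gr (le_trans (ler_norm_sum _ _ _))//.
have a0 : 0 < alpha by case/andP: alpha01.
have /andP[tau0 _] := tau_max_bounds tP; have /andP[tn0 tnT] := tI nN.
apply: (@le_trans _ _ (\sum_(0 <= k < n) weight alpha t n k * (beta * tau_max N t))).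
  rewrite big_nat_cond [leRHS]big_nat_cond; apply: ler_sum => k /andP[/andP[_ kn] _].
  have kN := leq_trans kn nN; rewrite -(Rint_weight nN kn) Rint_kern ?tkn//.
  apply: (Rint_kernM_le alpha01 (tkn nN kn)); first exact: measurable_funTS.
  by move=> s sI; rewrite (le_trans (gam_le sI))// ler_wpM2l// step_le_tau_max.
rewrite -mulr_suml sum_weight// mulrC ler_wpM2l ?mulr_ge0 ?(ltW tau0)//.
rewrite ler_wpM2r ?invr_ge0 ?(ltW a0)// t00 subr0 ge0_ler_powR ?nnegrE ?(ltW a0)//.
by rewrite (le_trans tn0).
Qed.

Let xL n : (n <= N)%N -> cL alpha * (x n + q (t n)) = LI alpha (state t c s_ n).
Proof.
move=> nN; rewrite (@LI_eq _ _ _ (fun p => \sum_(0 <= k < n)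
    \int[mu]_(s in `[t k, t k.+1[) (ek p (t n) s * (c k + gam k s)))); last first.
  by move=> p p0; exact: state_Rint.
have link k (kn : (k < n)%N) := LI_link alpha01 (dt0 (leq_trans kn nN)) (tle kn nN)
  (gB0 (leq_trans kn nN)) (mg k) (@g_le k).
rewrite LI_sum; last by move=> k /andP[_ kn]; have [] := link k kn.
rewrite xE'// mulrDr /gr !mulr_sumr -big_split/=; apply: eq_big_nat => k /andP[_ kn].
have [_ ->] := link k kn; rewrite -mulrDr; congr (_ * _).
have kN := leq_trans kn nN.
have i1 := integrable_kern alpha01 (tkn nN kn).
have i2 : mu.-integrable `[t k, t k.+1[ (EFin \o (fun s => kern (t n) s * gam k s)).
  apply: (@integrable_kernM _ _ alpha01 _ _ _ _ (beta * (t k.+1 - t k))); first exact: tkn.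
    exact: measurable_funTS.
  exact: gam_le.
rewrite -(Rint_weight nN kn) -RintegralZr// -RintegralD//; last first.
  by apply: eq_integrable (integrableZr _ (c k) i1).
by apply: eq_Rintegral => s _; rewrite mulrDr.
Qed.

Lemma mode_scheme_error :
  scheme_error alpha T lam0 N t lam beta (tau_max N t) dq x (q \o t) gr s_.
Proof.
split => //.
- by case: tP => _ ->.
- exact: tau_max_bounds.
- by move=> k kN; exact: step_le_tau_max.
- move=> k kN; have h := qL (tI (ltnW kN)) (tI kN).
  apply: (@le_trans _ _ (lam * (beta / lam * `|t k.+1 - t k|))).
    by rewrite ler_wpM2l// ltW.
  rewrite ger0_norm ?subr_ge0 ?dt0// le_eqVlt; apply/orP; left; apply/eqP; field.
  by rewrite gt_eqF.
- by move=> n nN; exact: (qd (tI nN)).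
Qed.

End OneMode.

Lemma mode_stability : exists2 C, 0 < C & forall N t lam beta dq m q x,
  is_partition T N t -> lam0 <= lam -> 0 <= beta ->
  lipschitz_in `[0, T] (beta / lam) m -> lipschitz_in `[0, T] (beta / lam) q ->
  (forall s, 0 <= s <= T -> `|q s| <= dq) ->
  (forall n, (n <= N)%N -> x n + q (t n) =
    - lam * (\int[mu]_(s in `[0, t n[) (kern (t n) s * m s) -
      \sum_(0 <= k < n) weight alpha t n k * ((m (t k) - x k + (m (t k.+1) - x k.+1)) / 2))) ->
  forall n, (n <= N)%N -> `|x n + q (t n)| <= C * (beta * tau_max N t + dq).
Proof.
have [C C0 hC] := scalar_stability alpha01 T0 l00.
exists C => // N t lam beta dq m q x tP lamP beta0 mL qL qd xE n nN.
have bl : 0 <= beta / lam by rewrite divr_ge0// (le_trans (ltW l00)).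
have T00 : (`[0, T] : set R) !=set0 by exists 0; rewrite /= in_itv/= lexx ltW.
(* The extension agrees with [m] on [[0, T]], so the integrals and grid values in the equation are
   unchanged. *)
have [mt mtL mtE] := lipschitz_extension T00 bl mL.
have tI k : (k <= N)%N -> 0 <= t k <= T.
  case: tP => t0 tN inc kN.
  by rewrite -{1}t0 -tN (increasing_upto_le inc)// (increasing_upto_le inc).
apply: (hC _ _ _ _ _ _ _ _ _ _ (mode_scheme_error tP lamP beta0 mtL qL qd _)) => //.
move=> k kN; rewrite xE//; congr (_ * (_ - _)).
  apply: eq_Rintegral => s /set_mem; rewrite /= in_itv/= => /andP[s0 sk]; rewrite mtE//.
  by rewrite /= in_itv/= s0 (le_trans (ltW sk))//; have /andP[] := tI k kN.
apply: eq_big_nat => l /andP[_ lk].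
have lN := leq_trans lk kN.
by rewrite !mtE ?tI//=; rewrite in_itv/= tI// ltnW.
Qed.

End ModeError.

(** * Regularity of the solution and of the source *)

Section RegularSolution.
Context {R : realType}.
Local Notation mu := (@lebesgue_measure R).
Local Notation U := (`]0, 1[%classic : set R).

Lemma compact_fun_bounded (X : topologicalType) (A : set X) (F : X -> R) :
  compact A -> {within A, continuous F} ->
  exists2 K, 0 <= K & forall x, A x -> `|F x| <= K.
Proof.
move=> cA cF; have [M [_ hM]] := compact_bounded (continuous_compact cF cA).
exists (`|M| + 1) => [|x Ax]; first by rewrite addr_ge0.
by apply: hM; [rewrite (le_lt_trans (ler_norm M))// ltrDl|exists x].
Qed.

Context (T : R) (u : R -> R -> R) (T0 : 0 < T).
Context (u_dx6 : forall x t : R, 0 <= x <= 1 -> 0 <= t <= T -> dx_exists 6 u x t).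
Context (u_dx6_cont : {within (`[0, 1] `*` `[0, T] : set (R * R)),
   continuous (fun p : R * R => dx 6 u p.1 p.2)}).
Context (u_dt : forall x t : R, 0 <= x <= 1 -> 0 <= t <= T -> derivableS `[0, T] (u x) t).
Context (u_dt_cont : {within (`[0, 1] `*` `[0, T] : set (R * R)),
   continuous (fun p : R * R => dt_cc T u p.1 p.2)}).

Let rect : set (R * R) := `[0, 1] `*` `[0, T].
Let compact_rect : compact rect.
Proof. by apply: compact_setX; exact: segment_compact. Qed.
Let rectP x t : 0 <= x <= 1 -> 0 <= t <= T -> rect (x, t).
Proof. by move=> h1 h2; split; rewrite /= in_itv. Qed.

Lemma chain_dx t : 0 <= t <= T -> chain 6 (fun j x => dx j u x t).
Proof.
move=> tT; split => j => [x j6 /andP[x0 x1]|j6].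
  apply: (@derivableS_is_derive _ `[0, 1] _ _ (Num.min x (1 - x))).
  - by rewrite lt_min x0 subr_gt0.
  - by move=> y; rewrite lt_min => /andP[h1 h2] /=; rewrite in_itv/=; move: h1 h2;
      rewrite !ltr_norml => /andP[h1 _] /andP[_ h2]; lra.
  - by apply: u_dx6 => //; rewrite !ltW.
apply: (@derivableS_within_continuous _ `[0, 1]) => x; rewrite /= in_itv/= => xI.
exact: u_dx6.
Qed.

Lemma dx6_bounded : exists2 K, 0 <= K &
  forall x t, 0 <= x <= 1 -> 0 <= t <= T -> `|dx 6 u x t| <= K.
Proof.
have [K K0 hK] := compact_fun_bounded compact_rect u_dx6_cont.
by exists K => // x t xI tI; apply: (hK (x, t)); exact: rectP.
Qed.

Lemma solution_time_lipschitz : exists2 L, 0 <= L &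
  forall x, 0 <= x <= 1 -> lipschitz_in `[0, T] L (u x).
Proof.
have [L L0 hL] := compact_fun_bounded compact_rect u_dt_cont.
exists L => // x xI.
have mono s t : 0 <= s -> s <= t -> t <= T -> `|u x t - u x s| <= L * `|t - s|.
  move=> s0 st tT; have [|||c] := @MVT_segment R (u x) (dt_cc T u x) s t.
  - by [].
  - move=> y; rewrite in_itv/= => /andP[sy yt].
    apply: (@derivableS_is_derive _ `[0, T] _ _ (Num.min (y - s) (t - y))).
    + by rewrite lt_min !subr_gt0 sy.
    + by move=> z; rewrite lt_min => /andP[h1 h2] /=; rewrite in_itv/=; move: h1 h2;
        rewrite !ltr_norml => /andP[h1 _] /andP[_ h2]; lra.
    + by apply: u_dt => //; lra.
  - apply: (@continuous_subspaceW _ _ _ `[0, T]).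
      by move=> z /=; rewrite !in_itv/=; lra.
    by apply: derivableS_within_continuous => z; rewrite /= in_itv/= => zI; exact: u_dt.
  - rewrite in_itv/= => cI ->; rewrite normrM ler_wpM2r//.
    by apply: (hL (x, c)); apply: rectP => //; lra.
move=> s t; rewrite /= !in_itv/= => /andP[s0 sT] /andP[t0 tT].
have [st|/ltW ts] := leP s t; first exact: mono.
by rewrite distrC [`|t - s|]distrC mono.
Qed.

Lemma dx_bounded j : (j <= 6)%N -> exists2 D, 0 <= D &
  forall x t, 0 <= x <= 1 -> 0 <= t <= T -> `|dx j u x t| <= D.
Proof.
move=> j6; have [K K0 hK] := dx6_bounded; have [L L0 hL] := solution_time_lipschitz.
have t0I : 0 <= (0 : R) <= T by rewrite lexx ltW.
have [_ /(_ 0%N isT) c0] := chain_dx t0I.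
have [B B0 hB] := compact_fun_bounded (@segment_compact _ 0 1) c0.
have BL0 : 0 <= B + L * T by rewrite addr_ge0// mulr_ge0// ltW.
have [D D0 hD] := @chain_bound R 6 (B + L * T) K j BL0 K0 j6.
exists D => // x t xI tI; apply: (hD _ (chain_dx tI)) => // y yI; last exact: hK.
rewrite /= -[u y t](subrK (u y 0)) addrC (le_trans (ler_normD _ _))// lerD//.
  by apply: hB; rewrite /= in_itv.
have := hL y yI 0 t; rewrite /= !in_itv/= lexx (ltW T0) tI => /(_ isT isT).
move=> /le_trans; apply; rewrite ler_wpM2l//.
by case/andP: tI => t0 tT; rewrite subr0 ger0_norm.
Qed.

(** Continuity of [u_xx] in time is obtained by interpolation: the increment of [u] is small in sup
    norm, so by [chain_small] its second derivative is small at some point within [r] of [x], and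
    the bound on the third derivative carries this to [x]. *)
Lemma dx2_time_continuous x t e : 0 <= x <= 1 -> 0 <= t <= T -> 0 < e ->
  exists2 d, 0 < d & forall s, 0 <= s <= T -> `|s - t| < d ->
    `|dx 2 u x s - dx 2 u x t| <= e.
Proof.
move=> xI tI e0; have [L L0 hL] := solution_time_lipschitz.
have [D D0 hD] := @dx_bounded 3 isT.
(* The bound [1 / 2] leaves room for an interval of length [r] on one side of [x]; the other bound
   keeps the drift [2 * D * r] below [e / 2]. *)
pose r := Num.min (2^-1) (e / (4 * (D + 1))).
have D10 : 0 < 4 * (D + 1) by lra.
have r0 : 0 < r by rewrite lt_min invr_gt0 ltr0n divr_gt0.
have r12 : r <= 2^-1 by rewrite /r ge_min lexx.
have rD : 2 * D * r <= e / 2.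
  have : r <= e / (4 * (D + 1)) by rewrite /r ge_min lexx orbT.
  by rewrite ler_pdivlMr// => h; nra.
have lan := @landau_gt0 R 2.
pose W := landau 2 * L + 1.
have W0 : 0 < W by rewrite ltr_wpDl// mulr_ge0// ltW.
exists (e * r ^+ 2 / (2 * W)) => [|s sI st].
  by rewrite divr_gt0 ?mulr_gt0 ?exprn_gt0.
pose w j y := dx j u y s - dx j u y t.
have cw : chain 6 w.
  have [d1 c1] := chain_dx sI; have [d2 c2] := chain_dx tI.
  split => j => [y j6 yI|j6]; first by apply: is_deriveB; [exact: d1|exact: d2].
  by move=> y; apply: cvgB; [exact: (c1 j j6 y)|exact: (c2 j j6 y)].
have [a [b [a0 b1 abr xab]]] : exists a b, [/\ 0 <= a, b <= 1, b - a = r & a <= x <= b].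
  have [x12|x12] := leP x 2^-1.
    by exists x, (x + r); split; lra.
  by exists (x - r), x; split; lra.
have ab : a < b by lra.
have w0 y : 0 <= y <= 1 -> `|w 0 y| <= L * `|s - t|.
  by move=> yI; apply: (hL y yI t s); rewrite /= in_itv.
have [c cab wc] := chain_small cw w0 (isT : (2 <= 6)%N) a0 ab b1.
rewrite abr in wc.
have cI : 0 <= c <= 1 by lra.
have w3 y : 0 < y < 1 -> `|w 3 y| <= 2 * D.
  move=> /andP[y0 y1]; rewrite (le_trans (ler_normB _ _))// mulr_natl mulr2n.
  by rewrite lerD// hD// !ltW.
have D20 : 0 <= 2 * D by rewrite mulr_ge0.
have h := chain_descend cw (isT : (2 < 6)%N) D20 w3 xI cI.
have xc : `|x - c| <= r by rewrite ler_norml; lra.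
have h2 : `|w 2 x - w 2 c| <= e / 2.
  by apply: (le_trans h); apply: le_trans rD; rewrite ler_wpM2l.
have h3 : `|w 2 c| <= e / 2.
  apply: (le_trans wc); rewrite ler_pdivrMr ?exprn_gt0//.
  have st' : `|s - t| * (2 * W) <= e * r ^+ 2.
    by rewrite -ler_pdivlMr ?mulr_gt0// ltW.
  have : landau 2 * L * `|s - t| <= W * `|s - t| by rewrite ler_wpM2r// lerDl.
  by rewrite mulrA => h4; nra.
rewrite -/(w 2 x) -[w 2 x](subrK (w 2 c)) (le_trans (ler_normD _ _))//.
by rewrite [e]splitr lerD.
Qed.

Lemma measurable_dx j t : (j < 6)%N -> 0 <= t <= T -> measurable_fun U (dx j u ^~ t).
Proof.
move=> j6 tI; have [_ c] := chain_dx tI.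
have m : measurable_fun (`[0, 1]%classic : set R) (dx j u ^~ t).
  by apply: subspace_continuous_measurable_fun; [exact: measurable_itv|exact: c].
apply: measurable_funS m; first exact: measurable_itv.
by move=> x; rewrite /= !in_itv/= => /andP[h1 h2]; rewrite !ltW.
Qed.

Lemma is_derive_sinM (a x : R) : is_derive x (1 : R) (fun y => sin (a * y)) (a * cos (a * x)).
Proof.
have d1 : is_derive x (1 : R) (fun y : R => a * y) a.
  by apply: is_derive_eq; rewrite scaler1.
have d2 := @is_derive1_comp R sin (fun y => a * y) x _ _ (is_derive_sin _) d1.
by move: d2; move/is_derive_eq; apply; rewrite mulrC.
Qed.

Lemma is_derive_cosM (a x : R) : is_derive x (1 : R) (fun y => cos (a * y)) (- (a * sin (a * x))).
Proof.
have d1 : is_derive x (1 : R) (fun y : R => a * y) a.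
  by apply: is_derive_eq; rewrite scaler1.
have d2 := @is_derive1_comp R cos (fun y => a * y) x _ _ (is_derive_cos _) d1.
by move: d2; move/is_derive_eq; apply; rewrite mulNr mulrC.
Qed.

Lemma dx2_coef t k : 0 <= t <= T -> u 0 t = 0 -> u 1 t = 0 ->
  L2_inner (dx 2 u ^~ t) (psi k) = - lambda k * L2_inner (u ^~ t) (psi k).
Proof.
move=> tI u0 u1; have [d c] := chain_dx tI.
pose a : R := k%:R * pi.
pose P (y : R) := Num.sqrt 2 * sin (a * y).
pose Q (y : R) := Num.sqrt 2 * a * cos (a * y).
have dP y : is_derive y (1 : R) P (Q y).
  by have := is_deriveZ (Num.sqrt 2) (is_derive_sinM a y); move/is_derive_eq; apply; rewrite /Q -mulrA.
have dQ y : is_derive y (1 : R) Q (- (a ^+ 2) * P y).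
  have := is_deriveZ (Num.sqrt 2 * a) (is_derive_cosM a y); move/is_derive_eq; apply.
  by rewrite /P [_ *: _]/GRing.scale/=; ring.
have cP : continuous P.
  by move=> y; apply/differentiable_continuous/derivable1_diffP; have [] := dP y.
have cQ : continuous Q.
  by move=> y; apply/differentiable_continuous/derivable1_diffP; have [] := dQ y.
have P0 : P 0 = 0 by rewrite /P mulr0 sin0 mulr0.
have P1 : P 1 = 0.
  by rewrite /P mulr1 /a mulr_natl -[pi *+ _]add0r (alternatingn (@sinDpi R)) sin0 !mulr0.
pose w j x := dx j u x t.
(* Green's formula: [F] has derivative [f], and it vanishes at both ends because the solution and
   the sine do. *)
pose F x := w 1 x * P x - w 0 x * Q x.
pose f x := w 2 x * P x + a ^+ 2 * (w 0 x * P x).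
have dF (x : R) : 0 < x < 1 -> is_derive x (1 : R) F (f x).
  move=> xI; have e1 := d 0%N x isT xI; have e2 := d 1%N x isT xI.
  have := is_deriveB (is_deriveM e2 (dP x)) (is_deriveM e1 (dQ x)).
  move/is_derive_eq; apply; rewrite /f /w ![_ *: _]/GRing.scale/=; ring.
have cc (G H : R -> R) : {within `[0, 1], continuous G} -> continuous H ->
    {within `[(0 : R), 1], continuous (fun x => G x * H x)}.
  by move=> cG cH x; apply: cvgM; [exact: cG|exact: (continuous_subspaceT cH)].
have cF : {within `[0, 1], continuous F}.
  by move=> x; apply: cvgB; [exact: (cc _ _ (c 1%N isT) cP)|exact: (cc _ _ (c 0%N isT) cQ)].
have cf : {within `[0, 1], continuous f}.
  move=> x; apply: cvgD; first exact: (cc _ _ (c 2%N isT) cP).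
  by apply: cvgM; [exact: cvg_cst|exact: (cc _ _ (c 0%N isT) cP)].
have h1 : derivable_oo_LRcontinuous F 0 1.
  have [_ l r] := (continuous_within_itvP F ltr01).1 cF.
  by split => // x; rewrite in_itv/= => xI; have [] := dF x xI.
have h2 : {in `]0, 1[, derive1 F =1 f}.
  by move=> x; rewrite in_itv/= => xI; rewrite derive1E; have [_ <-] := dF x xI.
have h := continuous_FTC2 ltr01 cf h1 h2.
have mw j : (j < 6)%N -> measurable_fun U (w j) by move=> j6; exact: measurable_dx.
have mP : measurable_fun U P by apply: measurable_funTS; exact: continuous_measurable_fun.
have mf : measurable_fun (`[0, 1]%classic : set R) (EFin \o f).
  by apply/measurable_EFinP; apply: subspace_continuous_measurable_fun.
have mf' (i : interval R) : [set` i] `<=` `[0, 1] -> measurable [set` i] -> measurable_fun [set` i] (EFin \o f).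
  by move=> s m; apply: measurable_funS mf.
have I0 : \int[mu]_(x in U) f x = 0.
  rewrite /Rintegral integral_itv_obnd_cbnd; last first.
    by apply: mf' => // x /=; rewrite !in_itv/=; lra.
  rewrite integral_itv_bndo_bndc; last first.
    by apply: mf' => // x /=; rewrite !in_itv/=; lra.
  by rewrite h -EFinB /F /w /= u0 u1 P0 P1 !(mulr0, mul0r, subr0).
have [D2 _ hD2] := @dx_bounded 2 isT; have [D0 _ hD0] := @dx_bounded 0 isT.
have bd (x : R) : 0 < x < 1 -> 0 <= x <= 1 by move=> /andP[h3 h4]; rewrite !ltW.
have psiE x : psi k x = P x by [].
have i2 : mu.-integrable U (EFin \o (fun x => w 2 x * P x)).
  apply: (@bounded_integrable _ _ (D2 * 2)); first by apply: measurable_funM => //; exact: mw.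
  by move=> x /bd xI; rewrite normrM ler_pM// ?hD2// -psiE psi_le.
have i0 : mu.-integrable U (EFin \o (fun x => w 0 x * P x)).
  apply: (@bounded_integrable _ _ (D0 * 2)); first by apply: measurable_funM => //; exact: mw.
  by move=> x /bd xI; rewrite normrM ler_pM// ?hD0// -psiE psi_le.
have i0' : mu.-integrable U (EFin \o (fun x => a ^+ 2 * (w 0 x * P x))).
  by apply: eq_integrable (integrableZl _ (a ^+ 2) i0).
move: I0; rewrite /f RintegralD// RintegralZl// => e.
by rewrite /lambda -/a mulNr; apply/eqP; rewrite -addr_eq0; apply/eqP.
Qed.

Lemma coef_time_lipschitz k : exists2 C, 0 <= C &
  lipschitz_in `[0, T] C (fun t => L2_inner (u ^~ t) (psi k)).
Proof.
have [L L0 hL] := solution_time_lipschitz; have [D _ hD] := @dx_bounded 0 isT.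
exists (L * 2); first by rewrite mulr_ge0.
move=> s t; rewrite /= !in_itv/= => sI tI.
have bd (x : R) : 0 < x < 1 -> 0 <= x <= 1 by move=> /andP[h3 h4]; rewrite !ltW.
have m r : 0 <= r <= T -> measurable_fun U (fun x => u x r * psi k x).
  by move=> rI; apply: measurable_funM; [exact: (@measurable_dx 0)|exact: measurable_psi].
have i r : 0 <= r <= T -> mu.-integrable U (EFin \o (fun x => u x r * psi k x)).
  move=> rI; apply: (@bounded_integrable _ _ (D * 2)); first exact: m.
  by move=> x /bd xI; rewrite normrM ler_pM// ?psi_le//; exact: hD.
rewrite /L2_inner -RintegralB//; [|exact: i|exact: i].
apply: Rint_unit_le => [|x /bd xI]; first by apply: measurable_funB; exact: m.
rewrite -mulrBl normrM mulrAC ler_pM ?psi_le//.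
by apply: (hL x xI); rewrite /= in_itv.
Qed.

End RegularSolution.

Section SumsAndLimits.
Context {R : realType}.
Implicit Types (x y : nat -> R).

Lemma cvg_sum_nat (F : nat -> nat -> R) (l : nat -> R) m n :
  (forall k, (m <= k < n)%N -> F k i @[i --> \oo] --> l k) ->
  \sum_(m <= k < n) F k i @[i --> \oo] --> \sum_(m <= k < n) l k.
Proof.
elim: n => [|n IH] h.
  by rewrite big_geq//; under eq_fun do rewrite big_geq//; exact: cvg_cst.
have [mn|nm] := leqP m n; last first.
  by rewrite big_geq//; under eq_fun do rewrite big_geq//; exact: cvg_cst.
rewrite big_nat_recr//=; under eq_fun do rewrite big_nat_recr//=.
apply: cvgD; last by apply: h; rewrite mn ltnSn.
by apply: IH => k /andP[h1 h2]; apply: h; rewrite h1 ltnW.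
Qed.

Lemma sum_cauchy_schwarz x y m n : (forall k, 0 <= x k * y k) ->
  (\sum_(m <= k < n) x k * y k) ^+ 2 <=
    (\sum_(m <= k < n) x k ^+ 2) * \sum_(m <= k < n) y k ^+ 2.
Proof.
move=> xy0; pose X := \sum_(m <= k < n) x k ^+ 2; pose Y := \sum_(m <= k < n) y k ^+ 2.
have X0 : 0 <= X by apply: sumr_ge0 => k _; exact: sqr_ge0.
have Y0 : 0 <= Y by apply: sumr_ge0 => k _; exact: sqr_ge0.
have S0 : 0 <= \sum_(m <= k < n) x k * y k by apply: sumr_ge0.
have := @quadratic_optimum _ (\sum_(m <= k < n) x k * y k) X (Y / 2) S0 X0.
have -> : 2 * X * (Y / 2) = X * Y by field.
apply; first by rewrite divr_ge0.
move=> th th0; rewrite /X /Y mulr_sumr !mulr_suml -big_split/=; apply: ler_sum => k _.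
rewrite -subr_ge0; have -> : th * x k ^+ 2 / 2 + y k ^+ 2 / 2 / th - x k * y k =
    (th * x k - y k) ^+ 2 / (2 * th) by field; rewrite gt_eqF.
by rewrite divr_ge0 ?sqr_ge0// mulr_ge0// ltW.
Qed.

Lemma sum_inv_sqr_tail N n : (0 < N <= n)%N ->
  \sum_(N.+1 <= k < n.+1) (k%:R ^+ 2)^-1 <= N%:R^-1 - n%:R^-1 :> R.
Proof.
move=> /andP[N0]; elim: n => [|n IH]; first by rewrite leqNgt N0.
rewrite leq_eqVlt => /predU1P[->|]; first by rewrite big_geq// subrr.
rewrite ltnS => Nn; rewrite big_nat_recr//=; apply: (le_trans (lerD (IH Nn) (lexx _))).
have n0 : 0 < n%:R :> R by rewrite ltr0n (leq_trans N0).
rewrite -addrA lerD2l -[n.+1%:R]natr1; move: (n%:R : R) n0 => z z0.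
have z1 : 0 < z + 1 by lra.
rewrite -subr_ge0 (_ : _ - _ = (z * (z + 1) ^+ 2)^-1); last by field; rewrite !gt_eqF.
by rewrite invr_ge0 mulr_ge0 ?sqr_ge0// ltW.
Qed.

Lemma sum_inv_sqr_le n : \sum_(1 <= k < n.+1) (k%:R ^+ 2)^-1 <= 2 :> R.
Proof.
case: n => [|n]; first by rewrite big_geq.
rewrite big_ltn// expr1n invr1.
have := @sum_inv_sqr_tail 1 n.+1 isT; have : 0 <= n.+1%:R^-1 :> R by rewrite invr_ge0.
by rewrite invr1 => h1 h2; move: h1 h2; set a := \sum_(_ <= _ < _) _; set b := _^-1; lra.
Qed.

Lemma sum_nonneg_le_widen x m n p : (n <= p)%N -> (forall k, 0 <= x k) ->
  \sum_(m <= k < n) x k <= \sum_(m <= k < p) x k.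
Proof.
move=> np x0; have [mn|nm] := leqP m n; last by rewrite big_geq ?sumr_ge0// ltnW.
by rewrite [leRHS](big_cat_nat mn np)/= lerDl sumr_ge0.
Qed.

Lemma bounded_monotone_limit x (S : R) : {homo x : n m / (n <= m)%N >-> n <= m} ->
  (forall n, x n <= S) -> exists l, [/\ x n @[n --> \oo] --> l, forall n, x n <= l & l <= S].
Proof.
move=> xi xS; have cx : cvgn x.
  by apply: nondecreasing_is_cvgn => //; exists S => _ [n _ <-].
exists (limn x); split => //; first by move=> n; exact: nondecreasing_cvgn_le.
by apply: limr_le => //; near=> n.
Unshelve. all: by end_near. Qed.

Lemma within_continuous_eps (A : set R) (g : R -> R) c e : {within A, continuous g} -> A c -> 0 < e ->
  exists2 d, 0 < d & forall z, A z -> `|z - c| < d -> `|g z - g c| <= e.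
Proof.
move=> /subspace_continuousP h Ac e0; have /cvgrPdist_le /(_ e e0) := h c Ac.
rewrite near_withinE => -[d /= d0 hd]; exists d => // z Az zc.
by rewrite distrC; apply: hd => //=; rewrite distrC.
Qed.

Lemma Rint_itv_le (a b L : R) (h : R -> R) : a <= b ->
  lebesgue_measure.-integrable `[a, b] (EFin \o h) ->
  (forall r, a <= r <= b -> `|h r| <= L) ->
  `|\int[lebesgue_measure]_(r in `[a, b]) h r| <= L * (b - a).
Proof.
move=> ab ih hL; apply: (le_trans (le_normr_Rintegral _ ih)) => //.
have m : measurable (`[a, b]%classic : set R) by exact: measurable_itv.
have e : (\int[lebesgue_measure]_(r in `[a, b]) L%:E = (L * (b - a))%:E)%E.
  rewrite integral_cst//= lebesgue_measure_itv/=; case: ifP => [_|].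
    by rewrite -EFinB -EFinM.
  rewrite lte_fin => /negbT; rewrite -leNgt => ba.
  have -> : b = a by apply/eqP; rewrite eq_le ab ba.
  by rewrite subrr mulr0 mule0.
have L0 : 0 <= L by apply: le_trans (hL a _); rewrite ?lexx.
have ic : lebesgue_measure.-integrable `[a, b] (EFin \o (fun=> L)).
  apply/integrableP; split; first by apply/measurable_EFinP; exact: measurable_cst.
  by under eq_integral do rewrite /= ger0_norm//; rewrite e ltry.
apply: (@le_trans _ _ (\int[lebesgue_measure]_(r in `[a, b]) L)).
  by apply: le_Rintegral => //; exact: integrable_norm ih.
by rewrite /Rintegral e.
Qed.

End SumsAndLimits.

(** * Time regularity of the Fourier coefficients of the source *)

Section SourceTerm.
Context {R : realType}.
Local Notation mu := (@lebesgue_measure R).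
Local Notation U := (`]0, 1[%classic : set R).

Lemma lambda_ge1 k : (0 < k)%N -> 1 <= lambda k :> R.
Proof.
move=> k0; rewrite /lambda; have p2 := pi_ge2 R.
have k1 : 1 <= k%:R :> R by rewrite ler1n.
by rewrite expr_ge1 ?mulr_ge0//; nra.
Qed.

Lemma spectral_sum_ge0 gamma (g : R -> R) : (0 <= spectral_sum gamma g)%E.
Proof.
by apply: nneseries_ge0 => n _ _; rewrite lee_fin mulr_ge0 ?powR_ge0// exprn_ge0.
Qed.

Lemma dom_norm_partial gamma (g : R -> R) B n : 0 <= B -> (dom_norm gamma g <= B%:E)%E ->
  \sum_(1 <= k < n.+1) lambda k `^ (2 * gamma) * L2_inner g (psi k) ^+ 2 <= B ^+ 2.
Proof.
move=> B0; rewrite /dom_norm; have := spectral_sum_ge0 gamma g.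
case E : (spectral_sum gamma g) => [r| |]//; last first.
  by rewrite poweRyr ?leye_eq// invr_eq0 pnatr_eq0.
rewrite lee_fin poweR_EFin lee_fin => r0 rB.
have rB2 : r <= B ^+ 2.
  have -> : r = (r `^ 2^-1) ^+ 2 by rewrite -powR_mulrn ?powR_ge0// -powRrM mulVf// powRr1.
  by rewrite lerXn2r ?nnegrE ?powR_ge0.
apply: le_trans rB2; rewrite -lee_fin -E /spectral_sum -sumEFin.
under eq_bigr do rewrite -real_normK ?num_real//.
apply: nneseries_lim_ge => k _ _.
by rewrite lee_fin mulr_ge0 ?powR_ge0// exprn_ge0.
Qed.

Lemma derivableS_dt_pair (A : set R) T (g : R -> R -> R) :
  (forall x t, A x -> 0 < t <= T -> derivableS `]0, T] (g x) t) ->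
  dt_pair A T g (dt_oc T g).
Proof.
move=> h x Ax t tI e e0; have /derivableS_cvg/cvg_quotientP/(_ e e0)[d d0 hd] := h x t Ax tI.
exists d => // s sI st; have [->|sn] := eqVneq s t; first by rewrite !subrr mulr0 subr0 normr0 mulr0.
have st0 : s - t != 0 by rewrite subr_eq0.
have := hd s; rewrite /= in_itv/= => /(_ sI sn st) h1.
have -> : g x s - g x t - dt_oc T g x t * (s - t) =
    ((g x s - g x t) / (s - t) - deriveS `]0, T] (g x) t) * (s - t).
  by rewrite mulrBl divfK.
by rewrite normrM ler_wpM2r.
Qed.

Lemma ereal_sum3_le (a b d : \bar R) (C r : R) : (0 <= a)%E -> (0 <= b)%E -> (0 <= d)%E ->
  0 < r -> (a + b + r%:E * d <= C%:E)%E ->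
  [/\ (a <= C%:E)%E, (b <= C%:E)%E & (d <= (C * r^-1)%:E)%E].
Proof.
move=> a0 b0 d0 r0 h; have e0 : (0 <= r%:E * d)%E by rewrite mule_ge0// lee_fin ltW.
split.
- by apply: le_trans h; rewrite -addeA leeDl// adde_ge0.
- by apply: le_trans h; rewrite addeAC leeDr// adde_ge0.
- have {}h : (r%:E * d <= C%:E)%E by apply: le_trans h; rewrite leeDr// adde_ge0.
  case: d d0 e0 h => [d| |]//; last by rewrite gt0_muley ?lte_fin// leye_eq.
  by rewrite -EFinM !lee_fin => d0 _ h; rewrite ler_pdivlMr// mulrC.
Qed.

Context (T C1 rho : R) (f : R -> R -> R) (T0 : 0 < T).
Context (f_diff : forall x t : R, 0 <= x <= 1 -> 0 < t <= T ->
   derivableS `]0, T] (f x) t /\ derivableS `]0, T] (dt_oc T f x) t).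
Context (f_L2 : forall t : R, 0 < t <= T ->
   [/\ in_L2 (f ^~ t), in_L2 (dt_oc T f ^~ t) & in_L2 (dt_oc T (dt_oc T f) ^~ t)]).
Context (rho_lt1 : rho < 1).
Context (f_bound : forall t : R, 0 < t <= T ->
   (dom_norm (5 / 2) (fun x => f x t)
    + dom_norm (1 / 2) (fun x => dt_oc T f x t)
    + (t `^ rho)%:E * dom_norm (1 / 2) (fun x => dt_oc T (dt_oc T f) x t)
    <= C1%:E)%E).

Let F k t := L2_inner (f ^~ t) (psi k).
Let G k t := L2_inner (dt_oc T f ^~ t) (psi k).
Let c k t := L2_inner (dt_oc T (dt_oc T f) ^~ t) (psi k).

Let parts_le t : 0 < t <= T ->
  [/\ (dom_norm (5 / 2) (fun x => f x t) <= C1%:E)%E,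
      (dom_norm (1 / 2) (fun x => dt_oc T f x t) <= C1%:E)%E &
      (dom_norm (1 / 2) (fun x => dt_oc T (dt_oc T f) x t) <= (C1 * t `^ (- rho))%:E)%E].
Proof.
move=> tI; rewrite powRN; apply: ereal_sum3_le (f_bound tI); try exact: poweR_ge0.
by apply: powR_gt0; case/andP: tI.
Qed.

Let C1_ge0 : 0 <= C1.
Proof.
have TI : 0 < T <= T by rewrite T0 lexx.
by have [h _ _] := parts_le TI; rewrite -lee_fin; apply: le_trans h; exact: poweR_ge0.
Qed.

Let half2 : 2 * (1 / 2) = 1 :> R. Proof. by field. Qed.

Let lambda_half k : lambda k `^ (2 * (1 / 2)) = lambda k :> R.
Proof. by rewrite half2 powRr1// sqr_ge0. Qed.

Let G_sum t n : 0 < t <= T -> \sum_(1 <= k < n.+1) lambda k * G k t ^+ 2 <= C1 ^+ 2.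
Proof.
move=> tI; have [_ h _] := parts_le tI; have := dom_norm_partial n C1_ge0 h.
by under eq_bigr do rewrite lambda_half.
Qed.

Let c_sum t n : 0 < t <= T ->
  \sum_(1 <= k < n.+1) lambda k * c k t ^+ 2 <= (C1 * t `^ (- rho)) ^+ 2.
Proof.
move=> tI; have [_ _ h] := parts_le tI; have := dom_norm_partial n _ h.
under eq_bigr do rewrite lambda_half.
by apply; rewrite mulr_ge0 ?powR_ge0.
Qed.

Let sqr_sum_le (a w : nat -> R) n B : (forall k, (0 < k)%N -> 1 <= w k) ->
  \sum_(1 <= k < n.+1) w k * a k ^+ 2 <= B -> \sum_(1 <= k < n.+1) a k ^+ 2 <= B.
Proof.
move=> w1; apply: le_trans; apply: ler_sum_nat => k /andP[k0 _].
by rewrite ler_peMl ?sqr_ge0// w1.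
Qed.

Let f_sqr_sum t n : 0 < t <= T -> \sum_(1 <= k < n.+1) L2_inner (f ^~ t) (psi k) ^+ 2 <= (C1 + 1) ^+ 2.
Proof.
move=> tI; have [h _ _] := parts_le tI; have h2 := dom_norm_partial n C1_ge0 h.
have h3 : C1 ^+ 2 <= (C1 + 1) ^+ 2 by rewrite lerXn2r ?nnegrE ?addr_ge0// lerDl.
apply: le_trans h3; apply: sqr_sum_le h2 => k k0.
have e1 : 1 `^ (2 * (5 / 2)) = 1 :> R by rewrite powR1.
by rewrite -[leLHS]e1 ge0_ler_powR ?nnegrE ?sqr_ge0 ?lambda_ge1//; lra.
Qed.

Lemma source_L1_le t : 0 < t <= T -> \int[mu]_(x in U) `|f x t| <= C1 + 1.
Proof.
move=> tI; have [h _ _] := f_L2 tI; apply: L1_le_coefs => //; first by rewrite ltr_wpDl.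
by move=> n; exact: f_sqr_sum.
Qed.

Let U01 x : U x -> 0 <= x <= 1.
Proof. by rewrite /= in_itv/= => /andP[h1 h2]; rewrite !ltW. Qed.

Let pair1 : dt_pair U T f (dt_oc T f).
Proof. by apply: derivableS_dt_pair => x t /U01 xI /(f_diff xI)[]. Qed.

Let pair2 : dt_pair U T (dt_oc T f) (dt_oc T (dt_oc T f)).
Proof. by apply: derivableS_dt_pair => x t /U01 xI /(f_diff xI)[]. Qed.

Lemma measurable_source : measurable_fun (U `*` `]0, T]) (fun z : R * R => f z.1 z.2).
Proof.
apply: (@slice_measurable _ U T f) => //.
  by move=> t /f_L2[[]].
by move=> x Ux t tI e e0; exact: dt_pair_continuous pair1 Ux tI e0.
Qed.

Let F_increment k s t : 0 < s <= t -> t <= T ->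
  mu.-integrable `[s, t] (EFin \o G k) /\ F k t - F k s = \int[mu]_(r in `[s, t]) G k r.
Proof.
move=> st tT; have /andP[s0 st'] := st.
apply: (@coef_increment _ T f (dt_oc T f) s t (C1 + 1)) => //.
- by rewrite ltr_wpDl.
- by move=> r /f_L2[].
- by move=> r /f_L2[].
move=> r /andP[sr rt] n; have rI : 0 < r <= T by rewrite (lt_le_trans s0 sr) (le_trans rt).
have h3 : C1 ^+ 2 <= (C1 + 1) ^+ 2 by rewrite lerXn2r ?nnegrE ?addr_ge0// lerDl.
by apply: le_trans h3; apply: sqr_sum_le (G_sum n rI); exact: lambda_ge1.
Qed.

(** The sign of [rho] is free; by monotonicity one of the two end values is a bound in either
    case. *)
Let powN_le s t r : 0 < s -> s <= r <= t -> r `^ (- rho) <= s `^ (- rho) + t `^ (- rho).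
Proof.
move=> s0 /andP[sr rt]; have r0 := lt_le_trans s0 sr; have t0 := lt_le_trans r0 rt.
have [h|h] := leP 0 (- rho).
  apply: (@le_trans _ _ (t `^ (- rho))); last by rewrite lerDr powR_ge0.
  by rewrite ge0_ler_powR// nnegrE ltW.
apply: (@le_trans _ _ (s `^ (- rho))); last by rewrite lerDl powR_ge0.
have rho0 : 0 <= rho by rewrite -oppr_le0 ltW.
rewrite !powRN lef_pV2 ?posrE ?powR_gt0//.
by apply: ge0_ler_powR => //; rewrite nnegrE ltW.
Qed.

Let G_increment k s t : 0 < s <= t -> t <= T ->
  mu.-integrable `[s, t] (EFin \o c k) /\ G k t - G k s = \int[mu]_(r in `[s, t]) c k r.
Proof.
move=> st tT; have /andP[s0 st'] := st.
pose B := C1 * (s `^ (- rho) + t `^ (- rho)) + 1.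
have B0 : 0 < B by rewrite ltr_wpDl// mulr_ge0// addr_ge0 ?powR_ge0.
apply: (@coef_increment _ T (dt_oc T f) (dt_oc T (dt_oc T f)) s t B) => //.
- by move=> r /f_L2[].
- by move=> r /f_L2[].
move=> r rI n; have /andP[sr rt] := rI.
have rI' : 0 < r <= T by rewrite (lt_le_trans s0 sr) (le_trans rt).
have h3 : (C1 * r `^ (- rho)) ^+ 2 <= B ^+ 2.
  rewrite lerXn2r ?nnegrE ?(ltW B0) ?mulr_ge0 ?powR_ge0//.
  apply: (@le_trans _ _ (C1 * (s `^ (- rho) + t `^ (- rho)))); last by rewrite lerDl.
  by rewrite ler_wpM2l// powN_le.
by apply: le_trans h3; apply: sqr_sum_le (c_sum n rI'); exact: lambda_ge1.
Qed.

(** The integral of [r^(- rho)] over []0, T]], finite because [rho < 1]. *)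
Let A := T `^ (1 - rho) / (1 - rho).
Let A0 : 0 <= A. Proof. by rewrite divr_ge0 ?powR_ge0// subr_ge0 ltW. Qed.

Let pow_int s : 0 < s <= T -> mu.-integrable `[s, T] (EFin \o (fun r => r `^ (- rho))) /\
  \int[mu]_(r in `[s, T]) r `^ (- rho) <= A.
Proof.
move=> /andP[s0 sT]; have r1 : 0 < 1 - rho by rewrite subr_gt0.
have := integral_powR_near0 r1 T0; rewrite addrAC subrr add0r -/A => e.
have sub : (`[s, T] : set R) `<=` `]0, T].
  by move=> r; rewrite /= !in_itv/= => /andP[h ->]; rewrite (lt_le_trans s0).
have i0 : mu.-integrable `]0, T] (EFin \o (fun r => r `^ (- rho))).
  apply/integrableP; split.
    by apply/measurable_EFinP; apply: measurable_funTS; exact: measurable_powR.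
  by under eq_integral do rewrite /= ger0_norm ?powR_ge0//; rewrite e ltry.
have i1 : mu.-integrable `[s, T] (EFin \o (fun r => r `^ (- rho))) by exact: integrableS i0.
split => //; rewrite -lee_fin /Rintegral fineK; last exact: integrable_fin_num.
rewrite -e; apply: ge0_subset_integral => //.
  by apply/measurable_EFinP; apply: measurable_funTS; exact: measurable_powR.
by move=> r _; rewrite lee_fin powR_ge0.
Qed.

(** [J] bounds the variation on [[s, T]] of the time derivative of a coefficient. It is controlled
    through the weighted square integral [I_], by [J^2 <= A * I_]: squares can be summed over [k]
    under the integral, where the bound on [f_tt] holds at each time. *)
Let J k s := \int[mu]_(r in `[s, T]) `|c k r|.
Let I_ k s := \int[mu]_(r in `[s, T]) (c k r ^+ 2 / r `^ (- rho)).

Let c_le k r : (0 < k)%N -> 0 < r <= T -> `|c k r| <= C1 * r `^ (- rho).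
Proof.
move=> k0 rI; have B0 : 0 <= C1 * r `^ (- rho) by rewrite mulr_ge0 ?powR_ge0.
rewrite -(@ler_pXn2r _ 2) ?nnegrE// real_normK ?num_real//.
apply: le_trans (c_sum k rI); case: k k0 => // k _.
rewrite big_nat_recr//= ler_wpDl ?sumr_ge0//.
  by move=> i _; rewrite mulr_ge0 ?sqr_ge0.
by rewrite ler_peMl ?sqr_ge0// lambda_ge1.
Qed.

Let sTP s r : 0 < s -> s <= r <= T -> 0 < r <= T.
Proof. by move=> s0 /andP[h ->]; rewrite (lt_le_trans s0 h). Qed.

Let c_int k s : 0 < s <= T -> mu.-integrable `[s, T] (EFin \o c k).
Proof. by move=> sI; have [] := @G_increment k s T sI (lexx T). Qed.

Let I_int k s : (0 < k)%N -> 0 < s <= T ->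
  mu.-integrable `[s, T] (EFin \o (fun r => c k r ^+ 2 / r `^ (- rho))).
Proof.
move=> k0 sI; have /andP[s0 _] := sI; have [i1 _] := pow_int sI.
have i2 : mu.-integrable `[s, T] (EFin \o (fun r => C1 ^+ 2 * r `^ (- rho))).
  by apply: eq_integrable (integrableZl _ (C1 ^+ 2) i1).
have /integrableP[/measurable_EFinP mc _] := c_int k sI.
apply: le_integrable i2 => //.
  apply/measurable_EFinP; apply: measurable_funM; first exact: measurable_funX.
  by apply: measurable_funV; apply: measurable_funTS; exact: measurable_powR.
move=> r; rewrite /= in_itv/= => /(sTP s0) rI; have /andP[r0 _] := rI.
have p0 : 0 < r `^ (- rho) by rewrite powR_gt0.
rewrite lee_fin [leRHS]ger0_norm ?mulr_ge0 ?sqr_ge0 ?(ltW p0)//.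
rewrite ger0_norm ?divr_ge0 ?sqr_ge0 ?(ltW p0)// ler_pdivrMr//.
have -> : C1 ^+ 2 * r `^ (- rho) * r `^ (- rho) = (C1 * r `^ (- rho)) ^+ 2 by ring.
have := c_le k0 rI; rewrite -(@ler_pXn2r _ 2) ?nnegrE ?mulr_ge0 ?(ltW p0)//.
by rewrite real_normK ?num_real.
Qed.

Let J_ge0 k s : 0 <= J k s. Proof. by apply: Rintegral_ge0. Qed.

Let J_sqr k s : (0 < k)%N -> 0 < s <= T -> J k s ^+ 2 <= A * I_ k s.
Proof.
move=> k0 sI; have /andP[s0 _] := sI; have [i1 hA] := pow_int sI.
have i2 := I_int k0 sI; have i3 := c_int k sI.
have I0 : 0 <= I_ k s.
  by apply: Rintegral_ge0 => r _; rewrite divr_ge0 ?sqr_ge0 ?powR_ge0.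
have -> : A * I_ k s = 2 * A * (I_ k s / 2) by field.
apply: quadratic_optimum => //; first by rewrite divr_ge0.
move=> th th0.
have -> : I_ k s / 2 / th = (2 * th)^-1 * I_ k s by field; rewrite gt_eqF.
apply: (@le_trans _ _ (th / 2 * \int[mu]_(r in `[s, T]) r `^ (- rho) + (2 * th)^-1 * I_ k s)).
  have i1' : mu.-integrable `[s, T] (EFin \o (fun r => th / 2 * r `^ (- rho))).
    by apply: eq_integrable (integrableZl _ (th / 2) i1) => // r _; rewrite /= EFinM.
  have i2' : mu.-integrable `[s, T]
      (EFin \o (fun r => (2 * th)^-1 * (c k r ^+ 2 / r `^ (- rho)))).
    by apply: eq_integrable (integrableZl _ ((2 * th)^-1) i2) => // r _; rewrite /= EFinM.
  have i3' := integrable_norm i3.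
  have i12 : mu.-integrable `[s, T] (EFin \o (fun r => th / 2 * r `^ (- rho) +
      (2 * th)^-1 * (c k r ^+ 2 / r `^ (- rho)))).
    by apply: eq_integrable (integrableD _ i1' i2').
  rewrite /I_ -RintegralZl// -RintegralZl// -RintegralD//.
  apply: le_Rintegral => // r; rewrite /= in_itv/= => /(sTP s0) /andP[r0 _].
  have p0 : 0 < r `^ (- rho) by rewrite powR_gt0.
  rewrite -[c k r ^+ 2]real_normK ?num_real//.
  move: (r `^ (- rho)) p0 (`|c k r|) => p p0 z.
  rewrite -subr_ge0; have -> : th / 2 * p + (2 * th)^-1 * (z ^+ 2 / p) - z =
      (th * p - z) ^+ 2 / (2 * th * p) by field; rewrite !gt_eqF.
  by rewrite divr_ge0 ?sqr_ge0// !mulr_ge0// ltW.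
by rewrite lerD2r [th * A / 2]mulrAC ler_wpM2l// divr_ge0// ltW.
Qed.

Let I_sum s n : 0 < s <= T -> \sum_(1 <= k < n.+1) lambda k * I_ k s <= C1 ^+ 2 * A.
Proof.
move=> sI; have /andP[s0 _] := sI; have [i1 hA] := pow_int sI.
have key (m : nat) : mu.-integrable `[s, T] (EFin \o (fun r =>
      \sum_(1 <= k < m.+1) lambda k * (c k r ^+ 2 / r `^ (- rho)))) /\
    \sum_(1 <= k < m.+1) lambda k * I_ k s = \int[mu]_(r in `[s, T])
      \sum_(1 <= k < m.+1) lambda k * (c k r ^+ 2 / r `^ (- rho)).
  elim: m => [|m [ih e]].
    have z : (fun r => \sum_(1 <= k < 1) lambda k * (c k r ^+ 2 / r `^ (- rho))) = fun=> 0.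
      by apply/funext => r; rewrite big_geq.
    rewrite z Rintegral_cst// mul0r big_geq//; split => //.
    by apply: eq_integrable (integrable0 _ _).
  have i2 := I_int (ltn0Sn m) sI.
  have i3 : mu.-integrable `[s, T] (EFin \o (fun r => lambda m.+1 * (c m.+1 r ^+ 2 / r `^ (- rho)))).
    by apply: eq_integrable (integrableZl _ (lambda m.+1) i2) => // r _; rewrite /= EFinM.
  have z : (fun r => \sum_(1 <= k < m.+2) lambda k * (c k r ^+ 2 / r `^ (- rho))) = fun r =>
      \sum_(1 <= k < m.+1) lambda k * (c k r ^+ 2 / r `^ (- rho)) +
        lambda m.+1 * (c m.+1 r ^+ 2 / r `^ (- rho)).
    by apply/funext => r; rewrite big_nat_recr.
  split; first by rewrite z; apply: eq_integrable (integrableD _ ih i3).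
  by rewrite big_nat_recr//= e z RintegralD// RintegralZl.
have [i2 ->] := key n.
apply: (@le_trans _ _ (\int[mu]_(r in `[s, T]) (C1 ^+ 2 * r `^ (- rho)))).
  apply: le_Rintegral => //.
    by apply: eq_integrable (integrableZl _ (C1 ^+ 2) i1) => // r _; rewrite /= EFinM.
  move=> r; rewrite /= in_itv/= => /(sTP s0) rI; have /andP[r0 _] := rI.
  have p0 : 0 < r `^ (- rho) by rewrite powR_gt0.
  under eq_bigr do rewrite mulrA.
  rewrite -mulr_suml ler_pdivrMr// (le_trans (c_sum n rI))//.
  by rewrite le_eqVlt; apply/orP; left; apply/eqP; ring.
by rewrite RintegralZl// ler_wpM2l ?sqr_ge0.
Qed.

Let J_sum s n : 0 < s <= T -> \sum_(1 <= k < n.+1) lambda k * J k s ^+ 2 <= (A * C1) ^+ 2.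
Proof.
move=> sI; apply: (@le_trans _ _ (A * \sum_(1 <= k < n.+1) lambda k * I_ k s)).
  rewrite mulr_sumr; apply: ler_sum_nat => k /andP[k0 _].
  by rewrite [leRHS]mulrCA ler_wpM2l ?sqr_ge0// J_sqr.
have -> : (A * C1) ^+ 2 = A * (C1 ^+ 2 * A) by ring.
by rewrite ler_wpM2l// I_sum.
Qed.

Let sn n := T / n.+1%:R.
Let snP n : 0 < sn n <= T.
Proof.
by rewrite /sn divr_gt0//= ler_pdivrMr// ler_peMr ?ler1n// ltW.
Qed.

Let J_homo k s s' : 0 < s -> s <= s' -> s' <= T -> J k s' <= J k s.
Proof.
move=> s0 ss' s'T; have i1 := integrable_norm (@c_int k s _).
have sI : 0 < s <= T by rewrite s0 (le_trans ss').
have {}i1 := i1 sI; have sub : (`[s', T] : set R) `<=` `[s, T].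
  by move=> r; rewrite /= !in_itv/= => /andP[h ->]; rewrite (le_trans ss' h).
have i2 : mu.-integrable `[s', T] (EFin \o (fun r => `|c k r|)) by exact: integrableS i1.
rewrite -lee_fin /J /Rintegral !fineK; [|exact: integrable_fin_num i1|exact: integrable_fin_num i2].
apply: ge0_subset_integral => //; by have /integrableP[] := i1.
Qed.

(** The limit exists because [J] increases as [s] tends to 0 and stays at most [A * C1]. The premise
    [0 < k] sits inside so that one function of [k] can be chosen. *)
Let J_limit k : exists l, (0 < k)%N -> [/\ J k (sn n) @[n --> \oo] --> l, 0 <= l &
  forall s, 0 < s <= T -> J k s <= l].
Proof.
case: k => [|k]; first by exists 0.
have inc : {homo (fun n => J k.+1 (sn n)) : n m / (n <= m)%N >-> n <= m}.
  move=> n m nm; have /andP[h1 h2] := snP n; have /andP[h3 h4] := snP m.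
  by apply: J_homo => //; rewrite /sn ler_pM2l// lef_pV2 ?posrE// ler_nat.
have bd n : J k.+1 (sn n) <= A * C1.
  rewrite -(@ler_pXn2r _ 2) ?nnegrE ?J_ge0 ?(mulr_ge0 A0 C1_ge0)//.
  apply: le_trans (J_sum k.+1 (snP n)); rewrite big_nat_recr//= ler_wpDl ?sumr_ge0//.
    by move=> i _; rewrite mulr_ge0 ?sqr_ge0.
  by rewrite ler_peMl ?sqr_ge0// lambda_ge1.
have [l [cl hl _]] := bounded_monotone_limit inc bd.
exists l => _; split => //; first exact: le_trans (hl 0%N).
move=> s /andP[s0 sT]; have [n hn] := archi_ge (T / s).
apply: le_trans (hl n); have /andP[h1 h2] := snP n; apply: J_homo => //.
rewrite /sn ler_pdivrMr// mulrC -ler_pdivrMr//.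
Qed.

(** [L k] is the derivative of the coefficient at [T] in absolute value plus a bound of its
    variation down to time 0. The bound on finite sums of [lambda k * J k s^2] is uniform in [s] and
    survives the limit. *)
Lemma source_coef_lipschitz : exists2 L : nat -> R, (forall k, 0 <= L k) &
  (exists2 S, 0 <= S & forall n, \sum_(1 <= k < n.+1) lambda k * L k ^+ 2 <= S) /\
  (forall k, (0 < k)%N -> lipschitz_in `]0, T] (L k) (fun t => L2_inner (f ^~ t) (psi k))).
Proof.
have [l hl] := @choice _ _ (fun k l => _) J_limit.
pose L k := if (0 < k)%N then `|G k T| + l k else 0.
have TI : 0 < T <= T by rewrite T0 lexx.
exists L; [|split].
- by move=> [|k]//; rewrite /L/= addr_ge0//; have [] := hl k.+1 isT.
- exists (2 * (C1 ^+ 2 + (A * C1) ^+ 2)) => [|n].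
    by rewrite mulr_ge0// addr_ge0 ?sqr_ge0.
  apply: (@le_trans _ _ (2 * (\sum_(1 <= k < n.+1) lambda k * G k T ^+ 2 +
      \sum_(1 <= k < n.+1) lambda k * l k ^+ 2))).
    rewrite -big_split/= mulr_sumr; apply: ler_sum_nat => k /andP[k0 _].
    rewrite /L k0 -mulrDr [leRHS]mulrCA ler_wpM2l ?sqr_ge0// -[G k T ^+ 2]real_normK ?num_real//.
    rewrite -subr_ge0; have -> : 2 * (`|G k T| ^+ 2 + l k ^+ 2) - (`|G k T| + l k) ^+ 2 =
      (`|G k T| - l k) ^+ 2 by ring.
    exact: sqr_ge0.
  rewrite ler_wpM2l// lerD ?G_sum//.
  have cv : \sum_(1 <= k < n.+1) lambda k * J k (sn m) ^+ 2 @[m --> \oo] -->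
      \sum_(1 <= k < n.+1) lambda k * l k ^+ 2.
    apply: cvg_sum_nat => k /andP[k0 _]; have [cl _ _] := hl k k0.
    by apply: cvgM; [exact: cvg_cst|rewrite expr2; under eq_fun do rewrite expr2; exact: cvgM].
  apply: (ler_cvg_to cv (@cvg_cst _ _ _ _ _)).
  by near=> m; exact: J_sum.
- move=> k k0 s t; rewrite /= !in_itv/=.
  have [_ l0 lJ] := hl k k0.
  have GL r : 0 < r <= T -> `|G k r| <= L k.
    move=> rI; have [i1 e] := @G_increment k r T rI (lexx T).
    rewrite -[G k r](subKr (G k T)) /L k0 (le_trans (ler_normB _ _))// lerD2l e.
    rewrite (le_trans (le_normr_Rintegral _ i1))//; exact: lJ.
  have key s' t' : 0 < s' -> s' <= t' -> t' <= T -> `|F k t' - F k s'| <= L k * `|t' - s'|.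
    move=> s0 st tT; have st' : 0 < s' <= t' by rewrite s0.
    have [i1 ->] := F_increment k st' tT; rewrite [`|t' - s'|]ger0_norm ?subr_ge0//.
    apply: Rint_itv_le => // r /andP[sr rt]; apply: GL.
    by rewrite (lt_le_trans s0 sr) (le_trans rt).
  move=> /andP[s0 sT] /andP[t0 tT]; have [st|/ltW ts] := leP s t; first exact: key.
  by rewrite distrC [`|t - s|]distrC; exact: key.
Unshelve. all: by end_near. Qed.

End SourceTerm.

(** * Aliasing *)

Section Reconstruction.
Context {R : realType}.
Local Notation mu := (@lebesgue_measure R).
Local Notation U := (`]0, 1[%classic : set R).

Lemma sqrt2_le2 : Num.sqrt 2 <= 2 :> R.
Proof. by rewrite -[leRHS]ger0_norm// -sqrtr_sqr ler_sqrt// expr2; lra. Qed.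

Section Alias.
Context (M : nat) (M0 : (0 < M)%N).

(* The grid mode onto which the continuous mode [k] is aliased. *)
Definition fold_mode (k : nat) : nat :=
  if (k %% (2 * M) < M)%N then (k %% (2 * M))%N else (2 * M - k %% (2 * M))%N.

Lemma fold_modeP j k : (0 < j < M)%N ->
  (fold_mode k == j) = ((k %% (2 * M) == j) || (k %% (2 * M) == 2 * M - j))%N.
Proof.
move=> jM; have r2 : (k %% (2 * M) < 2 * M)%N by rewrite ltn_pmod// muln_gt0.
by rewrite /fold_mode; move: (k %% (2 * M))%N r2 => r r2; case: ifP => h; lia.
Qed.

Lemma gsin_fold j k : (0 < j < M)%N -> fold_mode k != j ->
  \sum_(1 <= i < M) gsin M k i * gsin M j i = 0 :> R.
Proof.
move=> jM; rewrite fold_modeP// negb_or => /andP[n1 n2].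
have M20 : (0 < 2 * M)%N by rewrite muln_gt0.
have r2 : (k %% (2 * M) < 2 * M)%N by rewrite ltn_pmod.
apply: gsin_alias => //; apply/negP => d.
  have : ((k %% (2 * M) + j) %% (2 * M) == 0)%N by rewrite modnDml; exact: d.
  move: (k %% (2 * M))%N r2 n1 n2 => r r2 n1 n2 e.
  have [h|h] := ltnP (r + j) (2 * M); first by move: e; rewrite modn_small//; lia.
  have e2 : (r + j = (r + j - 2 * M) + 2 * M)%N by lia.
  by move: e; rewrite e2 modnDr modn_small; lia.
have [jk|kj] := leqP j k.
  move: d; rewrite (_ : k - j + (j - k) = k - j)%N; last by lia.
  move=> /dvdnP[q e]; have ek : k = (q * (2 * M) + j)%N by lia.
  by move: n1; rewrite ek modnMDl modn_small ?eqxx//; lia.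
move: d; rewrite (_ : k - j + (j - k) = j - k)%N; last by lia.
by move=> /dvdn_leq; lia.
Qed.

Lemma fold_inv_sqr_sum j n : (0 < j < M)%N ->
  \sum_(1 <= k < n.+1) (if fold_mode k == j then (k%:R ^+ 2)^-1 else 0) <=
    4 / j%:R ^+ 2 :> R.
Proof.
move=> jM; have j0 : 0 < j%:R :> R by rewrite ltr0n; case/andP: jM.
pose t (k : nat) : R := if fold_mode k == j then (k%:R ^+ 2)^-1 else 0.
have t0 k : 0 <= t k by rewrite /t; case: ifP => // _; rewrite invr_ge0 sqr_ge0.
have blocks m : \sum_(0 <= k < 2 * M * m) t k =
    \sum_(0 <= l < m) \sum_(0 <= r < 2 * M) t (2 * M * l + r)%N.
  elim: m => [|m IH]; first by rewrite muln0 !big_geq.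
  rewrite big_nat_recr//= -IH mulnS addnC (@big_cat_nat _ _ _ (2 * M * m))//= ?leq_addr//.
  congr (_ + _); rewrite -{1}[(2 * M * m)%N]add0n big_addn addnC addnK.
  by apply: eq_bigr => r _; rewrite addnC.
have block l : \sum_(0 <= r < 2 * M) t (2 * M * l + r)%N <= 2 / j%:R ^+ 2 * (l.+1%:R ^+ 2)^-1.
  pose B : R := (j%:R ^+ 2)^-1 * (l.+1%:R ^+ 2)^-1.
  have B0 : 0 <= B by rewrite mulr_ge0// invr_ge0 sqr_ge0.
  apply: (@le_trans _ _ (\sum_(0 <= r < 2 * M) ((if r == j then B else 0) +
      (if r == (2 * M - j)%N then B else 0)))).
    apply: ler_sum_nat => r /andP[_ rM].
    have tB : (j * l.+1 <= 2 * M * l + r)%N -> ((2 * M * l + r)%:R ^+ 2)^-1 <= B.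
      move=> h; rewrite /B -invfM -exprMn -natrM lef_pV2 ?posrE ?exprn_gt0 ?ltr0n//.
      - by rewrite lerXn2r ?nnegrE// ler_nat.
      - by apply: leq_trans h; rewrite muln_gt0; case/andP: jM => ->.
      - by rewrite muln_gt0; case/andP: jM => ->.
    rewrite /t fold_modeP// mulnC modnMDl modn_small//.
    case: (r =P j) => [rj|_] /=.
      rewrite ler_wpDr//; first by case: ifP.
      by rewrite mulnC; apply: tB; rewrite rj; nia.
    rewrite add0r; case: (r =P (2 * M - j)%N) => [rj|_] //.
    by rewrite mulnC; apply: tB; rewrite rj; nia.
  rewrite big_split/= -!big_mkcond !big_nat1_eq.
  have -> : 2 / j%:R ^+ 2 * (l.+1%:R ^+ 2)^-1 = B + B :> R.
    by rewrite /B; ring.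
  by apply: lerD; case: ifP.
apply: (@le_trans _ _ (\sum_(0 <= k < 2 * M * n.+1) t k)).
  apply: (@le_trans _ _ (\sum_(0 <= k < n.+1) t k)).
    by rewrite [leRHS]big_ltn//= lerDr.
  by apply: sum_nonneg_le_widen => //; nia.
rewrite blocks; apply: (le_trans (ler_sum _ (fun l _ => block l))).
rewrite -mulr_sumr (_ : 4 / _ = 2 / j%:R ^+ 2 * 2); last by rewrite mulrAC -natrM.
rewrite ler_wpM2l ?divr_ge0 ?sqr_ge0//; apply: le_trans (sum_inv_sqr_le n.+1).
by rewrite [leRHS]big_add1.
Qed.

Lemma psi_node k i : psi k (node M i) = Num.sqrt 2 * gsin M k i :> R.
Proof.
rewrite /psi /gsin /theta /node /mesh natrM; congr (_ * sin _).
by rewrite -!mulrA; congr (_ * _); rewrite mulrCA.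
Qed.

Lemma gmode_psi_le j k : (0 < j < M)%N ->
  `|gmode M (fun i => psi k (node M i)) j| <= (if fold_mode k == j then 2 else 0) :> R.
Proof.
move=> jM; rewrite /gmode; under eq_bigr do rewrite psi_node -mulrA.
rewrite -mulr_sumr; case: ifPn => [_|h]; last by rewrite gsin_fold// !mulr0 normr0.
have M0' : 0 < M%:R :> R by rewrite ltr0n.
rewrite !normrM [`|2|]ger0_norm// [`|M%:R^-1|]ger0_norm ?invr_ge0// [`|Num.sqrt 2|]ger0_norm ?sqrtr_ge0//.
have s2 := sqrt2_le2.
have h := gsin_sum_le M0 k j (R := R).
apply: (@le_trans _ _ (2 / M%:R * (2 * (M%:R / 2)))).
  by rewrite ler_wpM2l ?divr_ge0// ler_pM ?sqrtr_ge0.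
by rewrite le_eqVlt; apply/orP; left; apply/eqP; field; rewrite gt_eqF.
Qed.

Lemma node_itv i : (0 < i < M)%N -> 0 < (node M i : R) < 1.
Proof.
move=> /andP[i0 iM]; have M0' : 0 < M%:R :> R by rewrite ltr0n.
by rewrite /node /mesh divr_gt0 ?ltr0n//= ltr_pdivrMr// mul1r ltr_nat.
Qed.

(** For the sine means the grid mode [j] collects exactly the coefficients folded onto [j], each
    with a factor at most 2. Convergence of the means at the nodes transfers the bound to [w]. *)
Lemma gmode_fold_le (w : R -> R) (B : R) j (d E : R) (ell : nat -> R) : (0 < j < M)%N -> 0 <= d ->
  measurable_fun U w -> (forall y, 0 < y < 1 -> `|w y| <= B) ->
  (forall x, 0 < x < 1 -> forall e, 0 < e -> exists2 r, 0 < r &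
     forall y, 0 < y < 1 -> `|y - x| < r -> `|w y - w x| <= e) ->
  (forall k, (0 < k)%N -> `|L2_inner w (psi k)| <= d * ell k) ->
  (forall k, 0 <= ell k) ->
  (forall n, \sum_(1 <= k < n.+1) (if fold_mode k == j then ell k else 0) <= E) ->
  `|gmode M (fun i => w (node M i)) j| <= 2 * d * E.
Proof.
move=> jM d0 mw wB cw wl l0 lE.
have le n : `|gmode M (fun i => fmean n w (node M i)) j| <= 2 * d * E.
  rewrite /fmean gmode_sum (le_trans (ler_norm_sum _ _ _))//.
  apply: (@le_trans _ _ (2 * d * \sum_(1 <= k < n.+2) (if fold_mode k == j then ell k else 0))).
    rewrite mulr_sumr; apply: ler_sum_nat => k /andP[k0 _].
        have h1 : acoef n k / acoef n 0 <= 1 :> R by rewrite ler_pdivrMr ?acoef0_gt0// mul1r acoef_le0.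
    have h0 : 0 <= acoef n k / acoef n 0 :> R by rewrite divr_ge0 ?acoef_ge0.
    have h2 := ler_pM h0 (normr_ge0 _) h1 (wl k k0).
    rewrite gmodeZ normrM (normrM (acoef n k / acoef n 0)) (ger0_norm h0).
    apply: (@le_trans _ _ (1 * (d * ell k) * (if fold_mode k == j then 2 else 0))).
      by apply: ler_pM (normr_ge0 _) h2 (gmode_psi_le k jM); rewrite mulr_ge0.
    case: ifP => _; last by rewrite !mulr0.
    by rewrite le_eqVlt; apply/orP; left; apply/eqP; ring.
  by rewrite ler_wpM2l ?mulr_ge0.
have cv : gmode M (fun i => fmean n w (node M i)) j @[n --> \oo] -->
    gmode M (fun i => w (node M i)) j.
  rewrite /gmode; apply: cvgM; first exact: cvg_cst.
  apply: cvg_sum_nat => i iM; apply: cvgM; last exact: cvg_cst.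
  have nI := node_itv iM.
  exact: fmean_cvg mw nI wB (cw _ nI).
rewrite ler_norml; apply/andP; split.
  apply: (ler_cvg_to (@cvg_cst _ _ _ _ _) cv); near=> n.
  by have := le n; rewrite ler_norml => /andP[].
apply: (ler_cvg_to cv (@cvg_cst _ _ _ _ _)); near=> n.
by have := le n; rewrite ler_norml => /andP[].
Unshelve. all: by end_near. Qed.

(** Cauchy-Schwarz with the factors [1 / k] and [k * ell k] suggests [beta j^2 = 4 / j^2 * Q j],
    where [Q j] is the part of the sum of [(k * ell k)^2] folded onto [j]. The fibres of the folding
    are disjoint, so the [Q j] add up to at most [S] for every [M]. *)
Lemma fold_weights (ell : nat -> R) S : (forall k, 0 <= ell k) ->
  (forall n, \sum_(1 <= k < n.+1) (k%:R * ell k) ^+ 2 <= S) ->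
  exists2 beta : nat -> R, (forall j, 0 <= beta j) &
    (forall j n, (0 < j < M)%N ->
      \sum_(1 <= k < n.+1) (if fold_mode k == j then ell k else 0) <= beta j) /\
    \sum_(1 <= j < M) j%:R ^+ 2 * beta j ^+ 2 <= 4 * S.
Proof.
move=> l0 lS.
pose q j n : R := \sum_(1 <= k < n.+1) (if fold_mode k == j then (k%:R * ell k) ^+ 2 else 0).
have term0 j k : 0 <= (if fold_mode k == j then (k%:R * ell k) ^+ 2 else 0) :> R.
  by case: ifP => _ //; exact: sqr_ge0.
have qlim j : exists l, [/\ q j n @[n --> \oo] --> l, forall n, q j n <= l & l <= S].
  apply: bounded_monotone_limit => [n m nm|n].
    by apply: sum_nonneg_le_widen => // k; exact: term0.
  apply: le_trans (lS n); apply: ler_sum => k _; case: ifP => _ //; exact: sqr_ge0.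
have [Q hQ] := choice qlim.
have Q0 j : 0 <= Q j.
  by have [_ h _] := hQ j; apply: le_trans (h 0%N); rewrite /q big_geq.
exists (fun j => Num.sqrt (4 / j%:R ^+ 2 * Q j)) => [j|]; first exact: sqrtr_ge0.
split => [j n jM|].
  have s0 : 0 <= \sum_(1 <= k < n.+1) (if fold_mode k == j then ell k else 0) :> R.
    by apply: sumr_ge0 => k _; case: ifP.
  rewrite -[leLHS](@ger0_norm R)// -sqrtr_sqr ler_sqrt ?mulr_ge0 ?divr_ge0 ?sqr_ge0//.
  pose x k : R := if fold_mode k == j then k%:R^-1 else 0.
  pose y k : R := if fold_mode k == j then k%:R * ell k else 0.
  have -> : \sum_(1 <= k < n.+1) (if fold_mode k == j then ell k else 0) =
      \sum_(1 <= k < n.+1) x k * y k.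
    apply: eq_big_nat => k /andP[k0 _]; rewrite /x /y; case: ifP => _; last by rewrite mul0r.
    by rewrite mulKf// pnatr_eq0 -lt0n.
  have xy0 k : 0 <= x k * y k.
    by rewrite /x /y; case: ifP => _; rewrite ?mul0r// !mulr_ge0// invr_ge0.
  apply: (le_trans (sum_cauchy_schwarz _ _ xy0)).
  apply: ler_pM; rewrite ?sumr_ge0//; try by move=> k _; exact: sqr_ge0.
    apply: le_trans (fold_inv_sqr_sum n jM); apply: ler_sum => k _; rewrite /x.
    by case: ifP => _; rewrite ?exprVn// expr0n.
  have [_ h _] := hQ j; apply: le_trans (h n); apply: ler_sum => k _; rewrite /y.
  by case: ifP => _ //; rewrite expr0n.
apply: (@le_trans _ _ (\sum_(1 <= j < M) 4 * Q j)).
  apply: ler_sum_nat => j /andP[j0 _].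
  rewrite sqr_sqrtr ?mulr_ge0 ?divr_ge0 ?sqr_ge0//.
  by rewrite le_eqVlt; apply/orP; left; apply/eqP; field; rewrite pnatr_eq0 -lt0n.
rewrite -mulr_sumr ler_wpM2l//.
have cv : \sum_(1 <= j < M) q j n @[n --> \oo] --> \sum_(1 <= j < M) Q j.
  by apply: cvg_sum_nat => j _; have [] := hQ j.
apply: (ler_cvg_to cv (@cvg_cst _ _ _ _ _)); near=> n.
rewrite /q exchange_big/=; apply: le_trans (lS n); apply: ler_sum => k _.
under eq_bigr do rewrite eq_sym.
rewrite -big_mkcond big_nat1_eq; case: ifP => _ //; exact: sqr_ge0.
Unshelve. all: by end_near. Qed.

End Alias.

Lemma sin_lipschitz (a b : R) : `|sin a - sin b| <= `|a - b|.
Proof.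
have key (x y : R) : x <= y -> `|sin y - sin x| <= `|y - x|.
  move=> xy; have [|c _ ->] := @MVT_segment R sin cos x y xy.
  - by apply: continuous_subspaceT; exact: continuous_sin.
  by rewrite normrM ler_piMl// cos_max.
have [ab|/ltW ba] := leP a b; last exact: key.
by rewrite distrC [`|a - b|]distrC; exact: key.
Qed.

Lemma psi_near_le k (c x : R) : psi k c = 0 -> `|psi k x| <= 2 * (k%:R * pi * `|x - c|).
Proof.
move=> pc; rewrite -[psi k x]subr0 -pc /psi -mulrBr normrM ler_pM//.
  by rewrite ger0_norm ?sqrtr_ge0// sqrt2_le2.
apply: (le_trans (sin_lipschitz _ _)).
by rewrite -mulrBr normrM ger0_norm// mulr_ge0 ?pi_ge0.
Qed.

(** By Cauchy-Schwarz the means at [x] are at most a constant times the square root of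
    [sum (psi k x / k)^2]. This tends to 0 at an end point: the first [N] terms by the distance to
    [c], the others because they sum to at most [4 / N]. It will show that increments of [u_xx] in
    time vanish at the ends, where [u_xx] itself is not prescribed. *)
Lemma boundary_vanish (w : R -> R) (B d S : R) (ell : nat -> R) (c : R) : 0 <= d -> 0 <= S ->
  0 <= c <= 1 -> (forall k, psi k c = 0 :> R) ->
  measurable_fun U w -> (forall y, 0 < y < 1 -> `|w y| <= B) ->
  {within `[0, 1], continuous w} ->
  (forall k, (0 < k)%N -> `|L2_inner w (psi k)| <= d * ell k) ->
  (forall k, 0 <= ell k) ->
  (forall n, \sum_(1 <= k < n.+1) (k%:R * ell k) ^+ 2 <= S) ->
  w c = 0.
Proof.
move=> d0 S0 cI pc mw wB cw wl l0 lS.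
have inU (y : R) : 0 < y < 1 -> `[0, 1]%classic y.
  by move=> /andP[h1 h2]; rewrite /= in_itv/= !ltW.
have psis n N (x : R) : (0 < N)%N -> \sum_(1 <= k < n.+1) (k%:R^-1 * `|psi k x|) ^+ 2 <=
    N%:R * (2 * (pi * `|x - c|)) ^+ 2 + 4 / N%:R :> R.
  move=> N0; have N0' : 0 < N%:R :> R by rewrite ltr0n.
  apply: (@le_trans _ _ (\sum_(1 <= k < (n + N).+1) (k%:R^-1 * `|psi k x|) ^+ 2)).
    by apply: sum_nonneg_le_widen => [|k]; [rewrite ltnS leq_addr|exact: sqr_ge0].
  rewrite (@big_cat_nat _ _ _ N.+1)//=; last by rewrite ltnS leq_addl.
  apply: lerD.
    apply: (@le_trans _ _ (\sum_(1 <= k < N.+1) (2 * (pi * `|x - c|)) ^+ 2)).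
      apply: ler_sum_nat => k /andP[k0 _]; have k0' : 0 < k%:R :> R by rewrite ltr0n.
      rewrite lerXn2r ?nnegrE ?mulr_ge0 ?pi_ge0 ?invr_ge0//.
      rewrite mulrC ler_pdivrMr// (le_trans (psi_near_le x (pc k)))//.
      by rewrite le_eqVlt; apply/orP; left; apply/eqP; ring.
    by rewrite sumr_const_nat subn1/= -[leLHS]mulr_natl.
  apply: (@le_trans _ _ (\sum_(N.+1 <= k < (n + N).+1) 4 * (k%:R ^+ 2)^-1)).
    apply: ler_sum_nat => k /andP[k0 _]; rewrite exprMn exprVn mulrC ler_wpM2r ?invr_ge0 ?sqr_ge0//.
    have -> : 4 = 2 ^+ 2 :> R by rewrite expr2 -natrM.
    by rewrite lerXn2r ?nnegrE// psi_le.
  rewrite -mulr_sumr ler_wpM2l// (le_trans (sum_inv_sqr_tail _))//.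
    by rewrite N0 leq_addl.
  by rewrite gerBl invr_ge0.
have wx N (x : R) : (0 < N)%N -> 0 < x < 1 ->
    `|w x| ^+ 2 <= d ^+ 2 * (S * (N%:R * (2 * (pi * `|x - c|)) ^+ 2 + 4 / N%:R)).
  move=> N0 xI; set Z := S * _.
  have Z0 : 0 <= Z.
    apply: mulr_ge0 => //; apply: addr_ge0; last exact: divr_ge0.
    by apply: mulr_ge0 => //; exact: sqr_ge0.
  have bound n : `|fmean n w x| <= Num.sqrt (d ^+ 2 * Z).
    rewrite /fmean (le_trans (ler_norm_sum _ _ _))//.
    apply: (@le_trans _ _ (d * \sum_(1 <= k < n.+2) (k%:R * ell k) * (k%:R^-1 * `|psi k x|))).
      rewrite mulr_sumr; apply: ler_sum_nat => k /andP[k0 _].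
      have h1 : acoef n k / acoef n 0 <= 1 :> R by rewrite ler_pdivrMr ?acoef0_gt0// mul1r acoef_le0.
      have h0 : 0 <= acoef n k / acoef n 0 :> R by rewrite divr_ge0 ?acoef_ge0.
      have h2 := ler_pM h0 (normr_ge0 _) h1 (wl k k0).
      rewrite (normrM _ (psi k x)) (normrM (acoef n k / acoef n 0)) (ger0_norm h0).
      have -> : d * (k%:R * ell k * (k%:R^-1 * `|psi k x|)) = 1 * (d * ell k) * `|psi k x|.
        by field; rewrite pnatr_eq0 -lt0n.
      exact: ler_wpM2r.
    set s := \sum_(_ <= _ < _) _.
    have s0 : 0 <= s by apply: sumr_ge0 => k _; rewrite !mulr_ge0// invr_ge0.
    have dZ : 0 <= d ^+ 2 * Z by rewrite mulr_ge0// sqr_ge0.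
    rewrite -[leLHS](@ger0_norm R) ?mulr_ge0// -sqrtr_sqr ler_sqrt//.
    rewrite exprMn ler_wpM2l ?sqr_ge0//.
    apply: (le_trans (sum_cauchy_schwarz _ _ _)).
      by move=> k; rewrite !mulr_ge0// invr_ge0.
    by apply: ler_pM; rewrite ?lS ?psis// sumr_ge0// => k _; exact: sqr_ge0.
  have cv : fmean n w x @[n --> \oo] --> w x.
    apply: (fmean_cvg mw xI wB) => e e0.
    have [r r0 hr] := within_continuous_eps cw (inU x xI) e0.
    by exists r => // y /inU yI yx; exact: hr.
  have h : `|w x| <= Num.sqrt (d ^+ 2 * Z).
    rewrite ler_norml; apply/andP; split.
      apply: (ler_cvg_to (@cvg_cst _ _ _ _ _) cv); near=> n.
      by have := bound n; rewrite ler_norml => /andP[].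
    apply: (ler_cvg_to cv (@cvg_cst _ _ _ _ _)); near=> n.
    by have := bound n; rewrite ler_norml => /andP[].
  have dZ0 : 0 <= d ^+ 2 * Z by rewrite mulr_ge0// sqr_ge0.
  by rewrite -(sqr_sqrtr dZ0) lerXn2r ?nnegrE ?sqrtr_ge0.
apply/eqP; rewrite -normr_le0; apply/ler_addgt0Pl => e e0; rewrite addr0.
have e2 : 0 < e / 2 by rewrite divr_gt0.
pose K := d ^+ 2 * S + 1.
have K0 : 0 < K by rewrite ltr_wpDl// mulr_ge0// sqr_ge0.
(* [N] brings the tail below half of [(e / 2)^2]; afterwards [del], the distance of [x] to [c], is
   chosen to do the same with the first terms. *)
have [N hN] := archi_ge (8 * K / (e / 2) ^+ 2).
have N10 : 0 < N.+1%:R :> R by rewrite ltr0n.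
have cI' : `[0, 1]%classic c by rewrite /= in_itv.
have [r r0 hr] := within_continuous_eps cw cI' e2.
pose P : R := 8 * N.+1%:R * K * pi ^+ 2.
have P0 : 0 < P.
  apply: mulr_gt0; first by rewrite mulr_gt0// mulr_gt0.
  by rewrite exprn_gt0// pi_gt0.
pose del := Num.min (r / 2) (Num.min (4^-1) (e / 2 / (P + 1))).
have P10 : 0 < P + 1 by lra.
have del0 : 0 < del by rewrite !lt_min !divr_gt0// invr_gt0 ltr0n.
have delr : del < r by rewrite /del gt_min ltr_pdivrMr// ltr_pMr// ltr1n.
have del2 : del <= 4^-1 by rewrite /del !ge_min lexx orbT.
have delP : del <= e / 2 / (P + 1) by rewrite /del !ge_min lexx !orbT.
have [x xI xc] : exists2 x, 0 < x < 1 & `|x - c| = del.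
  have [h|h] := leP c 2^-1.
    exists (c + del); first by lra.
    by rewrite addrAC subrr add0r gtr0_norm.
  exists (c - del); first by lra.
  by rewrite addrAC subrr add0r normrN gtr0_norm.
have wc : `|w x - w c| <= e / 2 by apply: hr; rewrite ?xc//; exact: inU.
suff wx2 : `|w x| <= e / 2.
  rewrite -[w c](subrK (w x)) addrC (le_trans (ler_normD _ _))// [e]splitr lerD//.
  by rewrite distrC.
rewrite -(@ler_pXn2r _ 2) ?nnegrE ?(ltW e2)//.
apply: (le_trans (wx N.+1 x (ltn0Sn N) xI)); rewrite xc mulrA.
have SK : d ^+ 2 * S <= K by rewrite lerDl.
have Y0 : 0 <= N.+1%:R * (2 * (pi * del)) ^+ 2 + 4 / N.+1%:R :> R.
  apply: addr_ge0; last exact: divr_ge0.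
  by apply: mulr_ge0 => //; exact: sqr_ge0.
apply: (le_trans (ler_wpM2r Y0 SK)); rewrite mulrDr.
have h1 : K * (N.+1%:R * (2 * (pi * del)) ^+ 2) <= (e / 2) ^+ 2 / 2.
  have -> : K * (N.+1%:R * (2 * (pi * del)) ^+ 2) = P * del * del / 2.
    by rewrite /P; field.
  have dP : del * (P + 1) <= e / 2 by rewrite -ler_pdivlMr.
  have Pd0 : 0 <= P * del by rewrite mulr_ge0// ltW.
  rewrite ler_pM2r// expr2; apply: ler_pM => //; [exact: ltW|lra|lra].
have h2 : K * (4 / N.+1%:R) <= (e / 2) ^+ 2 / 2.
  have {}hN : 8 * K / (e / 2) ^+ 2 <= N.+1%:R.
    by apply: (le_trans hN); rewrite ler_nat.
  move: hN; rewrite ler_pdivrMr ?exprn_gt0// => hN.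
  rewrite mulrA ler_pdivrMr//; move: hN; set a := N.+1%:R; set b := (e / 2) ^+ 2; lra.
by rewrite [leRHS]splitr lerD.
Unshelve. all: by end_near. Qed.

End Reconstruction.

(** * Convergence *)

Section GammaPositive.
Context {R : realType} (alpha : R) (alpha01 : 0 < alpha < 1).
Local Notation mu := (@lebesgue_measure R).

Let beta01 : 0 < 1 - alpha < 1. Proof. by case/andP: alpha01 => ? ?; apply/andP; split; lra. Qed.

Lemma GammaE_cL : Gamma alpha = cL (1 - alpha).
Proof.
rewrite /Gamma /cL /LI; apply: eq_Rintegral => p _.
by rewrite mulrC opprB.
Qed.

Lemma Gamma_gt0 : 0 < Gamma alpha.
Proof. by rewrite GammaE_cL; exact: cL_gt0. Qed.

(** The inequality [p >= 1 - exp (- p)] bounds the integrand from below by a difference of two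
    exponentials against the density, and both integrals are known from [LI_exp]. *)
Lemma Gamma_succ_gt0 : 0 < Gamma (alpha + 1).
Proof.
have -> : Gamma (alpha + 1) = LI (1 - alpha) (fun p => p * expR (- p)).
  rewrite /Gamma /LI; apply: eq_Rintegral => p /set_mem; rewrite /= in_itv/= andbT => p0.
  have -> : alpha + 1 - 1 = 1 + (alpha - 1) by ring.
  by rewrite opprB powRD ?(gt_eqF p0) ?implybT// powRr1 ?(ltW p0)// mulrAC.
have i1 := inL_exp beta01 ltr01; have i2 := inL_exp beta01 (@ltr0n R 2).
have half0 : 0 < 2^-1 :> R by rewrite invr_gt0.
have i3 := inL_exp beta01 half0.
have i4 : inL (1 - alpha) (fun p => p * expR (- p)).
  apply: (inL_dom _ (inLZ 2 i3)) => [|p p0].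
    by apply: measurable_funM => //; apply: measurableT_comp => //; exact: measurable_expR.
  rewrite ger0_norm ?mulr_ge0 ?expR_ge0 ?(ltW p0)//.
  have h := @mulr_expN_le1 _ (p / 2).
  have -> : - p = - (p / 2) + - (p / 2) by field.
  rewrite expRD mulrA ler_wpM2r ?expR_ge0//.
  have {}h : p / 2 * expR (- (p / 2)) <= 1 by apply: h; rewrite divr_ge0// ltW.
  by move: h; set a := expR _; lra.
have i5 := inLB i1 i2.
apply: (@lt_le_trans _ _ (LI (1 - alpha) (fun p => expR (- (p * 1)) - expR (- (p * 2))))); last first.
  apply: LI_le i5 i4 _ => p p0; rewrite mulr1.
  have -> : - (p * 2) = - p + - p by ring.
  rewrite expRD -{1}[expR (- p)]mul1r -mulrBl ler_wpM2r ?expR_ge0//.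
  by rewrite lerBlDr -lerBlDl; have := @expR_ge1Dx R (- p); rewrite addrC.
rewrite LIB// !LI_exp// powR1 -mulrBr mulr_gt0 ?cL_gt0// subr_gt0.
have -> : 1 - alpha - 1 = - alpha by ring.
have a0 : 0 < alpha by case/andP: alpha01.
have e1 : 1 `^ alpha = 1 :> R by rewrite powR1.
rewrite powRN invf_lt1 ?powR_gt0// -[ltLHS]e1 gt0_ltr_powR ?nnegrE//.
exact: ltr1n.
Qed.

End GammaPositive.

(** * The relaxation equation of one Fourier coefficient of the solution *)

Section CoefficientEquation.
Context {R : realType} (alpha T : R) (phi : R -> R) (f u : R -> R -> R).
Context (alpha01 : 0 < alpha < 1) (T0 : 0 < T).
Context (u_sol : is_solution alpha T phi f u).
Context (u_dx6 : forall x t : R, 0 <= x <= 1 -> 0 <= t <= T -> dx_exists 6 u x t).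
Context (u_dx6_cont : {within (`[0, 1] `*` `[0, T] : set (R * R)),
   continuous (fun p : R * R => dx 6 u p.1 p.2)}).
Context (u_dt : forall x t : R, 0 <= x <= 1 -> 0 <= t <= T -> derivableS `[0, T] (u x) t).
Context (u_dt_cont : {within (`[0, 1] `*` `[0, T] : set (R * R)),
   continuous (fun p : R * R => dt_cc T u p.1 p.2)}).
Local Notation mu := (@lebesgue_measure R).
Local Notation U := (`]0, 1[%classic : set R).
Local Notation kern x := (fun s : R => (x - s) `^ (alpha - 1)).

Let v := dx 2 u.
Let inI (x : R) : 0 < x < 1 -> 0 <= x <= 1.
Proof. by move=> /andP[h1 h2]; rewrite !ltW. Qed.

Lemma solution_initial x : 0 <= x <= 1 -> u x 0 = phi x.
Proof.
move=> xI; have [h _] := u_sol.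
have t0 : 0 <= (0 : R) <= T by rewrite lexx ltW.
have [_ ->] := h x 0 xI t0.
by rewrite /frac_int set_itvoo0 Rintegral_set0 addr0.
Qed.

Lemma measurable_dx2 : measurable_fun (U `*` `]0, T]) (fun z : R * R => v z.1 z.2).
Proof.
apply: (@slice_measurable _ U T v) => //.
  move=> t /andP[t0 tT]; apply: (@measurable_dx _ T u u_dx6 2) => //.
  by rewrite (ltW t0).
move=> x; rewrite /= in_itv/= => /inI xI t /andP[t0 tT] e e0.
have tI : 0 <= t <= T by rewrite (ltW t0).
have [d d0 hd] := dx2_time_continuous T0 u_dx6 u_dx6_cont u_dt u_dt_cont xI tI e0.
by exists d => // s /andP[s0 sT]; apply: hd; rewrite (ltW s0).
Qed.

Lemma frac_kernelE (t s : R) : frac_kernel alpha t s = (Gamma alpha)^-1 * (t - s) `^ (alpha - 1).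
Proof. by rewrite /frac_kernel mulrC. Qed.

Lemma Rint_open_co (t : R) (g : R -> R) : measurable_fun setT g ->
  \int[mu]_(s in `]0, t[) (kern t s * g s) = \int[mu]_(s in `[0, t[) (kern t s * g s).
Proof.
move=> mg; rewrite /Rintegral integral_itv_obnd_cbnd//.
apply/measurable_EFinP; apply: measurable_funM; last exact: measurable_funTS.
exact: measurable_kern.
Qed.

Lemma integrable_open_kern (t : R) : 0 <= t -> mu.-integrable `]0, t[ (EFin \o kern t).
Proof.
move=> t0; have h : 0 <= t <= t by rewrite t0 lexx.
apply: integrableS (integrable_kern alpha01 h) => //.
by move=> s; rewrite /= !in_itv/= => /andP[/ltW -> ->].
Qed.

Context (mphi : measurable_fun U phi).
Context (mf : measurable_fun (U `*` `]0, T]) (fun z : R * R => f z.1 z.2)).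
Context (fi : forall t, 0 < t <= T -> mu.-integrable U (EFin \o (f ^~ t))).
Context (Cf : R) (fC : forall t, 0 < t <= T -> \int[mu]_(x in U) `|f x t| <= Cf).

(** The pointwise equation is paired with [psi k] and Green's formula replaces the coefficient of
    [u_xx]. Fubini is justified by the sup bound on [u_xx] and the bound [Cf] on the integral of the
    source, against the integrable kernel. *)
Lemma solution_coef_equation k t : 0 < t <= T ->
  L2_inner (u ^~ t) (psi k) - L2_inner (u ^~ 0) (psi k) = (Gamma alpha)^-1 *
    \int[mu]_(s in `]0, t[) (kern t s *
      (L2_inner (f ^~ s) (psi k) - lambda k * L2_inner (u ^~ s) (psi k))).
Proof.
move=> /andP[t0 tT]; have tI : 0 <= t <= T by rewrite (ltW t0).
have [D D0 hD] := @dx_bounded _ T u T0 u_dx6 u_dx6_cont u_dt u_dt_cont 2 isT.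
have [D' D'0 hD'] := @dx_bounded _ T u T0 u_dx6 u_dx6_cont u_dt u_dt_cont 0 isT.
have [G0 Gp] : Gamma alpha != 0 /\ 0 < Gamma alpha.
  by have := Gamma_gt0 alpha01 => h; rewrite gt_eqF.
pose F (z : R * R) := frac_kernel alpha t z.2 * (v z.1 z.2 + f z.1 z.2) * psi k z.1.
pose P x := (u x t - u x 0) * psi k x.
have mU : measurable U by exact: measurable_itv.
have mD : measurable (`]0, t[%classic : set R) by exact: measurable_itv.
have sT s : `]0, t[%classic s -> 0 < s <= T.
  by rewrite /= in_itv/= => /andP[-> /ltW h]; rewrite (le_trans h).
have sub : U `*` `]0, t[ `<=` U `*` `]0, T].
  by move=> [x s] [/= h1 h2]; split => //=; rewrite in_itv/=; exact: sT.
have mrect : measurable (U `*` `]0, T]) by exact: measurableX.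
have mk E : measurable_fun E (fun s => frac_kernel alpha t s).
  by apply: measurable_funM => //; exact: measurable_kern.
have mF : measurable_fun (U `*` `]0, t[) F.
  apply: measurable_funM; last first.
    apply: measurable_funTS; apply: (@measurableT_comp _ _ _ _ _ _ (psi k) _ fst) => //.
    exact: measurable_psi.
  apply: measurable_funM.
    apply: measurable_funTS; by apply: (@measurableT_comp _ _ _ _ _ _ (frac_kernel alpha t) _ snd).
  by apply: measurable_funD; [apply: measurable_funS measurable_dx2|apply: measurable_funS mf].
have vi s : 0 < s <= T -> mu.-integrable U (EFin \o (v ^~ s)).
  move=> /andP[s0 sT']; have sI : 0 <= s <= T by rewrite (ltW s0).
  apply: (@bounded_integrable _ _ D); first exact: (@measurable_dx _ T u u_dx6 2).
  by move=> x /inI xI; exact: hD.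
have vfi s : 0 < s <= T -> mu.-integrable U (EFin \o (fun x => v x s + f x s)).
  by move=> sI; apply: eq_integrable (integrableD _ (vi s sI) (fi sI)).
have vfpi s : 0 < s <= T -> mu.-integrable U (EFin \o (fun x => (v x s + f x s) * psi k x)).
  by move=> sI; exact: (integrableM_bounded (vfi s sI) (bounded_mfun_psi k)).
have iA s : `]0, t[%classic s -> mu.-integrable U (fun x => (F (x, s))%:E).
  move=> /sT sI; apply: eq_integrable (integrableZl _ (frac_kernel alpha t s) (vfpi s sI)) => // x _.
  by rewrite /F /= -EFinM mulrA.
pose b s := (D + Cf) * 2 * (Gamma alpha)^-1 * kern t s.
have ib : mu.-integrable `]0, t[ (EFin \o b).
  have ik := integrable_open_kern (ltW t0).
  by apply: eq_integrable (integrableZl _ ((D + Cf) * 2 * (Gamma alpha)^-1) ik).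
have hb s : `]0, t[%classic s -> \int[mu]_(x in U) `|F (x, s)| <= b s.
  move=> /sT sI; have /andP[s0 sT'] := sI; have sI' : 0 <= s <= T by rewrite (ltW s0).
  have i1 := integrable_norm (vfpi s sI).
  have i2 := integrable_norm (fi sI).
  have i3 : mu.-integrable U (EFin \o (fun x => (D + `|f x s|) * 2)).
    have ic : mu.-integrable U (EFin \o (fun=> D : R)).
      by apply: (@bounded_integrable _ _ D) => // x _; rewrite ger0_norm.
    have i4 : mu.-integrable U (EFin \o (fun x => D + `|f x s|)).
      by apply: eq_integrable (integrableD _ ic i2).
    by apply: eq_integrable (integrableZr _ 2 i4).
  have k0 : 0 <= frac_kernel alpha t s by rewrite divr_ge0 ?powR_ge0// ltW.
  have e : \int[mu]_(x in U) `|F (x, s)| =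
      frac_kernel alpha t s * \int[mu]_(x in U) `|(v x s + f x s) * psi k x|.
    rewrite -RintegralZl//; apply: eq_Rintegral => x _.
    by rewrite /F/= -mulrA normrM ger0_norm.
  rewrite e /b -[_ * _ * kern t s]mulrA -frac_kernelE mulrC ler_wpM2r//.
  apply: (@le_trans _ _ (\int[mu]_(x in U) ((D + `|f x s|) * 2))).
    apply: le_Rintegral => // x; rewrite /= in_itv/= => /inI xI.
    rewrite (normrM _ (psi k x)) ler_pM ?psi_le//.
    by rewrite (le_trans (ler_normD _ _))// lerD2r hD.
  have ic : mu.-integrable U (EFin \o (fun=> D : R)).
    by apply: (@bounded_integrable _ _ D) => // x _; rewrite ger0_norm.
  rewrite RintegralZr//; last by apply: eq_integrable (integrableD _ ic i2).
  by rewrite ler_wpM2r// RintegralD// Rint_unit_cst lerD2l fC.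
have mu_ r : 0 <= r <= T -> measurable_fun U (u ^~ r).
  by move=> rI; exact: (@measurable_dx _ T u u_dx6 0).
have z0 : 0 <= (0 : R) <= T by rewrite lexx ltW.
have mP : measurable_fun U P.
  apply: measurable_funM; last exact: measurable_psi.
  by apply: measurable_funB; exact: mu_.
have hP x : U x -> mu.-integrable `]0, t[ (fun s => (F (x, s))%:E) ->
    P x = \int[mu]_(s in `]0, t[) F (x, s).
  rewrite /= in_itv/= => /inI xI _; have [h _] := u_sol; have [i1 e] := h x t xI tI.
  rewrite /P solution_initial// e addrC addKr /frac_int -RintegralZr//.
have [i1 e1] := fubini_rect_dom mU mD mF iA ib hb mP hP.
have iu r : 0 <= r <= T -> mu.-integrable U (EFin \o (fun x => u x r * psi k x)).
  move=> rI; apply: (@bounded_integrable _ _ (D' * 2)).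
    by apply: measurable_funM; [exact: mu_|exact: measurable_psi].
  by move=> x /inI xI; rewrite normrM ler_pM ?psi_le//; exact: hD'.
have -> : L2_inner (u ^~ t) (psi k) - L2_inner (u ^~ 0) (psi k) = \int[mu]_(x in U) P x.
  rewrite /L2_inner -RintegralB//; [|exact: iu|exact: iu].
  by apply: eq_Rintegral => x _; rewrite /P mulrBl.
have [_ ub] := u_sol.
have inner s : 0 < s <= T -> \int[mu]_(x in U) F (x, s) = (Gamma alpha)^-1 * (kern t s *
    (L2_inner (f ^~ s) (psi k) - lambda k * L2_inner (u ^~ s) (psi k))).
  move=> sI; have /andP[s0 sT'] := sI; have sI' : 0 <= s <= T by rewrite (ltW s0).
  have [us0 us1] := ub s sI'.
  have j1 := integrableM_bounded (vi s sI) (bounded_mfun_psi k).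
  have j2 := integrableM_bounded (fi sI) (bounded_mfun_psi k).
  have -> : \int[mu]_(x in U) F (x, s) =
      frac_kernel alpha t s * \int[mu]_(x in U) ((v x s + f x s) * psi k x).
    rewrite -RintegralZl//; last exact: vfpi.
    by apply: eq_Rintegral => x _; rewrite /F/= mulrA.
  have -> : \int[mu]_(x in U) ((v x s + f x s) * psi k x) =
      L2_inner (v ^~ s) (psi k) + L2_inner (f ^~ s) (psi k).
    by rewrite /L2_inner -RintegralD//; apply: eq_Rintegral => x _; rewrite mulrDl.
  rewrite /v (@dx2_coef _ T u T0 u_dx6 u_dx6_cont u_dt u_dt_cont s k sI' us0 us1).
  by rewrite frac_kernelE mulNr [- _ + _]addrC -mulrA.
have i2 : mu.-integrable `]0, t[ (EFin \o (fun s => kern t s *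
    (L2_inner (f ^~ s) (psi k) - lambda k * L2_inner (u ^~ s) (psi k)))).
  apply: eq_integrable (integrableZl _ (Gamma alpha) i1) => // s /set_mem /sT sI.
  by rewrite /= inner// -EFinM mulVKf.
rewrite e1 -RintegralZl//.
by apply: eq_Rintegral => s /set_mem /sT sI; exact: inner.
Qed.

Lemma solution_coef_lipschitz k L : (0 < k)%N -> 0 <= L ->
  lipschitz_in `]0, T] L (fun t => L2_inner (f ^~ t) (psi k)) ->
  lipschitz_in `[0, T] (L / lambda k) (fun t => L2_inner (u ^~ t) (psi k)).
Proof.
move=> k0 L0 FL.
have lam0 : 0 < lambda k :> R by apply: lt_le_trans (lambda_ge1 k0).
have [C C0 zL] := @coef_time_lipschitz _ T u T0 u_dx6 u_dx6_cont u_dt u_dt_cont k.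
have ne1 : (`[0, T] : set R) !=set0 by exists 0; rewrite /= in_itv/= lexx ltW.
have ne2 : (`]0, T] : set R) !=set0 by exists T; rewrite /= in_itv/= T0 lexx.
have [z zg zE] := lipschitz_extension ne1 C0 zL.
(* The source is controlled on []0, T]] only; the extension also supplies a value at time 0, which
   the relaxation argument uses. *)
have [F Fg FE] := lipschitz_extension ne2 L0 FL.
have cz := lipschitz_inT_continuous zg; have cF := lipschitz_inT_continuous Fg.
have g00 : 0 < (Gamma alpha)^-1 by rewrite invr_gt0 Gamma_gt0.
have eqz t : 0 <= t <= T -> z t = z 0 + (Gamma alpha)^-1 *
    \int[mu]_(s in `[0, t[) ((t - s) `^ (alpha - 1) * (F s - lambda k * z s)).
  move=> /andP[t0 tT]; move: t0; rewrite le_eqVlt => /predU1P[<-|t0].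
    by rewrite set_itvco0 Rintegral_set0 mulr0 addr0.
  have tI : 0 < t <= T by rewrite t0.
  rewrite -Rint_open_co; last first.
    apply: measurable_funB; first exact: continuous_measurable_fun.
    by apply: measurable_funM => //; exact: continuous_measurable_fun.
  rewrite !zE /= ?in_itv/= ?lexx ?(ltW T0) ?(ltW t0)//.
  apply/eqP; rewrite addrC -subr_eq; apply/eqP; rewrite (solution_coef_equation k tI).
  congr (_ * _); apply: eq_Rintegral => s /set_mem; rewrite /= in_itv/= => /andP[s0 st].
  have sT := le_trans (ltW st) tT.
  by rewrite zE ?FE//= in_itv/= ?s0 ?(ltW s0).
have h := relaxation_lipschitz alpha01 T0 g00 lam0 L0 C0 zg Fg eqz.
by move=> s t sI tI; rewrite -!zE//; exact: h.
Qed.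

End CoefficientEquation.

(** Aliasing only lowers frequencies; with [gev_le] this gives [gev M j <= lambda k] for every [k]
    folded onto [j]. *)
Lemma fold_mode_ge (M j k : nat) : (0 < j < M)%N -> fold_mode M k == j -> (j <= k)%N.
Proof.
move=> jM; rewrite fold_modeP//; last by case/andP: jM => j0; apply: ltn_trans.
have := leq_mod k (2 * M); move: (k %% (2 * M))%N => r rk.
by case/orP => /eqP e; lia.
Qed.

Section Algebra.
Context {R : realType}.

Lemma compact_split (p1 p2 p3 g1 g2 g3 w1 w2 w3 U1 U2 U3 S : R) :
  (U1 + 10 * U2 + U3) / 12 = (p1 + 10 * p2 + p3) / 12 + (g1 + 10 * g2 + g3) / 12 + S ->
  (p1 + g1 + w1 - U1 + 10 * (p2 + g2 + w2 - U2) + (p3 + g3 + w3 - U3)) / 12 =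
    (w1 + 10 * w2 + w3) / 12 - S.
Proof. by lra. Qed.

Lemma weight_algebra (G w g a b : R) :
  G * w / 2 * (- g * b + - g * a) = - (g * G) * (w * ((a + b) / 2)).
Proof. by field. Qed.

Lemma mode_algebra (e g G J S : R) : e != 0 -> g != 0 -> G != 0 ->
  e^-1 * (G^-1 * J - - (g / G) * S) = - (g / (e * G)) * (- g^-1 * J - S).
Proof. by move=> e0 g0 G0; field; rewrite e0 g0 G0. Qed.

End Algebra.

(** * The error equation of a grid mode *)

Section GridError.
Context {R : realType} (alpha T : R) (phi : R -> R) (f u : R -> R -> R).
Context (alpha01 : 0 < alpha < 1) (T0 : 0 < T).
Context (u_sol : is_solution alpha T phi f u).
Context (u_dx6 : forall x t : R, 0 <= x <= 1 -> 0 <= t <= T -> dx_exists 6 u x t).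
Context (u_dx6_cont : {within (`[0, 1] `*` `[0, T] : set (R * R)),
   continuous (fun p : R * R => dx 6 u p.1 p.2)}).
Context (u_dt : forall x t : R, 0 <= x <= 1 -> 0 <= t <= T -> derivableS `[0, T] (u x) t).
Context (u_dt_cont : {within (`[0, 1] `*` `[0, T] : set (R * R)),
   continuous (fun p : R * R => dt_cc T u p.1 p.2)}).
Local Notation mu := (@lebesgue_measure R).
Local Notation U01 := (`]0, 1[%classic : set R).
Local Notation kern x := (fun s : R => (x - s) `^ (alpha - 1)).
Local Notation v := (dx 2 u).

Lemma Rint_lincomb (D : set R) (g : nat -> R -> R) (a : nat -> R) m n : measurable D ->
  (forall i, (m <= i < n)%N -> mu.-integrable D (EFin \o g i)) ->
  mu.-integrable D (EFin \o (fun s => \sum_(m <= i < n) a i * g i s)) /\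
  \int[mu]_(s in D) (\sum_(m <= i < n) a i * g i s) =
    \sum_(m <= i < n) a i * \int[mu]_(s in D) g i s.
Proof.
move=> mD; elim: n => [|n IH] h.
  have z : (fun s => \sum_(m <= i < 0) a i * g i s) = fun=> 0.
    by apply/funext => s; rewrite big_geq.
  by rewrite z Rintegral_cst// mul0r big_geq//; split => //; exact: integrable0.
have [mn|nm] := leqP m n; last first.
  have z : (fun s => \sum_(m <= i < n.+1) a i * g i s) = fun=> 0.
    by apply/funext => s; rewrite big_geq.
  by rewrite z Rintegral_cst// mul0r big_geq//; split => //; exact: integrable0.
have [|i1 e1] := IH; first by move=> i /andP[h1 h2]; apply: h; rewrite h1 ltnW.
have ign : mu.-integrable D (EFin \o g n) by apply: h; rewrite mn ltnSn.
have i2 : mu.-integrable D (EFin \o (fun s => a n * g n s)).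
  by apply: eq_integrable (integrableZl _ (a n) ign).
have z : (fun s => \sum_(m <= i < n.+1) a i * g i s) =
    fun s => \sum_(m <= i < n) a i * g i s + a n * g n s.
  by apply/funext => s; rewrite big_nat_recr.
rewrite z; split; first by apply: eq_integrable (integrableD _ i1 i2).
by rewrite RintegralD// e1 RintegralZl// big_nat_recr.
Qed.

(** Over a time increment the coefficients of [u_xx] move by at most [L k * |t - s|], those of [u]
    by [lambda k] times less; folding turns this into bounds for the grid modes, with [gev M j] in
    place of [lambda k]. The vanishing at the ends is included because the compact operator is
    diagonal on grid functions that are 0 there. *)
Lemma mode_lipschitz (M : nat) (L : nat -> R) S : (0 < M)%N -> (forall k, 0 <= L k) -> 0 <= S ->
  (forall n, \sum_(1 <= k < n.+1) lambda k * L k ^+ 2 <= S) ->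
  (forall k, (0 < k)%N -> lipschitz_in `[0, T] (L k / lambda k) (fun t => L2_inner (u ^~ t) (psi k))) ->
  exists2 beta : nat -> R, (forall j, 0 <= beta j) &
    \sum_(1 <= j < M) j%:R ^+ 2 * beta j ^+ 2 <= 4 * S /\
    forall s t, 0 <= s <= T -> 0 <= t <= T ->
      [/\ v 0 t - v 0 s = 0, v 1 t - v 1 s = 0 & forall j, (0 < j < M)%N ->
        `|gmode M (fun i => v (node M i) t - v (node M i) s) j| <= 2 * `|t - s| * beta j /\
        `|gmode M (fun i => u (node M i) t - u (node M i) s) j| <=
          2 * `|t - s| * (beta j / gev M j)].
Proof.
move=> M0 L0 S0 LS uL.
have inI (x : R) : 0 < x < 1 -> 0 <= x <= 1 by move=> /andP[h1 h2]; rewrite !ltW.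
have kS n : \sum_(1 <= k < n.+1) (k%:R * L k) ^+ 2 <= S.
  apply: le_trans (LS n); apply: ler_sum => k _.
  rewrite /lambda !exprMn ler_wpM2r ?sqr_ge0// ler_peMr ?sqr_ge0//.
  by rewrite expr_ge1 ?pi_ge0//; have := pi_ge2 R; lra.
have [beta b0 [bL bS]] := fold_weights M0 L0 kS.
exists beta => //; split => // s t sI tI.
have [_ ub] := u_sol; have [D D0 hD] := @dx_bounded _ T u T0 u_dx6 u_dx6_cont u_dt u_dt_cont 2 isT.
have [D' D'0 hD'] := @dx_bounded _ T u T0 u_dx6 u_dx6_cont u_dt u_dt_cont 0 isT.
have [ds cs] := chain_dx u_dx6 sI; have [dt ct] := chain_dx u_dx6 tI.
have wc j : (j < 6)%N -> {within `[(0 : R), 1], continuous (fun x => dx j u x t - dx j u x s)}.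
  by move=> j6 x; apply: cvgB; [exact: (ct j j6 x)|exact: (cs j j6 x)].
have wm j : (j < 6)%N -> measurable_fun U01 (fun x => dx j u x t - dx j u x s).
  by move=> j6; apply: measurable_funB; exact: (measurable_dx u_dx6).
have we j : (j < 6)%N -> forall x, 0 < x < 1 -> forall e, 0 < e -> exists2 r, 0 < r &
     forall y, 0 < y < 1 -> `|y - x| < r ->
       `|(dx j u y t - dx j u y s) - (dx j u x t - dx j u x s)| <= e.
  move=> j6 x /inI xI e e0.
  have xI' : `[0, 1]%classic x by rewrite /= in_itv.
  have [r r0 hr] := within_continuous_eps (wc j j6) xI' e0.
  by exists r => // y /inI yI; apply: hr; rewrite /= in_itv.
have bd2 y : 0 < y < 1 -> `|v y t - v y s| <= D + D.
  by move=> /inI yI; rewrite (le_trans (ler_normB _ _))// lerD// hD.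
have bd0 y : 0 < y < 1 -> `|u y t - u y s| <= D' + D'.
  by move=> /inI yI; rewrite (le_trans (ler_normB _ _))// lerD//; exact: hD'.
have ib j E r k : (j < 6)%N -> 0 <= r <= T ->
    (forall x, 0 <= x <= 1 -> `|dx j u x r| <= E) ->
    mu.-integrable U01 (EFin \o (fun x => dx j u x r * psi k x)).
  move=> j6 rI hE; apply: (@bounded_integrable _ _ (E * 2)).
    by apply: measurable_funM; [exact: (measurable_dx u_dx6)|exact: measurable_psi].
  by move=> x /inI xI; rewrite (normrM _ (psi k x)) ler_pM ?psi_le// hE.
have coefB j E k : (j < 6)%N -> (forall x r, 0 <= x <= 1 -> 0 <= r <= T -> `|dx j u x r| <= E) ->
    L2_inner (fun x => dx j u x t - dx j u x s) (psi k) =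
    L2_inner (dx j u ^~ t) (psi k) - L2_inner (dx j u ^~ s) (psi k).
  move=> j6 hE; rewrite /L2_inner -RintegralB//.
  - by apply: eq_Rintegral => x _; rewrite mulrBl.
  - by apply: (ib j E) => // x xI; exact: hE.
  - by apply: (ib j E) => // x xI; exact: hE.
have lamk k : (0 < k)%N -> 0 < lambda k :> R by move=> k0; apply: lt_le_trans (lambda_ge1 k0).
have uk k : (0 < k)%N -> `|L2_inner (u ^~ t) (psi k) - L2_inner (u ^~ s) (psi k)| <=
    L k / lambda k * `|t - s|.
  by move=> k0; apply: (uL k k0 s t); rewrite /= in_itv.
have [us0 us1] := ub s sI; have [ut0 ut1] := ub t tI.
have vl k : (0 < k)%N -> `|L2_inner (fun x => v x t - v x s) (psi k)| <= `|t - s| * L k.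
  move=> k0; rewrite (coefB 2 D)//.
  rewrite !(@dx2_coef _ T u T0 u_dx6 u_dx6_cont u_dt u_dt_cont)// -mulrBr normrM normrN.
  rewrite (gtr0_norm (lamk k k0)).
  apply: (@le_trans _ _ (lambda k * (L k / lambda k * `|t - s|))).
    by rewrite ler_wpM2l ?uk// ltW// lamk.
  by rewrite le_eqVlt; apply/orP; left; apply/eqP; field; rewrite gt_eqF ?lamk.
have ul k : (0 < k)%N -> `|L2_inner (fun x => u x t - u x s) (psi k)| <= `|t - s| * (L k / lambda k).
  by move=> k0; have := coefB 0%N D' k isT hD' => /= ->; rewrite mulrC; exact: uk.
have ts0 : 0 <= `|t - s| by [].
have pc0 k : psi k 0 = 0 :> R by rewrite /psi mulr0 sin0 mulr0.
have pc1 k : psi k 1 = 0 :> R.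
  by rewrite /psi mulr1 mulr_natl -[pi *+ _]add0r (alternatingn (@sinDpi R)) sin0 !mulr0.
split.
- by apply: (boundary_vanish ts0 S0 _ pc0 (wm 2 isT) bd2 (wc 2 isT) vl L0 kS); rewrite lexx ler01.
- by apply: (boundary_vanish ts0 S0 _ pc1 (wm 2 isT) bd2 (wc 2 isT) vl L0 kS); rewrite lexx ler01.
move=> j jM; split.
  apply: (gmode_fold_le M0 jM ts0 (wm 2 isT) bd2 (we 2 isT) vl L0).
  by move=> n; exact: bL.
have Ll0 k : 0 <= L k / lambda k by rewrite divr_ge0// sqr_ge0.
apply: (gmode_fold_le M0 jM ts0 (wm 0 isT) bd0 (we 0 isT) ul Ll0) => n.
have /andP[j0 jM'] := jM.
have gj : 0 < gev M j :> R.
  by apply: lt_le_trans (gev_ge M0 (ltnW jM')); rewrite divr_gt0// exprn_gt0// ltr0n.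
apply: (@le_trans _ _ ((\sum_(1 <= k < n.+1) (if fold_mode M k == j then L k else 0)) / gev M j)).
  rewrite mulr_suml; apply: ler_sum_nat => k /andP[k0 _].
  case: ifPn => [kj|_]; last by rewrite mul0r.
  rewrite ler_wpM2l// lef_pV2 ?posrE ?lamk//; apply: (le_trans (gev_le M0 j)).
  have jk := fold_mode_ge jM kj.
  by rewrite /lambda lerXn2r ?nnegrE ?mulr_ge0 ?pi_ge0// ler_wpM2r ?pi_ge0// ler_nat.
by rewrite ler_wpM2r ?invr_ge0 ?(ltW gj)// bL.
Qed.

Lemma node_itvcc (M i : nat) : (0 < M)%N -> (i <= M)%N -> 0 <= (node M i : R) <= 1.
Proof.
move=> M0 iM; have M0' : 0 < M%:R :> R by rewrite ltr0n.
by rewrite /node /mesh divr_ge0//= ler_pdivrMr// mul1r ler_nat.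
Qed.

Lemma measurable_dx2_time x t : 0 <= x <= 1 -> t <= T -> measurable_fun `]0, t[ (v x).
Proof.
move=> xI tT; have c : {within `[0, T], continuous (v x)}.
  apply/subspace_continuousP => s; rewrite /= in_itv/= => sI.
  apply/cvgrPdist_le => e e0.
  have [d d0 hd] := dx2_time_continuous T0 u_dx6 u_dx6_cont u_dt u_dt_cont xI sI e0.
  rewrite near_withinE; exists d => //= r /= rs; rewrite in_itv/= => rI.
  by rewrite distrC; apply: hd => //; rewrite distrC.
have m : measurable_fun (`[0, T]%classic : set R) (v x).
  by apply: subspace_continuous_measurable_fun => //; exact: measurable_itv.
apply: measurable_funS m => //.
by move=> s; rewrite /= !in_itv/= => /andP[/ltW -> /ltW h]; rewrite (le_trans h).
Qed.

Lemma integrable_frac_dx2 x t : 0 <= x <= 1 -> 0 <= t <= T ->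
  mu.-integrable `]0, t[ (EFin \o (fun s => frac_kernel alpha t s * v x s)).
Proof.
move=> xI /andP[t0 tT]; have G0 := Gamma_gt0 alpha01.
have [D D0 hD] := @dx_bounded _ T u T0 u_dx6 u_dx6_cont u_dt u_dt_cont 2 isT.
have ik := integrable_open_kern alpha01 t0.
have i1 : mu.-integrable `]0, t[ (EFin \o (fun s => (D / Gamma alpha) * kern t s)).
  by apply: eq_integrable (integrableZl _ (D / Gamma alpha) ik).
apply: le_integrable i1 => //.
  apply/measurable_EFinP; apply: measurable_funM; last exact: measurable_dx2_time.
  by apply: measurable_funM => //; exact: measurable_kern.
move=> s; rewrite /= in_itv/= => /andP[s0 st].
rewrite lee_fin /frac_kernel [leRHS]ger0_norm; last first.
  by rewrite mulr_ge0 ?divr_ge0 ?powR_ge0// ltW.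
rewrite normrM ger0_norm ?divr_ge0 ?powR_ge0 ?(ltW G0)//.
rewrite [leRHS](_ : _ = kern t s / Gamma alpha * D); last by rewrite mulrAC [D * _]mulrC mulrAC.
rewrite ler_wpM2l ?divr_ge0 ?powR_ge0 ?(ltW G0)// hD// (ltW s0)/=.
by rewrite (le_trans (ltW st)).
Qed.

Lemma solution_split x t : 0 <= x <= 1 -> 0 <= t <= T ->
  u x t = phi x + frac_int alpha f x t + frac_int alpha v x t.
Proof.
move=> xI tI; have [h _] := u_sol; have [i1 ->] := h x t xI tI.
have i2 := integrable_frac_dx2 xI tI.
rewrite -addrA; congr (_ + _).
have -> : frac_int alpha f x t = frac_int alpha (fun y s => v y s + f y s) x t - frac_int alpha v x t.
  rewrite /frac_int -RintegralB//.
  by apply: eq_Rintegral => s _; rewrite -mulrBr addrC addKr.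
by rewrite subrK.
Qed.

Lemma quad_weightE (t : nat -> R) n k : t k <= t k.+1 <= t n ->
  quad_weight alpha t n k.+1 = (Gamma alpha)^-1 * weight alpha t n k.
Proof.
move=> h; rewrite /quad_weight/=; congr (_ * _).
rewrite /weight -(Rint_kern alpha01 h) /Rintegral integral_itv_obnd_cbnd//.
by apply/measurable_EFinP; exact: measurable_kern.
Qed.

Section FixedGrid.
Context (M N : nat) (t : nat -> R) (U : nat -> nat -> R).
Context (M0 : (0 < M)%N) (tP : is_partition T N t) (US : scheme_S1 alpha phi f M N t U).

Let x_ i : R := node M i.
Let V s i := Hh M (fun l => v (x_ l) s) i.
Let xI i : (i <= M)%N -> 0 <= x_ i <= 1. Proof. exact: node_itvcc. Qed.
Let x0 : x_ 0 = 0. Proof. by rewrite /x_ /node mul0r. Qed.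
Let xM : x_ M = 1. Proof. by rewrite /x_ /node /mesh divff// pnatr_eq0 -lt0n. Qed.
Let z0T : 0 <= (0 : R) <= T. Proof. by rewrite lexx ltW. Qed.

Let tI n : (n <= N)%N -> 0 <= t n <= T.
Proof.
case: tP => t0 tN inc nN.
by rewrite -{1}t0 -tN (increasing_upto_le inc)// (increasing_upto_le inc).
Qed.

Let U_initial i : (i <= M)%N -> U 0 i = u (x_ i) 0.
Proof. by case: US => h _ _ iM; rewrite h// (solution_initial T0 u_sol)// xI. Qed.

Let U_boundary n : (n <= N)%N -> U n 0 = 0 /\ U n M = 0.
Proof.
case: n => [_|n nN]; last by case: US => _ h _; exact: h.
have [_ ub] := u_sol; have [h0 h1] := ub 0 z0T.
by rewrite !U_initial// x0 xM.
Qed.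

Let V_integral n i : (n <= N)%N -> (0 < i < M)%N ->
  mu.-integrable `]0, t n[ (EFin \o (fun s => frac_kernel alpha (t n) s * V s i)) /\
  Hh M (fun l => frac_int alpha v (x_ l) (t n)) i =
    \int[mu]_(s in `]0, t n[) (frac_kernel alpha (t n) s * V s i).
Proof.
move=> nN iM; have /andP[i0 iM'] := iM.
(* The compact operator as a linear combination of three neighbouring slices, which passes under the
   time integral. *)
pose a k : R := (if k == 1%N then 10 else 1) / 12.
pose g k s := frac_kernel alpha (t n) s * v (x_ (i.-1 + k)) s.
have ig k : (0 <= k < 3)%N -> mu.-integrable `]0, t n[ (EFin \o g k).
  move=> /andP[_ k3]; apply: integrable_frac_dx2; last exact: tI.
  apply: xI; apply: (@leq_trans (i.-1 + 2)); first by rewrite leq_add2l.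
  by rewrite addn2 prednK// ltnW.
have [i1 e1] := @Rint_lincomb _ g a 0 3 (measurable_itv _) ig.
have e3 F : \sum_(0 <= k < 3) a k * F k = (F 2%N + 10 * F 1%N + F 0%N) / 12 :> R.
  by rewrite !big_nat_recr//= big_geq// /a/=; field.
have ie : [/\ (i.-1 + 0 = i.-1)%N, (i.-1 + 1 = i)%N & (i.-1 + 2 = i.+1)%N].
  by rewrite addn0 addn1 addn2 prednK.
case: ie => ie0 ie1 ie2.
have eV s : \sum_(0 <= k < 3) a k * g k s = frac_kernel alpha (t n) s * V s i.
  by rewrite e3 /g ie0 ie1 ie2 /V /Hh iM; field.
split; first by apply: eq_integrable i1 => // s _; rewrite /= eV.
transitivity (\sum_(0 <= k < 3) a k * \int[mu]_(s in `]0, t n[) g k s).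
  by rewrite e3 /g ie0 ie1 ie2 /Hh iM.
by rewrite -e1; apply: eq_Rintegral => s _; rewrite eV.
Qed.

(** Applying the compact operator to the integral equation and subtracting the scheme removes [phi]
    and the integral of [f], which the scheme treats exactly. What remains is the exact memory of
    [u_xx] against the quadrature of the second differences of [U]; division by the symbol gives the
    form of [mode_stability]. *)
Lemma grid_mode_equation j n : (0 < j < M)%N -> (n <= N)%N ->
  gmode M (fun i => u (x_ i) (t n) - U n i) j =
  - (gev M j / (gsymb M j * Gamma alpha)) *
    (\int[mu]_(s in `[0, t n[) (kern (t n) s * (- gmode M (V s) j / gev M j)) -
     \sum_(0 <= k < n) weight alpha t n k * ((gmode M (U k) j + gmode M (U k.+1) j) / 2)).
Proof.
move=> jM nN; have /andP[j0 jM'] := jM; have [t0 tN inc] := tP.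
case: (posnP n) => [->|n0].
  rewrite t0 set_itvco0 Rintegral_set0 big_geq// subrr mulr0.
  rewrite (@eq_gmode _ _ _ (fun=> 0)) ?gmode0// => i /andP[_ iM].
  by rewrite U_initial ?subrr// ltnW.
have G0 := Gamma_gt0 alpha01; have Gn0 : Gamma alpha != 0 by rewrite gt_eqF.
have mu0 : 0 < gev M j :> R.
  by apply: lt_le_trans (gev_ge M0 (ltnW jM')); rewrite divr_gt0// exprn_gt0// ltr0n.
have eta0 : 0 < gsymb M j :> R.
  by have /andP[h _] := gsymb_bound M j (R := R); apply: lt_le_trans h; rewrite divr_gt0.
pose e i := u (x_ i) (t n) - U n i.
have [_ ub] := u_sol; have [uT0 uT1] := ub (t n) (tI nN).
have [Un0 UnM] := U_boundary nN.
have e0 : e 0%N = 0 by rewrite /e x0 uT0 Un0 subrr.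
have eM : e M = 0 by rewrite /e xM uT1 UnM subrr.
have n1N : (1 <= n <= N)%N by rewrite n0.
have HE i : (0 < i < M)%N -> Hh M e i = \int[mu]_(s in `]0, t n[) (frac_kernel alpha (t n) s * V s i) -
    \sum_(1 <= k < n.+1) quad_weight alpha t n k / 2 * (delta2 M (U k) i + delta2 M (U k.-1) i).
  move=> iM; have /andP[i0 iM'] := iM; have [_ <-] := V_integral nN iM.
  case: US => _ _ hS; have := hS n i n1N iM; rewrite /Hh iM /e.
  rewrite !(solution_split _ (tI nN)) ?xI ?(ltnW iM')//; last first.
    by rewrite (leq_trans _ (ltnW iM'))// leq_pred.
  set Sg := \sum_(_ <= _ < _) _ => hU.
  exact: compact_split hU.
have [i3 modeV] : mu.-integrable `]0, t n[ (EFin \o (fun s => kern (t n) s * gmode M (V s) j)) /\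
    gmode M (fun i => \int[mu]_(s in `]0, t n[) (frac_kernel alpha (t n) s * V s i)) j =
    (Gamma alpha)^-1 * \int[mu]_(s in `[0, t n[) (kern (t n) s * gmode M (V s) j).
  pose g i s := frac_kernel alpha (t n) s * V s i.
  have ig i : (1 <= i < M)%N -> mu.-integrable `]0, t n[ (EFin \o g i).
    by move=> iM; have [] := V_integral nN iM.
  have [i1 e1] := @Rint_lincomb _ g (fun i => 2 / M%:R * gsin M j i) 1 M (measurable_itv _) ig.
  have lc F : gmode M F j = \sum_(1 <= i < M) 2 / M%:R * gsin M j i * F i :> R.
    by rewrite /gmode mulr_sumr; apply: eq_bigr => i _; rewrite [RHS]mulrAC mulrA.
  rewrite lc -e1.
  have eg s : \sum_(1 <= i < M) 2 / M%:R * gsin M j i * g i s =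
      frac_kernel alpha (t n) s * gmode M (V s) j.
    by rewrite lc mulr_sumr; apply: eq_bigr => i _; rewrite /g mulrCA.
  have i2 : mu.-integrable `]0, t n[ (EFin \o (fun s => Gamma alpha *
      \sum_(1 <= i < M) 2 / M%:R * gsin M j i * g i s)).
    by apply: eq_integrable (integrableZl _ (Gamma alpha) i1).
  have ek s : Gamma alpha * \sum_(1 <= i < M) 2 / M%:R * gsin M j i * g i s =
      kern (t n) s * gmode M (V s) j.
    by rewrite eg frac_kernelE -mulrA mulVKf.
  have i3 : mu.-integrable `]0, t n[ (EFin \o (fun s => kern (t n) s * gmode M (V s) j)).
    by apply: eq_integrable i2 => // s _; rewrite /= ek.
  split => //; transitivity ((Gamma alpha)^-1 * \int[mu]_(s in `]0, t n[) (kern (t n) s * gmode M (V s) j)).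
    rewrite -RintegralZl//; apply: eq_Rintegral => s _; rewrite -ek mulKf//.
  congr (_ * _); rewrite /Rintegral integral_itv_obnd_cbnd//.
  by have /integrableP[] := i3.
have modeU k : (k <= N)%N -> gmode M (delta2 M (U k)) j = - gev M j * gmode M (U k) j.
  by move=> kN; have [h0 h1] := U_boundary kN; exact: gmode_delta2.
have := gmode_Hh M0 j e0 eM.
have -> : gmode M (Hh M e) j =
    gmode M (fun i => \int[mu]_(s in `]0, t n[) (frac_kernel alpha (t n) s * V s i)) j -
    gmode M (fun i => \sum_(1 <= k < n.+1)
      quad_weight alpha t n k / 2 * (delta2 M (U k) i + delta2 M (U k.-1) i)) j.
  by rewrite -gmodeB; exact: eq_gmode.
rewrite modeV gmode_sum big_add1/=.
rewrite (@eq_big_nat _ _ _ _ _ _ (fun k => - (gev M j / Gamma alpha) * (weight alpha t n k *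
    ((gmode M (U k) j + gmode M (U k.+1) j) / 2)))); last first.
  move=> k /andP[_ kn]; have kN := leq_trans kn nN.
  rewrite gmodeZ gmodeD !modeU ?(ltnW kN)// quad_weightE; first exact: weight_algebra.
  by rewrite !(increasing_upto_le inc)//.
rewrite -mulr_sumr => main.
have -> : gmode M (fun i => u (x_ i) (t n) - U n i) j = (gsymb M j)^-1 * (gsymb M j * gmode M e j).
  by rewrite mulKf// gt_eqF.
rewrite -main.
have -> : \int[mu]_(s in `[0, t n[) (kern (t n) s * (- gmode M (V s) j / gev M j)) =
    - (gev M j)^-1 * \int[mu]_(s in `[0, t n[) (kern (t n) s * gmode M (V s) j).
  have i4 : mu.-integrable `]0, t n[ (EFin \o
      (fun s => - (gev M j)^-1 * (kern (t n) s * gmode M (V s) j))).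
    by apply: eq_integrable (integrableZl _ (- (gev M j)^-1) i3).
  have e4 s : - (gev M j)^-1 * (kern (t n) s * gmode M (V s) j) =
      kern (t n) s * (- gmode M (V s) j / gev M j) by ring.
  transitivity (\int[mu]_(s in `]0, t n[) (kern (t n) s * (- gmode M (V s) j / gev M j))).
    rewrite /Rintegral integral_itv_obnd_cbnd//.
    have /integrableP[m4 _] := i4.
    by apply: eq_measurable_fun m4 => s _; rewrite /= e4.
  under eq_Rintegral do rewrite -e4.
  rewrite RintegralZl//; congr (_ * _); rewrite /Rintegral integral_itv_obnd_cbnd//.
  by have /integrableP[] := i3.
by apply: mode_algebra; rewrite ?gt_eqF.
Qed.

End FixedGrid.

End GridError.

Section Algebra.
Context {R : realType}.

Lemma compact_difference (a1 a2 a3 b1 b2 b3 : R) :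
  (a1 + 10 * a2 + a3) / 12 - (b1 + 10 * b2 + b3) / 12 =
    (a1 - b1 + 10 * (a2 - b2) + (a3 - b3)) / 12.
Proof. by field. Qed.

Lemma sub_swap (a b c d : R) : a - b - (c - d) = (a - c) - (b - d).
Proof. by ring. Qed.

Lemma add_swap (a b c : R) : a - b + (c - a) = c - b.
Proof. by ring. Qed.

Lemma double_slope (d b : R) : 2 * d * b + 2 * d * b = 4 * b * d.
Proof. by ring. Qed.

Lemma slope_le (d b : R) : 0 <= d -> 0 <= b -> 2 * d * b <= 4 * b * d.
Proof.
move=> d0 b0; rewrite -subr_ge0; have -> : 4 * b * d - 2 * d * b = 2 * (d * b) by ring.
by rewrite !mulr_ge0.
Qed.

Lemma cancel_gev (g e G b : R) : (g == 0) = false -> g / (e * G) * (4 * (b / g)) = 4 / (e * G) * b.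
Proof. by move=> /negbT g0; move: ((e * G)^-1) => z; field. Qed.

(** The upper bound on [g] serves the temporal part and produces [j^2 * b^2], which aliasing can
    sum; the lower bound serves the consistency part and leaves [1 / j^2], which is summable. *)
Lemma mode_energy (g C A b tau K h j : R) : 0 < g -> 0 < j -> g <= (j * pi) ^+ 2 ->
  j ^+ 2 / 4 <= g ->
  g * (C * (A * b * tau + 3 * K * h / g)) ^+ 2 <=
  2 * C ^+ 2 * (A ^+ 2 * tau ^+ 2 * pi ^+ 2 * (j ^+ 2 * b ^+ 2) +
    36 * K ^+ 2 * h ^+ 2 * (j ^+ 2)^-1).
Proof.
move=> g0 j0 gl gg; rewrite exprMn mulrCA [2 * _]mulrC -[leRHS]mulrA ler_wpM2l ?sqr_ge0//.
apply: (@le_trans _ _ (2 * (g * (A * b * tau) ^+ 2 + g * (3 * K * h / g) ^+ 2))).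
  rewrite -subr_ge0; have -> : 2 * (g * (A * b * tau) ^+ 2 + g * (3 * K * h / g) ^+ 2) -
    g * (A * b * tau + 3 * K * h / g) ^+ 2 = g * (A * b * tau - 3 * K * h / g) ^+ 2 by ring.
  by rewrite mulr_ge0 ?sqr_ge0// ltW.
rewrite ler_wpM2l// lerD//.
  have -> : A ^+ 2 * tau ^+ 2 * pi ^+ 2 * (j ^+ 2 * b ^+ 2) = (j * pi) ^+ 2 * (A * b * tau) ^+ 2.
    by ring.
  by rewrite ler_wpM2r ?sqr_ge0.
have -> : g * (3 * K * h / g) ^+ 2 = (3 * K * h) ^+ 2 / g by field; rewrite gt_eqF.
have -> : 36 * K ^+ 2 * h ^+ 2 * (j ^+ 2)^-1 = (3 * K * h) ^+ 2 / (j ^+ 2 / 4).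
  by field; rewrite gt_eqF.
by rewrite ler_wpM2l ?sqr_ge0// lef_pV2 ?posrE// divr_gt0// exprn_gt0.
Qed.

Lemma scaled_energy_sum (C G tau S K h : R) : 0 <= S -> 0 <= tau -> 0 <= h ->
  2^-1 * (2 * C ^+ 2 * ((6 / G) ^+ 2 * tau ^+ 2 * pi ^+ 2 * (4 * S) + 36 * K ^+ 2 * h ^+ 2 * 2)) <=
  C ^+ 2 * (144 * pi ^+ 2 * S / G ^+ 2 + 72 * K ^+ 2) * (h + tau) ^+ 2.
Proof.
move=> S0 t0 h0; set P := 144 * pi ^+ 2 * S / G ^+ 2; set Q := 72 * K ^+ 2.
have P0 : 0 <= P.
  exact: (divr_ge0 (mulr_ge0 (mulr_ge0 (ler0n _ _) (sqr_ge0 _)) S0) (sqr_ge0 _)).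
have Q0 : 0 <= Q by rewrite /Q mulr_ge0// sqr_ge0.
have -> : 2^-1 * (2 * C ^+ 2 * ((6 / G) ^+ 2 * tau ^+ 2 * pi ^+ 2 * (4 * S) +
    36 * K ^+ 2 * h ^+ 2 * 2)) = C ^+ 2 * (P * tau ^+ 2 + Q * h ^+ 2).
  by rewrite /P /Q exprMn exprVn; move: ((G ^+ 2)^-1) => z; field.
rewrite -mulrA ler_wpM2l ?sqr_ge0// mulrDl; apply: lerD; apply: ler_wpM2l => //.
  by rewrite lerXn2r ?nnegrE ?addr_ge0// lerDr.
by rewrite lerXn2r ?nnegrE ?addr_ge0// lerDl.
Qed.

End Algebra.

(** * Summation of the modes and the error bound *)

Section Convergence.
Context {R : realType} (alpha T : R) (phi : R -> R) (f u : R -> R -> R).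
Context (alpha01 : 0 < alpha < 1) (T0 : 0 < T).
Context (u_sol : is_solution alpha T phi f u).
Context (u_dx6 : forall x t : R, 0 <= x <= 1 -> 0 <= t <= T -> dx_exists 6 u x t).
Context (u_dx6_cont : {within (`[0, 1] `*` `[0, T] : set (R * R)),
   continuous (fun p : R * R => dx 6 u p.1 p.2)}).
Context (u_dt : forall x t : R, 0 <= x <= 1 -> 0 <= t <= T -> derivableS `[0, T] (u x) t).
Context (u_dt_cont : {within (`[0, 1] `*` `[0, T] : set (R * R)),
   continuous (fun p : R * R => dt_cc T u p.1 p.2)}).
Context (L : nat -> R) (S : R) (L0 : forall k, 0 <= L k) (S0 : 0 <= S).
Context (LS : forall n, \sum_(1 <= k < n.+1) lambda k * L k ^+ 2 <= S).
Context (uL : forall k, (0 < k)%N ->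
  lipschitz_in `[0, T] (L k / lambda k) (fun t => L2_inner (u ^~ t) (psi k))).
Local Notation v := (dx 2 u).

Lemma consistency_mode (M : nat) K s j : (0 < M)%N -> 0 <= s <= T -> 0 <= K ->
  (forall x, 0 <= x <= 1 -> `|dx 6 u x s| <= K) -> (0 < j < M)%N ->
  `|gmode M (Hh M (fun i => v (node M i) s)) j + gev M j * gmode M (fun i => u (node M i) s) j|
    <= 3 * K * mesh M ^+ 4.
Proof.
move=> M0 sI K0 hK jM; have [_ ub] := u_sol; have [us0 us1] := ub s sI.
have M0' : 0 < M%:R :> R by rewrite ltr0n.
have u0 : (fun i => u (node M i) s) 0%N = 0 by rewrite /node mul0r.
have uM : (fun i => u (node M i) s) M = 0 by rewrite /node /mesh divff// gt_eqF.
have e : gev M j * gmode M (fun i => u (node M i) s) j =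
    - gmode M (delta2 M (fun i => u (node M i) s)) j.
  by rewrite (@gmode_delta2 R M M0 (fun i => u (node M i) s) j u0 uM) mulNr opprK.
rewrite e -gmodeB.
have h0 : 0 < mesh M :> R by rewrite invr_gt0.
have h4 : 0 <= 3 / 2 * K * mesh M ^+ 4 by rewrite mulr_ge0 ?exprn_ge0 ?(ltW h0)// mulr_ge0.
apply: (@le_trans _ _ (2 * (3 / 2 * K * mesh M ^+ 4))); last first.
  by rewrite le_eqVlt; apply/orP; left; apply/eqP; field.
apply: gmode_le => // i iM; have /andP[i0 iM'] := iM.
have nS : node M i.+1 = node M i + mesh M :> R by rewrite /node -[i.+1%:R]natr1 mulrDl mul1r.
have nP : node M i.-1 = node M i - mesh M :> R.
  by rewrite /node -{2}(prednK i0) -[i.-1.+1%:R]natr1 mulrDl mul1r addrK.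
have hc : mesh M <= node M i :> R.
  by rewrite /node ler_peMl ?(ltW h0)// ler1n.
have ch : node M i + mesh M <= 1 :> R.
  by rewrite -nS; have /andP[] := @node_itvcc R M i.+1 M0 iM'.
have := compact_consistency (chain_dx u_dx6 sI) hK h0 hc ch.
by rewrite /Hh iM /delta2 nS nP.
Qed.

Lemma grid_convergence : exists2 X, 0 <= X &
  forall (M N : nat) (t : nat -> R) (U : nat -> nat -> R),
    (0 < M)%N -> is_partition T N t -> scheme_S1 alpha phi f M N t U ->
    forall n : nat, (1 <= n <= N)%N ->
      normA M (fun i => u (node M i) (t n) - U n i) <= X * (mesh M ^+ 4 + tau_max N t).
Proof.
have G0 := Gamma_gt0 alpha01.
(* A lower bound, on all grids, of the relaxation rates [gev M j / (gsymb M j * Gamma alpha)], from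
   [gev >= 1 / 4] and [gsymb <= 1]. *)
pose lam0 : R := 4^-1 / Gamma alpha.
have l00 : 0 < lam0 by rewrite divr_gt0// invr_gt0.
have [C C0 hC] := mode_stability alpha01 T0 l00.
have [K K0 hK] := dx6_bounded u_dx6_cont.
pose Y := C ^+ 2 * (144 * pi ^+ 2 * S / Gamma alpha ^+ 2 + 72 * K ^+ 2).
have Y0 : 0 <= Y.
  apply: (mulr_ge0 (sqr_ge0 _)); apply: addr_ge0; last exact: (mulr_ge0 (ler0n _ _) (sqr_ge0 _)).
  exact: (divr_ge0 (mulr_ge0 (mulr_ge0 (ler0n _ _) (sqr_ge0 _)) S0) (sqr_ge0 _)).
exists (Num.sqrt Y) => [|M N t U M0 tP US n /andP[n0 nN]]; first exact: sqrtr_ge0.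
have [beta b0 [bS bL]] := mode_lipschitz T0 u_sol u_dx6 u_dx6_cont u_dt u_dt_cont M0 L0 S0 LS uL.
have /andP[tau0 _] := tau_max_bounds T0 tP.
have h0 : 0 < mesh M :> R by rewrite invr_gt0 ltr0n.
set h4 := mesh M ^+ 4; set tau := tau_max N t.
have h40 : 0 <= h4 by rewrite exprn_ge0// ltW.
have M0' : 0 < M%:R :> R by rewrite ltr0n.
have [t0 tN inc] := tP.
have tI k : (k <= N)%N -> 0 <= t k <= T.
  by move=> kN; rewrite -{1}t0 -tN (increasing_upto_le inc)// (increasing_upto_le inc).
pose e i := u (node M i) (t n) - U n i.
have ehat j : (0 < j < M)%N -> `|gmode M e j| <=
    C * (6 / Gamma alpha * beta j * tau + 3 * K * h4 / gev M j).
  move=> jM; have /andP[j0 jM'] := jM.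
  have j1 : 1 <= j%:R :> R by rewrite ler1n.
  have mu4 : 4^-1 <= gev M j :> R.
    by apply: le_trans (gev_ge M0 (ltnW jM')); rewrite ler_peMl ?invr_ge0// expr_ge1.
  have mu0 : 0 < gev M j :> R by apply: lt_le_trans mu4; rewrite invr_gt0.
  have /andP[eta1 eta2] := gsymb_bound M j (R := R).
  have eta0 : 0 < gsymb M j :> R by apply: lt_le_trans eta1; rewrite divr_gt0.
  pose lam := gev M j / (gsymb M j * Gamma alpha).
  have lamP : lam0 <= lam.
    rewrite /lam0 /lam ler_pM ?invr_ge0 ?(ltW G0)//.
    by rewrite lef_pV2 ?posrE ?mulr_gt0// ler_piMl// ltW.
  have lam_gt0 : 0 < lam by apply: lt_le_trans lamP.
  (* The value of the mode of [u] that second differences would have to produce for the compact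
     relation to be exact. With [m] in the memory integral the error equation has no further defect,
     and [q] is the consistency error, of order [h^4]. *)
  pose m s := - gmode M (Hh M (fun i => v (node M i) s)) j / gev M j.
  pose uh s := gmode M (fun i => u (node M i) s) j.
  pose q s := uh s - m s.
  (* The modes of [u] and [m] each move at rate at most [2 * beta j / gev M j], so their difference
     [q] moves at rate at most twice that. *)
  pose B := lam * (4 * (beta j / gev M j)).
  have bg0 : 0 <= beta j / gev M j by rewrite divr_ge0// ltW.
  have B0 : 0 <= B by rewrite mulr_ge0 ?(ltW lam_gt0)// mulr_ge0.
  have Bl : B / lam = 4 * (beta j / gev M j) by rewrite /B mulrC mulKf// gt_eqF.
  have mL' s r : 0 <= s <= T -> 0 <= r <= T -> `|m r - m s| <= 2 * `|r - s| * (beta j / gev M j).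
    move=> sI rI; have [w0 w1 /(_ j jM)[wj _]] := bL s r sI rI.
    pose w i := v (node M i) r - v (node M i) s.
    have ew : gmode M (Hh M (fun i => v (node M i) r)) j - gmode M (Hh M (fun i => v (node M i) s)) j =
        gsymb M j * gmode M w j.
      have w0' : w 0 = 0 by rewrite /w /node mul0r.
      have wM' : w M = 0 by rewrite /w /node /mesh divff// gt_eqF.
      rewrite -(@gmode_Hh R M M0 w j w0' wM') -gmodeB; apply: eq_gmode => i iM; rewrite /Hh iM /w.
      exact: compact_difference.
    have -> : m r - m s = - (gsymb M j * gmode M w j) / gev M j by rewrite -ew /m -mulrBl opprD.
    rewrite normrM normrN normrM (gtr0_norm eta0) normfV (gtr0_norm mu0) mulrA.
    rewrite ler_wpM2r ?invr_ge0 ?(ltW mu0)//.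
    by apply: (le_trans _ wj); rewrite ler_piMl.
  have uL' s r : 0 <= s <= T -> 0 <= r <= T -> `|uh r - uh s| <= 2 * `|r - s| * (beta j / gev M j).
    by move=> sI rI; have [_ _ /(_ j jM)[_]] := bL s r sI rI; rewrite /uh -gmodeB.
  have mL : lipschitz_in `[0, T] (B / lam) m.
    move=> s r; rewrite /= !in_itv/= => sI rI; apply: (le_trans (mL' s r sI rI)).
    by rewrite Bl; apply: slope_le.
  have qL : lipschitz_in `[0, T] (B / lam) q.
    move=> s r; rewrite /= !in_itv/= => sI rI; rewrite Bl.
    rewrite (_ : q r - q s = (uh r - uh s) - (m r - m s)); last by rewrite /q; exact: sub_swap.
    apply: (le_trans (ler_normB _ _)); apply: (le_trans (lerD (uL' s r sI rI) (mL' s r sI rI))).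
    by rewrite le_eqVlt; apply/orP; left; apply/eqP; exact: double_slope.
  have qd s : 0 <= s <= T -> `|q s| <= 3 * K * h4 / gev M j.
    move=> sI; have -> : q s = (gmode M (Hh M (fun i => v (node M i) s)) j + gev M j * uh s) / gev M j.
      by rewrite /q /m mulNr opprK mulrDl [gev M j * _]mulrC mulfK ?gt_eqF// addrC.
    rewrite normrM normfV (gtr0_norm mu0) ler_wpM2r ?invr_ge0 ?(ltW mu0)//.
    by apply: consistency_mode => // x xI; exact: hK.
  pose x k := m (t k) - gmode M (U k) j.
  have xq k : x k + q (t k) = gmode M (fun i => u (node M i) (t k) - U k i) j.
    by rewrite gmodeB /x /q -/(uh (t k)); exact: add_swap.
  have xK l : m (t l) - x l = gmode M (U l) j by rewrite /x subKr.
  have xE k : (k <= N)%N -> x k + q (t k) = - lam *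
      (\int[lebesgue_measure]_(s in `[0, t k[) ((t k - s) `^ (alpha - 1) * m s) -
        \sum_(0 <= l < k) weight alpha t k l * ((m (t l) - x l + (m (t l.+1) - x l.+1)) / 2)).
    move=> kN; rewrite xq.
    rewrite (grid_mode_equation alpha01 T0 u_sol u_dx6 u_dx6_cont u_dt u_dt_cont M0 tP US jM kN).
    congr (_ * (_ - _)); apply: eq_bigr => l _.
    by rewrite -!xK.
  have := hC N t lam B _ m q x tP lamP B0 mL qL qd xE n nN; rewrite xq => /le_trans; apply.
  rewrite ler_wpM2l ?(ltW C0)// lerD2r ler_wpM2r ?(ltW tau0)//.
  have -> : B = 4 / (gsymb M j * Gamma alpha) * beta j.
    by rewrite /B /lam; by apply: cancel_gev; exact: gt_eqF.
  rewrite ler_wpM2r// invfM mulrA ler_wpM2r ?invr_ge0 ?(ltW G0)//.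
  by rewrite ler_pdivrMr//; move: eta1; lra.
have [_ ub] := u_sol; have [un0 un1] := ub (t n) (tI n nN).
have [_ /(_ n) Ub _] := US; have [Un0 UnM] : U n 0%N = 0 /\ U n M = 0 by apply: Ub; rewrite n0.
have e0 : e 0%N = 0 by rewrite /e /node mul0r un0 Un0 subrr.
have eM : e M = 0 by rewrite /e /node /mesh divff ?un1 ?UnM ?subrr// gt_eqF.
apply: (le_trans (normA_le M0 e0 eM)).
have th0 : 0 <= h4 + tau by rewrite addr_ge0// ltW.
rewrite -[h4 + tau](ger0_norm th0) -sqrtr_sqr -sqrtrM// ler_sqrt; last by rewrite mulr_ge0// sqr_ge0.
pose A := 6 / Gamma alpha.
have term j : (0 < j < M)%N -> gev M j * gmode M e j ^+ 2 <=
    2 * C ^+ 2 * (A ^+ 2 * tau ^+ 2 * pi ^+ 2 * (j%:R ^+ 2 * beta j ^+ 2) +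
      36 * K ^+ 2 * h4 ^+ 2 * (j%:R ^+ 2)^-1).
  move=> jM; have /andP[j0 jM'] := jM.
  have j0' : 0 < j%:R :> R by rewrite ltr0n.
  have gl := gev_le M0 j (R := R); have gg := gev_ge M0 (ltnW jM') (R := R).
  have mu0 : 0 < gev M j :> R by apply: lt_le_trans gg; rewrite divr_gt0// exprn_gt0.
  have h := ehat j jM.
  have h2 : gmode M e j ^+ 2 <= (C * (A * beta j * tau + 3 * K * h4 / gev M j)) ^+ 2.
    rewrite -[gmode M e j ^+ 2]real_normK ?num_real// lerXn2r ?nnegrE//.
    have n1 : 0 <= A * beta j * tau.
      by rewrite mulr_ge0 ?(ltW tau0)// mulr_ge0// divr_ge0// ltW.
    have n2 : 0 <= 3 * K * h4 by rewrite mulr_ge0// mulr_ge0.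
    by rewrite mulr_ge0 ?(ltW C0)// addr_ge0// divr_ge0// ltW.
  apply: (le_trans (ler_wpM2l (ltW mu0) h2)).
  apply: mode_energy => //; exact: ltW.
apply: (@le_trans _ _ (2^-1 * \sum_(1 <= j < M) (2 * C ^+ 2 *
   (A ^+ 2 * tau ^+ 2 * pi ^+ 2 * (j%:R ^+ 2 * beta j ^+ 2) +
      36 * K ^+ 2 * h4 ^+ 2 * (j%:R ^+ 2)^-1)))).
  by rewrite ler_wpM2l ?invr_ge0//; apply: ler_sum_nat => j; exact: term.
rewrite -mulr_sumr big_split/= -!mulr_sumr.
have i2 : \sum_(1 <= j < M) (j%:R ^+ 2)^-1 <= 2 :> R.
  by case: (M) M0 => // M' _; exact: sum_inv_sqr_le.
apply: (@le_trans _ _ (2^-1 * (2 * C ^+ 2 * (A ^+ 2 * tau ^+ 2 * pi ^+ 2 * (4 * S) +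
   36 * K ^+ 2 * h4 ^+ 2 * 2)))).
  have c0 : 0 <= 2 * C ^+ 2 by rewrite mulr_ge0// sqr_ge0.
  rewrite ler_wpM2l ?invr_ge0// ler_wpM2l//.
  apply: lerD; apply: ler_wpM2l => //.
    by rewrite mulr_ge0 ?sqr_ge0// mulr_ge0 ?sqr_ge0.
  by rewrite mulr_ge0 ?sqr_ge0// mulr_ge0 ?sqr_ge0.
rewrite /Y /A; apply: scaled_energy_sum => //; exact: ltW.
Qed.

End Convergence.

Theorem theorem4p3 (R : realType) (alpha T : R) (phi : R -> R)
    (f u : R -> R -> R) (rho C1 : R)
    (alpha01 : 0 < alpha < 1) (T_gt0 : 0 < T)
    (phi_dom : in_dom (9 / 2) phi)
    (f_diff : forall x t : R, 0 <= x <= 1 -> 0 < t <= T ->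
       derivableS `]0, T] (f x) t /\ derivableS `]0, T] (dt_oc T f x) t)
    (f_dom : forall t : R, 0 < t <= T ->
       [/\ in_dom (9 / 2) (fun x => f x t),
           in_dom (9 / 2) (fun x => dt_oc T f x t)
         & in_dom (9 / 2) (fun x => dt_oc T (dt_oc T f) x t)])
    (rho_lt1 : rho < 1)
    (f_bound : forall t : R, 0 < t <= T ->
       (dom_norm (5 / 2) (fun x => f x t)
        + dom_norm (1 / 2) (fun x => dt_oc T f x t)
        + (t `^ rho)%:E *
            dom_norm (1 / 2) (fun x => dt_oc T (dt_oc T f) x t)
        <= C1%:E)%E)
    (u_sol : is_solution alpha T phi f u)
    (u_dx6 : forall x t : R, 0 <= x <= 1 -> 0 <= t <= T -> dx_exists 6 u x t)
    (u_dx6_cont : {within (`[0, 1] `*` `[0, T] : set (R * R)),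
       continuous (fun p : R * R => dx 6 u p.1 p.2)})
    (u_dt : forall x t : R, 0 <= x <= 1 -> 0 <= t <= T ->
       derivableS `[0, T] (u x) t)
    (u_dt_cont : {within (`[0, 1] `*` `[0, T] : set (R * R)),
       continuous (fun p : R * R => dt_cc T u p.1 p.2)}) :
  exists2 C : R, 0 < C &
    forall (M N : nat) (t : nat -> R) (U : nat -> nat -> R),
      (0 < M)%N -> is_partition T N t -> scheme_S1 alpha phi f M N t U ->
      forall n : nat, (1 <= n <= N)%N ->
        normA M (fun i => u (node M i) (t n) - U n i)
        <= Num.sqrt (T `^ alpha / Gamma (alpha + 1)) *
             (C * (mesh M ^+ 4 + tau_max N t)).
Proof.
have a0 : 0 < alpha by case/andP: alpha01.
have f_L2 t : 0 < t <= T ->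
    [/\ in_L2 (f ^~ t), in_L2 (dt_oc T f ^~ t) & in_L2 (dt_oc T (dt_oc T f) ^~ t)].
  by move=> /f_dom[[h1 _] [h2 _] [h3 _]].
have [L L0 [[S S0 LS] FL]] := source_coef_lipschitz T_gt0 f_diff f_L2 rho_lt1 f_bound.
have mf := measurable_source T_gt0 f_diff f_L2.
have fi t : 0 < t <= T ->
    lebesgue_measure.-integrable (`]0, 1[ : set R) (EFin \o (f ^~ t)).
  by move=> /f_L2[h _ _]; exact: in_L2_integrable.
have fC t : 0 < t <= T -> \int[lebesgue_measure]_(x in `]0, 1[) `|f x t| <= C1 + 1.
  exact: (source_L1_le T_gt0 f_L2 f_bound).
have uL k : (0 < k)%N ->
    lipschitz_in `[0, T] (L k / lambda k) (fun t => L2_inner (u ^~ t) (psi k)).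
  move=> k0; exact: (solution_coef_lipschitz alpha01 T_gt0 u_sol u_dx6 u_dx6_cont u_dt u_dt_cont
    mf fi fC k0 (L0 k) (FL k k0)).
have [X X0 hX] := grid_convergence alpha01 T_gt0 u_sol u_dx6 u_dx6_cont u_dt u_dt_cont
  L0 S0 LS uL.
set A := Num.sqrt _.
have A0 : 0 < A by rewrite sqrtr_gt0 divr_gt0 ?powR_gt0 ?Gamma_succ_gt0.
(* The prefactor in the claim is a positive constant of the problem and is divided out; [X + 1] in
   place of [X] makes the constant positive. *)
exists ((X + 1) / A) => [|M N t U M0 tP US n nN]; first by rewrite divr_gt0// ltr_wpDl.
apply: (le_trans (hX M N t U M0 tP US n nN)).
have /andP[tau0 _] := tau_max_bounds T_gt0 tP.
have z0 : 0 <= mesh M ^+ 4 + tau_max N t.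
  by rewrite addr_ge0 ?(ltW tau0)// exprn_ge0// invr_ge0.
rewrite mulrA [A * _]mulrC divfK ?gt_eqF//.
by rewrite ler_wpM2r// lerDl.
Qed.
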